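(* Let $\alpha,s\in(0,1)$, $H_1,H_2\in(0,\tfrac12]$, $T>0$, and let $f$ be a deterministic mapping with $\|f(v)\|_{L^2(D)}\le C_f(1+\|v\|_{L^2(D)})$ and $\|f(v)-f(w)\|_{L^2(D)}\le C_f\|v-w\|_{L^2(D)}$ for all $v,w\in L^2(D)$ and some constant $C_f>0$. Assume $\frac{2sH_2}{\alpha}+H_1-1>0$ and $H_1+2s-1>0$. Let $u$ be the (mild) solution of $\partial_t u+{}_0\partial_t^{1-\alpha}A^s u=f(u)+\xi^{H_1,H_2}$ in $D\times(0,T]$ with zero initial value and zero Dirichlet boundary condition, and for $N\in\mathbb N^*$ let $\bar u_N$ be the solution of its spectral Galerkin semi-discretization in the span of the first $N$ eigenfunctions. Then for every $\sigma$ with $2\sigma<\min\{\frac{2sH_2}{\alpha}+H_1-1,\;H_1+2s-1\}$ there is a constant $C$, independent of $N$, such that for all $t\in[0,T]$ $$\mathbb{E}\|u(t)-\bar u_N(t)\|_{L^2(D)}^2\le C(N+1)^{-4\sigma}.$$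
   Context: $D=(0,1)$. $A=-\Delta$ on $D$ with zero Dirichlet boundary condition, with non-decreasing eigenvalues $\lambda_k$ and $L^2$-normalized eigenfunctions $\phi_k$, $k\ge1$; $A^{q}v=\sum_{k}\lambda_k^{q}(v,\phi_k)\phi_k$, where $(\cdot,\cdot)$ is the $L^2(D)$ inner product. ${}_0\partial_t^{1-\alpha}u=\frac{1}{\Gamma(\alpha)}\frac{\partial}{\partial t}\int_0^t(t-r)^{\alpha-1}u(r)dr$ is the Riemann--Liouville derivative. $E_{\alpha,\beta}(z)=\sum_{k\ge0}z^k/\Gamma(k\alpha+\beta)$ is the Mittag--Leffler function. Noise: $\xi^{H_1,H_2}=\frac{\partial^2W^{H_1,H_2}}{\partial x\partial t}$, where $W^{H_1,H_2}$ is a fractional Brownian sheet on $D\times[0,T]$, i.e. a centered Gaussian field on a stochastic basis $(\Omega,\mathcal F,(\mathcal F_t)_{t\in[0,T]},\mathbb P)$ with $\mathbb{E}[W^{H_1,H_2}(x,t)W^{H_1,H_2}(y,r)]=\frac{x^{2H_1}+y^{2H_1}-|x-y|^{2H_1}}{2}\cdot\frac{t^{2H_2}+r^{2H_2}-|t-r|^{2H_2}}{2}$. Integrals $\int\!\int g(y,r)\xi^{H_1,H_2}(y,r)\,dy\,dr$ of deterministic $g$ are Wiener integrals with respect to $W^{H_1,H_2}$ (rectangular increments for indicator functions, extended linearly and by $L^2(\Omega)$-closure). Mild solution $u$: $u(x,t)=\int_0^t\mathcal S(t-r)f(u(r))dr+\int_0^t\int_D G(t-r,x,y)\xi^{H_1,H_2}(y,r)dydr$,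 where $\mathcal S(t)v=\sum_{k\ge1}E_{\alpha,1}(-\lambda_k^st^\alpha)(v,\phi_k)\phi_k$ and $G(t,x,y)=\sum_{k\ge1}E_{\alpha,1}(-\lambda_k^st^\alpha)\phi_k(x)\phi_k(y)$. Semi-discrete solution: $\mathbb H_N=\mathrm{span}\{\phi_1,\dots,\phi_N\}$, $P_N$ is the $L^2(D)$-orthogonal projection onto $\mathbb H_N$, $A_N^s:\mathbb H_N\to\mathbb H_N$ is the restriction of $A^s$. $\bar u_N\in\mathbb H_N$ solves $\partial_t\bar u_N+{}_0\partial_t^{1-\alpha}A_N^s\bar u_N=P_Nf(\bar u_N)+\xi_{RS}^{H_1,H_2}$, $\bar u_N(0)=0$, with $\xi_{RS}^{H_1,H_2}(x,t)=\sum_{j=1}^N\int_D\phi_j(y)\xi^{H_1,H_2}(y,t)dy\,\phi_j(x)$; that is, $\bar u_N(x,t)=\int_0^t\mathcal S_{R,N}(t-r)P_Nf(\bar u_N(r))dr+\int_0^t\int_DG_{R,S}(t-r,x,y)\xi^{H_1,H_2}(y,r)dydr$, where $\mathcal S_{R,N}(t)v=\sum_{k=1}^NE_{\alpha,1}(-\lambda_k^st^\alpha)(v,\phi_k)\phi_k$ and $G_{R,S}(t,x,y)=\sum_{k=1}^NE_{\alpha,1}(-\lambda_k^st^\alpha)\phi_k(x)\phi_k(y)$. *)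

(* Defs.v *)
From HB Require Import structures.
From mathcomp Require Import all_boot all_order all_algebra.
From mathcomp Require Import all_classical all_reals all_analysis.

Set Implicit Arguments.
Unset Strict Implicit.
Unset Printing Implicit Defensive.

Import Order.TTheory GRing.Theory Num.Theory.
Import numFieldNormedType.Exports.

Local Open Scope classical_set_scope.
Local Open Scope ring_scope.

(** Elements of L^2(D), D = (0, 1), are represented by functions R -> R that
    are measurable on R; only their a.e. class on D matters, since [lebD] is
    the Lebesgue measure restricted to D. *)
Definition lebD (R : realType) :=
  mrestr (@lebesgue_measure R) (measurable_itv `]0, 1[).

Definition L2D (R : realType) : {pred (R -> R)} := Lfun (@lebD R) 2%:E.

Definition normD (R : realType) (v : R -> R) : \bar R :=
  'N[@lebD R]_2%:E[EFin \o v]%E.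

Definition dotD (R : realType) (v w : R -> R) : R :=
  \int[@lebD R]_x (v x * w x).

(** The sum of a series in L^2(D); the default value [cst 0] is only returned
    when the series has no sum in L^2(D). *)
Definition L2sum (R : realType) (F : nat -> R -> R) : R -> R :=
  xget (cst 0) [set g : R -> R | g \in @L2D R /\
    normD (fun x => \sum_(k < n) F k x - g x) @[n --> \oo] --> 0%E].

(** Eigenpairs of A = -Laplacian on D with zero Dirichlet boundary condition:
    in dimension one the eigenfunctions are classical. *)
Definition dirichlet_eigenpair (R : realType) (l : R) (p : R -> R) : Prop :=
  [/\ {within `[0, 1], continuous p}, p 0 = 0, p 1 = 0 &
    forall x, x \in `]0, 1[ ->
      [/\ derivable p x 1, derivable (derive1 p) x 1 &
          - derive1 (derive1 p) x = l * p x]].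

(** [lam k] and [phi k], for k : nat starting at 0, are the eigenvalue and the
    eigenfunction of index k + 1 in the usual numbering from 1. The last clause
    (completeness in L^2(D)) ensures that no eigenvalue is missing. *)
Record dirichlet_eigenbasis (R : realType)
    (lam : nat -> R) (phi : nat -> R -> R) : Prop := {
  eigenbasis_eigen : forall k, dirichlet_eigenpair (lam k) (phi k);
  eigenbasis_ndecr : {homo lam : j k / (j <= k)%N >-> j <= k};
  eigenbasis_L2D : forall k, phi k \in @L2D R;
  eigenbasis_ortho : forall j k, dotD (phi j) (phi k) = (j == k)%:R;
  eigenbasis_total : forall v, v \in @L2D R ->
    (forall k, dotD v (phi k) = 0) -> {ae @lebD R, forall x, v x = 0} }.

(** The Gamma function, meaningful for 0 < x. *)
Definition Gamma (R : realType) (x : R) : R :=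
  \int[@lebesgue_measure R]_(t in `]0, +oo[) (t `^ (x - 1) * expR (- t)).

Definition mittag_leffler (R : realType) (a b z : R) : R :=
  limn (series (fun k : nat => z ^+ k / Gamma (k%:R * a + b))).

Section solution_operators.
Variables (R : realType) (alpha s : R) (lam : nat -> R) (phi : nat -> R -> R).

Definition relaxation (k : nat) (t : R) : R :=
  mittag_leffler alpha 1 (- (lam k `^ s * t `^ alpha)).

Definition Sop (t : R) (v : R -> R) : R -> R :=
  L2sum (fun k x => relaxation k t * dotD v (phi k) * phi k x).

(** Pointwise sum; the series converges for 0 < t and x <> y in D. *)
Definition Gker (t x y : R) : R :=
  limn (series (fun k => relaxation k t * phi k x * phi k y)).

(** Galerkin counterparts on H_N, the span of [phi 0], ..., [phi N.-1]. *)
Definition projN (N : nat) (v : R -> R) : R -> R :=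
  fun x => \sum_(k < N) dotD v (phi k) * phi k x.

Definition in_HN (N : nat) (v : R -> R) : Prop :=
  exists c : 'I_N -> R,
    {ae @lebD R, forall x, v x = \sum_(k < N) c k * phi k x}.

Definition SopN (N : nat) (t : R) (v : R -> R) : R -> R :=
  fun x => \sum_(k < N) relaxation k t * dotD v (phi k) * phi k x.

Definition GkerN (N : nat) (t x y : R) : R :=
  \sum_(k < N) relaxation k t * phi k x * phi k y.

End solution_operators.

(** L^2(D)-valued simple functions of time, \sum_i \1_(A_i) v_i, are encoded by
    the list of the pairs (A_i, v_i). *)
Definition simple_data (R : realType) := seq (set R * (R -> R)).

Definition simple_wf (R : realType) (h : simple_data R) : Prop :=
  forall i, (i < size h)%N -> let p := nth (set0, cst 0) h i in
    measurable p.1 /\ p.2 \in @L2D R.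

Definition simple_eval (R : realType) (h : simple_data R) (r : R) : R -> R :=
  fun x => \sum_(p <- h) \1_(p.1) r * p.2 x.

Definition simple_int (R : realType) (t : R) (h : simple_data R) : R -> R :=
  fun x => \sum_(p <- h) fine (lebesgue_measure (p.1 `&` `]0, t[)) * p.2 x.

(** [I] is the Bochner integral over (0, t) of the L^2(D)-valued function
    [F]. *)
Definition is_bochner_integral (R : realType) (t : R)
    (F : R -> R -> R) (I : R -> R) : Prop :=
  [/\ {ae @lebesgue_measure R, forall r, r \in `]0, t[ -> F r \in @L2D R},
      I \in @L2D R &
   exists h : nat -> simple_data R,
   [/\ forall n, simple_wf (h n),
      {ae @lebesgue_measure R, forall r, r \in `]0, t[ ->
        normD (fun x => F r x - simple_eval (h n) r x) @[n --> \oo] --> 0%E},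
      (\int[@lebesgue_measure R]_(r in `]0%R, t[)
        normD (fun x => (F r x - simple_eval (h n) r x)%R))%E @[n --> \oo] --> 0%E &
      normD (fun x => simple_int t (h n) x - I x) @[n --> \oo] --> 0%E]].

Section noise.
Variables (d : measure_display) (Omega : measurableType d) (R : realType).
Variable P : probability Omega R.

(** The case of a zero variance is singled out because the library's
    [normal_prob m 0] is not the Dirac mass at m. *)
Definition centered_gaussian (X : Omega -> R) : Prop :=
  measurable_fun setT X /\
  exists2 sd : R, 0 <= sd & forall B : set R, measurable B ->
    P (X @^-1` B) = if sd == 0 then \d_(0 : R) B else normal_prob 0 sd B.

Definition fbm_cov (H x y : R) : R :=
  (x `^ (2 * H) + y `^ (2 * H) - `|x - y| `^ (2 * H)) / 2.

(** [W x t], for x in [0, 1] (the closure of D) and t in [0, T]. *)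
Record fractional_brownian_sheet (H1 H2 T : R) (W : R -> R -> Omega -> R)
    : Prop := {
  sheet_gaussian : forall (n : nat) (c x t : 'I_n -> R),
    (forall i, x i \in `[0, 1]) -> (forall i, t i \in `[0, T]) ->
    centered_gaussian (fun w => \sum_(i < n) c i * W (x i) (t i) w);
  sheet_cov : forall x y t r : R,
    x \in `[0, 1] -> y \in `[0, 1] -> t \in `[0, T] -> r \in `[0, T] ->
    'E_P[fun w => (W x t w * W y r w)%R]%E =
      (fbm_cov H1 x y * fbm_cov H2 t r)%:E }.

(** A rectangle function c \1_(]a, b] `*` ]a', b']) of (y, r) is encoded by
    (c, (a, b), (a', b')). *)
Definition step_data := seq (R * (R * R) * (R * R)).

Definition step_wf (T : R) (h : step_data) : Prop :=
  forall p, p \in h -> 0 <= p.1.2.1 <= p.1.2.2 /\ p.1.2.2 <= 1 /\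
                       0 <= p.2.1 <= p.2.2 /\ p.2.2 <= T.

Definition step_eval (h : step_data) (z : R * R) : R :=
  \sum_(p <- h) p.1.1 * ((p.1.2.1 < z.1 <= p.1.2.2) &&
                         (p.2.1 < z.2 <= p.2.2))%:R.

Definition step_wiener (W : R -> R -> Omega -> R) (h : step_data)
    (w : Omega) : R :=
  \sum_(p <- h) p.1.1 * (W p.1.2.2 p.2.2 w - W p.1.2.1 p.2.2 w
                         - W p.1.2.2 p.2.1 w + W p.1.2.1 p.2.1 w).

Definition space_time (T : R) : set (measurableTypeR R * measurableTypeR R) :=
  `]0, 1[%classic `*` `]0, T[%classic.

(** [X] is the Wiener integral of the deterministic function [g] of (y, r)
    over D `*` (0, T): the closure of [step_wiener], as an operator from
    L^2(D `*` (0, T)) to L^2(Omega). For Hurst indices at most 1/2 this operator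
    is closable, so that [X] is determined by [g] up to a null set. *)
Definition is_wiener_integral (W : R -> R -> Omega -> R) (T : R)
    (g : R * R -> R) (X : Omega -> R) : Prop :=
  [/\ measurable_fun (space_time T) g,
      measurable_fun setT X &
   exists h : nat -> step_data,
   [/\ forall n, step_wf T (h n),
      (\int[(@lebesgue_measure R \x @lebesgue_measure R)%E]_(z in
          space_time T)
        ((step_eval (h n) z - g z) ^+ 2)%R%:E)%E @[n --> \oo] --> 0%E &
      (\int[P]_w ((step_wiener W (h n) w - X w) ^+ 2)%R%:E)%E
        @[n --> \oo] --> 0%E]].

(** [Z w x], as a random element of L^2(D), is the stochastic convolution
    \int_0^t \int_D G(t - r, x, y) xi(y, r) dy dr. *)
Definition is_stoch_convolution (W : R -> R -> Omega -> R) (T : R)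
    (G : R -> R -> R -> R) (t : R) (Z : Omega -> R -> R) : Prop :=
  measurable_fun setT (fun z : Omega * measurableTypeR R => Z z.1 z.2) /\
  {ae @lebD R, forall x, is_wiener_integral W T
    (fun z => if z.2 < t then G (t - z.2) x z.1 else 0) (fun w => Z w x)}.

(** [u w t] : R -> R is a random field, with values in L^2(D), such that
    u(t) = \int_0^t S(t-r) F(u(r)) dr
           + \int_0^t \int_D G(t-r, ., y) xi(y, r) dy dr
    almost surely in L^2(D), for every t in [0, T]. *)
Definition solves_integral_equation (W : R -> R -> Omega -> R) (T : R)
    (S : R -> (R -> R) -> R -> R) (F : (R -> R) -> R -> R)
    (G : R -> R -> R -> R) (u : Omega -> R -> R -> R) : Prop :=
  [/\ measurable_fun (setT `*` `[0, T]%classic `*` setT)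
        (fun z : Omega * measurableTypeR R * measurableTypeR R =>
           u z.1.1 z.1.2 z.2),
      forall w t, t \in `[0, T] -> u w t \in @L2D R &
      forall t, t \in `[0, T] ->
      exists2 Z : Omega -> R -> R, is_stoch_convolution W T G t Z &
        {ae P, forall w, exists2 I : R -> R,
          is_bochner_integral t (fun r => S (t - r) (F (u w r))) I &
          {ae @lebD R, forall x, u w t x = I x + Z w x}}].

Definition mild_solution W T alpha s lam phi f u : Prop :=
  solves_integral_equation W T (Sop alpha s lam phi) f
    (Gker alpha s lam phi) u.

Definition galerkin_solution W T alpha s lam phi f N u : Prop :=
  solves_integral_equation W T (SopN alpha s lam phi N)
    (fun v => projN phi N (f v)) (GkerN alpha s lam phi N) u /\
  forall w t, t \in `[0, T] -> in_HN phi N (u w t).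

End noise.

(* Main.v *)
(** For a Hurst index H <= 1/2 the covariance of fractional Brownian motion is
    the Gram matrix, for the spectral weight xi^(1 - 2 H), of the Fourier
    transforms of the indicators of the intervals. Hence the second moment of
    the Wiener integral of a kernel g is bounded by the weighted L^2-norm of the
    space-time Fourier transform of g. For g = \sum_k e_k(t - r) phi_k(x) phi_k(y),
    e_k(tau) = E_alpha,1(- lambda_k^s tau^alpha), integrating in x decouples the
    indices by orthonormality, and leaves a sum of products of a space energy,
    O(k^(1 - 2 H1)) by an explicit computation with sines, and of a time energy,
    O(k^(- 4 s theta)) whenever alpha theta < H2 and theta <= 1, because e_k is
    nonnegative, nonincreasing and at most C (lambda_k^s tau^alpha)^(- theta):
    its Fourier transform at xi is controlled by its mass on (0, pi / xi). The
    tail k > N is O(N^(- (4 s theta + 2 H1 - 2))), which bounds the error in the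
    stochastic convolution. The properties of e_k come from the resolvent
    equation w + a * w = a of the Riemann-Liouville kernel a.

    The deterministic part uses that S(t) is a contraction and that
    ||S(t) - S_N(t) P_N|| <= C N^(- 2 s) t^(- alpha), and ends with a Gronwall
    argument for E||u - u_N||^2. The definition of a mild solution does not give
    the almost sure integrability of ||u(t)|| in time, which Gronwall needs. It
    follows from the equation at the final time T, since
    ||S(t) v|| <= C t^(- alpha) ||S(T) v||. *)

Require Import Defs.
From HB Require Import structures.
From mathcomp Require Import all_boot all_order all_algebra.
From mathcomp Require Import all_classical all_reals all_analysis measurable_realfun.
From mathcomp Require Import ring lra.
From mathcomp Require Import zify.

Set Implicit Arguments.
Unset Strict Implicit.
Unset Printing Implicit Defensive.

Import Order.TTheory GRing.Theory Num.Theory.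
Import numFieldNormedType.Exports.

Local Open Scope classical_set_scope.
Local Open Scope ring_scope.

Local Notation mu := lebesgue_measure.

(** * Changes of variables and the Riemann-Liouville kernels *)

(** Positivity of the resolvent w replaces complete monotonicity: it makes e_k nonincreasing and
    gives c / (1 + x) <= E_alpha,1(- x) <= C / (1 + x). The upper bound yields x^(- theta) for theta
    in [0, 1]; as the rate is 4 s theta + 2 H1 - 2, the constraints theta <= 1 and alpha theta < H2
    produce the two terms of the minimum. The lower bound compares S(t) with S(T).

    The step functions defining a Wiener integral converge to the kernel in L^2, not a priori in the
    weighted Fourier norm, and the series of G is controlled pointwise only off the diagonal. In
    both cases finite sums are bounded and Fatou's lemma passes to the limit.

    Each equation holds almost surely at a fixed time, with a null set depending on the time;
    pathwise Gronwall arguments are applied to a jointly measurable excess whose moments are known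
    at every time. As t^(- 2 alpha) may fail to be integrable, t^(- alpha) serves as a weight in
    Cauchy-Schwarz. The deterministic error N^(- 4 s) is harmless, since 4 sigma < 4 s + 2 H1 - 2 <
    4 s. *)

Lemma ge0_integral_affine (R : realType) (c a : R) (f : R -> \bar R) :
  0 < c -> measurable_fun [set: R] f -> (forall x, 0 <= f x)%E ->
  (\int[mu]_x f x = c%:E * \int[mu]_x f (c * x + a)%R)%E.
Proof.
move=> c0 mf f0.
have mg : measurable_fun [set: measurableTypeR R] ((fun x => c * x + a) : R -> measurableTypeR R).
  by apply: measurable_funD => //; apply: measurable_funM.
pose m : {measure set (measurableTypeR R) -> \bar R} :=
  mscale (NngNum (ltW c0)) (measure_function_pushforward__canonical__measure_function_Measure mu mg).
(* Lebesgue measure is determined by its values on half-open intervals, so it equals c times its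
   image under x |-> c x + a. *)
have E (A : set R) : measurable A -> mu A = m A.
  apply: lebesgue_measure_unique => X [[u v] _ <-] /=.
  rewrite /m /mscale /= /pushforward.
  rewrite (_ : _ @^-1` _ = `](u - a) / c, (v - a) / c]%classic); last first.
    apply/seteqP; split => x /=; rewrite !in_itv/= ltr_pdivrMr// ler_pdivlMr//
      ltrBlDr lerBrDr [x * c]mulrC //.
  rewrite !lebesgue_measure_itv/= !lte_fin ltr_pM2r ?invr_gt0// ltrD2r.
  case: ifP => _; last by rewrite mule0.
  by rewrite -!EFinB -EFinM; congr EFin; field; lra.
have -> : (\int[mu]_x f x = \int[m]_x f x)%E.
  by apply: eq_measure_integral => A mA _; exact: E.
by rewrite ge0_integral_mscale//= ge0_integral_pushforward.
Qed.
Arguments ge0_integral_affine {R} c a f.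

Lemma ge0_integral_shift (R : realType) (a : R) (f : R -> \bar R) :
  measurable_fun [set: R] f -> (forall x, 0 <= f x)%E ->
  (\int[mu]_x f (x + a)%R = \int[mu]_x f x)%E.
Proof.
move=> mf f0; rewrite [RHS](ge0_integral_affine 1 a)// mul1e.
by apply: eq_integral => x _; rewrite mul1r.
Qed.

Lemma ge0_integral_oppr (R : realType) (f : R -> \bar R) :
  measurable_fun [set: R] f -> (forall x, 0 <= f x)%E ->
  (\int[mu]_x f (- x)%R = \int[mu]_x f x)%E.
Proof.
move=> mf f0.
have mg : measurable_fun [set: measurableTypeR R] (-%R : R -> measurableTypeR R) by [].
transitivity (\int[measure_function_pushforward__canonical__measure_function_Measure mu mg]_x f x)%E.
  by rewrite ge0_integral_pushforward.
by apply: eq_measure_integral => A mA _; apply: lebesgue_measureN.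
Qed.

Lemma ge0_integral_reflect (R : realType) (a : R) (f : R -> \bar R) :
  measurable_fun [set: R] f -> (forall x, 0 <= f x)%E ->
  (\int[mu]_x f (a - x)%R = \int[mu]_x f x)%E.
Proof.
move=> mf f0; rewrite -(ge0_integral_oppr mf f0).
rewrite -[RHS](ge0_integral_shift (- a)) //; last first.
  by apply: measurableT_comp.
by apply: eq_integral => x _; rewrite opprD opprK addrC.
Qed.

(** For p < 1 the integrand is singular at 0, so the fundamental theorem is used on
    [t / (n + 2), t], and these intervals increase to (0, t]. The divisor n + 2 keeps the left end
    strictly below t. *)
Lemma ge0_integral_powR (R : realType) (p t : R) : 0 < p -> 0 <= t ->
  (\int[mu]_(r in `]0%R, t[) (r `^ (p - 1))%:E = (t `^ p / p)%:E)%E.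
Proof.
move=> p0; rewrite le_eqVlt => /predU1P[<-|t0].
  by rewrite set_itv_ge ?bnd_simp ?ltxx// integral_set0 powR0 ?gt_eqF// mul0r.
have step (a : R) : 0 < a < t ->
    (\int[mu]_(r in `[a, t]) (r `^ (p - 1))%:E = (t `^ p / p)%:E - (a `^ p / p)%:E)%E.
  move=> /andP[a0 at_].
  have d (x : R) : 0 < x -> is_derive x 1 (fun x : R => x `^ p / p) (x `^ (p - 1)).
    move=> x0; have := is_deriveM (is_derive1_powR p x0) (is_derive_cst (p^-1) x 1).
    by rewrite scaler0 add0r /GRing.scale/= mulrA mulVf ?gt_eqF// mul1r.
  have c (x : R) : 0 < x -> {for x, continuous (fun x : R => x `^ p / p)}.
    by move=> x0; apply/differentiable_continuous/derivable1_diffP; apply: ex_derive; apply: d.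
  rewrite (@continuous_FTC2 R _ (fun x : R => x `^ p / p) a t)//.
  - apply: continuous_in_subspaceT => x; rewrite inE/= in_itv/= => /andP[ax _].
    apply/differentiable_continuous/derivable1_diffP; apply: ex_derive.
    by apply: is_derive1_powR; apply: lt_le_trans ax.
  - split.
    + by move=> x; rewrite in_itv/= => /andP[ax _]; apply: ex_derive; apply: d; apply: lt_trans ax.
    + by apply: cvg_at_right_filter; apply: c.
    + by apply: cvg_at_left_filter; apply: c.
  - move=> x; rewrite in_itv/= => /andP[ax _]; rewrite derive1E.
    by have := d x (lt_trans a0 ax) => ?; rewrite derive_val.
pose F (n : nat) := `[t / n.+2%:R, t]%classic : set (measurableTypeR R).
have mp : measurable_fun [set: R] (fun r : R => (r `^ (p - 1))%:E).
  by apply/measurable_EFinP; exact: measurable_powR.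
have an n : 0 < t / n.+2%:R < t.
  by rewrite divr_gt0//= ltr_pdivrMr// ltr_pMr// ltr1n.
have UF : \bigcup_n F n = `]0, t]%classic.
  apply/seteqP; split => x /=.
    move=> [n _]; rewrite /F/= !in_itv/= => /andP[nx ->]; rewrite andbT.
    by apply: lt_le_trans nx; have /andP[] := an n.
  rewrite in_itv/= => /andP[x0 xt].
  exists (Num.truncn (t / x)) => //; rewrite /F/= in_itv/= xt andbT.
  rewrite ler_pdivrMr// mulrC -ler_pdivrMr//.
  apply/ltW; apply: (lt_trans (truncnS_gt _)); by rewrite ltr_nat.
rewrite integral_itv_bndo_bndc; last by apply: measurable_funTS.
apply/esym.
rewrite -UF.
suff [H1 H2] : (\int[mu]_(r in F i) (r `^ (p - 1))%:E)%E @[i --> \oo] --> (t `^ p / p)%:E /\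
  (\int[mu]_(r in F i) (r `^ (p - 1))%:E)%E @[i --> \oo] --> (\int[mu]_(r in \bigcup_n F n) (r `^ (p - 1))%:E)%E.
  exact: cvg_unique H1 H2.
split.
- rewrite (_ : (fun i => _) = (fun n => ((t `^ p / p) - (t / n.+2%:R) `^ p / p)%:E)).
    apply: cvg_EFin; first by near=> n.
    rewrite -[X in _ --> X]subr0; apply: cvgB; first exact: cvg_cst.
    rewrite -(mul0r p^-1); apply: cvgMl.
    have /cvg_at_rightP := powR_cvg0 p0; apply; split.
      by move=> n; have /andP[] := an n.
    rewrite -(mulr0 t); apply: cvgMr.
    by rewrite (cvg_shiftS (fun n => n.+1%:R^-1 : R)); exact: cvg_harmonic.
  by apply/funext => n; rewrite step// EFinB.
- apply: (@ge0_nondecreasing_set_cvg_integral _ _ _ F (fun r : R => (r `^ (p - 1))%:E) mu) => //.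
  - move=> i j ij; apply/subsetPset => x; rewrite /F/= !in_itv/= => /andP[jx ->].
    rewrite andbT; apply: le_trans jx.
    by rewrite ler_pM2l// lef_pV2 ?posrE// ler_nat.
  - by move=> i; exact: measurable_itv.
  - by move=> i; apply: measurable_funTS.
  - by move=> i x _; rewrite lee_fin powR_ge0.
Unshelve. all: by end_near.
Qed.

Lemma ge0_integral_powRN (R : realType) (p A : R) : 0 < p -> 0 < A ->
  (\int[mu]_(r in `[A, +oo[) (r `^ (- p - 1))%:E = (A `^ (- p) / p)%:E)%E.
Proof.
move=> p0 A0.
have d (x : R) : 0 < x -> is_derive x 1 (fun x : R => - (x `^ (- p) / p)) (x `^ (- p - 1)).
  move=> x0; have := is_deriveN (is_deriveM (is_derive1_powR (- p) x0) (is_derive_cst (p^-1) x 1)).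
  by rewrite scaler0 add0r /GRing.scale/= mulrA mulrN mulVf ?gt_eqF// mulN1r opprK.
have c (x : R) : 0 < x -> {for x, continuous (fun x : R => - (x `^ (- p) / p))}.
  by move=> x0; apply/differentiable_continuous/derivable1_diffP; apply: ex_derive; apply: d.
rewrite (@ge0_continuous_FTC2y R _ (fun x : R => - (x `^ (- p) / p)) A 0).
- by rewrite sub0e -EFinN opprK.
- by move=> x _; exact: powR_ge0.
- apply: continuous_in_subspaceT => x; rewrite inE/= in_itv/= andbT => Ax.
  apply/differentiable_continuous/derivable1_diffP; apply: ex_derive.
  by apply: is_derive1_powR; apply: lt_le_trans Ax.
- rewrite -oppr0; apply: cvgN; rewrite -(mul0r p^-1); apply: cvgMl.
  apply/cvgr0Pnorm_lt => e e0; near=> x.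
  have x0 : 0 < x by near: x; exact: nbhs_pinfty_gt.
  rewrite ger0_norm ?powR_ge0// powRN -[e]invrK ltf_pV2 ?posrE ?invr_gt0 ?powR_gt0//.
  have -> : e^-1 = (e^-1 `^ p^-1) `^ p.
    by rewrite -powRrM mulVf ?gt_eqF// powRr1// invr_ge0 ltW.
  apply: gt0_ltr_powR => //; rewrite ?nnegrE ?powR_ge0 ?ltW//.
- by move=> x Ax; apply: ex_derive; apply: d; apply: lt_trans Ax.
- by apply: cvg_at_right_filter; apply: c.
- move=> x; rewrite in_itv/= andbT => Ax; rewrite derive1E.
  by have := d x (lt_trans A0 Ax) => ?; rewrite derive_val.
Unshelve. all: by end_near.
Qed.

(** Setting the power to zero for x <= 0 turns integrals over half-lines and causal convolutions
    into integrals over the whole line. *)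
Definition powk (R : realType) (g x : R) : R := if 0 < x then x `^ (g - 1) else 0.

Lemma powk_ge0 (R : realType) (g x : R) : 0 <= powk g x.
Proof. by rewrite /powk; case: ifP => // _; exact: powR_ge0. Qed.

Lemma measurable_powk (R : realType) (g : R) : measurable_fun [set: R] (powk g).
Proof.
by apply: measurable_fun_ifT => //; exact: measurable_fun_ltr.
Qed.

Lemma powkM (R : realType) (g c x : R) : 0 < c -> powk g (c * x) = c `^ (g - 1) * powk g x.
Proof.
move=> c0; rewrite /powk pmulr_rgt0//; case: ifP => x0; last by rewrite mulr0.
by rewrite powRM// ltW.
Qed.

Lemma integral_powk_itv (R : realType) (g t : R) : 0 < g -> 0 <= t ->
  (\int[mu]_(r in `]-oo, t[) (powk g r)%:E = (t `^ g / g)%:E)%E.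
Proof.
move=> g0 t0; rewrite -ge0_integral_powR// integral_mkcond [RHS]integral_mkcond.
apply: eq_integral => x _; rewrite !patchE !mem_setE !in_itv/= /powk.
by case: (x < t); case: ltP.
Qed.

(** A single Taylor term of exp(t / 2), of degree above |g|, dominates t^g; half of the exponential
    decay is left over. *)
Lemma powR_expRN_le (R : realType) (g : R) : exists2 C : R, 0 <= C &
  forall t, 1 <= t -> t `^ g * expR (- t) <= C * expR (- (t / 2)).
Proof.
pose n := (Num.truncn `|g|).+1.
exists (2 ^+ n.+1 * n.+1`!%:R); first by rewrite mulr_ge0// exprn_ge0.
move=> t t1; have t0 : 0 < t by apply: lt_le_trans t1.
have H1 : t `^ g <= t ^+ n.+1.
  rewrite -(powR_mulrn _ (ltW t0)); apply: (ler_powR t1).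
  apply: (le_trans (ler_norm g)); apply: ltW; apply: (lt_trans (truncnS_gt _)).
  by rewrite ltr_nat.
have H2 : t ^+ n.+1 <= 2 ^+ n.+1 * n.+1`!%:R * expR (t / 2).
  have H := @expR_ge1Dxn R (t / 2) n (divr_ge0 (ltW t0) (ler0n _ _)).
  have H3 : (t / 2) ^+ n.+1 / n.+1`!%:R <= expR (t / 2) by apply: le_trans H; rewrite lerDr.
  rewrite ler_pdivrMr ?ltr0n ?fact_gt0// in H3.
  rewrite -mulrA [_ * expR _]mulrC; apply: le_trans (ler_wpM2l _ H3); last exact: exprn_ge0.
  by rewrite -exprMn mulrC divfK.
have -> : expR (- (t / 2)) = expR (t / 2) * expR (- t).
  by rewrite -expRD; congr expR; field.
by rewrite mulrA ler_wpM2r ?expR_ge0//; apply: le_trans H2.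
Qed.

Lemma integral_expRN_le (R : realType) (A c : R) : 0 < c ->
  (\int[mu]_(t in `[A, +oo[) (c * expR (- (c * t)))%:E = (expR (- (c * A)))%:E)%E.
Proof.
move=> c0.
have d (x : R) : is_derive x 1 (fun x : R => - expR (- (c * x))) (c * expR (- (c * x))).
  have : is_derive x 1 (fun x : R => - (c * x)) (- c).
    apply: is_deriveN; have := is_deriveZ c (is_derive_id x 1).
    by rewrite /GRing.scale/= mulr1.
  move=> h; have := is_deriveN (is_derive1_comp (is_derive_expR _) h).
  by rewrite mulrN opprK mulrC.
rewrite (@ge0_continuous_FTC2y R _ (fun x : R => - expR (- (c * x))) A 0).
- by rewrite sub0e -EFinN opprK.
- by move=> x _; rewrite mulr_ge0 ?expR_ge0 ?ltW.
- apply: continuous_subspaceT => x.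
  apply: cvgMr; apply: continuous_comp; last exact: continuous_expR.
  by apply: cvgN; apply: cvgMr.
- rewrite -oppr0; apply: cvgN.
  apply: (cvg_comp (fun x => c * x) (fun y => expR (- y)) _ (@cvgr_expR R)).
  by apply: gt0_cvgMry => //; exact: cvg_id.
- by move=> x Ax; apply: ex_derive; apply: d.
- apply: (@cvg_at_right_filter _ _ (fun x : R => - expR (- (c * x)))).
  have /derivable1_diffP/differentiable_continuous := @ex_derive _ _ _ _ _ _ _ (d A).
  exact.
- move=> x _; rewrite derive1E.
  by have := d x => ?; rewrite derive_val.
Qed.

Definition gamma_dens (R : realType) (g x : R) : R := powk g x * expR (- x).

Lemma gamma_dens_ge0 (R : realType) (g x : R) : 0 <= gamma_dens g x.
Proof. by rewrite mulr_ge0 ?powk_ge0 ?expR_ge0. Qed.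

Lemma measurable_gamma_dens (R : realType) (g : R) : measurable_fun [set: R] (gamma_dens g).
Proof.
apply: measurable_funM; first exact: measurable_powk.
apply: measurableT_comp => //; exact: measurable_expR.
Qed.

Lemma integral_gamma_lty (R : realType) (g : R) : 0 < g ->
  (\int[mu]_x (gamma_dens g x)%:E < +oo)%E.
Proof.
move=> g0.
have mG : measurable_fun [set: R] (fun x => (gamma_dens g x)%:E).
  by apply/measurable_EFinP; exact: measurable_gamma_dens.
have G0 x : (0 <= (gamma_dens g x)%:E)%E by rewrite lee_fin gamma_dens_ge0.
rewrite -(setUv `]-oo, 1[%classic) ge0_integral_setU//=; last 3 first.
- exact: measurableC.
- by rewrite setUv.
- by apply/disj_setPCl.
rewrite lte_add_pinfty//.
- apply: (@le_lt_trans _ _ (\int[mu]_(r in `]-oo, 1%R[) (powk g r)%:E)%E).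
    apply: ge0_le_integral => //.
    + by apply: measurable_funTS.
    + by apply: measurable_funTS; apply/measurable_EFinP; exact: measurable_powk.
    + move=> x _; rewrite lee_fin /gamma_dens /powk; case: ifP => x0; last by rewrite mul0r.
      by rewrite ler_piMr ?powR_ge0// expR_le1 oppr_le0 ltW.
  by rewrite integral_powk_itv// ltry.
- have [C C0 HC] := powR_expRN_le (g - 1).
  rewrite setCitvl.
  apply: (@le_lt_trans _ _ (\int[mu]_(r in `[1%R, +oo[) ((C * 2)%:E * (2^-1 * expR (- (2^-1 * r)))%:E))%E).
    apply: ge0_le_integral => //.
    + by apply: measurable_funTS.
    + apply: measurable_funTS; apply/measurable_EFinP.
      do 2 apply: measurable_funM => //.
      apply: measurableT_comp; first exact: measurable_expR.
      by apply: measurableT_comp => //; apply: measurable_funM.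
    + move=> x; rewrite /= in_itv/= andbT => x1; rewrite -EFinM lee_fin /gamma_dens /powk (lt_le_trans _ x1)//.
      by apply: (le_trans (HC _ x1)); rewrite [2^-1 * x]mulrC -!mulrA [2 * _]mulrA divff// mul1r.
  rewrite ge0_integralZl_EFin//.
  + by rewrite integral_expRN_le// ltry.
  + apply: measurable_funTS; apply/measurable_EFinP.
    apply: measurable_funM => //.
    apply: measurableT_comp; first exact: measurable_expR.
    by apply: measurableT_comp => //; apply: measurable_funM.
  + by rewrite mulr_ge0.
Qed.

Lemma integral_gamma_dens (R : realType) (g : R) : 0 < g ->
  (\int[mu]_x (gamma_dens g x)%:E = (Gamma g)%:E)%E.
Proof.
move=> g0; have H := integral_gamma_lty g0.
have -> : Gamma g = fine (\int[mu]_x (gamma_dens g x)%:E)%E.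
  rewrite /Gamma /Rintegral integral_mkcond; congr fine.
  apply: eq_integral => x _; rewrite patchE/= mem_setE in_itv/= andbT /gamma_dens /powk.
  by case: ifP; rewrite ?mul0r.
rewrite fineK// ge0_fin_numE//; apply: integral_ge0 => x _.
by rewrite lee_fin gamma_dens_ge0.
Qed.

#[local] Opaque Gamma.

(** Only the part of the Gamma integral over [A, A + 1] is kept. The factor 1 / 2 covers g < 1,
    where the power decreases but x <= 2 A. Since A is free, the bound makes 1 / Gamma(k a + d)
    decay faster than any geometric sequence. *)
Lemma Gamma_lower (R : realType) (g A : R) : 0 < g -> 1 <= A ->
  A `^ (g - 1) / 2 * expR (- (A + 1)) <= Gamma g.
Proof.
move=> g0 A1; have A0 : 0 < A by apply: lt_le_trans A1.
rewrite -lee_fin -integral_gamma_dens//.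
pose c := A `^ (g - 1) / 2 * expR (- (A + 1)).
have c0 : 0 <= c by rewrite mulr_ge0 ?expR_ge0// divr_ge0// powR_ge0.
apply: (@le_trans _ _ (\int[mu]_(r in `[A, (A + 1)%R]) c%:E)%E).
  rewrite integral_cst//= lebesgue_measure_itv/= lte_fin ltrDl ltr01 -EFinB.
  by rewrite addrAC subrr add0r mule1.
rewrite integral_mkcond; apply: ge0_le_integral => //.
- by move=> x _; rewrite patchE; case: ifP => // _; rewrite lee_fin.
- exact/(measurable_restrictT _ _).1.
- by apply/measurable_EFinP; exact: measurable_gamma_dens.
- move=> x _; rewrite patchE; case: ifP; last by rewrite lee_fin gamma_dens_ge0.
  rewrite mem_setE in_itv/= => /andP[Ax xA1]; rewrite lee_fin /gamma_dens /powk.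
  rewrite (lt_le_trans A0 Ax) /c ler_pM ?expR_ge0 ?divr_ge0 ?powR_ge0//; last first.
    by rewrite ler_expR lerN2.
  have x0 : 0 < x by apply: lt_le_trans Ax.
  have [g1|g1] := leP 1 g.
    apply: (@le_trans _ _ (A `^ (g - 1))).
      by rewrite ler_pdivrMr// ler_peMr ?powR_ge0// ler1n.
    by apply: ge0_ler_powR => //; rewrite ?subr_ge0 ?nnegrE// ?(ltW A0) ?(ltW x0).
  have xA : x <= 2 * A by apply: (le_trans xA1); lra.
  apply: (@le_trans _ _ ((2 * A) `^ (g - 1))).
    rewrite powRM ?(ltW A0)// mulrC ler_wpM2r ?powR_ge0//.
    rewrite -[X in X <= _](powR_inv1 (ler0n _ 2)); apply: ler_powR; first by rewrite ler1n.
    lra.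
  rewrite -(opprB 1 g) !powRN lef_pV2 ?posrE ?powR_gt0 ?mulr_gt0//.
  apply: ge0_ler_powR => //; rewrite ?nnegrE ?opprB ?subr_ge0 ?(ltW g1) ?(ltW x0)//.
  by rewrite mulr_ge0// (ltW A0).
Qed.

Lemma Gamma_gt0 (R : realType) (g : R) : 0 < g -> 0 < Gamma g.
Proof.
move=> g0; rewrite -lte_fin -integral_gamma_dens//.
rewrite lt_def; apply/andP; split; last first.
  by apply: integral_ge0 => x _; rewrite lee_fin gamma_dens_ge0.
apply/eqP => /= H0.
have mG : measurable_fun [set: R] (fun x => (gamma_dens g x)%:E).
  by apply/measurable_EFinP; exact: measurable_gamma_dens.
have := ae_eq_integral_abs mu measurableT mG; rewrite /=.
have -> : (\int[mu]_x `|(gamma_dens g x)%:E| = 0)%E.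
  by rewrite -[RHS]H0; apply: eq_integral => x _; rewrite gee0_abs// lee_fin gamma_dens_ge0.
case=> /(_ erefl) [N [mN N0 sub]] _.
have : (mu `]0%R, 1%R[%classic <= mu N)%E.
  apply: le_measure; rewrite ?inE//.
  move=> x /=; rewrite in_itv/= => /andP[x0 _]; apply: sub => /= /(_ Logic.I) /eqP.
  by rewrite eqe /gamma_dens /powk x0 mulf_eq0 gt_eqF ?powR_gt0//= gt_eqF ?expR_gt0.
by rewrite N0 lebesgue_measure_itv/= lte_fin ltr01 oppr0 adde0 lee_fin ler10.
Qed.

(* Substituting x = t z shows that the convolution of t^(g-1) and t^(d-1) is
   homogeneous; its value at 1 comes from Gamma g * Gamma d. *)
Definition powk_conv (R : realType) (g d x : R) : \bar R :=
  (\int[mu]_y (powk g (x - y) * powk d y)%:E)%E.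

Lemma powk_convE (R : realType) (g d x : R) : 0 < x ->
  powk_conv g d x = ((x `^ (g + d - 1))%:E * powk_conv g d 1)%E.
Proof.
move=> x0; rewrite {1}/powk_conv [LHS](ge0_integral_affine x 0 (fun y => (powk g (x - y) * powk d y)%:E) x0); last 2 first.
- apply/measurable_EFinP; apply: measurable_funM; last exact: measurable_powk.
  by apply: measurableT_comp; [exact: measurable_powk|apply: measurable_funB].
- by move=> y; rewrite lee_fin mulr_ge0 ?powk_ge0.
under eq_integral => y _ do rewrite addr0 -{1}(mulr1 x) -mulrBr !powkM// mulrACA EFinM.
rewrite ge0_integralZl_EFin//.
- rewrite muleA /powk_conv; congr (_ * _)%E; rewrite -EFinM; congr EFin.
  rewrite -powRD; last by rewrite (gt_eqF x0) implybT.
  rewrite -{1}(powRr1 (ltW x0)) -powRD; last by rewrite (gt_eqF x0) implybT.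
  by congr powR; ring.
- by move=> y _; rewrite lee_fin mulr_ge0 ?powk_ge0.
- apply/measurable_EFinP; apply: measurable_funM; last exact: measurable_powk.
  by apply: measurableT_comp; [exact: measurable_powk|apply: measurable_funB].
- by rewrite mulr_ge0 ?powR_ge0.
Qed.

Lemma powk_conv0 (R : realType) (g d x : R) : x <= 0 -> powk_conv g d x = 0%E.
Proof.
move=> x0; apply: integral0_eq => y _; rewrite /powk; case: ifP => // H1; last by rewrite mul0r.
case: ifP => H2; last by rewrite mulr0.
by move: H1; rewrite subr_gt0 => H1; have := lt_trans H2 (lt_le_trans H1 x0); rewrite ltxx.
Qed.

(** The Beta-Gamma identity. The product is the total mass of the convolution of the two Gamma
    densities; their exponentials combine to exp(- x), and homogeneity of the remaining convolution
    leaves the integral of Gamma (g + d). *)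
Lemma powk_conv1 (R : realType) (g d : R) : 0 < g -> 0 < d ->
  ((Gamma g * Gamma d)%:E = powk_conv g d 1 * (Gamma (g + d))%:E)%E.
Proof.
move=> g0 d0.
have mG (a : R) : measurable_fun [set: R] (fun x => (gamma_dens a x)%:E).
  by apply/measurable_EFinP; exact: measurable_gamma_dens.
have mgy (a b : R) : measurable_fun [set: R] (fun y => (powk a (b - y))%:E).
  by apply/measurable_EFinP; apply: measurableT_comp; [exact: measurable_powk|apply: measurable_funB].
have mgx (a b : R) : measurable_fun [set: R] (fun y => (gamma_dens a (y - b))%:E).
  by apply/measurable_EFinP; apply: measurableT_comp; [exact: measurable_gamma_dens|apply: measurable_funB].
transitivity (\int[mu]_y \int[mu]_x (gamma_dens g (x - y) * gamma_dens d y)%:E)%E.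
  transitivity (\int[mu]_y ((Gamma g)%:E * (gamma_dens d y)%:E))%E.
    rewrite ge0_integralZl_EFin ?integral_gamma_dens ?EFinM//.
    - by move=> y _; rewrite lee_fin gamma_dens_ge0.
    - exact: mG.
    - by apply/ltW/Gamma_gt0.
  apply: eq_integral => y _.
  under [RHS]eq_integral do rewrite EFinM.
  rewrite ge0_integralZr//; last 3 first.
  - exact: mgx.
  - by move=> x _; rewrite lee_fin gamma_dens_ge0.
  - by rewrite lee_fin gamma_dens_ge0.
  congr (_ * _)%E; rewrite -(integral_gamma_dens g0).
  apply/esym; apply: (ge0_integral_shift (- y) (mG g)).
  by move=> x; rewrite lee_fin gamma_dens_ge0.
have mgg : measurable_fun [set: R * R] (fun p => (gamma_dens g (p.2 - p.1) * gamma_dens d p.1)%:E).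
  apply/measurable_EFinP; apply: measurable_funM.
    by apply: measurableT_comp; [exact: measurable_gamma_dens|apply: measurable_funB].
  by apply: measurableT_comp => //; exact: measurable_gamma_dens.
rewrite (@fubini_tonelli _ _ _ _ _ mu mu (fun p : R * R => (gamma_dens g (p.2 - p.1) * gamma_dens d p.1)%:E))//=; last first.
  by move=> p; rewrite lee_fin mulr_ge0 ?gamma_dens_ge0.
rewrite -integral_gamma_dens ?addr_gt0//.
rewrite -ge0_integralZl//; last 3 first.
- exact: mG.
- by move=> x _; rewrite lee_fin gamma_dens_ge0.
- by apply: integral_ge0 => x _; rewrite lee_fin mulr_ge0 ?powk_ge0.
apply: eq_integral => x _ /=.
transitivity (powk_conv g d x * (expR (- x))%:E)%E.
  rewrite /powk_conv -ge0_integralZr//.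
  - apply: eq_integral => y _; rewrite -EFinM; congr EFin; rewrite /gamma_dens.
    have -> : expR (- x) = expR (- (x - y)) * expR (- y) by rewrite -expRD; congr expR; ring.
    by ring.
  - apply/measurable_EFinP; apply: measurable_funM; last exact: measurable_powk.
    by apply: measurableT_comp; [exact: measurable_powk|apply: measurable_funB].
  - by move=> y _; rewrite lee_fin mulr_ge0 ?powk_ge0.
rewrite /gamma_dens /powk; case: ifPn => x0; last first.
  by rewrite powk_conv0 ?leNgt// mul0e mul0r mule0.
by rewrite powk_convE// muleAC EFinM muleC.
Qed.

(** The Riemann-Liouville kernel, normalized so that orders add under convolution. The lock stops
    conversion from unfolding it. *)
HB.lock Definition rlk (R : realType) (g x : R) : R := powk g x / Gamma g.

Lemma rlkE (R : realType) (g x : R) : rlk g x = powk g x / Gamma g.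
Proof. by rewrite rlk.unlock. Qed.

Lemma rlk_ge0 (R : realType) (g x : R) : 0 < g -> 0 <= rlk g x.
Proof. by move=> g0; rewrite rlkE divr_ge0 ?powk_ge0// ltW// Gamma_gt0. Qed.

Lemma measurable_rlk (R : realType) (g : R) : measurable_fun [set: R] (rlk g).
Proof. by rewrite rlk.unlock; apply: measurable_funM => //; exact: measurable_powk. Qed.

Lemma rlk_conv (R : realType) (g d x : R) : 0 < g -> 0 < d ->
  (\int[mu]_y (rlk g (x - y) * rlk d y)%:E = (rlk (g + d) x)%:E)%E.
Proof.
move=> g0 d0; have [gd gd0] := (Gamma_gt0 g0, Gamma_gt0 d0).
have gdd := Gamma_gt0 (addr_gt0 g0 d0).
have c0 : 0 <= (Gamma g)^-1 / Gamma d.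
  by apply: divr_ge0; [rewrite invr_ge0; apply: ltW gd|apply: ltW gd0].
transitivity (((Gamma g)^-1 / Gamma d)%:E * powk_conv g d x)%E.
  rewrite -ge0_integralZl_EFin//.
  - apply: eq_integral => y _; rewrite -EFinM !rlkE; congr EFin.
    by rewrite mulrACA mulrC.
  - by move=> y _; rewrite lee_fin mulr_ge0 ?powk_ge0.
  - apply/measurable_EFinP; apply: measurable_funM; last exact: measurable_powk.
    by apply: measurableT_comp; [exact: measurable_powk|apply: measurable_funB].
rewrite rlkE /powk; case: ifPn => x0; last by rewrite powk_conv0 ?leNgt// mule0 mul0r.
rewrite powk_convE// muleCA [in RHS]EFinM; congr (_ * _)%E.
have := powk_conv1 g0 d0; clear c0; move: (Gamma g) (Gamma d) (Gamma (g + d)) gd gd0 gdd => G1 G2 G3 G10 G20 G30.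
(* Finiteness of the Beta integral also comes from this identity: an infinite value would make its
   right-hand side infinite. *)
case: (powk_conv g d 1) => [r||] //=.
- rewrite -!EFinM => -[H]; congr EFin.
  apply: (mulIf (lt0r_neq0 G30)); rewrite mulVf ?lt0r_neq0// -mulrA -H; field.
  by rewrite !lt0r_neq0.
- by rewrite gt0_mulye// lte_fin.
- by rewrite gt0_mulNye// lte_fin.
Qed.

(** * Monotonicity and decay of the Mittag-Leffler function *)

(** The coefficients of an entire power series, described by a growth condition that is stable under
    termwise differentiation. *)
Definition superexp (R : realType) (c : nat -> R) : Prop :=
  forall q : R, 0 < q <= 1 -> exists2 C : R, 0 <= C & forall k, `|c k| <= C * q ^+ k.

Lemma superexp_cvg (R : realType) (c : nat -> R) (x : R) : superexp c ->
  cvgn (pseries c x).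
Proof.
move=> sc; pose q := (2 * (1 + `|x|))^-1.
have x1 : 1 <= 1 + `|x| by rewrite lerDl.
have q0 : 0 < q by rewrite invr_gt0 mulr_gt0// (lt_le_trans _ x1).
have [] := sc q.
  by rewrite q0/= invf_le1 ?mulr_gt0 ?(lt_le_trans _ x1)// (le_trans x1)// ler_peMl ?ler1n// (le_trans _ x1).
move=> C C0 HC; apply: normed_cvg.
apply: (@series_le_cvg _ _ (fun k => C * 2^-1 ^+ k)).
- by move=> k; rewrite normr_ge0.
- by move=> k; rewrite mulr_ge0// exprn_ge0// invr_ge0.
- move=> k; rewrite /= normrM normrX.
  apply: (le_trans (ler_wpM2r (exprn_ge0 _ (normr_ge0 _)) (HC k))).
  rewrite -mulrA ler_wpM2l// -exprMn; apply: lerXn2r; rewrite ?nnegrE ?invr_ge0//.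
    by rewrite mulr_ge0// (ltW q0).
  rewrite /q invfM -mulrA ler_piMr ?invr_ge0// ler_pdivrMl ?(lt_le_trans _ x1)// mulr1.
  by rewrite lerDr.
- by apply: is_cvg_geometric_series; rewrite ger0_norm ?invr_ge0// invf_lt1// ltr1n.
Qed.

(** The hypothesis at q / 2 leaves a factor 2^(- (k + 1)), which absorbs the factor k + 1 of the
    derivative. *)
Lemma superexp_diffs (R : realType) (c : nat -> R) : superexp c ->
  superexp (pseries_diffs c).
Proof.
move=> sc q /andP[q0 q1]; have [] := sc (q / 2).
  by rewrite divr_gt0//= ler_pdivrMr// mul1r (le_trans q1)// ler1n.
move=> C C0 HC; exists C => // k; rewrite /pseries_diffs normrM normr_nat.
apply: (le_trans (ler_wpM2l (ler0n _ _) (HC k.+1))).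
rewrite mulrCA ler_wpM2l// expr_div_n mulrA ler_pdivrMr ?exprn_gt0//.
have qk : 0 <= q ^+ k by rewrite exprn_ge0// (ltW q0).
apply: (@le_trans _ _ (k.+1%:R * q ^+ k)).
  by rewrite ler_wpM2l// exprS ler_piMl.
rewrite mulrC ler_wpM2l// -natrX ler_nat; apply: ltnW; exact: ltn_expl.
Qed.

Lemma superexp_continuous (R : realType) (c : nat -> R) : superexp c ->
  continuous (fun x : R => limn (pseries c x)).
Proof.
move=> sc x.
have H : is_derive x 1 (fun x => limn (pseries c x)) (limn (pseries (pseries_diffs c) x)).
  apply: (@pseries_snd_diffs _ c (`|x| + 1)); try apply: superexp_cvg => //.
  - exact: superexp_diffs.
  - by do 2 apply: superexp_diffs.
  - by rewrite [`|_ + 1|]ger0_norm ?addr_ge0// ltrDl.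
have /derivable1_diffP/differentiable_continuous := @ex_derive _ _ _ _ _ _ _ H.
exact.
Qed.

Lemma superexp_invGamma (R : realType) (a d : R) : 0 < a -> 0 < d ->
  superexp (fun k : nat => (Gamma (k%:R * a + d))^-1).
Proof.
move=> a0 d0 q /andP[q0 q1].
have g0 (k : nat) : 0 < k%:R * a + d by rewrite ltr_wpDl// mulr_ge0 ?(ltW a0).
(* Chosen so that A^(- k a) = q^k. *)
pose A := q `^ (- a^-1).
have A1 : 1 <= A.
  rewrite /A powRN -[X in X <= _]invr1 lef_pV2 ?posrE ?powR_gt0//.
  by rewrite -(powRr0 q) ger_powR ?q0 ?invr_ge0 ?(ltW a0).
have A0 : 0 < A by apply: lt_le_trans A1.
pose C := 2 * expR (A + 1) * A `^ (1 - d).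
exists C; first by rewrite !mulr_ge0 ?expR_ge0 ?powR_ge0.
move=> k; rewrite ger0_norm; last by rewrite invr_ge0; apply/ltW/Gamma_gt0.
have : A `^ (k%:R * a + d - 1) / 2 * expR (- (A + 1)) <= Gamma (k%:R * a + d).
  exact: Gamma_lower.
have P0 : 0 < A `^ (k%:R * a + d - 1) / 2 * expR (- (A + 1)).
  by rewrite mulr_gt0 ?expR_gt0// divr_gt0// powR_gt0.
move=> H; rewrite -lef_pV2 ?posrE ?Gamma_gt0// in H.
apply: (le_trans H); rewrite le_eqVlt; apply/orP; left; apply/eqP.
rewrite !invfM expRN !invrK -powRN /C.
have -> : A `^ (- (k%:R * a + d - 1)) = A `^ (1 - d) * q ^+ k.
  have -> : - (k%:R * a + d - 1) = (1 - d) + - (k%:R * a) by ring.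
  rewrite powRD; last by rewrite (gt_eqF A0) implybT.
  have E : - a^-1 * - (k%:R * a) = k%:R by field; rewrite gt_eqF.
  congr (_ * _); rewrite /A -powRrM E.
  by rewrite powR_mulrn// (ltW q0).
ring.
Qed.

Lemma mittag_lefflerE (R : realType) (a b z : R) :
  mittag_leffler a b z = limn (pseries (fun k : nat => (Gamma (k%:R * a + b))^-1) z).
Proof.
rewrite /mittag_leffler /pseries; congr (limn (series _)).
by apply/funext => k; rewrite mulrC.
Qed.

Lemma continuous_mittag_leffler (R : realType) (a b : R) : 0 < a -> 0 < b ->
  continuous (mittag_leffler a b).
Proof.
move=> a0 b0; rewrite (_ : mittag_leffler a b = fun z => limn (pseries (fun k : nat => (Gamma (k%:R * a + b))^-1) z)).
  exact/superexp_continuous/superexp_invGamma.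
by apply/funext => z; rewrite mittag_lefflerE.
Qed.

Lemma mittag_leffler0 (R : realType) (a b : R) : mittag_leffler a b 0 = (Gamma b)^-1.
Proof.
rewrite /mittag_leffler; apply/cvg_lim => //.
rewrite -(cvg_shiftS (series _)) /=.
rewrite (_ : (fun n => _) = fun=> (Gamma b)^-1); first exact: cvg_cst.
apply/funext => n; rewrite /series/= big_nat_recl//= big1 => [|i _].
  by rewrite expr0 mul0r add0r addr0 mul1r.
by rewrite expr0n/= mul0r.
Qed.

Definition rls (R : realType) (a : R) (sel : nat -> bool) (d t : R) : \bar R :=
  (\sum_(0 <= k <oo) ((sel k)%:R * rlk (k%:R * a + d) t)%:E)%E.

(* [rlF a d t] = \sum_k (-1)^k [rlk (k a + d) t] = t^(d - 1) E_a,d(- t^a); the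
   even and odd terms are summed apart so that Tonelli applies to convolutions. *)
HB.lock Definition rlF (R : realType) (a d t : R) : R :=
  fine (rls a (fun k => ~~ odd k) d t) - fine (rls a odd d t).

Lemma rls_ge0 (R : realType) (a : R) sel (d t : R) : 0 < a -> 0 < d -> (0 <= rls a sel d t)%E.
Proof.
move=> a0 d0; apply: nneseries_ge0 => k _ _.
by rewrite lee_fin mulr_ge0// rlk_ge0// ltr_wpDl// mulr_ge0// (ltW a0).
Qed.

Lemma rls_le0 (R : realType) (a : R) sel (d t : R) : t <= 0 -> rls a sel d t = 0%E.
Proof.
move=> t0; apply: eseries0 => k _ _.
by rewrite rlkE /powk ltNge t0/= mul0r mulr0.
Qed.

Lemma measurable_rls (R : realType) (a : R) sel (d : R) : 0 < a -> 0 < d ->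
  measurable_fun [set: R] (rls a sel d).
Proof.
move=> a0 d0; apply: ge0_emeasurable_sum => k.
  by move=> x _ _; rewrite lee_fin mulr_ge0// rlk_ge0// ltr_wpDl// mulr_ge0// (ltW a0).
by move=> _; apply/measurable_EFinP; apply: measurable_funM => //; exact: measurable_rlk.
Qed.

Lemma rls_series (R : realType) (a d t : R) (sel : nat -> bool) : 0 < a -> 0 < d -> 0 < t ->
  cvgn (series (fun k => (sel k)%:R * rlk (k%:R * a + d) t)) /\
  rls a sel d t = (limn (series (fun k => (sel k)%:R * rlk (k%:R * a + d) t)))%:E.
Proof.
move=> a0 d0 t0.
have g0 (k : nat) : 0 < k%:R * a + d by rewrite ltr_wpDl// mulr_ge0 ?(ltW a0).
have H : cvgn (series (fun k => (sel k)%:R * rlk (k%:R * a + d) t)).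
  apply: (@series_le_cvg _ _ (fun k => t `^ (d - 1) * ((Gamma (k%:R * a + d))^-1 * (t `^ a) ^+ k))).
  - by move=> k; rewrite mulr_ge0// rlk_ge0.
  - move=> k; rewrite !mulr_ge0 ?exprn_ge0 ?powR_ge0// invr_ge0.
    by apply/ltW/Gamma_gt0.
  - move=> k; have -> : t `^ (d - 1) * ((Gamma (k%:R * a + d))^-1 * (t `^ a) ^+ k) = rlk (k%:R * a + d) t.
      rewrite rlkE /powk t0 mulrCA [RHS]mulrC; congr (_ * _).
      rewrite -powR_mulrn ?powR_ge0// -powRrM -powRD; last by rewrite (gt_eqF t0) implybT.
      by congr powR; ring.
    by apply: ler_piMl; [exact: rlk_ge0|rewrite lern1; case: (sel k)].
  - rewrite (_ : series _ = fun n => t `^ (d - 1) * pseries (fun k : nat => (Gamma (k%:R * a + d))^-1) (t `^ a) n); last first.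
      by apply/funext => n; rewrite /series /pseries/= mulr_sumr.
    apply: is_cvgM; first exact: is_cvg_cst.
    exact: superexp_cvg (superexp_invGamma a0 d0).
split=> //; rewrite /rls -EFin_lim//; congr (limn _).
by apply/funext => n; rewrite /series/= sumEFin.
Qed.

Lemma rls_fin (R : realType) (a d t : R) sel : 0 < a -> 0 < d -> rls a sel d t \is a fin_num.
Proof.
move=> a0 d0; have [t0|t0] := leP t 0; first by rewrite rls_le0.
by rewrite (rls_series sel a0 d0 t0).2.
Qed.

Lemma rlF_mittag_leffler (R : realType) (a d t : R) : 0 < a -> 0 < d -> 0 < t ->
  rlF a d t = t `^ (d - 1) * mittag_leffler a d (- t `^ a).
Proof.
move=> a0 d0 t0.
have [c1 E1] := rls_series (fun k => ~~ odd k) a0 d0 t0.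
have [c2 E2] := rls_series odd a0 d0 t0.
rewrite rlF.unlock E1 E2/= -limB// mittag_lefflerE; apply/cvg_lim => //.
rewrite (_ : (_ - _) = fun n => t `^ (d - 1) * pseries (fun k : nat => (Gamma (k%:R * a + d))^-1) (- t `^ a) n).
  apply: cvgM; first exact: cvg_cst.
  exact: superexp_cvg (superexp_invGamma a0 d0).
apply/funext => n; rewrite /pseries/= mulr_sumr.
transitivity (series (fun k : nat => (~~ odd k)%:R * rlk (k%:R * a + d) t) n - series (fun k : nat => (odd k)%:R * rlk (k%:R * a + d) t) n) => //.
rewrite /series/= -sumrB.
apply: eq_bigr => k _; rewrite -mulrBl exprNn.
have -> : (~~ odd k)%:R - (odd k)%:R = (-1) ^+ k :> R.
  by rewrite -signr_odd; case: (odd k); rewrite /= ?expr1 ?expr0; ring.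
have -> : rlk (k%:R * a + d) t = t `^ (d - 1) * ((Gamma (k%:R * a + d))^-1 * (t `^ a) ^+ k).
  rewrite rlkE /powk t0 mulrCA [LHS]mulrC; congr (_ * _).
  rewrite -powR_mulrn ?powR_ge0// -powRrM -powRD; last by rewrite (gt_eqF t0) implybT.
  by congr powR; ring.
ring.
Qed.

Lemma rls_conv (R : realType) (a d g t : R) (sel : nat -> bool) : 0 < a -> 0 < d -> 0 < g ->
  (\int[mu]_y ((rlk g (t - y))%:E * rls a sel d y) = rls a sel (g + d) t)%E.
Proof.
move=> a0 d0 g0.
have e0 (k : nat) (b : R) : 0 < b -> 0 < k%:R * a + b.
  by move=> b0; rewrite ltr_wpDl// mulr_ge0// (ltW a0).
have r0 (k : nat) (y b : R) : 0 < b -> (0 <= ((sel k)%:R * rlk (k%:R * a + b) y)%:E)%E.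
  by move=> b0; rewrite lee_fin mulr_ge0// rlk_ge0// e0.
have mr b : measurable_fun [set: R] (fun y => rlk b (t - y)).
  by apply: measurableT_comp; [exact: measurable_rlk|apply: measurable_funB].
transitivity (\int[mu]_y (\sum_(0 <= k <oo) ((rlk g (t - y))%:E * ((sel k)%:R * rlk (k%:R * a + d) y)%:E)))%E.
  apply: eq_integral => y _; rewrite nneseriesZl// => k _; exact: r0.
rewrite integral_nneseries//; last 2 first.
- move=> k; rewrite /=; apply/measurable_EFinP; apply: measurable_funM; first exact: mr.
  by apply: measurable_funM => //; exact: measurable_rlk.
- by move=> k y _; rewrite mule_ge0 ?r0// lee_fin rlk_ge0.
apply: eq_eseriesr => k _.
transitivity ((sel k)%:R%:E * \int[mu]_y (rlk g (t - y) * rlk (k%:R * a + d) y)%:E)%E.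
  rewrite -ge0_integralZl//.
  - by apply: eq_integral => y _; rewrite -!EFinM mulrCA.
  - apply/measurable_EFinP; apply: measurable_funM; [exact: mr|exact: measurable_rlk].
  - by move=> y _; rewrite lee_fin mulr_ge0 ?rlk_ge0 ?e0.
have E : k%:R * a + (g + d) = g + (k%:R * a + d) by rewrite addrCA.
by rewrite E rlk_conv ?e0// -EFinM.
Qed.

Lemma rlF_le0 (R : realType) (a d t : R) : t <= 0 -> rlF a d t = 0.
Proof. by move=> t0; rewrite rlF.unlock !rls_le0//= subrr. Qed.

(** Convolution with [rlk g] raises the order of each term by g. Tonelli applies to the even and to
    the odd terms apart, and their finiteness makes the difference integrable. *)
Lemma rlF_conv (R : realType) (a d g t : R) : 0 < a -> 0 < d -> 0 < g ->
  (\int[mu]_y (rlk g (t - y) * rlF a d y)%:E = (rlF a (g + d) t)%:E)%E /\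
  mu.-integrable [set: R] (fun y => (rlk g (t - y) * rlF a d y)%:E).
Proof.
move=> a0 d0 g0.
have gd : 0 < g + d by rewrite addr_gt0.
have mr b : measurable_fun [set: R] (fun y => rlk b (t - y)).
  by apply: measurableT_comp; [exact: measurable_rlk|apply: measurable_funB].
have fE sel y : (fine (rls a sel d y))%:E = rls a sel d y by rewrite fineK// rls_fin.
have I sel : mu.-integrable [set: R] (fun y => (rlk g (t - y) * fine (rls a sel d y))%:E).
  apply/integrableP; split.
    apply/measurable_EFinP; apply: measurable_funM; first exact: mr.
    by apply: measurableT_comp => //; exact: measurable_rls.
  rewrite (_ : (\int[mu]_y _)%E = rls a sel (g + d) t).
    by rewrite -(fineK (rls_fin t sel a0 gd)) ltry.
  rewrite -rls_conv//; apply: eq_integral => y _; rewrite gee0_abs ?EFinM ?fE//.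
  by rewrite mule_ge0 ?rls_ge0// lee_fin rlk_ge0.
have E : (fun y => (rlk g (t - y) * rlF a d y)%:E) =
    (fun y => (rlk g (t - y) * fine (rls a (fun k => ~~ odd k) d y))%:E -
              (rlk g (t - y) * fine (rls a odd d y))%:E)%E.
  by apply/funext => y; rewrite rlF.unlock mulrBr EFinB.
rewrite E; split; last exact: integrableB.
rewrite integralB//.
under eq_integral do rewrite EFinM fE.
under [X in (_ - X)%E]eq_integral do rewrite EFinM fE.
by rewrite !rls_conv// rlF.unlock EFinB !fineK// rls_fin.
Qed.

Lemma nneseries_S (R : realType) (u : nat -> R) : (forall k, 0 <= u k) ->
  (\sum_(0 <= k <oo) (u k)%:E = (u 0%N)%:E + \sum_(0 <= k <oo) (u k.+1)%:E)%E.
Proof.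
move=> u0; rewrite (nneseries_split _ 1%N); last by move=> k _; rewrite lee_fin.
rewrite big_nat1; congr (_ + _)%E.
rewrite -(@nneseries_addn _ _ 1%N); last by move=> k; rewrite lee_fin.
by apply: eq_eseriesr => k _; rewrite addn1.
Qed.

(** Removing the term k = 0 exchanges even and odd indices. Combined with [rlF_conv] at d = g = a,
    this is the resolvent equation for [rlF a a]. *)
Lemma rlF_rec (R : realType) (a d t : R) : 0 < a -> 0 < d ->
  rlF a d t = rlk d t - rlF a (d + a) t.
Proof.
move=> a0 d0.
have e0 (k : nat) (b : R) : 0 < b -> 0 < k%:R * a + b.
  by move=> b0; rewrite ltr_wpDl// mulr_ge0// (ltW a0).
have da : 0 < d + a by rewrite addr_gt0.
have shift sel : rls a sel d t = (((sel 0%N)%:R * rlk d t)%:E + rls a (sel \o S) (d + a) t)%E.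
  have H k : 0 <= (sel k)%:R * rlk (k%:R * a + d) t by rewrite mulr_ge0// rlk_ge0// e0.
  have E0 : 0%:R * a + d = d by rewrite mul0r add0r.
  have ES (k : nat) : k.+1%:R * a + d = k%:R * a + (d + a) by rewrite -natr1; ring.
  rewrite {1}/rls (nneseries_S H) E0; apply: (congr1 (fun x => _ + x)%E).
  by apply: eq_eseriesr => k _; rewrite ES.
rewrite rlF.unlock (shift (fun k => ~~ odd k)) (shift odd)/= mul1r mul0r add0e.
have -> : (fun k => ~~ odd k) \o S = odd by apply/funext => k /=; rewrite negbK.
have -> : (odd \o S) = (fun k => ~~ odd k) by apply/funext => k.
rewrite fineD ?rls_fin//=; ring.
Qed.

Lemma integral_rlk_tail (R : realType) (a s t : R) : 0 < a -> t <= s ->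
  (\int[mu]_y (rlk a (s - y) * (t <= y)%R%:R)%:E = ((s - t) `^ a / a / Gamma a)%:E)%E.
Proof.
move=> a0 ts.
have mr : measurable_fun [set: R] (fun z => (rlk a z * (z <= s - t)%R%:R)%:E).
  apply/measurable_EFinP; apply: measurable_funM; first exact: measurable_rlk.
  apply: measurableT_comp => //; exact: measurable_fun_ler.
transitivity (\int[mu]_y ((fun z => (rlk a z * (z <= s - t)%R%:R)%:E) (s - (y : R))%R))%E.
  by apply: eq_integral => y _; rewrite /= lerD2l lerN2.
rewrite (ge0_integral_reflect s mr); last by move=> z; rewrite lee_fin mulr_ge0// rlk_ge0.
transitivity ((Gamma a)^-1%:E * \int[mu]_(r in `]-oo, (s - t)%R[) (powk a r)%:E)%E; last first.
  by rewrite integral_powk_itv ?subr_ge0// -EFinM mulrC.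
rewrite integral_itv_bndo_bndc; last first.
  by apply: measurable_funTS; apply/measurable_EFinP; exact: measurable_powk.
rewrite -ge0_integralZl_EFin//.
- rewrite [RHS]integral_mkcond; apply: eq_integral => z _.
  rewrite patchE mem_setE in_itv/= rlkE; case: (z <= s - t).
    by rewrite mulr1 -EFinM mulrC.
  by rewrite mulr0.
- by move=> z _; rewrite lee_fin powk_ge0.
- by apply: measurable_funTS; apply/measurable_EFinP; exact: measurable_powk.
- by rewrite invr_ge0; apply/ltW/Gamma_gt0.
Qed.

Lemma eq_integral_le (R : realType) (f g : R -> \bar R) : f =1 g ->
  (\int[mu]_x f x <= \int[mu]_x g x)%E.
Proof. by move=> /funext ->. Qed.

Lemma rlk_le0 (R : realType) (g x : R) : x <= 0 -> rlk g x = 0.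
Proof. by move=> x0; rewrite rlkE /powk ltNge x0/= mul0r. Qed.

(** Transports an inequality between two integrals to their closed values. *)
Lemma le_eq2 d (T : porderType d) (x y x' y' : T) :
  x = x' -> y = y' -> (x <= y)%O -> (x' <= y')%O.
Proof. by move=> -> ->. Qed.

(** * Positivity of the resolvent and bounds for the relaxation function *)

Section resolvent.
Context {R : realType} (a : R) (a01 : 0 < a < 1).
Lemma resolvent_a0 : 0 < a. Proof. by case/andP: a01. Qed.
Lemma resolvent_a1 : 0 < 1 - a. Proof. by rewrite subr_gt0; case/andP: a01. Qed.
Let a0 := resolvent_a0.
Let a1 := resolvent_a1.
(** [w] is t^(a - 1) E_a,a(- t^a), the resolvent of the kernel [rlk a]; [e] below is E_a,1(- t^a),
    which equals 1 minus the integral of [w] over (0, t). *)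
Let w := rlF a a.
Let e := rlF a 1.

Lemma rlk1E (t : R) : rlk 1 t = (0 < t)%R%:R :> R.
Proof.
have G1 : Gamma (1 : R) = 1.
  apply: EFin_inj; rewrite -integral_gamma_dens//.
  transitivity (\int[mu]_(x in `]0%R, +oo[) (1 * expR (- (1 * (x : R))))%:E)%E.
    rewrite [RHS]integral_mkcond; apply: eq_integral => x _.
    rewrite patchE mem_setE in_itv/= andbT /gamma_dens /powk subrr powRr0 !mul1r.
    by case: ifP; rewrite ?mul0r ?mul1r.
  rewrite integral_itv_obnd_cbnd; last first.
    apply: measurable_funTS; apply/measurable_EFinP.
    apply: measurable_funM => //.
    apply: measurableT_comp; first exact: measurable_expR.
    by apply: measurableT_comp => //; apply: measurable_funM.
  by rewrite integral_expRN_le// mulr0 oppr0 expR0.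
by rewrite rlkE /powk subrr powRr0 G1 divr1; case: ifP.
Qed.

Lemma continuous_w (t : R) : 0 < t -> {for t, continuous w}.
Proof.
move=> t0; have H : {for t, continuous (fun t => t `^ (a - 1) * mittag_leffler a a (- t `^ a))}.
  have cp (p : R) : {for t, continuous (fun t : R => t `^ p)}.
    have /derivable1_diffP/differentiable_continuous := @ex_derive _ _ _ _ _ _ _ (is_derive1_powR p t0).
    exact.
  apply: cvgM; first exact: cp.
  apply: continuous_comp; last exact: continuous_mittag_leffler.
  by apply: cvgN; exact: cp.
suff : w x @[x --> t] --> w t by [].
rewrite /w rlF_mittag_leffler//; apply: cvg_trans H; apply: near_eq_cvg; near=> x.
have x0 : 0 < x by near: x; exact: lt_nbhsr.
by rewrite rlF_mittag_leffler.
Unshelve. all: by end_near.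
Qed.

(** Near 0 the factor E_a,a(- t^a) is close to its value 1 / Gamma(a) > 0. *)
Lemma w_pos0 : exists2 eps : R, 0 < eps & forall t, 0 < t <= eps -> 0 < w t.
Proof.
have c0 : continuous (mittag_leffler a a) by exact: continuous_mittag_leffler.
have M0 : 0 < mittag_leffler a a 0.
  by rewrite mittag_leffler0 invr_gt0; exact: Gamma_gt0.
have : \forall x \near (0 : R), 0 < mittag_leffler a a x by exact: (cvgr_gt _ (c0 0) _ M0).
move=> /nbhs_ballP[r /= r0 Hr].
exists ((r / 2) `^ a^-1); first by rewrite powR_gt0 ?divr_gt0.
move=> t /andP[t0 tr]; rewrite /w rlF_mittag_leffler// mulr_gt0 ?powR_gt0//.
apply: Hr; rewrite /ball/= sub0r opprK ger0_norm ?powR_ge0//.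
apply: (@le_lt_trans _ _ (r / 2)); last by rewrite ltr_pdivrMr// ltr_pMr// ltr1n.
apply: (@le_trans _ _ (((r / 2) `^ a^-1) `^ a)).
  by apply: ge0_ler_powR; rewrite ?nnegrE ?powR_ge0 ?(ltW t0) ?(ltW a0).
by rewrite -powRrM mulVf ?gt_eqF// powRr1// divr_ge0// (ltW r0).
Qed.

(* At a first zero t0 of w, pick t < t0 maximizing w on [t0 - delta, t0]; since
   y |-> a(t0 - y) / a(t - y) is nonincreasing (log-convexity of the kernel),
   the equation w = a - a * w at t and at t0 gives w t0 > 0. *)
Lemma rlF_gt0 (t : R) : 0 < t -> 0 < w t.
Proof.
move=> t0; rewrite ltNge; apply/negP => wt.
have [eps eps0 weps] := w_pos0.
pose A := [set x : R | eps <= x /\ w x <= 0].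
have At : A t.
  split=> //; rewrite leNgt; apply/negP => te.
  by have := weps t; rewrite t0 (ltW te) => /(_ isT); rewrite ltNge wt.
have hA : has_inf A by split; [exists t|exists eps => x []].
pose s := inf A.
have es : eps <= s by apply: lb_le_inf => [|x []//]; exists t.
have s0 : 0 < s by apply: lt_le_trans es.
have wlt x : 0 < x -> x < s -> 0 < w x.
  move=> x0 xs; have [xe|ex] := leP x eps; first by apply: weps; rewrite x0.
  rewrite ltNge; apply/negP => wx.
  suff : s <= x by rewrite leNgt xs.
  by apply: ge_inf; [case: hA|split=> //; exact: ltW].
have ws : w s <= 0.
  rewrite leNgt; apply/negP => ws.
  have : \forall x \near s, 0 < w x by exact: (cvgr_gt _ (continuous_w s0) _ ws).
  move=> /nbhs_ballP[r /= r0 Hr].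
  have [x [ex wx] xr] := inf_adherent r0 hA.
  have sx : s <= x by apply: ge_inf; [case: hA|split].
  suff : 0 < w x by rewrite ltNge wx.
  by apply: Hr; rewrite /ball/= distrC ger0_norm ?subr_ge0// ltrBlDl.
pose K := (Gamma a)^-1 / a.
have K0 : 0 < K by rewrite divr_gt0// invr_gt0; exact: Gamma_gt0.
(* The first bound gives t1 >= s / 2, hence rho >= 1 / 2; the second keeps the mass of the kernel
   near s, over a length at most [dl], below 1 / 4. *)
pose dl := Num.min (s / 2) ((4 * K)^-1 `^ a^-1).
have dl0 : 0 < dl by rewrite lt_min divr_gt0//= powR_gt0// invr_gt0 mulr_gt0.
have dls : dl <= s / 2 by rewrite ge_min lexx.
have sdl : 0 < s - dl by lra.
have dla : dl `^ a * K <= 4^-1.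
  rewrite -ler_pdivlMr// -invfM.
  apply: (@le_trans _ _ (((4 * K)^-1 `^ a^-1) `^ a)).
    apply: ge0_ler_powR; rewrite ?nnegrE ?powR_ge0 ?(ltW dl0) ?(ltW a0)//.
    by rewrite ge_min lexx orbT.
  by rewrite -powRrM mulVf ?lt0r_neq0// powRr1// invr_ge0 mulr_ge0// (ltW K0).
have [t1 t1in t1max] : exists2 c, c \in `[s - dl, s] & forall t, t \in `[s - dl, s] -> w t <= w c.
  apply: EVT_max; first by rewrite gerBl (ltW dl0).
  apply: continuous_in_subspaceT => x; rewrite inE/= in_itv/= => /andP[sx _].
  by apply: continuous_w; apply: lt_le_trans sx.
have wt1 : 0 < w t1.
  apply: (@lt_le_trans _ _ (w (s - dl))).
    by apply: wlt => //; rewrite gtrBl.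
  by apply: t1max; rewrite in_itv/= lexx gerBl (ltW dl0).
move: t1in; rewrite in_itv/= => /andP[sdt1 t1s].
have t10 : 0 < t1 by apply: lt_le_trans sdt1.
have {}t1s : t1 < s.
  by rewrite lt_neqAle t1s andbT; apply/eqP => t1s'; move: wt1; rewrite t1s' ltNge ws.
have aa : 0 < a + a by rewrite addr_gt0.
(* The ratio of the kernel at s to the kernel at t1; by [rat] it also bounds the ratio after
   shifting both by any y in (0, t1). *)
pose rho := (t1 / s) `^ (1 - a).
have rho_ge : 2^-1 <= rho.
  have h1 : 2^-1 <= t1 / s by rewrite ler_pdivlMr//; lra.
  apply: (le_trans h1); apply: ger1_powR; last by lra.
  by rewrite divr_gt0//= ler_pdivrMr// mul1r (ltW t1s).
have rlks : rlk a s = rho * rlk a t1.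
  rewrite !rlkE /powk s0 t10 /rho powRM ?invr_ge0 ?(ltW t10) ?(ltW s0)//.
  rewrite -(opprB 1 a) !powRN -[s^-1](powR_inv1 (ltW s0)) -powRrM mulN1r powRN.
  by field; rewrite !gt_eqF ?powR_gt0//; exact: Gamma_gt0.
have rat y : 0 < y -> y < t1 -> rlk a (s - y) <= rho * rlk a (t1 - y).
  move=> y0 yt1; have ys : y < s by apply: lt_trans t1s.
  have [sy ty] : 0 < s - y /\ 0 < t1 - y by rewrite !subr_gt0.
  rewrite !rlkE /powk sy ty mulrA ler_wpM2r//; first by rewrite invr_ge0; apply/ltW/Gamma_gt0.
  rewrite -(opprB 1 a) !powRN ler_pdivlMr ?powR_gt0// mulrC ler_pdivrMr ?powR_gt0//.
  rewrite /rho -powRM ?divr_ge0 ?(ltW t10) ?(ltW s0) ?(ltW sy)//.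
  apply: ge0_ler_powR; rewrite ?nnegrE ?(ltW a1) ?(ltW ty)//.
    by rewrite mulr_ge0 ?divr_ge0 ?(ltW t10) ?(ltW s0) ?(ltW sy).
  have r1 : t1 / s <= 1 by rewrite ler_pdivrMr// mul1r (ltW t1s).
  have r2 : t1 / s * s = t1 by rewrite divfK// gt_eqF.
  by rewrite mulrBr r2 lerB// ler_piMl// (ltW y0).
have [E1 I1] := rlF_conv s a0 a0 a0; have [E2 I2] := rlF_conv t1 a0 a0 a0.
have E3 := integral_rlk_tail a0 (ltW t1s).
have I3 : mu.-integrable [set: R] (fun y => (rlk a (s - y) * (t1 <= y)%R%:R)%:E).
  apply/integrableP; split.
    apply/measurable_EFinP; apply: measurable_funM.
      by apply: measurableT_comp; [exact: measurable_rlk|apply: measurable_funB].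
    by apply: measurableT_comp => //; exact: measurable_fun_ler.
  apply: (@le_lt_trans _ _ ((s - t1) `^ a / a / Gamma a)%:E); last exact: ltry.
  rewrite -E3; apply: eq_integral_le => y.
  by rewrite gee0_abs// lee_fin mulr_ge0// rlk_ge0.
(* Both sides are convolutions of [rlk a] with [w]. Below t1 the kernels are compared through rho;
   on [t1, s] the function [w] is at most its maximum w t1. *)
have Hle : rlF a (a + a) s <= rho * rlF a (a + a) t1 + w t1 * ((s - t1) `^ a / a / Gamma a).
  pose g y := (rho%:E * (rlk a (t1 - y) * rlF a a y)%:E + (w t1)%:E * (rlk a (s - y) * (t1 <= y)%R%:R)%:E)%E.
  have Ig2 := integrableZl measurableT rho I2.
  have Ig3 := integrableZl measurableT (w t1) I3.
  have Ig : mu.-integrable [set: R] g by exact: integrableD.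
  have Eg : (\int[mu]_y g y = (rho * rlF a (a + a) t1 + w t1 * ((s - t1) `^ a / a / Gamma a))%:E)%E.
    have -> : (\int[mu]_y g y = rho%:E * \int[mu]_y (rlk a (t1 - y) * rlF a a y)%:E +
        (w t1)%:E * \int[mu]_y (rlk a (s - y) * (t1 <= y)%R%:R)%:E)%E.
      by rewrite -(integralZl _ I2)// -(integralZl _ I3)// -integralD.
    by rewrite E2 E3.
  rewrite -lee_fin; apply: (le_eq2 E1 Eg); apply: le_integral => //.
  move=> y _; rewrite /g -!EFinM -EFinD lee_fin.
  have [y0|y0] := leP y 0.
    by rewrite /w !(rlF_le0 _ _ y0) !mulr0 add0r !mulr_ge0 ?rlk_ge0 ?(ltW wt1).
  have [t1y|yt1] := leP t1 y; last first.
    by rewrite !mulr0 addr0 mulrA ler_wpM2r ?rat//; apply/ltW/wlt => //; exact: lt_trans t1s.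
  rewrite (@rlk_le0 _ _ (t1 - y)) ?subr_le0// mul0r mulr0 add0r mulr1 mulrC.
  have [ys|sy] := leP y s; last by rewrite (@rlk_le0 _ _ (s - y)) ?mulr0// subr_le0 (ltW sy).
  rewrite ler_wpM2r ?rlk_ge0//; apply: t1max.
  by rewrite in_itv/= ys andbT (le_trans sdt1).
have kap : (s - t1) `^ a / a / Gamma a <= 4^-1.
  apply: le_trans dla; rewrite -mulrA /K [a^-1 / _]mulrC ler_wpM2r ?(ltW K0)//.
  apply: ge0_ler_powR; rewrite ?nnegrE ?(ltW a0) ?(ltW dl0) ?subr_ge0 ?(ltW t1s)//.
  by rewrite lerBlDl -lerBlDr.
have ws' : w s = rlk a s - rlF a (a + a) s by rewrite /w rlF_rec.
have wt' : w t1 = rlk a t1 - rlF a (a + a) t1 by rewrite /w rlF_rec.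
(* The resolvent equation at s and at t1 gives w s >= (rho - 1 / 4) w t1 >= w t1 / 4 > 0, against w
   s <= 0. *)
have : 2^-1 * w t1 - w t1 * 4^-1 <= w s.
  apply: (@le_trans _ _ (rho * w t1 - w t1 * ((s - t1) `^ a / a / Gamma a))).
    by rewrite lerB// ?ler_wpM2r ?ler_wpM2l ?(ltW wt1).
  rewrite ws' rlks {1}wt' mulrBr -addrA -opprD lerB//.
move: ws wt1; clear; lra.
Qed.

Lemma rlF_ge0 (y : R) : 0 <= w y.
Proof.
by have [y0|y0] := leP y 0; [rewrite /w rlF_le0|exact/ltW/rlF_gt0].
Qed.

Lemma rlF1E (t : R) : 0 < t -> e t = 1 - rlF a (1 + a) t.
Proof. by move=> t0; rewrite /e rlF_rec// rlk1E t0. Qed.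

(** The integral of [w] >= 0 over (0, t) grows with t. *)
Lemma rlF1_homo (s t : R) : 0 < s -> s <= t -> e t <= e s.
Proof.
move=> s0 st; rewrite !rlF1E ?(lt_le_trans s0 st)// lerB// -lee_fin.
have [E1 I1] := rlF_conv s a0 a0 ltr01; have [E2 I2] := rlF_conv t a0 a0 ltr01.
apply: (le_eq2 E1 E2); apply: le_integral => //= y _.
rewrite lee_fin ler_wpM2r//; first exact: rlF_ge0.
rewrite !rlk1E ler_nat !subr_gt0; case: (ltP y s) => // ys.
by rewrite (lt_le_trans ys st).
Qed.

(** [e] is the convolution of [rlk (1 - a)] with [w], since the orders add up to 1. On (0, t) the
    decreasing kernel is at least its value at t, and [w] has mass 1 - e t there. *)
Lemma rlF1_lower (t : R) : 0 < t -> rlk (1 - a) t * (1 - e t) <= e t.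
Proof.
move=> t0; have [b ab [b0 ba]] : exists2 b : R, b = 1 - a & 0 < b /\ b + a = 1.
  by exists (1 - a) => //; split=> //; rewrite subrK.
rewrite -ab {1}rlF1E// subKr -lee_fin EFinM.
have [E1 I1] := rlF_conv t a0 a0 ltr01.
have [E2 I2] := rlF_conv t a0 a0 b0.
have Ig := integrableZl measurableT (rlk b t) I1.
have Eg := integralZl measurableT I1 (rlk b t).
rewrite E1 in Eg; rewrite ba in E2.
apply: (le_eq2 Eg E2); apply: le_integral => //.
move=> y _; rewrite -EFinM lee_fin.
have [y0|y0] := leP y 0; first by rewrite (rlF_le0 _ _ y0) !mulr0.
rewrite mulrA; apply: ler_wpM2r; first exact: rlF_ge0.
rewrite rlk1E subr_gt0; have [yt|yt] := ltP y t; last by rewrite mulr0 rlk_ge0.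
rewrite mulr1 !rlkE /powk subr_gt0 yt t0 ler_wpM2r ?invr_ge0//.
  by apply/ltW/Gamma_gt0.
have -> : b - 1 = - a by rewrite ab addrAC subrr add0r.
rewrite !powRN lef_pV2 ?posrE ?powR_gt0 ?subr_gt0//.
by apply: ge0_ler_powR; rewrite ?nnegrE ?(ltW a0) ?subr_ge0 ?(ltW yt) ?(ltW t0)// gerBl (ltW y0).
Qed.

Lemma rlF1_ge0 (t : R) : 0 <= e t.
Proof.
rewrite -lee_fin; have [E2 I2] := rlF_conv t a0 a0 a1.
have Ea : 1 - a + a = 1 by rewrite subrK.
rewrite Ea in E2; apply: (le_eq2 erefl E2); apply: integral_ge0 => y _.
by rewrite lee_fin mulr_ge0 ?rlk_ge0 ?rlF_ge0.
Qed.

(** 1 - e is the convolution of [rlk a] with [e]. On (0, t) the nonincreasing [e] is at least e t,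
    and the kernel has mass [rlk (a + 1) t]. *)
Lemma rlF1_upper (t : R) : 0 < t -> e t * rlk (a + 1) t <= 1 - e t.
Proof.
move=> t0; rewrite [in X in _ <= X]rlF1E// subKr (_ : 1 + a = a + 1); last by rewrite addrC.
have [E1 I1] := rlF_conv t a0 ltr01 a0.
have Ec := rlk_conv t a0 ltr01.
have [b ba] : exists b : R, b = a + 1 by exists (a + 1).
rewrite -ba in E1 Ec *.
rewrite -lee_fin EFinM.
have I2 : mu.-integrable [set: R] (fun y => (rlk a (t - y) * rlk 1 y)%:E).
  apply/integrableP; split.
    apply/measurable_EFinP; apply: measurable_funM; last exact: measurable_rlk.
    by apply: measurableT_comp; [exact: measurable_rlk|apply: measurable_funB].
  apply: (@le_lt_trans _ _ (rlk b t)%:E); last exact: ltry.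
  rewrite -Ec; apply: eq_integral_le => y.
  by rewrite gee0_abs// lee_fin mulr_ge0// rlk_ge0.
have Ig := integrableZl measurableT (e t) I2.
have Eg := integralZl measurableT I2 (e t).
rewrite Ec in Eg; apply: (le_eq2 Eg E1); apply: le_integral => //.
move=> y _; rewrite -EFinM lee_fin.
have [ty|yt] := leP t y; first by rewrite (@rlk_le0 _ a) ?subr_le0// !mul0r mulr0.
rewrite mulrCA; apply: ler_wpM2l; first exact: rlk_ge0.
rewrite rlk1E; have [y0|y0] := ltP 0 y; last by rewrite mulr0 rlF_le0.
by rewrite mulr1; apply: rlF1_homo => //; exact: ltW.
Qed.

Lemma rlF1_le1 (t : R) : 0 < t -> e t <= 1.
Proof.
move=> t0; rewrite rlF1E// gerBl -lee_fin.
have [E1 I1] := rlF_conv t a0 a0 ltr01.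
apply: (le_eq2 erefl E1); apply: integral_ge0 => y _.
by rewrite lee_fin mulr_ge0 ?rlk_ge0 ?rlF_ge0.
Qed.

End resolvent.

Lemma mittag_leffler_rlF (R : realType) (a x : R) : 0 < a -> 0 < x ->
  mittag_leffler a 1 (- x) = rlF a 1 (x `^ a^-1).
Proof.
move=> a0 x0; rewrite rlF_mittag_leffler ?powR_gt0// subrr powRr0 mul1r.
by rewrite -powRrM mulVf ?gt_eqF// powRr1// (ltW x0).
Qed.

Lemma mittag_leffler1_0 (R : realType) (a : R) : mittag_leffler a 1 0 = 1.
Proof.
rewrite mittag_leffler0; have := @rlk1E R 1.
by rewrite rlkE /powk ltr01 subrr powRr0 mul1r.
Qed.

Lemma mittag_leffler_homo (R : realType) (a x y : R) : 0 < a < 1 -> 0 <= x -> x <= y ->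
  mittag_leffler a 1 (- y) <= mittag_leffler a 1 (- x).
Proof.
move=> a01; have a0 : 0 < a by case/andP: a01.
rewrite le_eqVlt => /predU1P[<- y0|x0 xy].
  rewrite oppr0 mittag_leffler1_0; move: y0; rewrite le_eqVlt => /predU1P[<-|y0].
    by rewrite oppr0 mittag_leffler1_0.
  by rewrite mittag_leffler_rlF// rlF1_le1// powR_gt0.
have y0 : 0 < y by apply: lt_le_trans xy.
rewrite (mittag_leffler_rlF a0 x0) (mittag_leffler_rlF a0 y0); apply: (rlF1_homo a01); first exact: powR_gt0.
by apply: ge0_ler_powR; rewrite ?nnegrE ?invr_ge0 ?(ltW a0) ?(ltW x0) ?(ltW y0).
Qed.

(** With x = t^a and z = e t, [rlF1_upper] reads z x <= Gamma(a + 1) (1 - z); adding z <= 1 gives C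
    = 1 + Gamma(a + 1). *)
Lemma mittag_leffler_le (R : realType) (a : R) : 0 < a < 1 ->
  exists2 C : R, 0 < C & forall x, 0 <= x -> mittag_leffler a 1 (- x) <= C / (1 + x).
Proof.
move=> a01; have a0 : 0 < a by case/andP: a01.
have a10 : 0 < a + 1 by rewrite addr_gt0.
have G := Gamma_gt0 a10.
exists (1 + Gamma (a + 1)); first by rewrite addr_gt0.
move=> x; rewrite le_eqVlt => /predU1P[<-|x0].
  by rewrite oppr0 mittag_leffler1_0 addr0 divr1 lerDl (ltW G).
have p0 : 0 < x `^ a^-1 by apply: powR_gt0.
rewrite mittag_leffler_rlF// ler_pdivlMr ?addr_gt0// mulrDr mulr1.
have := rlF1_upper a01 p0; have := rlF1_le1 a01 p0.
rewrite rlkE /powk p0 addrK -powRrM mulVf ?gt_eqF// powRr1 ?(ltW x0)//.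
move: (rlF a 1 _) (rlF1_ge0 a01 (x `^ a^-1)) => z z0 z1; rewrite mulrA ler_pdivrMr// => H.
rewrite lerD//; apply: (le_trans H).
by rewrite ler_piMl ?(ltW G)// gerBl.
Qed.

(** With x = t^a and z = e t, [rlF1_lower] reads 1 - z <= x Gamma(1 - a) z, so that 1 <= (1 + x
    Gamma(1 - a)) z <= (1 + x) (1 + Gamma(1 - a)) z. *)
Lemma mittag_leffler_ge (R : realType) (a : R) : 0 < a < 1 ->
  exists2 c : R, 0 < c & forall x, 0 <= x -> c / (1 + x) <= mittag_leffler a 1 (- x).
Proof.
move=> a01; have a0 : 0 < a by case/andP: a01.
have a1 : 0 < 1 - a by rewrite subr_gt0; case/andP: a01.
have G := Gamma_gt0 a1.
exists (1 + Gamma (1 - a))^-1; first by rewrite invr_gt0 addr_gt0.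
move=> x; rewrite le_eqVlt => /predU1P[<-|x0].
  by rewrite oppr0 mittag_leffler1_0 addr0 divr1 invf_le1 ?addr_gt0// lerDl (ltW G).
have p0 : 0 < x `^ a^-1 by apply: powR_gt0.
rewrite mittag_leffler_rlF// -invfM.
have := rlF1_lower a01 p0.
have E : 1 - a - 1 = - a by rewrite addrAC subrr add0r.
rewrite rlkE /powk p0 E powRN -powRrM mulVf ?gt_eqF// powRr1 ?(ltW x0)//.
move: (Gamma (1 - a)) G => g g0; move: (rlF a 1 _) (rlF1_ge0 a01 (x `^ a^-1)) => z z0 H.
have : 1 - z <= x * g * z.
  by rewrite -ler_pdivrMl ?mulr_gt0// invfM.
move=> {}H; rewrite -[X in X <= _]div1r ler_pdivrMr ?mulr_gt0 ?addr_gt0//.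
move: H; rewrite -mulrA (mulrC x) => H; nra.
Qed.

(** * Square-integrable functions *)

Lemma cvg_sqr (R : realType) (u : nat -> R) (l : R) :
  u n @[n --> \oo] --> l -> u n ^+ 2 @[n --> \oo] --> l ^+ 2.
Proof. by move=> h; rewrite expr2; under eq_fun do rewrite expr2; exact: cvgM. Qed.

Lemma le1D_of_sqr_le (R : realType) (z l : R) : z ^+ 2 <= l -> z <= 1 + l.
Proof. by move=> h; have := sqr_ge0 (z - 1); nra. Qed.

Section L2.
Context d (T : measurableType d) (R : realType) (m : {measure set T -> \bar R}).
Local Notation L2 := (Lfun m 2%:E).

Definition dot (v w : T -> R) : R := (\int[m]_x (v x * w x))%R.
Definition nrm (v : T -> R) : R := Num.sqrt (dot v v).

Lemma L2_measurable (v : T -> R) : v \in L2 -> measurable_fun [set: T] v.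
Proof. by rewrite inE/= => /andP[]; rewrite inE. Qed.

Lemma L2_integrable (v w : T -> R) : v \in L2 -> w \in L2 ->
  m.-integrable [set: T] (fun x => (v x * w x)%:E).
Proof.
by move=> v2 w2; have := Lfun2_mul_Lfun1 v2 w2 => /Lfun1_integrable.
Qed.

Lemma L2_add (v w : T -> R) : v \in L2 -> w \in L2 -> (fun x => v x + w x) \in L2.
Proof. by move=> v2 w2; have [_] := Lfun_addr_closed m (lee1n 2); apply. Qed.

Lemma L2Z (c : R) (v : T -> R) : v \in L2 -> (fun x => c * v x) \in L2.
Proof. by move=> v2; have [_ H] := Lfun_submod_closed m (lee1n 2); have := H c v 0 v2 (Lfun_addr_closed m (lee1n 2)).1; rewrite addr0. Qed.

Lemma L2N (v : T -> R) : v \in L2 -> (fun x => - v x) \in L2.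
Proof. by move=> /(L2Z (-1)); under eq_fun do rewrite mulN1r. Qed.

Lemma L2B (v w : T -> R) : v \in L2 -> w \in L2 -> (fun x => v x - w x) \in L2.
Proof. by move=> v2 w2; apply: L2_add => //; apply: L2N. Qed.

Lemma L2_0 : (fun=> 0) \in L2.
Proof. by have [] := Lfun_addr_closed m (lee1n 2). Qed.

Lemma L2_sum I (r : seq I) (P : pred I) (v : I -> T -> R) :
  (forall i, v i \in L2) -> (fun x => \sum_(i <- r | P i) v i x) \in L2.
Proof.
move=> v2; elim: r => [|i r IH].
  by under eq_fun do rewrite big_nil; exact: L2_0.
under eq_fun do rewrite big_cons.
by case: (P i) => //; apply: L2_add.
Qed.

Lemma dotC (v w : T -> R) : dot v w = dot w v.
Proof. by rewrite /dot; congr fine; apply: eq_integral => x _; rewrite mulrC. Qed.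

Lemma dotDl (u v w : T -> R) : u \in L2 -> v \in L2 -> w \in L2 ->
  dot (fun x => u x + v x) w = dot u w + dot v w.
Proof.
move=> u2 v2 w2; rewrite /dot -RintegralD//; try exact: L2_integrable.
by congr fine; apply: eq_integral => x _; rewrite mulrDl.
Qed.

Lemma dotZl (c : R) (v w : T -> R) : v \in L2 -> w \in L2 ->
  dot (fun x => c * v x) w = c * dot v w.
Proof.
move=> v2 w2; rewrite /dot -RintegralZl//; last exact: L2_integrable.
by congr fine; apply: eq_integral => x _; rewrite mulrA.
Qed.

Lemma dotNl (v w : T -> R) : v \in L2 -> w \in L2 ->
  dot (fun x => - v x) w = - dot v w.
Proof.
move=> v2 w2; rewrite -mulN1r -dotZl//.
by congr dot; apply/funext => x; rewrite mulN1r.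
Qed.

Lemma dotBl (u v w : T -> R) : u \in L2 -> v \in L2 -> w \in L2 ->
  dot (fun x => u x - v x) w = dot u w - dot v w.
Proof. by move=> u2 v2 w2; rewrite dotDl ?dotNl//; exact: L2N. Qed.

Lemma dot0l (w : T -> R) : dot (fun=> 0) w = 0.
Proof. by rewrite /dot /Rintegral integral0_eq// => x _; rewrite mul0r. Qed.

Lemma dot_suml I (r : seq I) (P : pred I) (v : I -> T -> R) (w : T -> R) :
  (forall i, v i \in L2) -> w \in L2 ->
  dot (fun x => \sum_(i <- r | P i) v i x) w = \sum_(i <- r | P i) dot (v i) w.
Proof.
move=> v2 w2; elim: r => [|i r IH].
  by under eq_fun do rewrite big_nil; rewrite dot0l big_nil.
under eq_fun do rewrite big_cons; rewrite big_cons.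
by case: (P i) => //; rewrite dotDl ?IH//; exact: L2_sum.
Qed.

Lemma dot_ge0 (v : T -> R) : 0 <= dot v v.
Proof. by apply: Rintegral_ge0 => x _; rewrite -expr2 sqr_ge0. Qed.

Lemma nrm_ge0 (v : T -> R) : 0 <= nrm v.
Proof. exact: sqrtr_ge0. Qed.

Lemma sqr_nrm (v : T -> R) : nrm v ^+ 2 = dot v v.
Proof. by rewrite sqr_sqrtr// dot_ge0. Qed.

Lemma EFin_dot (v : T -> R) : v \in L2 -> ((dot v v)%:E = \int[m]_x ((v x) ^+ 2)%:E)%E.
Proof.
move=> v2; rewrite /dot /Rintegral fineK; last first.
  by apply: integrable_fin_num => //; exact: L2_integrable.
by apply: eq_integral => x _; rewrite expr2.
Qed.

Lemma Lnorm_nrm (v : T -> R) : v \in L2 -> ('N[m]_2%:E[EFin \o v] = (nrm v)%:E)%E.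
Proof.
move=> v2.
have : ('N[m]_2%:E[EFin \o v] < +oo)%E by move: v2; rewrite inE/= => /andP[_]; rewrite inE.
have := Lnorm_ge0 m 2%:E (EFin \o v).
have n2 : (2 : R) != 0 by [].
have := @poweR_Lnorm _ _ _ m (EFin \o v) 2 n2.
have -> : (\int[m]_x `|(EFin \o v) x| `^ 2 = (dot v v)%:E)%E.
  rewrite EFin_dot//; apply: eq_integral => x _ /=.
  by rewrite powR_mulrn// real_normK// num_real.
case: ('N[m]_2%:E[EFin \o v])%E => [r||]//=.
rewrite lee_fin => -[] H r0 _; congr EFin.
by rewrite /nrm -H powR_mulrn// sqrtr_sqr ger0_norm.
Qed.

Lemma cauchy_schwarz (v w : T -> R) : v \in L2 -> w \in L2 -> dot v w <= nrm v * nrm w.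
Proof.
move=> v2 w2.
have H (a b : R) : 2 * a * b * dot v w <= a ^+ 2 * dot v v + b ^+ 2 * dot w w.
  have av := L2Z a v2; have bw := L2Z b w2.
  have := dot_ge0 (fun x => a * v x - b * w x).
  rewrite dotBl// ?(dotC _ (fun x => _ - _)); last exact: L2B.
  rewrite !dotBl// !dotZl// !(dotC _ (fun x => _ * _)) !dotZl// (dotC w v).
  lra.
have [v0|v0] := eqVneq (nrm v) 0.
  rewrite v0 mul0r leNgt; apply/negP => d0.
  have := H ((dot w w + 1) / dot v w) 1.
  rewrite -(sqr_nrm v) v0 expr0n/= mulr0 add0r mulr1 expr1n mul1r mulrA divfK ?gt_eqF//.
  by have := dot_ge0 w; lra.
have [w0|w0] := eqVneq (nrm w) 0.
  rewrite w0 mulr0 leNgt; apply/negP => d0.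
  have := H 1 ((dot v v + 1) / dot v w).
  rewrite -(sqr_nrm w) w0 expr0n/= mulr0 addr0 mulr1 expr1n mul1r mulrA divfK ?gt_eqF//.
  by have := dot_ge0 v; lra.
have vw : 0 < nrm v * nrm w by rewrite mulr_gt0// lt_def ?v0 ?w0 nrm_ge0.
have := H (nrm w) (nrm v); rewrite -!sqr_nrm.
have -> : nrm w ^+ 2 * nrm v ^+ 2 + nrm v ^+ 2 * nrm w ^+ 2 = (2 * nrm w * nrm v) * (nrm v * nrm w) by ring.
by rewrite ler_pM2l// -mulrA mulr_gt0// mulrC.
Qed.

Lemma nrmD (v w : T -> R) : v \in L2 -> w \in L2 -> nrm (fun x => v x + w x) <= nrm v + nrm w.
Proof.
move=> v2 w2; rewrite -ler_sqr ?nnegrE ?addr_ge0 ?nrm_ge0// sqr_nrm.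
have vw := L2_add v2 w2.
rewrite dotDl// !(dotC _ (fun x => _ + _)) !dotDl// (dotC w v).
by have := cauchy_schwarz v2 w2; rewrite -!sqr_nrm; lra.
Qed.

Lemma nrmZ (c : R) (v : T -> R) : v \in L2 -> nrm (fun x => c * v x) = `|c| * nrm v.
Proof.
move=> v2; rewrite /nrm dotZl ?(dotC v)// ?dotZl//; last exact: L2Z.
by rewrite mulrA -expr2 sqrtrM ?sqr_ge0// sqrtr_sqr.
Qed.

Lemma nrmN (v : T -> R) : v \in L2 -> nrm (fun x => - v x) = nrm v.
Proof.
by move=> /(nrmZ (-1)); under eq_fun do rewrite mulN1r; rewrite normrN1 mul1r.
Qed.

Lemma nrmB (v w : T -> R) : v \in L2 -> w \in L2 -> nrm (fun x => v x - w x) <= nrm v + nrm w.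
Proof. by move=> v2 w2; rewrite -(nrmN w2); apply: nrmD => //; exact: L2N. Qed.

Lemma nrm_distC (v w : T -> R) : v \in L2 -> w \in L2 ->
  nrm (fun x => v x - w x) = nrm (fun x => w x - v x).
Proof.
move=> v2 w2; rewrite -nrmN; last exact: L2B.
by congr nrm; apply/funext => x; rewrite opprB.
Qed.

Lemma nrm_triangle (u v w : T -> R) : u \in L2 -> v \in L2 -> w \in L2 ->
  nrm (fun x => u x - w x) <= nrm (fun x => u x - v x) + nrm (fun x => v x - w x).
Proof.
move=> u2 v2 w2; rewrite (_ : (fun x => u x - w x) = (fun x => (u x - v x) + (v x - w x))).
  by apply: nrmD; exact: L2B.
by apply/funext => x; rewrite addrA subrK.
Qed.

Lemma L2_of_sqr (v : T -> R) : measurable_fun [set: T] v ->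
  (\int[m]_x ((v x) ^+ 2)%:E < +oo)%E -> v \in L2.
Proof.
move=> mv fv; rewrite inE/=; apply/andP; split; rewrite inE//=.
rewrite /finite_norm.
have n2 : (2 : R) != 0 by [].
have := @poweR_Lnorm _ _ _ m (EFin \o v) 2 n2.
have -> : (\int[m]_x `|(EFin \o v) x| `^ 2 = \int[m]_x ((v x) ^+ 2)%:E)%E.
  apply: eq_integral => x _ /=.
  by rewrite powR_mulrn// real_normK// num_real.
case: ('N[m]_2%:E[EFin \o v])%E => [r||]//= H; rewrite ?ltry//.
by move: fv; rewrite -H (negbTE n2).
Qed.

Lemma L2_ae (v w : T -> R) : v \in L2 -> measurable_fun [set: T] w ->
  {ae m, forall x, v x = w x} -> w \in L2.
Proof.
move=> v2 mw vw; apply: L2_of_sqr => //.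
have mv := L2_measurable v2.
rewrite (@ge0_ae_eq_integral _ _ _ m setT _ (fun x => ((v x) ^+ 2)%:E))//.
- by rewrite -EFin_dot// ltry.
- by apply/measurable_EFinP; exact: measurable_funX.
- by apply/measurable_EFinP; exact: measurable_funX.
- by move=> x _; rewrite lee_fin sqr_ge0.
- by move=> x _; rewrite lee_fin sqr_ge0.
- by apply: filterS vw => x -> _.
Qed.

Lemma dot_ae (v v' w : T -> R) : v \in L2 -> v' \in L2 -> w \in L2 ->
  {ae m, forall x, v x = v' x} -> dot v w = dot v' w.
Proof.
move=> v2 v'2 w2 vv'; rewrite /dot /Rintegral; congr fine.
apply: ae_eq_integral => //.
- by apply/measurable_EFinP; apply: measurable_funM; exact: L2_measurable.
- by apply/measurable_EFinP; apply: measurable_funM; exact: L2_measurable.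
- by apply: filterS vv' => x -> _.
Qed.

Lemma limn_einf_bound (u : nat -> \bar R) (B : \bar R) : (forall n, u n <= B)%E -> (limn_einf u <= B)%E.
Proof.
move=> uB; rewrite limn_einf_lim; apply: lime_le; first exact: is_cvg_einfs.
by near=> n; apply: (@le_trans _ _ (u n)) => //; apply: ereal_inf_lbound; exists n => /=.
Unshelve. all: by end_near.
Qed.

Lemma measurable_limn_einf (h : nat -> T -> \bar R) : (forall n, measurable_fun [set: T] (h n)) ->
  measurable_fun [set: T] (fun x => limn_einf (h ^~ x)).
Proof.
move=> mh; rewrite (_ : (fun x => _) = fun x => (- limn_esup (fun n => - h n x))%E).
  by apply: measurableT_comp => //; apply: measurable_fun_limn_esup => n; apply: measurableT_comp.
apply/funext => x; rewrite -limn_einfN; congr limn_einf.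
by apply/funext => n; rewrite /= oppeK.
Qed.

(** The means of passing an L^2 bound from approximations to their almost everywhere limit. *)
Lemma fatou_sqr (h : nat -> T -> R) (g : T -> R) (B : \bar R) :
  (forall n, measurable_fun [set: T] (h n)) -> measurable_fun [set: T] g ->
  {ae m, forall x, h n x @[n --> \oo] --> g x} ->
  (forall n, \int[m]_x (h n x ^+ 2)%:E <= B)%E -> (\int[m]_x (g x ^+ 2)%:E <= B)%E.
Proof.
move=> mh mg hg hB.
have mh2 n : measurable_fun [set: T] (fun x => (h n x ^+ 2)%:E).
  by apply/measurable_EFinP; apply: measurable_funX.
apply: le_trans (limn_einf_bound hB).
have F := @fatou _ _ _ m setT measurableT (fun n x => (h n x ^+ 2)%:E) mh2.
apply: le_trans (F _) => [|n x _]; last by rewrite lee_fin sqr_ge0.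
have H0 x : (0 <= limn_einf (fun n => (h n x ^+ 2)%:E))%E.
  rewrite limn_einf_lim; apply: lime_ge; first exact: is_cvg_einfs.
  near=> n; apply: le_ereal_inf_tmp => _ [k _ <-].
  by rewrite lee_fin sqr_ge0.
rewrite le_eqVlt; apply/orP; left; apply/eqP; apply: ge0_ae_eq_integral => //.
- by apply/measurable_EFinP; apply: measurable_funX.
- by apply: measurable_limn_einf.
- by move=> x _; rewrite lee_fin sqr_ge0.
- apply: filterS hg => x hgx _.
  have h2 : (h n x ^+ 2)%:E @[n --> \oo] --> (g x ^+ 2)%:E.
    by apply: cvg_EFin; [near=> n|exact: cvg_sqr].
  rewrite is_cvg_limn_einfE; first by apply/esym/cvg_lim.
  by apply/cvg_ex; exists (g x ^+ 2)%:E.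
Unshelve. all: by end_near.
Qed.

Lemma nrm_le_sqr (v : T -> R) (B : R) : v \in L2 -> 0 <= B ->
  ((\int[m]_x (v x ^+ 2)%:E <= (B ^+ 2)%:E)%E <-> nrm v <= B).
Proof.
move=> v2 B0; rewrite -EFin_dot// lee_fin -sqr_nrm; split => H.
  by rewrite -ler_sqr ?nnegrE ?nrm_ge0.
by rewrite ler_sqr ?nnegrE ?nrm_ge0.
Qed.

(* A subsequence with summable increments converges almost everywhere, by
   Fatou applied to the sum of the increments. *)
Lemma L2_complete (v : nat -> T -> R) : (forall n, v n \in L2) ->
  (forall e : R, 0 < e -> exists N, forall i j, (N <= i)%N -> (N <= j)%N ->
     nrm (fun x => v i x - v j x) <= e) ->
  exists2 g, g \in L2 & forall e : R, 0 < e -> exists N, forall n, (N <= n)%N ->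
    nrm (fun x => v n x - g x) <= e.
Proof.
move=> v2 vc.
have /choice[Nf HNf] : forall k, exists N, forall i j, (N <= i)%N -> (N <= j)%N ->
    nrm (fun x => v i x - v j x) <= 2^-1 ^+ k by move=> k; apply: vc; rewrite exprn_gt0.
(* A running maximum, so that the index of step k meets the requirements of all earlier steps
   too. *)
pose ph k := (\max_(i < k.+1) Nf i)%N.
have phN i k : (i <= k)%N -> (Nf i <= ph k)%N.
  by move=> ik; apply: (@leq_bigmax _ (fun i : 'I_k.+1 => Nf i) (Ordinal (ik : (i < k.+1)%N))).
pose u k := v (ph k).
have u2 k : u k \in L2 by exact: v2.
have mu_ k := L2_measurable (u2 k).
have u_cauchy k i j : (k <= i)%N -> (k <= j)%N -> nrm (fun x => u i x - u j x) <= 2^-1 ^+ k.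
  by move=> ki kj; apply: HNf; exact: phN.
pose D k x := `|u k.+1 x - u k x|.
pose S n x := \sum_(k < n) D k x.
have D2 k : D k \in L2.
  have B2 := L2B (u2 k.+1) (u2 k).
  apply: L2_of_sqr; first by apply: measurableT_comp => //; exact: L2_measurable B2.
  apply: (@le_lt_trans _ _ (dot (fun x => u k.+1 x - u k x) (fun x => u k.+1 x - u k x))%:E); last exact: ltry.
  rewrite EFin_dot// le_eqVlt; apply/orP; left; apply/eqP; apply: eq_integral => x _.
  by rewrite /D real_normK// num_real.
have nD k : nrm (D k) <= 2^-1 ^+ k.
  apply: le_trans (u_cauchy k k.+1 k (leqnSn k) (leqnn k)).
  apply/nrm_le_sqr => //; first exact: nrm_ge0.
  rewrite sqr_nrm EFin_dot; last exact: L2B.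
  rewrite le_eqVlt; apply/orP; left; apply/eqP; apply: eq_integral => x _.
  by rewrite /D real_normK// num_real.
have S2 n : S n \in L2 by apply: L2_sum.
have nS n : nrm (S n) <= 2 * (1 - 2^-1 ^+ n).
  elim: n => [|n IH].
    rewrite expr0 subrr mulr0 /S (_ : (fun _ => _) = fun=> 0); last by apply/funext => x; rewrite big_ord0.
    by rewrite /nrm dot0l sqrtr0.
  rewrite (_ : S n.+1 = fun x => S n x + D n x); last by apply/funext => x; rewrite /S big_ord_recr.
  apply: (le_trans (nrmD (S2 n) (D2 n))); apply: (le_trans (lerD IH (nD n))).
  by rewrite exprS; lra.
have IS n : (\int[m]_x (S n x ^+ 2)%:E <= 4%:E)%E.
  have -> : 4 = 2 ^+ 2 :> R by rewrite -natrX.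
  apply/nrm_le_sqr => //; apply: (le_trans (nS n)).
  by rewrite ler_piMr// gerBl exprn_ge0.
have mS n : measurable_fun [set: T] (fun x => (S n x ^+ 2)%:E).
  by apply/measurable_EFinP; apply: measurable_funX; exact: L2_measurable.
have Sbnd : {ae m, forall x, exists M : R, forall n, S n x <= M}.
  have F := @fatou _ _ _ m setT measurableT (fun n x => (S n x ^+ 2)%:E) mS.
  have {}F : (\int[m]_x limn_einf (fun n => (S n x ^+ 2)%:E) <= 4%:E)%E.
    apply: le_trans (limn_einf_bound IS); apply: F => n x _.
    by rewrite lee_fin sqr_ge0.
  have mlim : measurable_fun [set: T] (fun x => limn_einf (fun n => (S n x ^+ 2)%:E)).
    exact: measurable_limn_einf.
  have lim0 x : (0 <= limn_einf (fun n => (S n x ^+ 2)%:E))%E.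
    rewrite limn_einf_lim; apply: lime_ge; first exact: is_cvg_einfs.
    near=> n; apply: le_ereal_inf_tmp => _ [k _ <-].
    by rewrite lee_fin sqr_ge0.
  have : m.-integrable setT (fun x => limn_einf (fun n => (S n x ^+ 2)%:E)).
    apply/integrableP; split=> //.
    under eq_integral do rewrite gee0_abs//.
    by apply: le_lt_trans F _; rewrite ltry.
  move=> /(integrable_ae measurableT); apply: filterS => x /(_ Logic.I) Hx.
  exists (1 + fine (limn_einf (fun n => (S n x ^+ 2)%:E))) => n.
  have nd : {homo (fun k => S k x) : a b / (a <= b)%N >-> a <= b}.
    move=> a b ab; rewrite /S -(subnKC ab) big_split_ord/= lerDl.
    by apply: sumr_ge0 => i _; exact: normr_ge0.
  have Sn0 : 0 <= S n x by apply: sumr_ge0 => i _; exact: normr_ge0.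
  have : ((S n x ^+ 2)%:E <= limn_einf (fun n => (S n x ^+ 2)%:E))%E.
    rewrite limn_einf_lim; apply: lime_ge; first exact: is_cvg_einfs.
    exists n => // k /= nk; apply: le_ereal_inf_tmp => _ [j /= kj <-].
    rewrite lee_fin ler_sqr ?nnegrE//; first by apply: nd; exact: leq_trans kj.
    by apply: sumr_ge0 => i _; exact: normr_ge0.
  by rewrite -(fineK Hx) lee_fin => /le1D_of_sqr_le.
have ucvg : {ae m, forall x, cvgn (fun k => u k x)}.
  apply: filterS Sbnd => x [M HM].
  have : cvgn (series (fun k => u k.+1 x - u k x)).
    apply: normed_cvg; apply: nondecreasing_is_cvgn.
      by apply: nondecreasing_series => k _ _; exact: normr_ge0.
    exists M => _ [n _ <-]; apply: (le_trans _ (HM n)).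
    by rewrite /S -(big_mkord xpredT (fun k => D k x)).
  move=> /cvg_ex[l Hl]; apply/cvg_ex; exists (l + u 0%N x).
  rewrite (_ : (fun k => _) = fun k => series (fun k => u k.+1 x - u k x) k + u 0%N x).
    by apply: cvgD => //; exact: cvg_cst.
  apply/funext => k; rewrite /series/= telescope_sumr// subrK//.
(* The lower limit is measurable everywhere and equals the limit wherever the subsequence
   converges. *)
pose g x := fine (limn_einf (fun k => (u k x)%:E)).
have mg : measurable_fun [set: T] g.
  apply: measurableT_comp => //; apply: measurable_limn_einf => // n.
  exact/measurable_EFinP.
have ug : {ae m, forall x, u k x @[k --> \oo] --> g x}.
  apply: filterS ucvg => x /cvg_ex[l Hl].
  have Hl' : (u k x)%:E @[k --> \oo] --> l%:E by apply: cvg_EFin => //; near=> n.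
  rewrite /g is_cvg_limn_einfE; last by apply/cvg_ex; exists l%:E.
  by rewrite (cvg_lim _ Hl').
have gk k : (\int[m]_x ((u k x - g x) ^+ 2)%:E <= ((2^-1 ^+ k) ^+ 2)%:E)%E.
  apply: (@fatou_sqr (fun j x => u k x - u (k + j)%N x)) => //.
  - by move=> n; apply: measurable_funB.
  - exact: measurable_funB.
  - apply: filterS ug => x Hx; apply: cvgB; first exact: cvg_cst.
    have -> : (fun j => u (k + j)%N x) = (fun j => u (j + k)%N x) by apply/funext => j; rewrite addnC.
    by rewrite (cvg_shiftn k (fun j => u j x)).
  - move=> n; apply/nrm_le_sqr; [exact: L2B|exact: exprn_ge0|].
    by apply: u_cauchy => //; exact: leq_addr.
have kg2 k : (fun x => u k x - g x) \in L2.
  by apply: L2_of_sqr; [exact: measurable_funB|apply: le_lt_trans (gk k) _; rewrite ltry].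
have g2 : g \in L2.
  rewrite (_ : g = fun x => u 0%N x - (u 0%N x - g x)); first exact: L2B.
  by apply/funext => x; rewrite subKr.
exists g => // e e0.
have [k ke] : exists k, 2 * 2^-1 ^+ k <= e.
  have : (fun k : nat => 2 * 2^-1 ^+ k : R) @ \oo --> 2 * (0 : R).
    apply: cvgM; first exact: cvg_cst.
    by apply: cvg_expr; rewrite ger0_norm// invf_lt1// ltr1n.
  rewrite mulr0 => /cvgr_le /(_ e e0)[k _ /(_ k (leqnn k))].
  by exists k.
exists (Nf k) => n kn; apply: le_trans ke.
apply: (le_trans (nrm_triangle (v2 n) (u2 k) g2)).
rewrite mulr2n mulrDl mul1r lerD//.
  by apply: HNf => //; exact: phN.
by apply/nrm_le_sqr => //; exact: exprn_ge0.
Unshelve. all: by end_near.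
Qed.

(** * Finite expansions in an orthonormal family *)

Section orthonormal.
Variable p : nat -> T -> R.
Hypothesis p2 : forall k, p k \in L2.
Hypothesis po : forall j k, dot (p j) (p k) = (j == k)%:R.

Definition lincomb (a : nat -> R) (n : nat) (x : T) : R := \sum_(k < n) a k * p k x.

Lemma L2_lincomb (a : nat -> R) n : lincomb a n \in L2.
Proof. by apply: L2_sum => k; exact: L2Z. Qed.

Lemma dot_lincomb (a : nat -> R) n (v : T -> R) : v \in L2 ->
  dot (lincomb a n) v = \sum_(k < n) a k * dot (p k) v.
Proof.
move=> v2; rewrite /lincomb dot_suml//; last by move=> k; exact: L2Z.
by apply: eq_bigr => k _; rewrite dotZl.
Qed.

Lemma dot_lincomb_p (a : nat -> R) n j :
  dot (lincomb a n) (p j) = if (j < n)%N then a j else 0.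
Proof.
rewrite dot_lincomb//; case: ifPn => jn.
  rewrite (bigD1 (Ordinal jn))//= po eqxx mulr1 big1 ?addr0// => i ij.
  rewrite po (_ : _ == _ = false) ?mulr0//; apply/eqP => ij'; move: ij => /eqP; apply.
  exact: val_inj.
rewrite big1// => i _; rewrite po (_ : _ == _ = false) ?mulr0//.
by apply/eqP => ij; move: jn; rewrite -ij ltn_ord.
Qed.

Lemma sqr_nrm_lincomb (a : nat -> R) n : nrm (lincomb a n) ^+ 2 = \sum_(k < n) a k ^+ 2.
Proof.
rewrite sqr_nrm dot_lincomb ?L2_lincomb//; apply: eq_bigr => k _.
by rewrite dotC dot_lincomb_p ltn_ord expr2.
Qed.

Lemma bessel (v : T -> R) n : v \in L2 -> \sum_(k < n) dot v (p k) ^+ 2 <= nrm v ^+ 2.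
Proof.
move=> v2; have l2 := L2_lincomb (fun k => dot v (p k)) n.
have := dot_ge0 (fun x => v x - lincomb (fun k => dot v (p k)) n x).
have vl2 := L2B v2 l2.
rewrite dotBl// ?(dotC _ (fun x => _ - _)) !dotBl// -!sqr_nrm sqr_nrm_lincomb.
rewrite (dotC v) dot_lincomb//.
have -> : \sum_(k < n) dot v (p k) * dot (p k) v = \sum_(k < n) dot v (p k) ^+ 2.
  by apply: eq_bigr => k _; rewrite (dotC (p k)) expr2.
by rewrite subrr subr0 subr_ge0.
Qed.

End orthonormal.

End L2.

(** * The Dirichlet eigenbasis *)

Lemma sin_natpi (R : realType) (n : nat) (x : R) : sin (x + n%:R * pi) = (-1) ^+ n * sin x.
Proof.
rewrite mulr_natl (alternatingn (@sinDpi R)).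
by [].
Qed.

Lemma sin_eq0_natpi (R : realType) (x : R) : 0 < x -> sin x = 0 ->
  exists2 n : nat, (0 < n)%N & x = n%:R * pi.
Proof.
move=> x0 sx; pose n := Num.truncn (x / pi); pose r := x - n%:R * pi.
have pi0 : 0 < pi :> R := pi_gt0 R.
have nx : n%:R * pi <= x.
  by rewrite -ler_pdivlMr//; rewrite truncn_le divr_ge0 ?(ltW x0) ?(ltW pi0).
have xn : x < n.+1%:R * pi by rewrite -ltr_pdivrMr//; exact: truncnS_gt.
have r0 : 0 <= r by rewrite subr_ge0.
have rpi : r < pi by rewrite ltrBlDl -[X in _ + X]mul1r -mulrDl natr1.
have sr : sin r = 0.
  have : sin (r + n%:R * pi) = 0 by rewrite subrK.
  by rewrite sin_natpi => /eqP; rewrite mulf_eq0 signr_eq0/= => /eqP.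
have r00 : r = 0.
  apply/eqP; rewrite eq_le r0 andbT leNgt; apply/negP => r0'.
  by have := @sin_gt0_pi R r; rewrite r0' rpi sr ltxx => /(_ isT).
have xE : x = n%:R * pi by apply/eqP; rewrite -subr_eq0; apply/eqP.
exists n => //; rewrite lt0n; apply/eqP => n0.
by move: x0; rewrite xE n0 mul0r ltxx.
Qed.

Lemma pair_continuous (R : realType) (p : R -> R) (x : R) : derivable p x 1 -> {for x, continuous p}.
Proof. by move=> /derivable1_diffP/differentiable_continuous; exact. Qed.

(** If l <= 0, then (p p')' = p'^2 - l p^2 >= 0, so p p' is nondecreasing. But p^2 rises from 0 to a
    positive value and returns to 0, so p p' is positive at some point and negative at a later one.
    The mean value theorem finds these points inside (0, 1), where alone p' is under control. *)
Lemma dirichlet_gt0 (R : realType) (l : R) (p : R -> R) : dirichlet_eigenpair l p ->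
  (exists2 x, x \in `]0, 1[ & p x != 0) -> 0 < l.
Proof.
move=> [cp p0 p1 dp] [x0]; rewrite in_itv/= => /andP[x00 x01] px0.
rewrite ltNge; apply/negP => l0.
have d1 (x : R) : x \in `]0, 1[ -> is_derive x 1 p (derive1 p x).
  by move=> /dp[dpx _ _]; rewrite derive1E; exact: derivableP.
have d2 (x : R) : x \in `]0, 1[ -> is_derive x 1 (derive1 p) (- (l * p x)).
  move=> /dp[_ dpx <-]; rewrite opprK derive1E; exact: derivableP.
have dq (x : R) : x \in `]0, 1[ -> is_derive x 1 (fun x => p x * p x) (2 * (p x * derive1 p x)).
  move=> x01'; have := is_deriveM (d1 _ x01') (d1 _ x01').
  by rewrite /GRing.scale/= (_ : _ + _ = 2 * (p x * derive1 p x)); last by ring.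
have dpp (x : R) : x \in `]0, 1[ -> is_derive x 1 (fun x => p x * derive1 p x) (derive1 p x ^+ 2 - l * p x ^+ 2).
  move=> x01'; have := is_deriveM (d1 _ x01') (d2 _ x01').
  by rewrite /GRing.scale/= (_ : _ + _ = derive1 p x ^+ 2 - l * p x ^+ 2); last by ring.
have cq (a b : R) : 0 <= a -> a < b -> b <= 1 -> {within `[a, b], continuous (fun x => p x * p x)}.
  move=> a0 ab b1.
  have H : {within `[0, 1], continuous (fun x => p x * p x)} by move=> z; apply: continuousM; exact: cp.
  apply: continuous_subspaceW H => z /=; rewrite !in_itv/= => /andP[az zb].
  by rewrite (le_trans a0 az) (le_trans zb b1).
have q0 : 0 < p x0 * p x0 by rewrite -expr2 exprn_even_gt0//= px0.
pose q (x : R) := p x * p x; pose q' (x : R) := 2 * (p x * derive1 p x).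
have H1 (x : R) : x \in `]0, x0[ -> is_derive x 1 q (q' x).
  by rewrite in_itv/= => /andP[x0' xx]; apply: dq; rewrite in_itv/= x0' (lt_trans xx).
have H2 (x : R) : x \in `]x0, 1[ -> is_derive x 1 q (q' x).
  by rewrite in_itv/= => /andP[x0' xx]; apply: dq; rewrite in_itv/= xx (lt_trans x00).
have [y1] := MVT x00 H1 (cq _ _ (lexx 0) x00 (ltW x01)); rewrite /q /q'.
rewrite in_itv/= => /andP[y10 y1x]; rewrite p0 mulr0 !subr0 => E1.
have [y2] := MVT x01 H2 (cq _ _ (ltW x00) x01 (lexx 1)); rewrite /q /q'.
rewrite in_itv/= => /andP[y2x y21]; rewrite p1 mulr0 sub0r => E2.
have y12 : y1 < y2 by apply: lt_trans y2x.
have cpp : {within `[y1, y2], continuous (fun x => p x * derive1 p x)}.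
  apply: continuous_in_subspaceT => x; rewrite inE/= in_itv/= => /andP[yx xy].
  apply: pair_continuous; apply: ex_derive; apply: dpp.
  by rewrite in_itv/= (lt_le_trans y10 yx) (le_lt_trans xy y21).
have H3 (x : R) : x \in `]y1, y2[ -> is_derive x 1 (fun x => p x * derive1 p x) (derive1 p x ^+ 2 - l * p x ^+ 2).
  rewrite in_itv/= => /andP[yx xy]; apply: dpp.
  by rewrite in_itv/= (lt_trans y10 yx) (lt_trans xy y21).
have [y3] := MVT y12 H3 cpp.
move=> _; set P1 := p y1 * _; set P2 := p y2 * _ => E3.
have P10 : 0 < P1.
  have : 0 < 2 * P1 * x0 by rewrite -E1.
  by rewrite pmulr_lgt0// pmulr_rgt0.
have P20 : P2 < 0.
  have : 2 * P2 * (1 - x0) < 0 by rewrite -E2 oppr_lt0.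
  by rewrite pmulr_llt0 ?subr_gt0// pmulr_rlt0.
have : 0 <= P2 - P1.
  rewrite E3 mulr_ge0 ?subr_ge0 ?(ltW y12)//.
  by rewrite (le_trans (y := 0)) ?mulr_le0_ge0 ?sqr_ge0.
by rewrite subr_ge0 leNgt (lt_trans P20 P10).
Qed.

Lemma is_derive0_cst (R : realType) (f : R -> R) (x y : R) :
  (forall x : R, x \in `]0, 1[ -> is_derive x 1 f 0) -> x \in `]0, 1[ -> y \in `]0, 1[ -> f x = f y.
Proof.
move=> df; wlog xy : x y / x < y.
  move=> H x01 y01; have [xy|yx|->//] := ltgtP x y; first exact: H.
  by apply/esym; exact: H.
rewrite !in_itv/= => /andP[x0 x1] /andP[y0 y1].
have H (z : R) : x <= z -> z <= y -> is_derive z 1 f 0.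
  by move=> xz zy; apply: df; rewrite in_itv/= (lt_le_trans x0 xz) (le_lt_trans zy y1).
have H1 (z : R) : z \in `]x, y[ -> is_derive z 1 f ((fun=> 0) z).
  by rewrite in_itv/= => /andP[xz zy]; apply: H; exact: ltW.
have H2 : {within `[x, y], continuous f}.
  apply: continuous_in_subspaceT => z; rewrite inE/= in_itv/= => /andP[xz zy].
  by apply: pair_continuous; apply: ex_derive; exact: H.
have [z _] := MVT xy H1 H2.
by move=> /eqP; rewrite mul0r subr_eq0 => /eqP.
Qed.

(** Variation of constants: the coefficients [A] and [B] of p in the basis sin(m x), cos(m x) have
    zero derivative. The resulting formula on (0, 1) extends to the end points by continuity; p 0 =
    0 removes the cosine and p 1 = 0 quantizes m. *)
Lemma dirichlet_sin (R : realType) (l : R) (p : R -> R) : dirichlet_eigenpair l p -> 0 < l ->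
  exists A : R, A * sin (Num.sqrt l) = 0 /\ forall x, x \in `[0, 1] -> p x = A * sin (Num.sqrt l * x).
Proof.
move=> [cp p0 p1 dp] l0; set m := Num.sqrt l.
have m0 : 0 < m by rewrite sqrtr_gt0.
have m2 : m ^+ 2 = l by rewrite sqr_sqrtr// ltW.
have d1 (x : R) : x \in `]0, 1[ -> is_derive x 1 p (derive1 p x).
  by move=> /dp[dpx _ _]; rewrite derive1E; exact: derivableP.
have d2 (x : R) : x \in `]0, 1[ -> is_derive x 1 (derive1 p) (- (l * p x)).
  move=> /dp[_ dpx <-]; rewrite opprK derive1E; exact: derivableP.
have dm (x : R) : is_derive x 1 (fun x : R => m * x) m.
  have := is_deriveZ m (is_derive_id x (1 : R)); by rewrite /GRing.scale/= mulr1.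
have ds (x : R) : is_derive x 1 (fun x : R => sin (m * x)) (m * cos (m * x)).
  have := is_derive1_comp (is_derive_sin (m * x)) (dm x); by rewrite mulrC.
have dc (x : R) : is_derive x 1 (fun x : R => cos (m * x)) (- (m * sin (m * x))).
  have := is_derive1_comp (is_derive_cos (m * x)) (dm x); by rewrite mulNr mulrC.
pose B x := p x * cos (m * x) - m^-1 * derive1 p x * sin (m * x).
pose A x := p x * sin (m * x) + m^-1 * derive1 p x * cos (m * x).
have dmp (x : R) : x \in `]0, 1[ -> is_derive x 1 (fun x => m^-1 * derive1 p x) (- (m * p x)).
  move=> /d2 h; have := is_deriveZ m^-1 h; rewrite /GRing.scale/= -m2.
  by rewrite (_ : _ * _ = - (m * p x)); last by field; rewrite gt_eqF.
have dB (x : R) : x \in `]0, 1[ -> is_derive x 1 B 0.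
  move=> x01; have := is_deriveB (is_deriveM (d1 _ x01) (dc x)) (is_deriveM (dmp _ x01) (ds x)).
  rewrite /GRing.scale/=; set z := (X in is_derive _ _ _ X).
  suff -> : z = 0 by [].
  by rewrite /z; field; rewrite gt_eqF.
have dA (x : R) : x \in `]0, 1[ -> is_derive x 1 A 0.
  move=> x01; have := is_deriveD (is_deriveM (d1 _ x01) (ds x)) (is_deriveM (dmp _ x01) (dc x)).
  rewrite /GRing.scale/=; set z := (X in is_derive _ _ _ X).
  suff -> : z = 0 by [].
  by rewrite /z; field; rewrite gt_eqF.
have h01 : (2^-1 : R) \in `]0, 1[ by rewrite in_itv/= invr_gt0 ltr0n/= invf_lt1// ltr1n.
pose a := A 2^-1; pose b := B 2^-1.
have pE (x : R) : x \in `]0, 1[ -> p x = b * cos (m * x) + a * sin (m * x).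
  move=> x01; rewrite /a /b -(is_derive0_cst dA x01 h01) -(is_derive0_cst dB x01 h01) /A /B.
  transitivity (p x * (cos (m * x) ^+ 2 + sin (m * x) ^+ 2)); last by ring.
  by rewrite cos2Dsin2 mulr1.
pose r x := b * cos (m * x) + a * sin (m * x).
have cr (x : R) : {for x, continuous r}.
  by apply: pair_continuous; apply: ex_derive; apply: is_deriveD (is_deriveZ b (dc x)) (is_deriveZ a (ds x)).
have [_ cp0 cp1] := (continuous_within_itvP p (@ltr01 R)).1 cp.
have r0 : p 0 = r 0.
  rewrite -(cvg_lim _ cp0)//; apply/cvg_lim => //.
  apply: cvg_trans (cvg_at_right_filter (cr 0)).
  apply: near_eq_cvg; near=> x; rewrite pE// in_itv/=; apply/andP; split=> //.
have r1 : p 1 = r 1.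
  rewrite -(cvg_lim _ cp1)//; apply/cvg_lim => //.
  apply: cvg_trans (cvg_at_left_filter (cr 1)).
  apply: near_eq_cvg; near=> x; rewrite pE// in_itv/=; apply/andP; split=> //.
have b0 : b = 0.
  by move: r0; rewrite p0 /r mulr0 cos0 sin0 mulr0 addr0 mulr1 => <-.
have as0 : a * sin m = 0.
  by move: r1; rewrite p1 /r b0 mul0r add0r mulr1 => <-.
exists a; split=> // x; rewrite in_itv/= => /andP[x0 x1].
have [->|x0'] := eqVneq x 0; first by rewrite p0 mulr0 sin0 mulr0.
have [->|x1'] := eqVneq x 1; first by rewrite p1 mulr1 as0.
by rewrite pE ?in_itv/= ?lt_neqAle ?x0 ?x1 ?x1' 1?eq_sym ?x0'// b0 mul0r add0r.
Unshelve. all: by end_near.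
Qed.

Lemma ge0_integral_lebD (R : realType) (f : R -> \bar R) :
  measurable_fun [set: R] f -> (forall x, 0 <= f x)%E ->
  (\int[@lebD R]_x f x = \int[lebesgue_measure]_(x in `]0%R, 1%R[) f x)%E.
Proof.
move=> mf f0.
rewrite (@ge0_negligible_integral _ _ _ (@lebD R) setT (~` `]0, 1[%classic))//; last 2 first.
- exact: measurableC.
- transitivity (@lebesgue_measure R (~` `]0%R, 1%R[ `&` `]0%R, 1%R[)); first by [].
  by rewrite setICl measure0.
rewrite setTD setCK; apply: eq_measure_integral => A mA A01.
  transitivity (@lebesgue_measure R (A `&` `]0%R, 1%R[)); first by [].
  by rewrite setIidl.
Qed.

Lemma integral_lebD (R : realType) (f : R -> \bar R) : measurable_fun [set: R] f ->
  (\int[@lebD R]_x f x = \int[lebesgue_measure]_(x in `]0%R, 1%R[) f x)%E.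
Proof.
move=> mf; rewrite integralE [RHS]integralE !ge0_integral_lebD//.
- exact: measurable_funeneg.
- exact: measurable_funepos.
Qed.

Lemma ae_lebD (R : realType) (Q : R -> Prop) :
  {ae @lebD R, forall x, Q x} <-> {ae lebesgue_measure, forall x, x \in `]0, 1[ -> Q x}.
Proof.
split=> -[N [mN N0 NQ]].
  exists (N `&` `]0%R, 1%R[); split=> //; first exact: measurableI.
  move=> x /= /not_implyP[x01 nQ]; split=> //; exact: NQ.
exists (N `|` ~` `]0%R, 1%R[); split=> //.
- by apply: measurableU => //; exact: measurableC.
- transitivity (@lebesgue_measure R ((N `|` ~` `]0%R, 1%R[) `&` `]0%R, 1%R[)); first by [].
  rewrite setIUl setICl setU0; apply: subset_measure0 N0 => //.
  exact: measurableI.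
- move=> x /= nQ; have [x01|x01] := boolP (x \in `]0%R, 1%R[); [left|right].
    by apply: NQ => /= /(_ x01).
  by move=> /= x01'; move: x01; rewrite x01'.
Qed.

Lemma is_derive_sinZ (R : realType) (m x : R) : is_derive x 1 (fun x : R => sin (m * x)) (m * cos (m * x)).
Proof.
have dm : is_derive x 1 (fun x : R => m * x) m.
  by have := is_deriveZ m (is_derive_id x (1 : R)); rewrite /GRing.scale/= mulr1.
by have := is_derive1_comp (is_derive_sin (m * x)) dm; rewrite mulrC.
Qed.

Lemma continuous_sinZ (R : realType) (m : R) : continuous (fun x : R => sin (m * x)).
Proof. by move=> x; apply: pair_continuous; apply: ex_derive; exact: is_derive_sinZ. Qed.

Lemma measurable_sinZ (R : realType) (m : R) : measurable_fun [set: R] (fun x : R => sin (m * x)).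
Proof. by apply: continuous_measurable_fun; exact: continuous_sinZ. Qed.

Lemma integral_sin_sin (R : realType) (j k : nat) : (0 < j)%N -> (0 < k)%N ->
  (\int[lebesgue_measure]_(x in `]0%R, 1%R[) (sin (j%:R * pi * x) * sin (k%:R * pi * x))%:E =
   ((j == k)%:R / 2)%:E :> \bar R)%E.
Proof.
move=> j0 k0; have pi0 : pi != 0 :> R by rewrite gt_eqF// pi_gt0.
(* A primitive of cos(c x) that includes c = 0, so that j = k and j <> k share one computation. *)
pose K (c x : R) := if c == 0 then x else sin (c * x) / c.
have dK (c x : R) : is_derive x 1 (K c) (cos (c * x)).
  rewrite /K; case: eqP => [->|/eqP c0]; first by rewrite mul0r cos0; exact: is_derive_id.
  have := is_deriveZ c^-1 (is_derive_sinZ c x).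
  rewrite /GRing.scale/= mulKf//.
  suff -> : (fun x => sin (c * x) / c) = (c^-1 \*: (fun x0 : R => sin (c * x0))) by [].
  by apply/funext => z; rewrite /GRing.scale/= mulrC.
have c0 : (j%:R * pi - k%:R * pi == 0 :> R) = (j == k).
  by rewrite -mulrBl mulf_eq0 (negbTE pi0) orbF subr_eq0 eqr_nat.
have c1 : (j%:R * pi + k%:R * pi == 0 :> R) = false.
  by rewrite -mulrDl mulf_eq0 (negbTE pi0) orbF -natrD pnatr_eq0 addn_eq0 (gtn_eqF j0).
have sj n : sin (n%:R * pi) = 0 :> R by have := sin_natpi n (0 : R); rewrite add0r sin0 mulr0.
pose F (x : R) := 2^-1 * (K (j%:R * pi - k%:R * pi) x - K (j%:R * pi + k%:R * pi) x).
have dF (x : R) : is_derive x 1 F (sin (j%:R * pi * x) * sin (k%:R * pi * x)).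
  have := is_deriveZ 2^-1 (is_deriveB (dK (j%:R * pi - k%:R * pi) x) (dK (j%:R * pi + k%:R * pi) x)).
  rewrite /GRing.scale/= mulrBl mulrDl cosB cosD.
  set z := (X in is_derive _ _ _ X -> _).
  suff -> : z = sin (j%:R * pi * x) * sin (k%:R * pi * x) by [].
  by rewrite /z; field.
have cf : continuous (fun x : R => sin (j%:R * pi * x) * sin (k%:R * pi * x)).
  by move=> x; apply: continuousM; exact: continuous_sinZ.
have cF (x : R) : {for x, continuous F} by apply: pair_continuous; apply: ex_derive; exact: dF.
rewrite -(@integral_itv_bndoo R 0 1 _ true false); last first.
  by apply: measurable_funTS; apply/measurable_EFinP; exact: continuous_measurable_fun.
rewrite (@continuous_FTC2 R _ F 0 1)//.
- rewrite -EFinB; congr EFin; rewrite /F /K c0 c1 !mulr0 !mulr1 sin0 !mul0r.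
  have -> : sin (j%:R * pi + k%:R * pi) = 0 :> R by rewrite -mulrDl -natrD sj.
  have -> : sin (j%:R * pi - k%:R * pi) = 0 :> R by rewrite sinB !sj !(mul0r, mulr0) subr0.
  by case: eqP => _; rewrite !mul0r ?subr0 ?mulr0 ?subr0 ?mulr1 ?mul1r.
- exact: continuous_subspaceT.
- split.
  + by move=> x _; apply: ex_derive; exact: dF.
  + by apply: cvg_at_right_filter; exact: cF.
  + by apply: cvg_at_left_filter; exact: cF.
- by move=> x _; rewrite derive1E; have [_ ->] := dF x.
Qed.

Lemma dotDE (R : realType) (v w : R -> R) : dotD v w = dot (@lebD R) v w.
Proof. by []. Qed.

Lemma dotD_on (R : realType) (v w v' w' : R -> R) :
  measurable_fun [set: R] v -> measurable_fun [set: R] w ->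
  measurable_fun [set: R] v' -> measurable_fun [set: R] w' ->
  (forall x, x \in `]0, 1[ -> v x = v' x) -> (forall x, x \in `]0, 1[ -> w x = w' x) ->
  dotD v w = dotD v' w'.
Proof.
move=> mv mw mv' mw' vv ww; rewrite /dotD /Rintegral !integral_lebD.
- by congr fine; apply: eq_integral => x; rewrite inE => x01; rewrite vv// ww.
- by apply/measurable_EFinP; exact: measurable_funM.
- by apply/measurable_EFinP; exact: measurable_funM.
Qed.

Lemma dotD_sin (R : realType) (a b : R) (j k : nat) : (0 < j)%N -> (0 < k)%N ->
  dotD (fun x : R => a * sin (j%:R * pi * x)) (fun x => b * sin (k%:R * pi * x)) =
  a * b * ((j == k)%:R / 2).
Proof.
move=> j0 k0.
have H := integral_sin_sin R j0 k0.
have I : (@lebesgue_measure R).-integrable `]0%R, 1%R[ (fun x => (sin (j%:R * pi * x) * sin (k%:R * pi * x))%:E).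
  apply: (@integrableS _ _ _ _ (`[0%R, 1%R] : set (measurableTypeR R))) => //.
    by move=> x /=; rewrite !in_itv/= => /andP[/ltW -> /ltW ->].
  apply: continuous_compact_integrable; first exact: segment_compact.
  apply: continuous_subspaceT => x; apply: continuousM; exact: continuous_sinZ.
have <- : \int[@lebesgue_measure R]_(x in `]0%R, 1%R[) (sin (j%:R * pi * x) * sin (k%:R * pi * x)) = (j == k)%:R / 2 by rewrite /Rintegral H.
rewrite -RintegralZl// /dotD /Rintegral integral_lebD.
  by congr fine; apply: eq_integral => x _; congr EFin; ring.
by apply/measurable_EFinP; apply: measurable_funM; apply: measurable_funM => //; exact: measurable_sinZ.
Qed.

Lemma L2D_sin (R : realType) (a : R) (j : nat) :
  (fun x : R => a * sin (j%:R * pi * x)) \in @L2D R.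
Proof.
apply: L2_of_sqr; first by apply: measurable_funM => //; exact: measurable_sinZ.
apply: (@le_lt_trans _ _ (\int[@lebD R]_x (cst (a ^+ 2)%:E x))%E).
  apply: ge0_le_integral => //.
  - by move=> x _; rewrite lee_fin sqr_ge0.
  - apply/measurable_EFinP; apply: measurable_funX; apply: measurable_funM => //; exact: measurable_sinZ.
  - move=> x _; rewrite lee_fin exprMn ler_piMr// ?sqr_ge0//.

rewrite integral_cst//.
set l := (X in (_ * X)%E); have -> : l = 1%E.
  transitivity (@lebesgue_measure R (setT `&` `]0%R, 1%R[)); first by [].
  by rewrite setTI lebesgue_measure_itv/= lte_fin ltr01 oppr0 adde0.
by rewrite mule1 ltry.
Qed.

(** Each eigenvalue is (n_k pi)^2 with n_k >= 1. Orthonormality makes k |-> n_k injective, the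
    ordering makes it increasing, and completeness makes it reach every positive integer; hence n_k
    = k + 1. The sign of c stays undetermined. *)
Lemma eigenbasis_sin (R : realType) (lam : nat -> R) (phi : nat -> R -> R) :
  dirichlet_eigenbasis lam phi -> forall k,
  lam k = (k.+1%:R * pi) ^+ 2 /\ exists2 c : R, c ^+ 2 = 2 &
    forall x, x \in `[0, 1] -> phi k x = c * sin (k.+1%:R * pi * x).
Proof.
move=> [E lamD p2 po tot].
have pm k := L2_measurable (p2 k).
have H k : exists nc : nat * R, [/\ (0 < nc.1)%N, lam k = (nc.1%:R * pi) ^+ 2, nc.2 ^+ 2 = 2 &
    forall x, x \in `[0, 1] -> phi k x = nc.2 * sin (nc.1%:R * pi * x)].
  have l0 : 0 < lam k.
    apply: dirichlet_gt0 (E k) _; apply: contrapT => nx.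
    have := po k k; rewrite eqxx (@dotD_on _ _ _ (cst 0) (cst 0))//.
    - by rewrite /dotD /Rintegral integral0_eq ?mulr0//= => [/eqP|x _]; rewrite ?mulr0// eq_sym oner_eq0.
    - exact: pm.
    - exact: pm.
    - by move=> x x01; apply/eqP/negPn/negP => px; apply: nx; exists x.
    - by move=> x x01; apply/eqP/negPn/negP => px; apply: nx; exists x.
  have [A [As pA]] := dirichlet_sin (E k) l0.
  have sl0 : 0 < Num.sqrt (lam k) by rewrite sqrtr_gt0.
  have A0 : A != 0.
    apply/eqP => A0; have := po k k; rewrite eqxx (@dotD_on _ _ _ (cst 0) (cst 0))//.
    - by rewrite /dotD /Rintegral integral0_eq ?mulr0//= => [/eqP|x _]; rewrite ?mulr0// eq_sym oner_eq0.
    - exact: pm.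
    - exact: pm.
    - by move=> x x01; rewrite pA ?A0 ?mul0r//; exact: subset_itv_oo_cc.
    - by move=> x x01; rewrite pA ?A0 ?mul0r//; exact: subset_itv_oo_cc.
  move/eqP: As; rewrite mulf_eq0 (negbTE A0)/= => /eqP /(sin_eq0_natpi sl0)[n n0 ln].
  exists (n, A); split=> //=; last by move=> x x01; rewrite pA// ln.
    by rewrite -ln sqr_sqrtr// ltW.
  have := po k k; rewrite (@dotD_on _ _ _ (fun x : R => A * sin (n%:R * pi * x)) (fun x : R => A * sin (n%:R * pi * x)))//.
  - rewrite dotD_sin// eqxx -expr2 /= => /(congr1 (fun z => z * 2)).
    by rewrite !mul1r mulrVK ?unitfE// eqxx mul1r.
  - exact: pm.
  - exact: pm.
  - by apply: measurable_funM => //; exact: measurable_sinZ.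
  - by apply: measurable_funM => //; exact: measurable_sinZ.
  - by move=> x x01; rewrite pA ?ln//; exact: subset_itv_oo_cc.
  - by move=> x x01; rewrite pA ?ln//; exact: subset_itv_oo_cc.
have /choice[nc Hnc] := H; pose n k := (nc k).1.
have n0 k : (0 < n k)%N by have [] := Hnc k.
have msin (c m : R) : measurable_fun [set: R] (fun x : R => c * sin (m * x)).
  by apply: measurable_funM => //; exact: measurable_sinZ.
have pE k x : x \in `]0, 1[ -> phi k x = (nc k).2 * sin ((n k)%:R * pi * x).
  by move=> x01; have [_ _ _ ->//] := Hnc k; exact: subset_itv_oo_cc.
have c0 k : (nc k).2 != 0.
  have [_ _ + _] := Hnc k; case: eqP => // ->; rewrite expr0n/= => /esym/eqP.
  by rewrite pnatr_eq0.
have inj j k : n j = n k -> j = k.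
  move=> njk; apply/eqP; have := po j k.
  rewrite (dotD_on (pm j) (pm k) (msin (nc j).2 _) (msin (nc k).2 _) (pE j) (pE k))//.
  rewrite dotD_sin// njk eqxx; case: eqP => //= _ /eqP.
  by rewrite !mulf_eq0 (negbTE (c0 j)) (negbTE (c0 k)) oner_eq0 invr_eq0 pnatr_eq0.
have mono j k : (j <= k)%N -> (n j <= n k)%N.
  move=> jk; have := lamD _ _ jk; have [_ -> _ _] := Hnc j; have [_ -> _ _] := Hnc k.
  rewrite ler_sqr ?nnegrE ?mulr_ge0 ?pi_ge0// ler_pM2r ?pi_gt0// ler_nat.
  by [].
have smono j k : (j < k)%N -> (n j < n k)%N.
  by move=> jk; rewrite ltn_neqAle mono ?(ltnW jk)// andbT; apply/eqP => /inj jk'; rewrite jk' ltnn in jk.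
have surj m : (0 < m)%N -> exists k, n k = m.
  move=> m0; apply: contrapT => nm.
  have := tot _ (L2D_sin 1 m) => -[|N [mN N0 HN]].
    move=> k; rewrite (dotD_on (msin _ _) (pm k) (msin _ _) (msin (nc k).2 _) (fun _ _ => erefl) (pE k))//.
    rewrite dotD_sin//; case: eqP => [mn|_]; last by rewrite mul0r mulr0.
    by case: nm; exists k.
  have := dotD_sin (1:R) (1:R) m0 m0; rewrite eqxx.
  rewrite dotDE (@dot_ae _ _ _ (@lebD R) _ (cst 0))//; last 4 first.
  - exact: L2D_sin.
  - exact: L2_0.
  - exact: L2D_sin.
  - by exists N.
  by rewrite /dot /Rintegral integral0_eq => [/= /eqP|x _]; rewrite ?mul0r// eq_sym !mulf_eq0 oner_eq0 invr_eq0 pnatr_eq0.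
have nE k : n k = k.+1.
  elim/ltn_ind: k => k IH.
  have kn : (k < n k)%N.
    case: k IH => [|k] IH; first exact: n0.
    by have := smono k k.+1 (ltnSn k); rewrite (IH k).
  apply/eqP; rewrite eqn_leq kn andbT leqNgt; apply/negP => kn'.
  have [j nj] := surj k.+1 (ltn0Sn k).
  have [jk|kj] := ltnP j k; first by move: nj; rewrite IH// => -[] jk'; rewrite jk' ltnn in jk.
  by have := mono _ _ kj; rewrite nj leqNgt kn'.
move=> k; have := Hnc k; rewrite -/(n k) nE => -[_ -> c2 pk]; split=> //.
by exists (nc k).2.
Qed.

(** * Spectral representation of fractional Brownian motion *)

Lemma normr_sin_le (R : realType) (x : R) : `|sin x| <= `|x|.
Proof.
wlog x0 : x / 0 <= x.
  move=> H; have [/H//|/ltW x0] := leP 0 x.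
  by rewrite -normrN -sinN -(normrN x) H// oppr_ge0.
have d (s : R) (y : R) : is_derive y 1 (fun y : R => y - s * sin y) (1 - s * cos y).
  have := is_deriveB (is_derive_id y (1 : R)) (is_deriveZ s (is_derive_sin y)).
  by rewrite /GRing.scale/=.
have H (s : R) : `|s| <= 1 -> 0 <= x - s * sin x.
  move=> s1.
  have D1 (y : R) : y \in `]0, x[ -> derivable (fun y : R => y - s * sin y) y 1.
    by move=> _; apply: ex_derive; exact: d.
  have D2 (y : R) : y \in `]0, x[ -> 0 <= (fun y : R => y - s * sin y)^`()%classic y.
    move=> _; rewrite derive1E; have [_ ->] := d s y.
    rewrite subr_ge0; apply: (le_trans (ler_norm _)); rewrite normrM mulr_ile1//.
    by rewrite ler_norml cos_geN1 cos_le1.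
  have cs : {within `[0, x], continuous (fun y : R => y - s * sin y)}.
    by apply: continuous_subspaceT => y; apply: pair_continuous; apply: ex_derive; exact: d.
  have := @ger0_derive1_le R (fun y => y - s * sin y) 0 x D1 D2 true false cs 0 x.
  by rewrite !in_itv/= !lexx x0 sin0 mulr0 subr0; apply.
rewrite (ger0_norm x0) ler_norml; apply/andP; split.
  by have := H (-1); rewrite normrN1 lexx => /(_ isT); rewrite mulN1r opprK => h; rewrite -subr_ge0 opprK addrC.
by have := H 1; rewrite normr1 lexx => /(_ isT); rewrite mul1r subr_ge0.
Qed.

Lemma one_sub_cos_le (R : realType) (x : R) : 1 - cos x <= x ^+ 2.
Proof.
have -> : 1 - cos x = 2 * sin (x / 2) ^+ 2.
  have {1}-> : x = x / 2 + x / 2 by field.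
  by rewrite cosD; have := cos2Dsin2 (x / 2); rewrite -!expr2; lra.
have : `|sin (x / 2)| ^+ 2 <= `|x / 2| ^+ 2 by rewrite ler_sqr ?nnegrE// normr_sin_le.
by rewrite !real_normK ?num_real//; have := sqr_ge0 x; set s := sin _ ^+ 2; move=> ? ?; nra.
Qed.

(** For xi > 0 this is xi^(- 2 H - 1) (1 - cos(xi z)), the integrand of the spectral formula for
    |z|^(2 H). *)
Definition fbm_kernel (R : realType) (H z xi : R) : R := powk (- (2 * H)) xi * (1 - cos (xi * z)).

Lemma fbm_kernel_ge0 (R : realType) (H z xi : R) : 0 <= fbm_kernel H z xi.
Proof. by rewrite mulr_ge0 ?powk_ge0// subr_ge0 cos_le1. Qed.

Lemma measurable_cosM (R : realType) (z : R) : measurable_fun [set: R] (fun xi : R => cos (xi * z)).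
Proof.
apply: measurableT_comp; first exact: continuous_measurable_fun (@continuous_cos R).
exact: measurable_funM.
Qed.

Lemma measurable_sinM (R : realType) (z : R) : measurable_fun [set: R] (fun xi : R => sin (xi * z)).
Proof.
apply: measurableT_comp; first exact: continuous_measurable_fun (@continuous_sin R).
exact: measurable_funM.
Qed.

Lemma measurable_fbm_kernel (R : realType) (H z : R) : measurable_fun [set: R] (fbm_kernel H z).
Proof.
apply: measurable_funM; first exact: measurable_powk.
by apply: measurable_funB => //; exact: measurable_cosM.
Qed.

Lemma fbm_kernelZ (R : realType) (H z xi : R) : 0 < z ->
  fbm_kernel H z xi = z `^ (2 * H + 1) * fbm_kernel H 1 (z * xi).
Proof.
move=> z0; rewrite /fbm_kernel powkM// mulr1 (mulrC xi z) !mulrA -powRD ?(gt_eqF z0) ?implybT//.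
by rewrite (_ : 2 * H + 1 + _ = 0) ?powRr0 ?mul1r//; ring.
Qed.

(** Scaling xi reduces to z = 1. There the integrand is at most xi^(1 - 2 H) near 0 and 2 xi^(- 2 H
    - 1) at infinity, so c is finite; it is positive because 1 - cos >= 1 on [pi / 2, pi]. *)
Lemma integral_fbm_kernel (R : realType) (H : R) : 0 < H < 1 ->
  exists2 c : R, 0 < c & forall z,
    (\int[mu]_xi (fbm_kernel H z xi)%:E = (c * `|z| `^ (2 * H))%:E)%E.
Proof.
move=> /andP[H0 H1].
have mk z := measurable_fbm_kernel H z.
have mkE z : measurable_fun [set: R] (EFin \o fbm_kernel H z) by apply/measurable_EFinP.
have k0 z x : (0 <= (EFin \o fbm_kernel H z) x)%E by rewrite lee_fin fbm_kernel_ge0.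
pose c := (\int[mu]_xi (fbm_kernel H 1 xi)%:E)%E.
have cfin : (c < +oo)%E.
  pose g (x : R) : R := (powk (2 - 2 * H) x * (x < 1)%R%:R) + 2 * (x `^ (- (2 * H) - 1) * (1 <= x)%R%:R).
  have m1 : measurable_fun [set: R] (fun x : R => powk (2 - 2 * H) x * (x < 1)%R%:R).
    apply: measurable_funM; first exact: measurable_powk.
    apply: (@measurable_comp _ _ _ _ _ _ setT (fun b : bool => b%:R : R)) => //.
    exact: measurable_fun_ltr.
  have m2 : measurable_fun [set: R] (fun x : R => x `^ (- (2 * H) - 1) * (1 <= x)%R%:R).
    apply: measurable_funM; first exact: measurable_powR.
    apply: (@measurable_comp _ _ _ _ _ _ setT (fun b : bool => b%:R : R)) => //.
    exact: measurable_fun_ler.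
  apply: (@le_lt_trans _ _ (\int[mu]_x (g x)%:E)%E).
    apply: ge0_le_integral => //.
    - by move=> x _; exact: k0.
    - exact: mkE.
    - apply/measurable_EFinP; apply: measurable_funD => //; exact: measurable_funM.
    - move=> x _; rewrite lee_fin /fbm_kernel /g mulr1.
      have [x1|x1] := ltP x 1.
        rewrite mulr1 !mulr0 addr0 /powk; case: ifPn => x0; last by rewrite mul0r.
        rewrite (_ : 2 - 2 * H - 1 = (- (2 * H) - 1) + 2%:R); last by ring.
        rewrite [leRHS]powRD ?(gt_eqF x0) ?implybT// -[2 in leRHS]/(2%:R) powR_mulrn ?(ltW x0)//.
        by rewrite ler_wpM2l ?powR_ge0// one_sub_cos_le.
      rewrite mulr0 add0r mulr1 mulrC /powk (lt_le_trans ltr01 x1) ler_wpM2r ?powR_ge0//.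
      by rewrite lerBlDr -lerBlDl -[2]/(1 + 1) opprD addrA subrr sub0r cos_geN1.
  rewrite /g; under eq_integral do rewrite EFinD.
  rewrite ge0_integralD//; last 4 first.
  - by move=> x _; rewrite lee_fin mulr_ge0// powk_ge0.
  - exact/measurable_EFinP.
  - by move=> x _; rewrite lee_fin !mulr_ge0// powR_ge0.
  - by apply/measurable_EFinP; exact: measurable_funM.
  apply: lte_add_pinfty.
    apply: (@le_lt_trans _ _ (1 `^ (2 - 2 * H) / (2 - 2 * H))%:E); last exact: ltry.
    rewrite -(@integral_powk_itv R) ?subr_gt0//; last lra.
    rewrite [leRHS]integral_mkcond le_eqVlt; apply/orP; left; apply/eqP; apply: eq_integral => x _.
    rewrite patchE mem_setE in_itv/=; case: (x < 1); by rewrite ?mulr1 ?mulr0.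
  under eq_integral do rewrite EFinM.
  rewrite ge0_integralZl//; last 2 first.
  - exact/measurable_EFinP.
  - by move=> x _; rewrite lee_fin mulr_ge0// powR_ge0.
  rewrite (_ : (\int[mu]_x _)%E = (1 `^ (- (2 * H)) / (2 * H))%:E) ?ltry//.
  rewrite -ge0_integral_powRN//; last lra.
  rewrite [RHS]integral_mkcond; apply: eq_integral => x _.
  by rewrite patchE mem_setE in_itv/= andbT; case: (1 <= x); rewrite ?mulr1 ?mulr0.
have c_gt0 : (0 < c)%E.
  have pi2 : (pi / 2 : R) < pi by rewrite ltr_pdivrMr// ltr_pMr ?pi_gt0// ltr1n.
  apply: (@lt_le_trans _ _ (\int[@lebesgue_measure R]_(x in `[(pi / 2)%R, pi%R]) ((cst (pi `^ (- (2 * H) - 1))%:E : R -> \bar R) x))%E).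
    rewrite integral_cst//= lebesgue_measure_itv/= lte_fin pi2.
    by rewrite -EFinB -EFinM lte_fin mulr_gt0 ?powR_gt0 ?pi_gt0// subr_gt0.
  rewrite /c integral_mkcond; apply: ge0_le_integral => //.
  - by move=> x _; rewrite patchE; case: ifP => // _; rewrite lee_fin powR_ge0.
  - by apply/(measurable_restrictT _ _).1 => //; exact: measurable_cst.
  - exact: mkE.
  - move=> x _; rewrite patchE; case: ifPn => [|_]; last by rewrite lee_fin fbm_kernel_ge0.
    rewrite inE/= in_itv/= => /andP[x1 x2]; have pi0 := pi_gt0 R.
    have x0 : 0 < x by apply: lt_le_trans x1; rewrite divr_gt0.
    rewrite lee_fin /fbm_kernel mulr1 /powk x0 -[leLHS]mulr1 ler_pM ?powR_ge0//.
      rewrite -opprD !powRN lef_pV2 ?posrE ?powR_gt0//.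
      by apply: ge0_ler_powR => //; rewrite ?nnegrE ?(ltW x0) ?(ltW pi0)//; lra.
    rewrite lerBrDl -lerBrDr subrr.
    rewrite -[x](subrK pi) cosDpi oppr_le0 cos_ge0_pihalf//.
    by apply/andP; split; lra.
have cE : c = (fine c)%:E by rewrite fineK// ge0_fin_numE ?ltW.
exists (fine c); first by rewrite -lte_fin -cE.
have key (z : R) : 0 < z -> (\int[mu]_xi (fbm_kernel H z xi)%:E = (fine c * `|z| `^ (2 * H))%:E)%E.
  move=> z0; rewrite (gtr0_norm z0) EFinM -cE.
  rewrite /c (@ge0_integral_affine R z 0 _ z0 (mkE 1) (k0 1))/=.
  under eq_integral do rewrite fbm_kernelZ// EFinM.
  rewrite ge0_integralZl//; last 3 first.
  - apply: measurableT_comp (mkE 1) _; exact: measurable_funM.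
  - by move=> x _; exact: k0.
  - by rewrite lee_fin powR_ge0.
  rewrite powRD ?(gt_eqF z0) ?implybT// powRr1 ?(ltW z0)// EFinM.
  rewrite [RHS]muleC !muleA; congr (_ * _)%E.
  by apply: eq_integral => x _; rewrite addr0.
move=> z; have [z0|z0|<-] := ltgtP 0 z; first exact: key.
  rewrite -normrN -key ?oppr_gt0//; apply: eq_integral => x _.
  by rewrite /fbm_kernel mulrN cosN.
rewrite normr0 powR0 ?mulr0; last by rewrite gt_eqF// mulr_gt0.
by apply: integral0_eq => x _; rewrite /fbm_kernel mulr0 cos0 subrr mulr0.
Qed.

Definition trig (R : realType) (b : bool) (z : R) : R := if b then cos z else sin z.

(** xi times the cosine transform ([b] true) or sine transform of the indicator of (a, c]. *)
Definition trig_diff (R : realType) (b : bool) (a c xi : R) : R :=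
  if b then sin (xi * c) - sin (xi * a) else cos (xi * a) - cos (xi * c).

(** The factor is xi^(- 1 / 2 - H): the square root xi^(1 / 2 - H) of the spectral weight, divided
    by the xi contained in [trig_diff]. *)
Definition fbm_spec (R : realType) (H : R) (b : bool) (a c xi : R) : R :=
  powk (1 / 2 - H) xi * trig_diff b a c xi.

Lemma powk_sqr (R : realType) (g xi : R) : powk g xi * powk g xi = powk (2 * g - 1) xi.
Proof.
rewrite /powk; case: ifP => x0; last by rewrite mulr0.
by rewrite -powRD ?(gt_eqF x0) ?implybT//; congr (_ `^ _); ring.
Qed.

Lemma fbm_spec_prod (R : realType) (H a c a' c' xi : R) :
  fbm_spec H true a c xi * fbm_spec H true a' c' xi +
  fbm_spec H false a c xi * fbm_spec H false a' c' xi =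
  fbm_kernel H (c - a') xi + fbm_kernel H (a - c') xi -
  fbm_kernel H (c - c') xi - fbm_kernel H (a - a') xi.
Proof.
rewrite /fbm_spec /fbm_kernel /trig_diff 4!(mulrBr xi) !cosB.
have -> : - (2 * H) = 2 * (1 / 2 - H) - 1 by field.
by rewrite -powk_sqr; ring.
Qed.

Lemma measurable_fbm_spec (R : realType) (H : R) b (a c : R) : measurable_fun [set: R] (fbm_spec H b a c).
Proof.
apply: measurable_funM; first exact: measurable_powk.
rewrite /trig_diff; case: b; apply: measurable_funB; try exact: measurable_sinM; exact: measurable_cosM.
Qed.

Section fbm_spec.
Variables (R : realType) (H c : R).
Hypothesis cE : forall z, (\int[mu]_xi (fbm_kernel H z xi)%:E = (c * `|z| `^ (2 * H))%:E)%E.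

Lemma fbm_spec_L2 b (x y : R) : fbm_spec H b x y \in Lfun (@lebesgue_measure R) 2%:E.
Proof.
apply: L2_of_sqr; first exact: measurable_fbm_spec.
apply: (@le_lt_trans _ _ (\int[mu]_xi (2 * fbm_kernel H (y - x) xi)%:E)%E).
  apply: ge0_le_integral => //.
  - by move=> xi _; rewrite lee_fin sqr_ge0.
  - by apply/measurable_EFinP; apply: measurable_funX; exact: measurable_fbm_spec.
  - by apply/measurable_EFinP; apply: measurable_funM => //; exact: measurable_fbm_kernel.
  - move=> xi _; rewrite lee_fin.
    have := fbm_spec_prod H x y x y xi; rewrite !subrr /fbm_kernel !mulr0 !cos0 !subrr !mulr0 !subr0 -!expr2.
    rewrite -(opprB y x) mulrN cosN.
    have := sqr_ge0 (fbm_spec H true x y xi); have := sqr_ge0 (fbm_spec H false x y xi).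
    by move=> ? ? h; have -> : 2 * (powk (- (2 * H)) xi * (1 - cos (xi * (y - x)))) =
      powk (- (2 * H)) xi * (1 - cos (xi * (y - x))) + powk (- (2 * H)) xi * (1 - cos (xi * (y - x))); [ring|]; rewrite -h; case: b; rewrite ?lerDl ?lerDr.
under eq_integral do rewrite EFinM.
rewrite ge0_integralZl//.
- by rewrite cE -EFinM ltry.
- by apply/measurable_EFinP; exact: measurable_fbm_kernel.
- by move=> xi _; rewrite lee_fin fbm_kernel_ge0.
Qed.

Lemma fbm_kernel_integrable z : (@lebesgue_measure R).-integrable setT (fun xi => (fbm_kernel H z xi)%:E).
Proof.
apply/integrableP; split; first by apply/measurable_EFinP; exact: measurable_fbm_kernel.
under eq_integral do rewrite gee0_abs ?lee_fin ?fbm_kernel_ge0//.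
by rewrite cE ltry.
Qed.

Lemma Rintegral_fbm_kernel z : \int[@lebesgue_measure R]_xi (fbm_kernel H z xi) = c * `|z| `^ (2 * H).
Proof. by rewrite /Rintegral cE. Qed.

(** In the second difference of the covariance the powers of single end points cancel, leaving half
    of the four powers of distances; integrating [fbm_spec_prod] gives c times the same four terms,
    whence the factor 2 c. *)
Lemma dot_fbm_spec (x y x' y' : R) :
  dot mu (fbm_spec H true x y) (fbm_spec H true x' y') +
  dot mu (fbm_spec H false x y) (fbm_spec H false x' y') =
  2 * c * (fbm_cov H y y' - fbm_cov H x y' - fbm_cov H y x' + fbm_cov H x x').
Proof.
have I := fbm_kernel_integrable.
rewrite /dot -RintegralD//; try by apply: L2_integrable; exact: fbm_spec_L2.
under eq_Rintegral do rewrite fbm_spec_prod.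
have I2 := integrableD measurableT (I (y - x')) (I (x - y')).
have I3 := integrableB measurableT I2 (I (y - y')).
rewrite (RintegralB measurableT I3 (I (x - x'))) (RintegralB measurableT I2 (I (y - y'))).
rewrite (RintegralD measurableT (I (y - x')) (I (x - y'))) !Rintegral_fbm_kernel /fbm_cov.
by field.
Qed.

End fbm_spec.

(** * Second moments of Wiener integrals *)

Lemma cvg_epsP (R : realType) (u : nat -> R) (l : R) :
  (forall e : R, 0 < e -> exists N, forall n, (N <= n)%N -> `|u n - l| <= e) <-> u n @[n --> \oo] --> l.
Proof.
split=> H.
  by apply/cvgrPdist_le => e /H[N HN]; exists N => // n /= /HN; rewrite distrC.
by move=> e e0; have /cvgrPdist_le/(_ e e0)[N _ HN] := H; exists N => n /HN; rewrite distrC.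
Qed.

Lemma cvge0_epsP (R : realType) (u : nat -> \bar R) : (forall n, 0 <= u n)%E ->
  (forall e : R, 0 < e -> exists N, forall n, (N <= n)%N -> (u n <= e%:E)%E) <-> u n @[n --> \oo] --> 0%E.
Proof.
move=> u0; split=> H.
  apply/fine_cvgP; split.
    have [N HN] := H 1 ltr01; exists N => // n /= /HN un.
    by rewrite ge0_fin_numE// (le_lt_trans un) ?ltry.
  apply/cvg_epsP => e /H[N HN]; exists N => n /HN un.
  rewrite subr0 /= ger0_norm ?fine_ge0// -lee_fin fineK//.
  by rewrite ge0_fin_numE// (le_lt_trans un) ?ltry.
move/fine_cvgP: H => [[N1 _ fu] /cvg_epsP H] e /H[N2 HN2].
exists (maxn N1 N2) => n; rewrite geq_max => /andP[n1 n2].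
have := HN2 n n2; rewrite subr0 /= ger0_norm ?fine_ge0// => h.
by rewrite -[u n]fineK ?lee_fin//; exact: fu.
Qed.

Lemma lee_two_add (R : realType) (x y : \bar R) (a b : R) : (x <= a%:E)%E -> (y <= b%:E)%E ->
  (2%:E * x + 2%:E * y <= (2 * a + 2 * b)%:E)%E.
Proof.
move=> xa yb; have -> : (2 * a + 2 * b)%:E = (2%:E * a%:E + 2%:E * b%:E)%E by [].
by apply: leeD; apply: lee_wpmul2l.
Qed.

Lemma lee_mulEFin (R : realType) (k a : R) (x : \bar R) : 0 <= k -> (x <= a%:E)%E ->
  (k%:E * x <= (k * a)%:E)%E.
Proof. by move=> k0 xa; rewrite EFinM; apply: lee_wpmul2l. Qed.

Section bilinear.
Context d (T : measurableType d) (R : realType) (m : {measure set T -> \bar R}).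
Local Notation L2 := (Lfun m 2%:E).

Lemma dotDr (u v w : T -> R) : u \in L2 -> v \in L2 -> w \in L2 ->
  dot m w (fun x => u x + v x) = dot m w u + dot m w v.
Proof. by move=> u2 v2 w2; rewrite dotC dotDl// !(dotC _ w). Qed.

Lemma dotBr (u v w : T -> R) : u \in L2 -> v \in L2 -> w \in L2 ->
  dot m w (fun x => u x - v x) = dot m w u - dot m w v.
Proof. by move=> u2 v2 w2; rewrite dotC dotBl// !(dotC _ w). Qed.

Lemma dotZr (c : R) (v w : T -> R) : v \in L2 -> w \in L2 ->
  dot m w (fun x => c * v x) = c * dot m w v.
Proof. by move=> v2 w2; rewrite dotC dotZl// (dotC _ w). Qed.

Lemma dot_sumr I (r : seq I) (P : pred I) (v : I -> T -> R) (w : T -> R) :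
  (forall i, v i \in L2) -> w \in L2 ->
  dot m w (fun x => \sum_(i <- r | P i) v i x) = \sum_(i <- r | P i) dot m w (v i).
Proof.
by move=> v2 w2; rewrite dotC dot_suml//; apply: eq_bigr => i _; rewrite dotC.
Qed.

Lemma dot_sum2 I (r : seq I) (a b : I -> R) (u v : I -> T -> R) :
  (forall i, u i \in L2) -> (forall i, v i \in L2) ->
  dot m (fun x => \sum_(i <- r) a i * u i x) (fun x => \sum_(i <- r) b i * v i x) =
  \sum_(i <- r) \sum_(j <- r) a i * b j * dot m (u i) (v j).
Proof.
move=> u2 v2; have uZ i := L2Z (a i) (u2 i); have vZ i := L2Z (b i) (v2 i).
rewrite dot_suml//; last exact: L2_sum.
apply: eq_bigr => i _; rewrite dot_sumr//; apply: eq_bigr => j _.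
by rewrite dotZl// dotZr// mulrA.
Qed.

Lemma sqrD_integral_le (D : set T) (u v : T -> R) : measurable D -> measurable_fun D u -> measurable_fun D v ->
  (\int[m]_(x in D) ((u x + v x) ^+ 2)%:E <=
   2%:E * \int[m]_(x in D) (u x ^+ 2)%:E + 2%:E * \int[m]_(x in D) (v x ^+ 2)%:E)%E.
Proof.
move=> mD mu_ mv.
have q (f : T -> R) : measurable_fun D f -> measurable_fun D (fun x => (f x ^+ 2)%:E).
  by move=> mf; apply/measurable_EFinP; exact: measurable_funX.
rewrite -!ge0_integralZl_EFin//; try by [exact: q|move=> x _; rewrite lee_fin sqr_ge0].
rewrite -ge0_integralD//; try by [apply: measurable_funeM; exact: q|move=> x _; rewrite -EFinM lee_fin mulr_ge0// sqr_ge0].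
apply: ge0_le_integral => //.
- by move=> x _; rewrite lee_fin sqr_ge0.
- by apply: q; exact: measurable_funD.
- by apply: emeasurable_funD; apply: measurable_funeM; exact: q.
- move=> x _; rewrite -!EFinM -EFinD lee_fin.
  by have := sqr_ge0 (u x - v x); lra.
Qed.

Lemma sqrB_integral_le (D : set T) (u v : T -> R) : measurable D -> measurable_fun D u -> measurable_fun D v ->
  (\int[m]_(x in D) ((u x - v x) ^+ 2)%:E <=
   2%:E * \int[m]_(x in D) (u x ^+ 2)%:E + 2%:E * \int[m]_(x in D) (v x ^+ 2)%:E)%E.
Proof.
move=> mD mu_ mv; have mNv : measurable_fun D (fun x => - v x) by exact: measurableT_comp.
have := sqrD_integral_le mD mu_ mNv.
by under [X in (_ <= _ + _ * X)%E -> _]eq_integral do rewrite sqrrN.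
Qed.

End bilinear.

(** * Product measures and sums of tensor products *)

Section sprod.
Context d1 d2 (T1 : measurableType d1) (T2 : measurableType d2) (R : realType).
Variable m1 : {sigma_finite_measure set T1 -> \bar R}.
Variable m2 : {sigma_finite_measure set T2 -> \bar R}.

(* The library does not make [m1 \x m2] canonically sigma-finite. *)
Definition sprod : set (T1 * T2)%type -> \bar R := (m1 \x m2)%E.

HB.instance Definition _ := Measure.copy sprod (m1 \x m2)%E.

Lemma sprod_sigma_finite : sigma_finite setT sprod.
Proof.
have /sigma_finiteP[F [TF ndF Foo]] := sigma_finiteT m1.
have /sigma_finiteP[G [TG ndG Goo]] := sigma_finiteT m2.
exists (fun n => F n `*` G n).
  rewrite -setXTT TF TG predeqE => -[x y]; split => [[/= [n _ Fnx] [k _ Gky]]|].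
    exists (maxn n k) => //; split.
    - by move: x Fnx; exact/subsetPset/ndF/leq_maxl.
    - by move: y Gky; exact/subsetPset/ndG/leq_maxr.
  by move=> [n _ []/= ? ?]; split; exists n.
move=> k; have [? ?] := Foo k; have [? ?] := Goo k.
split; first exact: measurableX.
by rewrite /sprod product_measure1E// lte_mul_pinfty// ge0_fin_numE.
Qed.

HB.instance Definition _ := @Measure_isSigmaFinite.Build _ _ _ sprod sprod_sigma_finite.

Lemma sprodE (f : T1 * T2 -> \bar R) : (\int[sprod]_z f z = \int[(m1 \x m2)%E]_z f z)%E.
Proof. exact: eq_measure_integral. Qed.

Lemma sprod_integrable (f : T1 * T2 -> \bar R) :
  (m1 \x m2)%E.-integrable setT f -> sprod.-integrable setT f.
Proof. by move=> /integrableP[mf If]; apply/integrableP; split; rewrite ?sprodE. Qed.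

Lemma sprod_tonelli (f : T1 * T2 -> \bar R) : measurable_fun setT f -> (forall z, 0 <= f z)%E ->
  (\int[sprod]_z f z = \int[m1]_x \int[m2]_y f (x, y))%E.
Proof. by move=> mf f0; rewrite sprodE fubini_tonelli1. Qed.

End sprod.

Section prod.
Context d d' (T : measurableType d) (T' : measurableType d') (R : realType).
Variables (m : {sigma_finite_measure set T -> \bar R}) (m' : {sigma_finite_measure set T' -> \bar R}).

Lemma measurable_Rintegral2 (F : T * T' -> R) : measurable_fun setT F ->
  measurable_fun setT (fun x => \int[m']_y F (x, y)).
Proof.
move=> mF; have mFE : measurable_fun setT (EFin \o F) by apply/measurable_EFinP.
rewrite /Rintegral; apply: measurableT_comp => //.
under eq_fun do rewrite integralE.
apply: emeasurable_funB.
- have := @measurable_fun_fubini_tonelli_F _ _ _ _ R m' (funepos (fun z => (F z)%:E)) (measurable_funepos mFE) (fun x => funepos_ge0 _ x).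
  by congr (measurable_fun _ _); apply/funext => x; apply: eq_integral => y _; rewrite !funeposE.
- have := @measurable_fun_fubini_tonelli_F _ _ _ _ R m' (funeneg (fun z => (F z)%:E)) (measurable_funeneg mFE) (fun x => funeneg_ge0 _ x).
  by congr (measurable_fun _ _); apply/funext => x; apply: eq_integral => y _; rewrite !funenegE.
Qed.

Lemma measurable_prodM (f : T -> R) (g : T' -> R) : measurable_fun setT f -> measurable_fun setT g ->
  measurable_fun setT (fun z : T * T' => f z.1 * g z.2).
Proof.
by move=> mf mg; apply: measurable_funM; apply: measurableT_comp.
Qed.

Lemma integrable_prodM (f : T -> R) (g : T' -> R) :
  m.-integrable setT (EFin \o f) -> m'.-integrable setT (EFin \o g) ->
  (m \x m')%E.-integrable setT (fun z : T * T' => (f z.1 * g z.2)%:E).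
Proof.
move=> If Ig; have /integrableP[/measurable_EFinP mf If'] := If; have /integrableP[/measurable_EFinP mg Ig'] := Ig.
apply: (iffRL (integrable12ltyP _ _ _)); first by apply/measurable_EFinP; exact: measurable_prodM.
under eq_integral do under eq_integral do rewrite /= normrM EFinM.
under eq_integral.
  move=> x _; rewrite ge0_integralZl//; last first.
    by apply/measurable_EFinP; exact: measurableT_comp.
  over.
have E := ge0_fin_numE; set I := (\int[m']_y _)%E in Ig' *.
rewrite /= -/I; have I0 : (0 <= I)%E by apply: integral_ge0 => y _; exact: abse_ge0.
have -> : I = (fine I)%:E by rewrite fineK// ge0_fin_numE.
rewrite ge0_integralZr//; last 2 first.
- by apply/measurable_EFinP; exact: measurableT_comp.
- by rewrite lee_fin fine_ge0.
by apply: lte_mul_pinfty => //; [exact: integral_ge0|rewrite ge0_fin_numE//; exact: integral_ge0|rewrite ltry].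
Qed.

Lemma Rintegral_prodM (f : T -> R) (g : T' -> R) :
  m.-integrable setT (EFin \o f) -> m'.-integrable setT (EFin \o g) ->
  \int[(sprod m m')]_z (f z.1 * g z.2) = (\int[m]_x f x) * (\int[m']_y g y).
Proof.
move=> If Ig; have I := integrable_prodM If Ig.
rewrite /Rintegral sprodE (_ : integral (m \x m')%E _ _ = \int[m]_x \int[m']_y (f x * g y)%:E)%E; last exact/esym/(integral12_prod_meas1 I).
have fE := integrable_fin_num measurableT Ig.
move: fE; rewrite /=; set C := (\int[m']_x (g x)%:E)%E => fE.
have -> : (\int[m]_x \int[m']_y (f x * g y)%:E = \int[m]_x ((fine C)%:E * (f x)%:E))%E.
  apply: eq_integral => x _; under eq_integral do rewrite EFinM.
  by rewrite integralZl// -/C fineK// muleC.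
transitivity (\int[m]_x (fine C * f x)); first by [].
by rewrite RintegralZl// mulrC.
Qed.

End prod.

Section tensor.
Context d d' (T : measurableType d) (T' : measurableType d') (R : realType).
Variables (m : {sigma_finite_measure set T -> \bar R}) (m' : {sigma_finite_measure set T' -> \bar R}).

(** Applied to step functions it expands a squared norm into Gram matrices; applied to kernel sums
    with orthonormal [u], the double sum collapses to its diagonal. *)
Lemma integral_tensor_sum I (r : seq I) (c : I -> R) (u : I -> T -> R) (v : I -> T' -> R) :
  (forall i, u i \in Lfun m 2%:E) -> (forall i, v i \in Lfun m' 2%:E) ->
  (\int[(sprod m m')]_z ((\sum_(i <- r) c i * (u i z.1 * v i z.2)) ^+ 2)%:E =
   (\sum_(i <- r) \sum_(j <- r) c i * c j * (dot m (u i) (u j) * dot m' (v i) (v j)))%:E)%E.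
Proof.
move=> u2 v2.
have mu_ i := L2_measurable (u2 i); have mv i := L2_measurable (v2 i).
rewrite sprod_tonelli; last 2 first.
- apply/measurable_EFinP; apply: measurable_funX; apply: measurable_sum => i.
  by apply: measurable_funM => //; exact: measurable_prodM.
- by move=> z; rewrite lee_fin sqr_ge0.
transitivity (\int[m]_x ((\sum_(i <- r) \sum_(j <- r) c i * c j * dot m' (v i) (v j) * (u i x * u j x))%:E))%E.
  apply: eq_integral => x _.
  transitivity (dot m' (fun y => \sum_(i <- r) (c i * u i x) * v i y) (fun y => \sum_(i <- r) (c i * u i x) * v i y))%:E.
    rewrite EFin_dot; last by apply: L2_sum => i; exact: L2Z.
    by apply: eq_integral => y _; congr ((_ ^+ 2)%:E); apply: eq_bigr => i _; rewrite mulrA.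
  rewrite dot_sum2//; congr EFin; apply: eq_bigr => i _; apply: eq_bigr => j _; ring.
under eq_integral do rewrite -sumEFin; under eq_integral do (under eq_bigr do rewrite -sumEFin).
have I2 i j : m.-integrable setT (fun x => (c i * c j * dot m' (v i) (v j) * (u i x * u j x))%:E).
  under eq_fun do rewrite EFinM.
  by apply: integrableZl => //; exact: L2_integrable.
rewrite integral_sum//; last by move=> i; apply: integrable_sum.
rewrite -sumEFin; apply: eq_bigr => i _.
rewrite integral_sum// -sumEFin; apply: eq_bigr => j _.
under eq_integral do rewrite EFinM.
rewrite integralZl//; last exact: L2_integrable.
rewrite -[X in (_ * X)%E]fineK; last by apply: integrable_fin_num => //; exact: L2_integrable.
by rewrite -EFinM; congr EFin; rewrite -/(Rintegral _ _ _) -/(dot m (u i) (u j)); ring.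
Qed.

End tensor.

(** * Weighted space-time Fourier coefficients *)

Section spectral.
Variables (R : realType) (T : R).
Hypothesis T0 : 0 < T.
Local Notation mu := (@lebesgue_measure R).
Local Notation mm := (sprod mu mu).
Local Notation RR := (measurableTypeR R).

Definition on_ST (z : RR * RR) : R := (0 < z.1 < 1)%R%:R * (0 < z.2 < T)%R%:R.

(** The cutoffs make each test function square integrable on the plane, so that a Fourier
    coefficient at a fixed frequency is a continuous functional on L^2. *)
Definition trig_ST (b : bool * bool) (xi : RR * RR) (z : RR * RR) : R :=
  (trig b.1 (xi.1 * z.1) * (0 < z.1 < 1)%R%:R) * (trig b.2 (xi.2 * z.2) * (0 < z.2 < T)%R%:R).

Lemma measurable_bool (d : measure_display) (A : measurableType d) (p : A -> bool) : measurable_fun setT p ->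
  measurable_fun setT (fun x => (p x)%:R : R).
Proof. by move=> mp; apply: (@measurable_comp _ _ _ _ _ _ setT (fun b : bool => b%:R : R)). Qed.

Lemma measurable_itvR (a b : R) : measurable_fun setT (fun x : R => (a < x < b)%R%:R : R).
Proof. by apply: measurable_bool; apply: measurable_and; exact: measurable_fun_ltr. Qed.

Lemma measurable_trig (b : bool) : measurable_fun setT (@trig R b).
Proof.
by case: b; apply: continuous_measurable_fun; [exact: continuous_cos|exact: continuous_sin].
Qed.

Lemma trig_le1 b (x : R) : `|trig b x| <= 1.
Proof. by case: b; rewrite /trig ler_norml ?cos_geN1 ?cos_le1 ?sin_geN1 ?sin_le1. Qed.

Lemma measurable_on_ST : measurable_fun setT on_ST.
Proof.
by apply: measurable_funM; apply: (measurableT_comp (measurable_itvR _ _)).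
Qed.

Lemma measurable_trig_ST b : measurable_fun setT (fun w : (RR * RR) * (RR * RR) => trig_ST b w.1 w.2).
Proof.
have m1 : measurable_fun setT (fun w : (RR * RR) * (RR * RR) => w.1.1 * w.2.1).
  by apply: measurable_funM; apply: measurableT_comp.
have m2 : measurable_fun setT (fun w : (RR * RR) * (RR * RR) => w.1.2 * w.2.2).
  by apply: measurable_funM; apply: measurableT_comp.
apply: measurable_funM; apply: measurable_funM.
- exact: measurableT_comp (measurable_trig _) m1.
- by apply: (measurableT_comp (measurable_itvR 0 1)); apply: measurableT_comp.
- exact: measurableT_comp (measurable_trig _) m2.
- by apply: (measurableT_comp (measurable_itvR 0 T)); apply: measurableT_comp.
Qed.

Lemma measurable_trig_ST2 b xi : measurable_fun setT (trig_ST b xi).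
Proof.
exact: measurableT_comp (measurable_trig_ST b) (pair1_measurable xi).
Qed.

Lemma trig_ST_le b xi z : `|trig_ST b xi z| <= on_ST z.
Proof.
rewrite /trig_ST /on_ST !normrM; apply: ler_pM; rewrite ?mulr_ge0 ?normr_ge0//.
  by rewrite normr_nat ler_piMl// trig_le1.
by rewrite normr_nat ler_piMl// trig_le1.
Qed.

Lemma integral_on_ST : (\int[mm]_z (on_ST z ^+ 2)%:E = T%:E)%E.
Proof.
have itv (a b : R) : a <= b -> (\int[mu]_x ((a < x < b)%R%:R)%:E = (b - a)%:E)%E.
  move=> ab.
  transitivity (\int[mu]_(x in `]a, b[) (cst 1%E x))%E.
    rewrite [RHS]integral_mkcond; apply: eq_integral => x _.
    by rewrite patchE mem_setE in_itv/=; case: ifP.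
  rewrite integral_cst//= mul1e lebesgue_measure_itv/= lte_fin.
  by move: ab; rewrite le_eqVlt => /predU1P[->|->]; rewrite ?ltxx ?subrr// -EFinB.
rewrite sprod_tonelli; last 2 first.
- by apply/measurable_EFinP; apply: measurable_funX; exact: measurable_on_ST.
- by move=> z; rewrite lee_fin sqr_ge0.
transitivity (\int[mu]_x (((0 < x < 1)%R%:R)%:E * T%:E))%E.
  apply: eq_integral => x _.
  transitivity (\int[mu]_y (((0 < x < 1)%R%:R)%:E * ((0 < y < T)%R%:R)%:E))%E.
    apply: eq_integral => y _; rewrite -EFinM /on_ST/=; congr EFin.
    by case: (0 < x < 1); case: (0 < y < T); rewrite ?(mulr1, mulr0) ?expr1n ?expr0n.
  rewrite ge0_integralZl//; last by apply/measurable_EFinP; exact: measurable_itvR.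
  by rewrite itv ?subr0 ?ltW.
rewrite ge0_integralZr//; last 2 first.
- by apply/measurable_EFinP; exact: measurable_itvR.
- by rewrite lee_fin ltW.
by rewrite itv// subr0 mul1e.
Qed.

Lemma L2_le_on_ST (f : RR * RR -> R) (M : R) : measurable_fun setT f ->
  (forall z, `|f z| <= M * on_ST z) -> f \in Lfun mm 2%:E.
Proof.
move=> mf fM; apply: L2_of_sqr => //.
apply: (@le_lt_trans _ _ (\int[mm]_z ((M ^+ 2)%:E * (on_ST z ^+ 2)%:E))%E).
  apply: ge0_le_integral => //.
  - by move=> z _; rewrite lee_fin sqr_ge0.
  - by apply/measurable_EFinP; exact: measurable_funX.
  - apply: measurable_funeM; apply/measurable_EFinP; apply: measurable_funX; exact: measurable_on_ST.
  - move=> z _; rewrite -EFinM lee_fin -exprMn -real_normK ?num_real//.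
    by rewrite ler_sqr ?nnegrE ?(le_trans _ (fM z)).
rewrite ge0_integralZl//.
- by rewrite integral_on_ST -EFinM ltry.
- by apply/measurable_EFinP; apply: measurable_funX; exact: measurable_on_ST.
- by move=> z _; rewrite lee_fin sqr_ge0.
- by rewrite lee_fin sqr_ge0.
Qed.

Lemma trig_ST_L2 b xi : trig_ST b xi \in Lfun mm 2%:E.
Proof.
apply: (@L2_le_on_ST _ 1); first exact: measurable_trig_ST2.
by move=> z; rewrite mul1r trig_ST_le.
Qed.

Variables (H1 H2 : R).

(* [powk (3 / 2 - H)] is xi^(1/2 - H), the square root of the spectral weight;
   [b] selects a cosine or a sine in each of the two variables. *)
Definition specK (b : bool * bool) (h : RR * RR -> R) (xi : RR * RR) : R :=
  powk (3 / 2 - H1) xi.1 * powk (3 / 2 - H2) xi.2 * dot mm h (trig_ST b xi).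

Lemma measurable_specK_gen d (A : measurableType d) b (h : A * (RR * RR) -> R) : measurable_fun setT h ->
  measurable_fun setT (fun w : A * (RR * RR) => specK b (fun z => h (w.1, z)) w.2).
Proof.
move=> mh; apply: measurable_funM.
  have m1 : measurable_fun setT (fun w : A * (RR * RR) => w.2.1) by exact: measurableT_comp.
  have m2 : measurable_fun setT (fun w : A * (RR * RR) => w.2.2) by exact: measurableT_comp.
  by apply: measurable_funM; [exact: measurableT_comp (measurable_powk _) m1|exact: measurableT_comp (measurable_powk _) m2].
apply: (@measurable_Rintegral2 _ _ _ _ _ mm (fun v : (A * (RR * RR)) * (RR * RR) => h (v.1.1, v.2) * trig_ST b v.1.2 v.2)).
apply: measurable_funM.
  apply: measurableT_comp mh _; apply: measurable_fun_pair => //.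
  by apply: measurableT_comp.
have mp : measurable_fun setT (fun v : (A * (RR * RR)) * (RR * RR) => (v.1.2, v.2)).
  by apply: measurable_fun_pair => //; apply: measurableT_comp.
exact: measurableT_comp (measurable_trig_ST b) mp.
Qed.

Lemma measurable_specK b (h : RR * RR -> R) : measurable_fun setT h -> measurable_fun setT (specK b h).
Proof.
move=> mh.
have := @measurable_specK_gen _ unit b (fun w => h w.2) (measurableT_comp mh (@measurable_snd _ _ _ _)).
by move=> /measurableT_comp /(_ (pair1_measurable tt)).
Qed.

Lemma Rintegral_itv_trig (b : bool) (a c L xi : R) : 0 <= a -> a <= c -> c <= L -> 0 < xi ->
  \int[mu]_y ((a < y <= c)%R%:R * (trig b (xi * y) * (0 < y < L)%R%:R)) = xi^-1 * trig_diff b a c xi.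
Proof.
move=> a0 ac cL xi0.
pose F (y : R) := xi^-1 * (if b then sin (xi * y) else - cos (xi * y)).
have dxi (y : R) : is_derive y 1 (fun y : R => xi * y) xi.
  by have := is_deriveZ xi (is_derive_id y (1 : R)); rewrite /GRing.scale/= mulr1.
have dF (y : R) : is_derive y 1 F (trig b (xi * y)).
  rewrite /F /trig; case: b F.
    have := is_deriveZ xi^-1 (is_derive1_comp (is_derive_sin (xi * y)) (dxi y)).
    by rewrite /GRing.scale/= (mulrC (cos _)) mulKf ?gt_eqF.
  have := is_deriveZ xi^-1 (is_deriveN (is_derive1_comp (is_derive_cos (xi * y)) (dxi y))).
  by rewrite /GRing.scale/= mulNr opprK (mulrC (sin _)) mulKf ?gt_eqF.
have cF (y : R) : {for y, continuous F} by apply: pair_continuous; apply: ex_derive; exact: dF.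
have mt : measurable_fun setT (fun y : R => (trig b (xi * y))%:E).
  by apply/measurable_EFinP; apply: measurableT_comp (measurable_trig b) _; exact: measurable_funM.
have ct : continuous (fun y : R => trig b (xi * y)).
  move=> y; apply: pair_continuous; case: b F dF cF mt => *.
    by apply: ex_derive; exact: is_derive1_comp (is_derive_cos (xi * y)) (dxi y).
  by apply: ex_derive; exact: is_derive1_comp (is_derive_sin (xi * y)) (dxi y).
(* The cutoff 0 < y < L is strict at L, so the interval is open at c exactly when c = L. *)
transitivity (fine (\int[mu]_(y in [set` Interval (BRight a) (BSide (c == L) c)]) (trig b (xi * y))%:E)%E).
  rewrite /Rintegral; congr fine; rewrite [RHS]integral_mkcond; apply: eq_integral => y _.
  rewrite patchE mem_setE in_itv/=.
  have -> : (y < c ?<= if (c != L)) = if c == L then y < c else y <= c by case: (c == L).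
  have [ay|ya] := ltP a y; rewrite /= ?mul0r//.
  rewrite (le_lt_trans a0 ay)/=; have [->|cL'] := eqVneq c L.
    by have [yL|Ly] := ltP y L; rewrite ?(ltW yL) ?mulr1 ?mul1r ?mulr0.
  have [yc|cy] := leP y c; rewrite ?mul0r//.
  by rewrite (le_lt_trans yc) ?mul1r ?mulr1// lt_neqAle cL'.
rewrite integral_itv_bndoo; last exact: measurable_funTS.
move: ac; rewrite le_eqVlt => /predU1P[->|ac].
  rewrite set_itv_ge ?bnd_simp ?ltxx// integral_set0/= /trig_diff.
  by case: (b); rewrite subrr mulr0.
rewrite -(@integral_itv_bndoo R a c _ true false); last exact: measurable_funTS.
rewrite (@continuous_FTC2 R _ F a c)//=.
- rewrite /F /trig_diff; case: (b); ring.
- exact: continuous_subspaceT.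
- split.
  + by move=> y _; apply: ex_derive; exact: dF.
  + by apply: cvg_at_right_filter; exact: cF.
  + by apply: cvg_at_left_filter; exact: cF.
- by move=> y _; rewrite derive1E; have [_ ->] := dF y.
Qed.

Lemma integrable_itv_trig (b : bool) (L xi : R) (p : R -> bool) : measurable_fun setT p ->
  mu.-integrable setT (fun y => ((p y)%:R * (trig b (xi * y) * (0 < y < L)%R%:R))%:E).
Proof.
move=> mp.
have m1 : measurable_fun setT (fun y : R => (p y)%:R * (trig b (xi * y) * (0 < y < L)%R%:R)).
  apply: measurable_funM; first exact: measurable_bool.
  apply: measurable_funM; last exact: measurable_itvR.
  by apply: measurableT_comp (measurable_trig b) _; exact: measurable_funM.
have I1 : mu.-integrable setT (fun y => ((0 < y < L)%R%:R : R)%:E).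
  apply/integrableP; split; first by apply/measurable_EFinP; exact: measurable_itvR.
  apply: (@le_lt_trans _ _ (\int[mu]_(y in `]0%R, L[) (cst 1%E y))%E).
    rewrite [leRHS]integral_mkcond le_eqVlt; apply/orP; left; apply/eqP; apply: eq_integral => y _.
    by rewrite patchE mem_setE in_itv/=; case: ifP; rewrite /= ?normr1 ?normr0.
  rewrite integral_cst//= mul1e lebesgue_measure_itv/= lte_fin.
  by case: ifP; rewrite -?EFinB ltry.
apply: (le_integrable _ _ _ I1) => //; first exact/measurable_EFinP.
move=> y _; rewrite /= lee_fin !normrM !normr_nat.
case: (p y); rewrite ?mul0r ?mul1r//; apply: ler_piMl => //; exact: trig_le1.
Qed.

Lemma Rintegral_seq (I : eqType) (r : seq I) (F : I -> RR * RR -> R) :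
  (forall i, i \in r -> mm.-integrable setT (EFin \o F i)) ->
  \int[mm]_z (\sum_(i <- r) F i z) = \sum_(i <- r) \int[mm]_z F i z /\
  mm.-integrable setT (EFin \o (fun z => \sum_(i <- r) F i z)).
Proof.
elim: r => [|i r IH] Ir.
  rewrite big_nil; under eq_fun do rewrite big_nil.
  by rewrite /Rintegral integral0; split => //; exact: integrable0.
have [E I2] := IH (fun j jr => Ir j (mem_behead (s := i :: r) jr)).
have I1 := Ir i (mem_head i r).
under eq_fun do rewrite big_cons; rewrite big_cons -E; split.
  exact: (RintegralD measurableT I1 I2).
exact: (integrableD measurableT I1 I2).
Qed.

Lemma specK_step b (h : step_data R) xi : step_wf T h ->
  specK b (step_eval h) xi = \sum_(p <- h) p.1.1 *
    (fbm_spec H1 b.1 p.1.2.1 p.1.2.2 xi.1 * fbm_spec H2 b.2 p.2.1 p.2.2 xi.2).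
Proof.
move=> wf.
have [x1|x1] := ltP 0 xi.1; last first.
  rewrite /specK /powk ltNge x1/= !mul0r big1// => p _.
  by rewrite /fbm_spec /powk ltNge x1/= !mul0r mulr0.
have [x2|x2] := ltP 0 xi.2; last first.
  rewrite /specK {2}/powk ltNge x2/= mulr0 mul0r big1// => p _.
  by rewrite /fbm_spec {2}/powk ltNge x2/= mul0r !mulr0.
pose F (p : R * (R * R) * (R * R)) (z : RR * RR) : R := p.1.1 *
  (((p.1.2.1 < z.1 <= p.1.2.2)%R%:R * (trig b.1 (xi.1 * z.1) * (0 < z.1 < 1)%R%:R)) *
   ((p.2.1 < z.2 <= p.2.2)%R%:R * (trig b.2 (xi.2 * z.2) * (0 < z.2 < T)%R%:R))).
have mb (a c : R) : measurable_fun setT (fun y : R => a < y <= c).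
  by apply: measurable_and; [exact: measurable_fun_ltr|exact: measurable_fun_ler].
have I1 (p : R * (R * R) * (R * R)) := integrable_itv_trig b.1 1 xi.1 (mb p.1.2.1 p.1.2.2).
have I2 (p : R * (R * R) * (R * R)) := integrable_itv_trig b.2 T xi.2 (mb p.2.1 p.2.2).
have IF (p : R * (R * R) * (R * R)) : mm.-integrable setT (EFin \o F p).
  have I12 := sprod_integrable (integrable_prodM (I1 p) (I2 p)).
  have := @integrableZl _ _ _ mm setT measurableT p.1.1 _ I12.
  by apply: eq_integrable => // z _; rewrite /= -EFinM.
rewrite /specK; have -> : dot mm (step_eval h) (trig_ST b xi) = \int[mm]_z (\sum_(p <- h) F p z).
  apply: eq_Rintegral => z _; rewrite /step_eval mulr_suml; apply: eq_bigr => p _.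
  by rewrite /F /trig_ST -mulnb natrM; ring.
have [-> _] := Rintegral_seq (fun p (_ : p \in h) => IF p).
rewrite mulr_sumr; apply: eq_big_seq => p ph.
have /andP[a0 ac] := (wf p ph).1; have [c1 [/andP[a0' ac'] cT]] := (wf p ph).2.
have I12 := sprod_integrable (integrable_prodM (I1 p) (I2 p)).
rewrite /F (RintegralZl p.1.1 measurableT I12) (Rintegral_prodM (I1 p) (I2 p)).
rewrite !Rintegral_itv_trig// /fbm_spec.
have P H (x : R) : 0 < x -> powk (1 / 2 - H) x = powk (3 / 2 - H) x * x^-1.
  move=> x0; rewrite /powk x0 (_ : 3 / 2 - H - 1 = (1 / 2 - H - 1) + 1); last by field.
  by rewrite [in RHS]powRD ?(gt_eqF x0) ?implybT// powRr1 ?(ltW x0)// mulfK ?gt_eqF.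
by rewrite (P H1)// (P H2)//; ring.
Qed.

Definition bools2 : seq (bool * bool) := [:: (true, true); (true, false); (false, true); (false, false)].

(** The squared weighted norm of the space-time Fourier transform; the four cosine-sine products on
    the positive quadrant take the place of complex exponentials on the whole plane. *)
Definition specQ (h : RR * RR -> R) : \bar R := (\sum_(b <- bools2) \int[mm]_xi (specK b h xi ^+ 2)%:E)%E.

Lemma specK_le_specQ b h : (\int[mm]_xi (specK b h xi ^+ 2)%:E <= specQ h)%E.
Proof.
have K0 b' : (0 <= \int[mm]_xi (specK b' h xi ^+ 2)%:E)%E.
  by apply: integral_ge0 => xi _; rewrite lee_fin sqr_ge0.
have bb : b \in bools2 by case: b {K0} => -[] [].
by rewrite /specQ (bigD1_seq b)//= leeDl//; apply: sume_ge0.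
Qed.

End spectral.

(** * Second moments of step integrals and of their limits *)

Section sheet.
Variables (d : measure_display) (Omega : measurableType d) (R : realType).
Variables (P : probability Omega R) (H1 H2 T : R) (W : R -> R -> Omega -> R).
Hypothesis T0 : 0 < T.
Hypothesis sW : fractional_brownian_sheet P H1 H2 T W.
Variables (c1 c2 : R).
Hypothesis cE1 : forall z, (\int[@lebesgue_measure R]_xi (fbm_kernel H1 z xi)%:E = (c1 * `|z| `^ (2 * H1))%:E)%E.
Hypothesis cE2 : forall z, (\int[@lebesgue_measure R]_xi (fbm_kernel H2 z xi)%:E = (c2 * `|z| `^ (2 * H2))%:E)%E.
Hypothesis c1_gt0 : 0 < c1.
Hypothesis c2_gt0 : 0 < c2.
Local Notation mu := (@lebesgue_measure R).
Local Notation mm := (sprod mu mu).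
Local Notation RR := (measurableTypeR R).

Lemma sheet_measurable x t : x \in `[0, 1] -> t \in `[0, T] -> measurable_fun setT (W x t).
Proof.
move=> x01 t0T; have [+ _] := sheet_gaussian sW (fun _ : 'I_1 => 1) (fun _ => x01) (fun _ => t0T).
by under eq_fun do rewrite big_ord_recl big_ord0 addr0 mul1r.
Qed.

Lemma sheet_L2 x t : x \in `[0, 1] -> t \in `[0, T] -> W x t \in Lfun P 2%:E.
Proof.
move=> x01 t0T; apply: L2_of_sqr; first exact: sheet_measurable.
have := sheet_cov sW x01 x01 t0T t0T; rewrite unlock => E.
rewrite (_ : integral _ _ _ = (fbm_cov H1 x x * fbm_cov H2 t t)%:E) ?ltry// -E.
Qed.

Lemma sheet_dot x y t r : x \in `[0, 1] -> y \in `[0, 1] -> t \in `[0, T] -> r \in `[0, T] ->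
  dot P (W x t) (W y r) = fbm_cov H1 x y * fbm_cov H2 t r.
Proof.
move=> x01 y01 t0T r0T; have := sheet_cov sW x01 y01 t0T r0T; rewrite unlock => E.
by rewrite /dot /Rintegral; move: E => /= ->.
Qed.

Definition sheet_incr (p : R * (R * R) * (R * R)) (w : Omega) : R :=
  W p.1.2.2 p.2.2 w - W p.1.2.1 p.2.2 w - W p.1.2.2 p.2.1 w + W p.1.2.1 p.2.1 w.

Definition step_ok (p : R * (R * R) * (R * R)) : Prop :=
  0 <= p.1.2.1 <= p.1.2.2 /\ p.1.2.2 <= 1 /\ 0 <= p.2.1 <= p.2.2 /\ p.2.2 <= T.

Lemma step_ok_in p : step_ok p -> [/\ p.1.2.1 \in `[0, 1], p.1.2.2 \in `[0, 1],
  p.2.1 \in `[0, T] & p.2.2 \in `[0, T] ].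
Proof. by case => /andP[? ?] [? [/andP[? ?] ?]]; split; rewrite in_itv/=; apply/andP; split; lra. Qed.

Lemma sheet_incr_L2 p : step_ok p -> sheet_incr p \in Lfun P 2%:E.
Proof.
move=> /step_ok_in[a b a' b']; apply: L2_add; last exact: sheet_L2.
by apply: L2B; [apply: L2B|]; exact: sheet_L2.
Qed.

Lemma sheet_incr_dot p q : step_ok p -> step_ok q -> dot P (sheet_incr p) (sheet_incr q) =
  (fbm_cov H1 p.1.2.2 q.1.2.2 - fbm_cov H1 p.1.2.1 q.1.2.2 - fbm_cov H1 p.1.2.2 q.1.2.1 + fbm_cov H1 p.1.2.1 q.1.2.1) *
  (fbm_cov H2 p.2.2 q.2.2 - fbm_cov H2 p.2.1 q.2.2 - fbm_cov H2 p.2.2 q.2.1 + fbm_cov H2 p.2.1 q.2.1).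
Proof.
move=> okp okq; have q2 := sheet_incr_L2 okq.
have [a b a' b'] := step_ok_in okp; have [e f e' f'] := step_ok_in okq.
have W2 := sheet_L2.
have dl x t : x \in `[0, 1] -> t \in `[0, T] -> dot P (W x t) (sheet_incr q) =
  (fbm_cov H1 x q.1.2.2 - fbm_cov H1 x q.1.2.1) * (fbm_cov H2 t q.2.2 - fbm_cov H2 t q.2.1).
  move=> x01 t0T; rewrite /sheet_incr.
  rewrite dotDr ?dotBr ?sheet_dot//; try by [exact: W2|apply: L2B; exact: W2|apply: L2B; [apply: L2B|]; exact: W2].
  ring.
rewrite {1}/sheet_incr dotDl ?dotBl ?dl//; try by [exact: W2|apply: L2B; exact: W2|apply: L2B; [apply: L2B|]; exact: W2].
ring.
Qed.

(** The isometry on step functions. Summing over the four cosine-sine combinations factors each Gram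
    entry into a space part and a time part, which are 2 c1 and 2 c2 times the covariances of the
    increments. *)
Lemma specQ_step (h : step_data R) : step_wf T h ->
  (specQ T H1 H2 (step_eval h) = (4 * c1 * c2)%:E * \int[P]_w (step_wiener W h w ^+ 2)%:E)%E.
Proof.
move=> wf.
(* The value 0 on ill-formed rectangles makes [V p] square integrable for every index p, as the
   expansion of the sum requires. *)
pose V (p : R * (R * R) * (R * R)) : Omega -> R := if `[< step_ok p >] then sheet_incr p else fun=> 0.
have V2 p : V p \in Lfun P 2%:E.
  by rewrite /V; case: asboolP => [ok|_]; [exact: sheet_incr_L2|exact: L2_0].
have -> : (\int[P]_w (step_wiener W h w ^+ 2)%:E =
   (\sum_(p <- h) \sum_(q <- h) p.1.1 * q.1.1 * dot P (V p) (V q))%:E)%E.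
  rewrite -dot_sum2// EFin_dot; last by apply: L2_sum => p; exact: L2Z.
  apply: eq_integral => w _; congr ((_ ^+ 2)%:E); apply: eq_big_seq => p ph.
  by rewrite /V; case: asboolP => // -[]; exact: wf.
rewrite /specQ.
have S2 b (p : R * (R * R) * (R * R)) : fbm_spec H1 b p.1.2.1 p.1.2.2 \in Lfun mu 2%:E by exact: fbm_spec_L2.
have S2' b (p : R * (R * R) * (R * R)) : fbm_spec H2 b p.2.1 p.2.2 \in Lfun mu 2%:E by exact: fbm_spec_L2.
under eq_bigr => b _.
  under eq_integral do rewrite specK_step//.
  rewrite (integral_tensor_sum h (fun p => p.1.1) (S2 b.1) (S2' b.2)).
  over.
rewrite /bools2 !big_cons big_nil adde0 -!EFinD -EFinM; congr EFin => /=.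
rewrite -!big_split/= mulr_sumr; apply: eq_big_seq => p ph.
rewrite -!big_split/= mulr_sumr; apply: eq_big_seq => q qh.
rewrite /V; case: asboolP => [okp|[]]; last exact: wf.
case: asboolP => [okq|[]]; last exact: wf.
rewrite sheet_incr_dot//.
set r1 := (X in 4 * c1 * c2 * (_ * (X * _))); set r2 := (X in 4 * c1 * c2 * (_ * (_ * X))).
have key (c A1 A2 B1 B2 : R) : A1 + A2 = 2 * c1 * r1 -> B1 + B2 = 2 * c2 * r2 ->
    c * (A1 * B1) + (c * (A1 * B2) + (c * (A2 * B1) + c * (A2 * B2))) = 4 * c1 * c2 * (c * (r1 * r2)).
  move=> E1 E2; transitivity (c * ((A1 + A2) * (B1 + B2))); first by ring.
  by rewrite E1 E2; ring.
by apply: key; [exact: dot_fbm_spec cE1 _ _ _ _|exact: dot_fbm_spec cE2 _ _ _ _].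
Qed.

(** At a fixed frequency the coefficient is an L^2 pairing with [trig_ST]; Cauchy-Schwarz
    applies. *)
Lemma specK_lim b (h : nat -> RR * RR -> R) (g : RR * RR -> R) xi :
  (forall n, h n \in Lfun mm 2%:E) -> g \in Lfun mm 2%:E ->
  nrm mm (fun z => h n z - g z) @[n --> \oo] --> 0 ->
  specK T H1 H2 b (h n) xi @[n --> \oo] --> specK T H1 H2 b g xi.
Proof.
move=> h2 g2 hg; apply: cvgM; first exact: cvg_cst.
have t2 := trig_ST_L2 T0 b xi.
pose M := nrm mm (trig_ST T b xi) + 1.
have M0 : 0 < M by rewrite ltr_wpDl ?nrm_ge0.
apply/cvg_epsP => e e0; have /cvg_epsP/(_ (e / M)) := hg.
rewrite divr_gt0// => /(_ isT)[N HN]; exists N => n /HN; rewrite subr0 ger0_norm ?nrm_ge0// => hn.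
rewrite -dotBl//; have d2 := L2B (h2 n) g2.
have cs : `|dot mm (fun z => h n z - g z) (trig_ST T b xi)| <= nrm mm (fun z => h n z - g z) * nrm mm (trig_ST T b xi).
  rewrite ler_norml cauchy_schwarz// andbT lerNl -dotNl// -(nrmN d2) cauchy_schwarz//; exact: L2N.
apply: (le_trans cs); rewrite -(divfK (lt0r_neq0 M0) e); apply: ler_pM; rewrite ?nrm_ge0//.
by rewrite /M lerDl.
Qed.

Lemma step_eval_L2 (h : step_data R) : (fun z => step_eval h z * on_ST T z) \in Lfun mm 2%:E.
Proof.
pose M : R := \sum_(p <- h) `|p.1.1|.
have ms : measurable_fun setT (step_eval h : RR * RR -> R).
  apply: measurable_sum => p; apply: measurable_funM => //; apply: measurable_bool.
  have m1 (a c : R) : measurable_fun setT (fun z : RR * RR => a < z.1 <= c).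
    have : measurable_fun setT (fun y : R => a < y <= c).
      by apply: measurable_and; [exact: measurable_fun_ltr|exact: measurable_fun_ler].
    by move=> /measurableT_comp; apply.
  have m2 (a c : R) : measurable_fun setT (fun z : RR * RR => a < z.2 <= c).
    have : measurable_fun setT (fun y : R => a < y <= c).
      by apply: measurable_and; [exact: measurable_fun_ltr|exact: measurable_fun_ler].
    by move=> /measurableT_comp; apply.
  by apply: measurable_and.
apply: (@L2_le_on_ST _ _ T0 _ M).
  by apply: measurable_funM => //; exact: measurable_on_ST.
have s0 z : 0 <= on_ST T z by rewrite mulr_ge0.
move=> z; rewrite normrM (ger0_norm (s0 z)) ler_wpM2r// /step_eval.
apply: (le_trans (ler_norm_sum _ _ _)); apply: ler_sum => p _.
by rewrite normrM normr_nat ler_piMr// lern1 leq_b1.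
Qed.

Lemma specK_on_ST b (h : RR * RR -> R) xi :
  specK T H1 H2 b (fun z => h z * on_ST T z) xi = specK T H1 H2 b h xi.
Proof.
congr (_ * _); apply: eq_Rintegral => z _; rewrite -mulrA; congr (_ * _).
rewrite /on_ST /trig_ST; case: (0 < z.1 < 1); case: (0 < z.2 < T); by rewrite ?(mulr0, mul0r, mulr1, mul1r).
Qed.

Lemma step_wiener_cat (h h' : step_data R) w : step_wiener W (h ++ h') w = step_wiener W h w + step_wiener W h' w.
Proof. by rewrite /step_wiener big_cat. Qed.

Definition step_opp (h : step_data R) : step_data R := [seq (- p.1.1, p.1.2, p.2) | p <- h].

Lemma step_wiener_sub (h h' : step_data R) w :
  step_wiener W (h ++ step_opp h') w = step_wiener W h w - step_wiener W h' w.
Proof.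
rewrite step_wiener_cat; congr (_ + _); rewrite /step_wiener /step_opp big_map/= -sumrN.
by apply: eq_bigr => p _; rewrite mulNr.
Qed.

Lemma step_eval_sub (h h' : step_data R) z : step_eval (h ++ step_opp h') z = step_eval h z - step_eval h' z.
Proof.
rewrite /step_eval big_cat; congr (_ + _); rewrite /step_opp big_map/= -sumrN.
by apply: eq_bigr => p _; rewrite mulNr.
Qed.

Lemma step_wf_sub (h h' : step_data R) : step_wf T h -> step_wf T h' -> step_wf T (h ++ step_opp h').
Proof.
move=> wf wf' p; rewrite mem_cat => /orP[/wf//|/mapP[q /wf' okq ->]]; exact: okq.
Qed.

Lemma measurable_step_wiener (h : step_data R) : step_wf T h -> measurable_fun setT (step_wiener W h).
Proof.
rewrite /step_wiener; elim: h => [_|p h IH wf].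
  by under eq_fun do rewrite big_nil; exact: measurable_cst.
under eq_fun do rewrite big_cons; apply: measurable_funD.
  apply: measurable_funM => //; exact: L2_measurable (sheet_incr_L2 (wf p (mem_head p h))).
by apply: IH => q qh; apply: wf; rewrite in_cons qh orbT.
Qed.

Lemma wiener_integral_sub g g' X X' : is_wiener_integral P W T g X -> is_wiener_integral P W T g' X' ->
  is_wiener_integral P W T (fun z => g z - g' z) (fun w => X w - X' w).
Proof.
move=> [mg mX [h [wf hg hX]]] [mg' mX' [h' [wf' hg' hX']]].
have mD : measurable (space_time T) by exact: measurableX.
split; [exact: measurable_funB|exact: measurable_funB|].
exists (fun n => h n ++ step_opp (h' n)).
have ms (k : step_data R) : measurable_fun (space_time T) (step_eval k).
  apply: measurable_funTS; apply: measurable_sum => p; apply: measurable_funM => //; apply: measurable_bool.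
  have m0 (a c : R) : measurable_fun setT (fun y : R => a < y <= c).
    by apply: measurable_and; [exact: measurable_fun_ltr|exact: measurable_fun_ler].
  by apply: measurable_and; apply: (measurableT_comp (m0 _ _)).
have eps (d' : measure_display) (A : measurableType d') (m : {measure set A -> \bar R}) (D : set A) (u v : nat -> A -> R) :
    measurable D -> (forall n, measurable_fun D (u n)) -> (forall n, measurable_fun D (v n)) ->
    (\int[m]_(z in D) (u n z ^+ 2)%:E)%E @[n --> \oo] --> 0%E ->
    (\int[m]_(z in D) (v n z ^+ 2)%:E)%E @[n --> \oo] --> 0%E ->
    (\int[m]_(z in D) ((u n z - v n z) ^+ 2)%:E)%E @[n --> \oo] --> 0%E.
  move=> mD' mu_ mv; have i0 (w : nat -> A -> R) n : (0 <= \int[m]_(z in D) (w n z ^+ 2)%:E)%E.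
    by apply: integral_ge0 => z _; rewrite lee_fin sqr_ge0.
  move=> /(cvge0_epsP (i0 u)) hu /(cvge0_epsP (i0 v)) hv.
  apply/(cvge0_epsP (i0 (fun n z => u n z - v n z))) => e e0.
  have [N1 HN1] := hu (e / 4) ltac:(by rewrite divr_gt0).
  have [N2 HN2] := hv (e / 4) ltac:(by rewrite divr_gt0).
  exists (maxn N1 N2) => n; rewrite geq_max => /andP[/HN1 h1 /HN2 h2].
  apply: (le_trans (sqrB_integral_le _ mD' (mu_ n) (mv n))).
  have -> : e = 2 * (e / 4) + 2 * (e / 4) by field.
  exact: lee_two_add.
split.
- by move=> n; exact: step_wf_sub.
- have E n : (\int[(@lebesgue_measure R \x @lebesgue_measure R)%E]_(z in space_time T)
      ((step_eval (h n ++ step_opp (h' n)) z - (g z - g' z)) ^+ 2)%:E =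
    \int[(@lebesgue_measure R \x @lebesgue_measure R)%E]_(z in space_time T)
      (((step_eval (h n) z - g z) - (step_eval (h' n) z - g' z)) ^+ 2)%:E)%E.
    by apply: eq_integral => z _; rewrite step_eval_sub; congr ((_ ^+ 2)%:E); ring.
  under eq_fun do rewrite E.
  have m1 n : measurable_fun (space_time T) (fun z => step_eval (h n) z - g z) by exact: measurable_funB.
  have m2 n : measurable_fun (space_time T) (fun z => step_eval (h' n) z - g' z) by exact: measurable_funB.
  exact: (eps _ _ (@lebesgue_measure R \x @lebesgue_measure R)%E (space_time T) _ _ mD m1 m2 hg hg').
- have E n : (\int[P]_w ((step_wiener W (h n ++ step_opp (h' n)) w - (X w - X' w)) ^+ 2)%:E =
     \int[P]_w (((step_wiener W (h n) w - X w) - (step_wiener W (h' n) w - X' w)) ^+ 2)%:E)%E.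
    by apply: eq_integral => w _; rewrite step_wiener_sub; congr ((_ ^+ 2)%:E); ring.
  under eq_fun do rewrite E.
  have m1 n : measurable_fun setT (fun w => step_wiener W (h n) w - X w).
    by apply: measurable_funB => //; exact: measurable_step_wiener.
  have m2 n : measurable_fun setT (fun w => step_wiener W (h' n) w - X' w).
    by apply: measurable_funB => //; exact: measurable_step_wiener.
  exact: (eps _ _ P setT _ _ measurableT m1 m2 hX hX').
Qed.

(** The steps h_n approach g in L^2 only, which gives pointwise convergence of their transforms. The
    step integrals are Cauchy in L^2(Omega), so by the isometry the transforms are Cauchy in the
    weighted norm, and Fatou bounds the distance from h_N to g. The constant is 2 * 2 / (4 c1 c2),
    each 2 coming from (a + b)^2 <= 2 a^2 + 2 b^2. The exceptional line z.1 = x0 is the diagonal of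
    the kernel at x = x0. *)
Lemma wiener_integral_le (g g0 : RR * RR -> R) (x0 : R) X : is_wiener_integral P W T g X ->
  measurable_fun setT g0 -> (forall z, space_time T z -> z.1 != x0 -> g z = g0 z) ->
  (\int[P]_w (X w ^+ 2)%:E <= ((c1 * c2)^-1)%:E * specQ T H1 H2 g0)%E.
Proof.
move=> [mg mX [h [wf hg hX]]] mg0 gg0.
pose gS z := g0 z * on_ST T z; pose hS n z := step_eval (h n) z * on_ST T z.
have mgS : measurable_fun setT gS by apply: measurable_funM => //; exact: measurable_on_ST.
have hS2 n : hS n \in Lfun mm 2%:E by exact: step_eval_L2.
have mhS n := L2_measurable (hS2 n).
have mST : measurable (space_time T) by exact: measurableX.
have STE z : space_time T z -> on_ST T z = 1.
  by rewrite /space_time /on_ST /=; case: z => y r /=; rewrite !in_itv/= => -[-> ->]; rewrite mulr1.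
have STE' z : ~ space_time T z -> on_ST T z = 0.
  rewrite /space_time /on_ST /=; case: z => y r /=; rewrite !in_itv/=.
  by case: (0 < y < 1); case: (0 < r < T); rewrite ?(mulr0, mul0r, mulr1) => // -[].
have ms (k : step_data R) : measurable_fun setT (step_eval k : RR * RR -> R).
  apply: measurable_sum => p; apply: measurable_funM => //; apply: measurable_bool.
  have m0 (a c : R) : measurable_fun setT (fun y : R => a < y <= c).
    by apply: measurable_and; [exact: measurable_fun_ltr|exact: measurable_fun_ler].
  by apply: measurable_and; apply: (measurableT_comp (m0 _ _)).
have DE n : (\int[(@lebesgue_measure R \x @lebesgue_measure R)%E]_(z in space_time T)
    ((step_eval (h n) z - g z) ^+ 2)%:E = \int[mm]_z ((hS n z - gS z) ^+ 2)%:E)%E.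
  rewrite sprodE integral_mkcond; apply: ge0_ae_eq_integral => //.
  - have md : measurable_fun (space_time T) (fun z : RR * RR => (step_eval (h n) z - g z) ^+ 2).
      by apply: measurable_funX; apply: measurable_funB => //; apply: measurable_funTS; exact: ms.
    have := (measurable_restrictT (fun z : RR * RR => ((step_eval (h n) z - g z) ^+ 2)%:E) mST).1.
    by apply; exact/measurable_EFinP.
  - by apply/measurable_EFinP; apply: measurable_funX; exact: measurable_funB.
  - by move=> z _; rewrite patchE; case: ifP => // _; rewrite lee_fin sqr_ge0.
  - by move=> z _; rewrite lee_fin sqr_ge0.
  - exists ([set x0] `*` setT); split.
    + by apply: measurableX.
    + transitivity (@lebesgue_measure R [set x0] * @lebesgue_measure R setT)%E.
        exact: product_measure1E.
      by rewrite lebesgue_measure_set1 mul0e.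
    + move=> z /= /not_implyP[_ nz]; split => //; apply: contrapT => zx; apply: nz.
      rewrite patchE /hS /gS -mulrBl; case: ifPn; rewrite ?inE ?notin_setE => zST.
        by rewrite STE// mulr1 gg0//; apply/eqP.
      by rewrite STE'// mulr0 expr0n.
have i0 n : (0 <= \int[mm]_z ((hS n z - gS z) ^+ 2)%:E)%E.
  by apply: integral_ge0 => z _; rewrite lee_fin sqr_ge0.
have hg' : forall e : R, 0 < e -> exists N, forall n, (N <= n)%N -> (\int[mm]_z ((hS n z - gS z) ^+ 2)%:E <= e%:E)%E.
  by apply/(cvge0_epsP i0); under eq_fun do rewrite -DE.
have gS2 : gS \in Lfun mm 2%:E.
  have [N HN] := hg' 1 ltr01.
  have d2 : (fun z => hS N z - gS z) \in Lfun mm 2%:E.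
    apply: L2_of_sqr; first exact: measurable_funB.
    by apply: le_lt_trans (HN N (leqnn N)) _; rewrite ltry.
  rewrite (_ : gS = fun z => hS N z - (hS N z - gS z)); first exact: L2B.
  by apply/funext => z; rewrite subKr.
have nhg : nrm mm (fun z => hS n z - gS z) @[n --> \oo] --> 0.
  apply/cvg_epsP => e e0; have [N HN] := hg' (e ^+ 2) (exprn_gt0 2 e0).
  exists N => n /HN hn; rewrite subr0 ger0_norm ?nrm_ge0//.
  by apply/nrm_le_sqr => //; [exact: L2B|exact: ltW].
pose sq (f : Omega -> R) : \bar R := (\int[P]_w (f w ^+ 2)%:E)%E.
have sq0 f : (0 <= sq f)%E by apply: integral_ge0 => w _; rewrite lee_fin sqr_ge0.
have mh n := measurable_step_wiener (wf n).
have hX' (e : R) : 0 < e -> exists N, forall n, (N <= n)%N -> (sq (fun w => (step_wiener W (h n) w - X w)%R) <= e%:E)%E.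
  by move: e; apply/(cvge0_epsP (fun n => sq0 (fun w => step_wiener W (h n) w - X w))).
have sqC n m : sq (fun w => (step_wiener W (h n) w - step_wiener W (h m) w)%R) = sq (step_wiener W (h n ++ step_opp (h m))).
  by apply: eq_integral => w _; rewrite step_wiener_sub.
have sq2 (a b c : Omega -> R) : measurable_fun setT a -> measurable_fun setT b ->
    (forall w, c w = a w + b w) -> (sq c <= 2%:E * sq a + 2%:E * sq b)%E.
  move=> ma mb cab; rewrite /sq; under eq_integral do rewrite cab.
  exact: sqrD_integral_le.
have sqN (a b : Omega -> R) : sq (fun w => (a w - b w)%R) = sq (fun w => (b w - a w)%R).
  by apply: eq_integral => w _; rewrite -sqrrN opprB.
pose kap := 4 * c1 * c2; have kap0 : 0 < kap by rewrite !mulr_gt0.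
suff H (e : R) : 0 < e -> (sq X <= e%:E + ((c1 * c2)^-1)%:E * specQ T H1 H2 g0)%E.
  by apply/lee_addgt0Pr => e e0; rewrite addeC; exact: H.
(* The errors collected below add up to 66 [e1], which is less than e. *)
move=> e0; pose e1 := e / 2 / 100; have e10 : 0 < e1 by rewrite !divr_gt0.
have [N1 HN1] := hX' e1 e10.
have Kle b : (\int[mm]_xi (specK T H1 H2 b (hS N1) xi ^+ 2)%:E <=
    2%:E * \int[mm]_xi (specK T H1 H2 b g0 xi ^+ 2)%:E + (8 * kap * e1)%:E)%E.
  have mK (f : RR * RR -> R) : measurable_fun setT f -> measurable_fun setT (specK T H1 H2 b f) by exact: measurable_specK.
  have KB (u v : RR * RR -> R) xi : u \in Lfun mm 2%:E -> v \in Lfun mm 2%:E ->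
      specK T H1 H2 b (fun z => u z - v z) xi = specK T H1 H2 b u xi - specK T H1 H2 b v xi.
    by move=> u2 v2; rewrite /specK dotBl// ?mulrBr//; exact: trig_ST_L2.
  have KgE xi : specK T H1 H2 b g0 xi = specK T H1 H2 b gS xi by rewrite /gS specK_on_ST.
  have hSE n k xi : specK T H1 H2 b (hS n) xi - specK T H1 H2 b (hS k) xi =
      specK T H1 H2 b (step_eval (h n ++ step_opp (h k))) xi.
    rewrite -KB// -[RHS]specK_on_ST; congr specK; apply/funext => z.
    by rewrite step_eval_sub mulrBl.
  (* Fatou in j, applied to the transforms of h_N1 - h_(j + N1); the isometry turns their norms into
     distances of step integrals. *)
  have Kd : (\int[mm]_xi ((specK T H1 H2 b (hS N1) xi - specK T H1 H2 b gS xi) ^+ 2)%:E <= (4 * kap * e1)%:E)%E.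
    apply: (@fatou_sqr _ _ _ mm (fun j xi => specK T H1 H2 b (hS N1) xi - specK T H1 H2 b (hS (j + N1)%N) xi)).
    - by move=> j; apply: measurable_funB; exact: mK.
    - by apply: measurable_funB; exact: mK.
    - apply: aeW => xi; apply: cvgB; first exact: cvg_cst.
      rewrite (cvg_shiftn N1 (fun j => specK T H1 H2 b (hS j) xi)).
      exact: specK_lim.
    - move=> j.
      have wfj := step_wf_sub (wf N1) (wf (j + N1)%N).
      have Qj := specQ_step wfj; rewrite -/(sq _) -sqC in Qj.
      apply: (@le_trans _ _ (specQ T H1 H2 (step_eval (h N1 ++ step_opp (h (j + N1)%N))))).
        under eq_integral do rewrite hSE.
        exact: specK_le_specQ.
      rewrite Qj -/kap.
      have : (sq (fun w => (step_wiener W (h N1) w - step_wiener W (h (j + N1)%N) w)%R) <= (4 * e1)%:E)%E.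
        apply: (le_trans (sq2 _ _ _ (measurable_funB (mh N1) mX) (measurable_funB mX (mh (j + N1)%N)) _)).
          by move=> w; rewrite /=; ring.
        rewrite (sqN X) (_ : 4 * e1 = 2 * e1 + 2 * e1); last by ring.
        apply: lee_two_add; apply: HN1 => //; exact: leq_addl.
      move=> sqe; have -> : 4 * kap * e1 = kap * (4 * e1) by ring.
      by apply: lee_mulEFin => //; exact: ltW.
  apply: (le_trans (y := (2%:E * \int[mm]_xi (specK T H1 H2 b gS xi ^+ 2)%:E +
     2%:E * \int[mm]_xi ((specK T H1 H2 b (hS N1) xi - specK T H1 H2 b gS xi) ^+ 2)%:E)%E)).
    have := sqrD_integral_le mm measurableT (mK _ mgS) (measurable_funB (mK _ (mhS N1)) (mK _ mgS)).
    by under eq_integral do rewrite addrC subrK.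
  apply: leeD; first by under [X in (_ <= _ * X)%E]eq_integral do rewrite KgE.
  rewrite (_ : 8 * kap * e1 = 2 * (4 * kap * e1)); last by ring.
  exact: lee_mulEFin.
have QN : (kap%:E * sq (step_wiener W (h N1)) <= 2%:E * specQ T H1 H2 g0 + (32 * kap * e1)%:E)%E.
  rewrite /sq -(specQ_step (wf N1)) /specQ.
  under eq_bigr do under eq_integral do rewrite -specK_on_ST.
  apply: (le_trans (lee_sum _ (fun b _ => Kle b))).
  rewrite big_split/= -ge0_sume_distrr; last by move=> b _; apply: integral_ge0 => xi _; rewrite lee_fin sqr_ge0.
  apply: leeD => //; rewrite /bools2 !big_cons big_nil adde0 -!EFinD lee_fin.
  by rewrite (_ : 8 * kap * e1 + _ = 32 * kap * e1) ?lexx//; ring.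
apply: (le_trans (sq2 _ _ _ (mh N1) (measurable_funB mX (mh N1)) _)); first by move=> w; rewrite /=; ring.
have W1 : (sq (step_wiener W (h N1)) <= (2 / kap)%:E * specQ T H1 H2 g0 + (32 * e1)%:E)%E.
  have k0 : (0 <= (kap^-1)%:E)%E by rewrite lee_fin invr_ge0 ltW.
  have := lee_wpmul2l k0 QN.
  rewrite muleA -EFinM mulVf ?gt_eqF// mul1e ge0_muleDr ?muleA -?EFinM.
  - by rewrite (mulrC _ 2) (_ : kap^-1 * (32 * kap * e1) = 32 * e1)//; field; rewrite gt_eqF.
  - rewrite mule_ge0//; apply: sume_ge0 => b _; apply: integral_ge0 => xi _; rewrite lee_fin sqr_ge0//.
  - by rewrite lee_fin !mulr_ge0// ltW.
have W2 : (2%:E * sq (fun w => (X w - step_wiener W (h N1) w)%R) <= (2 * e1)%:E)%E.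
  by rewrite sqN; apply: lee_mulEFin => //; exact: HN1.
have Q0 : (0 <= specQ T H1 H2 g0)%E.
  by apply: sume_ge0 => b _; apply: integral_ge0 => xi _; rewrite lee_fin sqr_ge0.
apply: (le_trans (leeD (lee_wpmul2l _ W1) W2)) => //.
rewrite ge0_muleDr ?muleA -?EFinM; last 2 first.
- by rewrite mule_ge0// lee_fin divr_ge0// ltW.
- by rewrite lee_fin mulr_ge0// ltW.
rewrite (_ : 2 * (2 / kap) = (c1 * c2)^-1); last by rewrite /kap; field; rewrite !gt_eqF.
rewrite -addeA addeC; apply: leeD => //; rewrite -EFinD lee_fin /e1; lra.
Qed.

End sheet.

(** * Dirichlet test and Fourier energy estimates *)

Lemma telescope_rev (R : realType) (f : nat -> R) (m n : nat) : (m <= n)%N ->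
  \sum_(m <= k < n) (f k - f k.+1) = f m - f n.
Proof.
move=> mn; rewrite -[RHS]opprB -telescope_sumr// -sumrN.
by apply: eq_bigr => k _; rewrite opprB.
Qed.

Lemma abel_sum (R : realType) (a b : nat -> R) (n : nat) :
  \sum_(k < n) a k * b k = (\sum_(k < n) a k) * b n + \sum_(k < n) (\sum_(j < k.+1) a j) * (b k - b k.+1).
Proof.
elim: n => [|n IH]; first by rewrite !big_ord0 mul0r addr0.
rewrite big_ord_recr /= IH [X in _ = _ + X]big_ord_recr/= [X in _ = X * _ + _]big_ord_recr/=.
by rewrite [X in _ = _ + (_ + X * _)]big_ord_recr/=; ring.
Qed.

Lemma dirichlet_test (R : realType) (a b : nat -> R) (B : R) :
  (forall n, `|\sum_(k < n) a k| <= B) -> (forall k, b k.+1 <= b k) ->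
  b n @[n --> \oo] --> 0 -> cvgn (series (fun k => a k * b k)).
Proof.
move=> aB bD b0; have B0 : 0 <= B by apply: le_trans (aB 0%N).
have bge0 k : 0 <= b k.
  have H j : b (k + j)%N <= b k.
    by elim: j => [|j IH]; rewrite ?addn0// addnS (le_trans (bD _)).
  rewrite leNgt; apply/negP => bk.
  have /cvg_epsP/(_ (- b k / 2)) := b0; rewrite divr_gt0 ?oppr_gt0// => /(_ isT)[N HN].
  have := HN (k + N)%N (leq_addl _ _); rewrite subr0 ler0_norm; last by apply: le_trans (H N) (ltW bk).
  by have := H N; lra.
pose c k := (\sum_(j < k.+1) a j) * (b k - b k.+1).
have cc : cvgn (series c).
  apply: normed_cvg; apply: (@series_le_cvg _ _ (fun k => B * (b k - b k.+1))) => [k|k|k|].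
  - exact: normr_ge0.
  - by rewrite mulr_ge0// subr_ge0.
  - by rewrite /= /c normrM ler_pM// ger0_norm// subr_ge0.
  - apply: nondecreasing_is_cvgn.
      apply/nondecreasing_seqP => n; rewrite /series/= big_nat_recr//= lerDl mulr_ge0// subr_ge0//.
    exists (B * b 0%N) => _ [n _ <-]; rewrite /series/= -mulr_sumr ler_wpM2l//.
    rewrite telescope_rev // gerBl//.
have sE : series (fun k => a k * b k) = (fun n => (\sum_(k < n) a k) * b n + series c n).
  by apply/funext => n; rewrite /series/= !big_mkord abel_sum.
rewrite sE; apply: is_cvgD => //; apply/cvg_ex; exists 0; apply/cvg_epsP => e e0.
have B1 : 0 < B + 1 by rewrite ltr_wpDl.
have /cvg_epsP/(_ (e / (B + 1))) := b0; rewrite divr_gt0// => /(_ isT)[N HN].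
exists N => n /HN; rewrite !subr0 normrM => bn.
rewrite -(divfK (lt0r_neq0 B1) e) mulrC ler_pM//.
by apply: le_trans (aB n) _; rewrite lerDl.
Qed.

Lemma sum_cos_le (R : realType) (th : R) (n : nat) : sin (th / 2) != 0 ->
  `|\sum_(k < n) cos (k.+1%:R * th)| <= `|sin (th / 2)|^-1.
Proof.
move=> s0.
have E : 2 * sin (th / 2) * \sum_(k < n) cos (k.+1%:R * th) = sin (n%:R * th + th / 2) - sin (th / 2).
  elim: n => [|n IH]; first by rewrite big_ord0 mulr0 mul0r add0r subrr.
  rewrite big_ord_recr/= mulrDr IH.
  have -> : n%:R * th + th / 2 = n.+1%:R * th - th / 2 by rewrite -natr1; field.
  by rewrite sinB sinD; ring.
have s1 (x : R) : `|sin x| <= 1 by rewrite ler_norml sin_geN1 sin_le1.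
have s0' : 0 < `|sin (th / 2)| by rewrite normr_gt0.
have := congr1 Num.norm E; rewrite !normrM normr_nat => E'.
have : 2 * `|sin (th / 2)| * `|\sum_(k < n) cos (k.+1%:R * th)| <= 2.
  by rewrite E' (le_trans (ler_normB _ _))// -[2]/(1 + 1) lerD.
rewrite -mulrA -[leRHS]mulr1 ler_pM2l// => h.
by rewrite -[leRHS]mul1r ler_pdivlMr// mulrC.
Qed.

(** The product formula leaves two Dirichlet kernels, at angles pi (x - y) and pi (x + y); the sines
    of their half-angles do not vanish for distinct x and y in (0, 1). The bound depends on x and y,
    which is enough for pointwise convergence. *)
Lemma sum_sin_sin_le (R : realType) (x y : R) : 0 < x < 1 -> 0 < y < 1 -> x != y ->
  exists B : R, forall n, `|\sum_(k < n) sin (k.+1%:R * pi * x) * sin (k.+1%:R * pi * y)| <= B.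
Proof.
move=> /andP[x0 x1] /andP[y0 y1] xy; have pi0 := pi_gt0 R.
have s1 : sin (pi * (x - y) / 2) != 0.
  have H (z : R) : 0 < z -> z < 1 -> 0 < sin (pi * z / 2).
    move=> z0 z1; apply: sin_gt0_pi; rewrite (divr_gt0 (mulr_gt0 pi0 z0) (ltr0Sn R 1))/=.
    by rewrite ltr_pdivrMr// ltr_pM2l//; lra.
  have [xy'|yx|/eqP] := ltgtP x y; last by rewrite (negbTE xy).
    rewrite -opprB mulrN mulNr sinN oppr_eq0 gt_eqF// H ?subr_gt0//; lra.
  by rewrite gt_eqF// H ?subr_gt0//; lra.
have s2 : sin (pi * (x + y) / 2) != 0.
  rewrite gt_eqF//; apply: sin_gt0_pi; rewrite (divr_gt0 (mulr_gt0 pi0 (addr_gt0 x0 y0)) (ltr0Sn R 1))/=.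
  by rewrite ltr_pdivrMr// ltr_pM2l//; lra.
exists (`|sin (pi * (x - y) / 2)|^-1 + `|sin (pi * (x + y) / 2)|^-1) => n.
have E : \sum_(k < n) sin (k.+1%:R * pi * x) * sin (k.+1%:R * pi * y) =
    (\sum_(k < n) cos (k.+1%:R * (pi * (x - y))) - \sum_(k < n) cos (k.+1%:R * (pi * (x + y)))) / 2.
  rewrite -sumrB mulr_suml; apply: eq_bigr => k _.
  rewrite (_ : k.+1%:R * (pi * (x - y)) = k.+1%:R * pi * x - k.+1%:R * pi * y); last by ring.
  rewrite (_ : k.+1%:R * (pi * (x + y)) = k.+1%:R * pi * x + k.+1%:R * pi * y); last by ring.
  by rewrite cosB cosD; field.
rewrite E normrM (ger0_norm (x := 2^-1)) ?invr_ge0//.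
have h1 := sum_cos_le n s1; have h2 := sum_cos_le n s2.
have := ler_normB (\sum_(k < n) cos (k.+1%:R * (pi * (x - y)))) (\sum_(k < n) cos (k.+1%:R * (pi * (x + y)))).
set u := `|_ - _|; have : 0 <= u by exact: normr_ge0.
by move: h1 h2; lra.
Qed.

Lemma powRN_diff_ge (R : realType) (p : R) (n : nat) : 0 < p ->
  p * n.+2%:R `^ (- p - 1) <= n.+1%:R `^ (- p) - n.+2%:R `^ (- p) :> R.
Proof.
move=> p0; have n12 : n.+1%:R < n.+2%:R :> R by rewrite ltr_nat.
have n0 : 0 < n.+1%:R :> R by rewrite ltr0n.
have d (x : R) : x \in `]n.+1%:R, n.+2%:R[ -> is_derive x 1 (fun x : R => x `^ (- p)) (- p * x `^ (- p - 1)).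
  by rewrite in_itv/= => /andP[nx _]; apply: is_derive1_powR; exact: lt_trans nx.
have c : {within `[n.+1%:R, n.+2%:R], continuous (fun x : R => x `^ (- p))}.
  apply: continuous_in_subspaceT => x; rewrite inE/= in_itv/= => /andP[nx _].
  by apply: pair_continuous; apply: ex_derive; apply: is_derive1_powR; exact: lt_le_trans nx.
have [x] := MVT n12 d c; rewrite in_itv/= => /andP[nx xn] E.
have e1 : n.+2%:R - n.+1%:R = 1 :> R by rewrite -[n.+2%:R]natr1; ring.
rewrite -[leRHS]opprB E e1 mulr1 mulNr opprK ler_pM2l//.
have x0 : 0 < x by exact: lt_trans nx.
have -> : - p - 1 = - (p + 1) by ring.
rewrite !powRN lef_pV2 ?posrE ?powR_gt0//; apply: ge0_ler_powR; rewrite ?nnegrE ?(ltW x0)//; last exact: ltW.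
by rewrite addr_ge0// ltW.
Qed.

(** Comparison with the telescoping sum of (k + 1)^(- p) - (k + 2)^(- p). The factor 2^(p + 1) pays
    for replacing k + 2 by k + 1. *)
Lemma sum_powRN_le (R : realType) (p : R) (N n : nat) : 0 < p ->
  \sum_(N <= k < n) k.+1%:R `^ (- p - 1) <= 2 `^ (p + 1) / p * N.+1%:R `^ (- p) :> R.
Proof.
move=> p0.
have H (k : nat) : k.+1%:R `^ (- p - 1) <= 2 `^ (p + 1) / p * (k.+1%:R `^ (- p) - k.+2%:R `^ (- p)) :> R.
  have h := powRN_diff_ge k p0.
  have e : k.+1%:R `^ (- p - 1) <= 2 `^ (p + 1) * k.+2%:R `^ (- p - 1) :> R.
    have -> : - p - 1 = - (p + 1) by ring.
    rewrite !powRN ler_pdivlMr ?powR_gt0// mulrC ler_pdivrMr ?powR_gt0// -powRM//.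
    by apply: ge0_ler_powR; [lra|by rewrite nnegrE ler0n|by rewrite nnegrE mulr_ge0// ler0n|rewrite -natrM ler_nat; lia].
  apply: (le_trans e); rewrite -mulrA ler_wpM2l ?powR_ge0// ler_pdivlMl//.
have [nN|Nn] := leqP n N.
  by rewrite big_geq// !mulr_ge0 ?powR_ge0// invr_ge0 ltW.
apply: (le_trans (ler_sum _ (fun k _ => H k))); rewrite -mulr_sumr.
rewrite ler_wpM2l ?divr_ge0 ?powR_ge0 ?(ltW p0)//.
rewrite telescope_rev ?(ltnW Nn)// gerBl powR_ge0//.
Qed.

Lemma Rintegral_shift (R : realType) (a : R) (f : R -> R) : measurable_fun [set: R] f ->
  \int[@lebesgue_measure R]_x f (x + a) = \int[@lebesgue_measure R]_x f x.
Proof.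
move=> mf; have mfE : measurable_fun [set: R] (EFin \o f) by apply/measurable_EFinP.
rewrite /Rintegral; congr fine; rewrite integralE [RHS]integralE; congr (_ - _)%E.
  rewrite -[RHS](ge0_integral_shift a (measurable_funepos mfE) (fun x => funepos_ge0 _ x)).
  by apply: eq_integral => x _; rewrite !funeposE.
rewrite -[RHS](ge0_integral_shift a (measurable_funeneg mfE) (fun x => funeneg_ge0 _ x)).
by apply: eq_integral => x _; rewrite !funenegE.
Qed.

Lemma Rintegral_reflect (R : realType) (a : R) (f : R -> R) : measurable_fun [set: R] f ->
  \int[@lebesgue_measure R]_x f (a - x) = \int[@lebesgue_measure R]_x f x.
Proof.
move=> mf; have mfE : measurable_fun [set: R] (EFin \o f) by apply/measurable_EFinP.
rewrite /Rintegral; congr fine; rewrite integralE [RHS]integralE; congr (_ - _)%E.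
  rewrite -[RHS](ge0_integral_reflect a (measurable_funepos mfE) (fun x => funepos_ge0 _ x)).
  by apply: eq_integral => x _; rewrite !funeposE.
rewrite -[RHS](ge0_integral_reflect a (measurable_funeneg mfE) (fun x => funeneg_ge0 _ x)).
by apply: eq_integral => x _; rewrite !funenegE.
Qed.

(** * Fourier transforms of decreasing functions of time *)

Section half_period.
Variables (R : realType) (ep psi : R -> R) (h : R).
Hypothesis h0 : 0 < h.
Hypothesis mep : measurable_fun [set: R] ep.
Hypothesis mpsi : measurable_fun [set: R] psi.
Hypothesis ep_ge0 : forall x, 0 <= ep x.
Hypothesis ep_neg : forall x, x <= 0 -> ep x = 0.
Hypothesis ep_noninc : forall x y, 0 < x -> x <= y -> ep y <= ep x.
Hypothesis iep : (@lebesgue_measure R).-integrable setT (EFin \o ep).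
Hypothesis psi_le1 : forall x, `|psi x| <= 1.
Hypothesis psi_anti : forall x, psi (x + h) = - psi x.
Local Notation mu := (@lebesgue_measure R).

(* Shifting by half a period changes the sign of [psi], so twice the integral is
   the integral of [(ep x - ep (x + h)) * psi x]. *)
Lemma half_period_le :
  `|\int[mu]_x (ep x * psi x)| <= \int[mu]_x (ep x * (x <= h)%R%:R).
Proof.
have mps : measurable_fun [set: R] (fun x => ep x * psi x) by exact: measurable_funM.
have msh : measurable_fun [set: R] (fun x : R => x + h) by exact: measurable_funD.
have meh : measurable_fun [set: R] (fun x : R => ep (x + h)) by exact: measurableT_comp.
have le_int (g : R -> R) : measurable_fun [set: R] g -> (forall x, `|g x| <= ep x) -> mu.-integrable setT (EFin \o g).
  move=> mg gep; apply: (le_integrable _ _ _ iep) => //; first exact/measurable_EFinP.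
  by move=> x _; rewrite /= lee_fin (ger0_norm (ep_ge0 x)).
have ieh : mu.-integrable setT (EFin \o (fun x => ep (x + h))).
  apply/integrableP; split; first exact/measurable_EFinP.
  have /integrableP[_] := iep; under eq_integral do rewrite /= ger0_norm//.
  move=> ifin; under eq_integral do rewrite /= ger0_norm//.
  rewrite (@ge0_integral_shift R h (EFin \o ep)) //; first exact/measurable_EFinP.
have le_inth (g : R -> R) : measurable_fun [set: R] g -> (forall x, `|g x| <= ep (x + h)) -> mu.-integrable setT (EFin \o g).
  move=> mg gep; apply: (le_integrable _ _ _ ieh) => //; first exact/measurable_EFinP.
  by move=> x _; rewrite /= lee_fin (ger0_norm (ep_ge0 _)).
have ips : mu.-integrable setT (EFin \o (fun x => ep x * psi x)).
  by apply: le_int => // x; rewrite normrM (ger0_norm (ep_ge0 x)) ler_piMr.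
have mph : measurable_fun [set: R] (fun x => ep (x + h) * psi x) by exact: measurable_funM.
have iph : mu.-integrable setT (EFin \o (fun x => ep (x + h) * psi x)).
  by apply: le_inth => // x; rewrite normrM (ger0_norm (ep_ge0 _)) ler_piMr.
have E : 2 * \int[mu]_x (ep x * psi x) = \int[mu]_x (ep x * psi x - ep (x + h) * psi x).
  rewrite RintegralB// mulrDl mul1r; congr (_ + _).
  rewrite -[LHS](Rintegral_shift h mps) -mulN1r -RintegralZl//.
  by apply: eq_Rintegral => x _; rewrite psi_anti; ring.
have mind : measurable_fun [set: R] (fun x : R => (x <= h)%R%:R : R).
  by apply: measurable_bool; exact: measurable_fun_ler.
have mi : measurable_fun [set: R] (fun x => ep x * (x <= h)%R%:R) by exact: measurable_funM.
have ii : mu.-integrable setT (EFin \o (fun x => ep x * (x <= h)%R%:R)).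
  by apply: le_int => // x; rewrite normrM (ger0_norm (ep_ge0 x)) normr_nat ler_piMr// lern1 leq_b1.
have mih : measurable_fun [set: R] (fun x => ep (x + h) * (x + h <= h)%R%:R).
  exact: (measurableT_comp mi msh).
have iih : mu.-integrable setT (EFin \o (fun x => ep (x + h) * (x + h <= h)%R%:R)).
  by apply: le_inth => // x; rewrite normrM (ger0_norm (ep_ge0 _)) normr_nat ler_piMr// lern1 leq_b1.
have iB := integrableB measurableT iep ieh.
have i2 := integrableZl measurableT 2 iih.
have iS := integrableD measurableT iB i2.
(* This integrand dominates |(ep x - ep (x + h)) psi x|: for x <= 0, where ep x = 0, the third term
   changes - ep (x + h) into + ep (x + h). In the integral the first two terms cancel. *)
have F : \int[mu]_x (ep x - ep (x + h) + 2 * (ep (x + h) * (x + h <= h)%R%:R)) = 2 * \int[mu]_x (ep x * (x <= h)%R%:R).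
  rewrite (RintegralD measurableT iB i2) (RintegralB measurableT iep ieh) (RintegralZl 2 measurableT iih).
  by rewrite (Rintegral_shift h mep) subrr add0r (Rintegral_shift h mi).
suff : 2 * `|\int[mu]_x (ep x * psi x)| <= 2 * \int[mu]_x (ep x * (x <= h)%R%:R) by rewrite ler_pM2l.
rewrite -[X in X * `|_|](@ger0_norm R 2)// -normrM E -F.
have iD := integrableB measurableT ips iph.
apply: (le_trans (le_normr_Rintegral measurableT iD)).
apply: le_Rintegral => //; first exact: integrable_norm iD.
move=> x _; rewrite -mulrBl normrM (le_trans (ler_piMr _ (psi_le1 x)))//.
have [x0|x0] := leP x 0.
  rewrite ep_neg// sub0r normrN (ger0_norm (ep_ge0 _)).
  by rewrite -lerBrDr subrr x0 mulr1; have := ep_ge0 (x + h); lra.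
have -> : (x + h <= h) = false by rewrite -lerBrDr subrr leNgt x0.
rewrite !mulr0 addr0 ger0_norm// subr_ge0 ep_noninc// lerDl ltW//.
Qed.

End half_period.

Lemma measurable_indM (R : realType) (f : R -> R) (p : R -> bool) : measurable_fun [set: R] f ->
  measurable_fun [set: R] p -> measurable_fun [set: R] (fun x => f x * (p x)%:R).
Proof. by move=> mf mp; apply: measurable_funM => //; exact: measurable_bool. Qed.

Lemma integral_powk_lt (R : realType) (g c : R) : 0 < g -> 0 <= c ->
  (\int[mu]_x (powk g x * (x < c)%R%:R)%:E = (c `^ g / g)%:E)%E.
Proof.
move=> g0 c0; rewrite -(integral_powk_itv g0 c0) [RHS]integral_mkcond; apply: eq_integral => x _.
by rewrite patchE mem_setE in_itv/=; case: (x < c); rewrite ?mulr1 ?mulr0.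
Qed.

Lemma integral_powk_split (R : realType) (g p A B : R) : 0 < g -> 0 < p -> 0 <= A -> 0 <= B ->
  (\int[mu]_x (A * (powk g x * (x < 1)%R%:R) + B * (x `^ (- p - 1) * (1 <= x)%R%:R))%:E = (A / g + B / p)%:E)%E.
Proof.
move=> g0 p0 A0 B0.
have m1 : measurable_fun [set: R] (fun x : R => powk g x * (x < 1)%R%:R).
  by apply: measurable_indM; [exact: measurable_powk|exact: measurable_fun_ltr].
have m2 : measurable_fun [set: R] (fun x : R => x `^ (- p - 1) * (1 <= x)%R%:R).
  by apply: measurable_indM; [exact: measurable_powR|exact: measurable_fun_ler].
under eq_integral do rewrite EFinD.
rewrite ge0_integralD//; last 4 first.
- by move=> x _; rewrite lee_fin !mulr_ge0// powk_ge0.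
- by apply/measurable_EFinP; exact: measurable_funM.
- by move=> x _; rewrite lee_fin !mulr_ge0// powR_ge0.
- by apply/measurable_EFinP; exact: measurable_funM.
under eq_integral do rewrite EFinM; under [X in (_ + X)%E]eq_integral do rewrite EFinM.
rewrite !ge0_integralZl//; last 4 first.
- exact/measurable_EFinP.
- by move=> x _; rewrite lee_fin mulr_ge0// powR_ge0.
- exact/measurable_EFinP.
- by move=> x _; rewrite lee_fin mulr_ge0// powk_ge0.
rewrite integral_powk_lt// powR1 div1r EFinD !EFinM; congr (_ + _ * _)%E.
have -> : p^-1 = 1 `^ (- p) / p by rewrite powR1 div1r.
rewrite -(ge0_integral_powRN p0 ltr01) [RHS]integral_mkcond; apply: eq_integral => x _.
by rewrite patchE mem_setE in_itv/= andbT; case: (1 <= x); rewrite ?mulr1 ?mulr0.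
Qed.

Lemma trigBpi (R : realType) b (x : R) : trig b (x - pi) = - trig b x.
Proof.
case: b => /=; rewrite /trig.
  by rewrite -[in RHS](subrK pi x) cosDpi opprK.
by rewrite -[in RHS](subrK pi x) sinDpi opprK.
Qed.

Section time_bound.
Variables (R : realType) (H be T : R).
Hypothesis H12 : 0 < H <= 2^-1.
Hypothesis be0 : 0 <= be.
Hypothesis beH : be < H.
Hypothesis T0 : 0 < T.
Local Notation mu := (@lebesgue_measure R).

(** The transform is at most the mass of [ep] on (0, min(pi / xi, T)). Against the weight xi^(1 - 2
    H), the bound by T is used for xi < 1 and gives the first summand of the constant; for xi >= 1
    the half period gives a multiple of xi^(- 2 (H - be) - 1), which is integrable since be < H. *)
Lemma time_fourier_le (M t : R) (ep : R -> R) (b : bool) : 0 <= M -> 0 <= t <= T ->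
  measurable_fun [set: R] ep -> (forall x, 0 <= ep x) -> (forall x, x <= 0 -> ep x = 0) ->
  (forall x, t <= x -> ep x = 0) -> (forall x y, 0 < x -> x <= y -> ep y <= ep x) ->
  (forall x, 0 < x -> ep x <= M * x `^ (- be)) ->
  (\int[mu]_xi ((powk (3 / 2 - H) xi * \int[mu]_r (ep (t - r) * trig b (xi * r))) ^+ 2)%:E <=
   ((T `^ (2 - 2 * be) / (2 - 2 * H) + pi `^ (2 - 2 * be) / (2 * (H - be))) / (1 - be) ^+ 2 * M ^+ 2)%:E)%E.
Proof.
move=> M0 /andP[t0 tT] mep ep0 epneg ept epn epM.
have /andP[H0 H2] := H12.
have H2' : 2 * H <= 1 by rewrite -ler_pdivlMl// mulr1.
have b1 : 0 < 1 - be by move: beH be0; lra.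
have epk x : ep x <= M * (powk (1 - be) x * (x < T)%R%:R).
  rewrite /powk; have [x0|x0] := ltP 0 x; last by rewrite epneg// mul0r mulr0.
  have [xT|Tx] := ltP x T; last by rewrite ept ?mulr0// (le_trans tT).
  by rewrite mulr1 (_ : 1 - be - 1 = - be) ?epM//; ring.
have mk : measurable_fun [set: R] (fun x : R => powk (1 - be) x * (x < T)%R%:R).
  by apply: measurable_indM; [exact: measurable_powk|exact: measurable_fun_ltr].
have k0 x : 0 <= powk (1 - be) x * (x < T)%R%:R by rewrite mulr_ge0// powk_ge0.
have iep : mu.-integrable setT (EFin \o ep).
  apply/integrableP; split; first exact/measurable_EFinP.
  apply: (@le_lt_trans _ _ (\int[mu]_x (M%:E * (powk (1 - be) x * (x < T)%R%:R)%:E))%E).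
    apply: ge0_le_integral => //.
    - by apply: measurableT_comp => //; exact/measurable_EFinP.
    - by apply: measurable_funeM; exact/measurable_EFinP.
    - by move=> x _; rewrite /= ger0_norm// -EFinM lee_fin.
  rewrite ge0_integralZl//; last 2 first.
  - exact/measurable_EFinP.
  - by move=> x _; rewrite lee_fin.
  by rewrite integral_powk_lt ?ltW// -EFinM ltry.
have bnd (c : R) : 0 < c -> \int[mu]_x (ep x * (x <= c)%R%:R) <= M * (c `^ (1 - be) / (1 - be)).
  move=> c0.
  have mi : measurable_fun [set: R] (fun x => ep x * (x <= c)%R%:R).
    by apply: measurable_indM => //; exact: measurable_fun_ler.
  have H1 : (\int[mu]_x (ep x * (x <= c)%R%:R)%:E <= (M * (c `^ (1 - be) / (1 - be)))%:E)%E.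
    rewrite EFinM -(integral_powk_lt b1 (ltW c0)) -ge0_integralZl//; last 2 first.
    - apply/measurable_EFinP; apply: measurable_indM; [exact: measurable_powk|exact: measurable_fun_ltr].
    - by move=> x _; rewrite lee_fin mulr_ge0// powk_ge0.
    (* The point c is removed because the mass is taken over x <= c while the power is integrated
       over x < c. *)
    rewrite (@ge0_negligible_integral _ _ _ mu setT [set c])//; last 3 first.
    - exact/measurable_EFinP.
    - by move=> x _; rewrite lee_fin mulr_ge0.
    - exact: lebesgue_measure_set1.
    rewrite [leRHS](@ge0_negligible_integral _ _ _ mu setT [set c])//; last 3 first.
    - apply: measurable_funeM; apply/measurable_EFinP; apply: measurable_indM; [exact: measurable_powk|exact: measurable_fun_ltr].
    - by move=> x _; rewrite -EFinM lee_fin mulr_ge0// mulr_ge0// powk_ge0.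
    - exact: lebesgue_measure_set1.
    apply: ge0_le_integral => //.
    - by apply: measurableD.
    - by move=> x _; rewrite lee_fin mulr_ge0.
    - by apply: measurable_funTS; exact/measurable_EFinP.
    - apply: measurable_funTS; apply: measurable_funeM; apply/measurable_EFinP; apply: measurable_indM; [exact: measurable_powk|exact: measurable_fun_ltr].
    - move=> x /= [_ /eqP xc]; rewrite -EFinM lee_fin mulrA (le_eqVlt x c) (negbTE xc)/=.
      case: (x < c); rewrite ?mulr0// !mulr1; apply: (le_trans (epk x)).
      by rewrite ler_wpM2l// ler_piMr ?powk_ge0// lern1 leq_b1.
  rewrite /Rintegral -lee_fin fineK// ge0_fin_numE.
    by apply: le_lt_trans H1 _; rewrite ltry.
  by apply: integral_ge0 => x _; rewrite lee_fin mulr_ge0.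
pose E xi := \int[mu]_r (ep (t - r) * trig b (xi * r)).
(* The cutoff c may lie past the half period, or past T, where [ep] already vanishes; in both cases
   the mass up to pi / xi is at most the mass up to c. *)
have Eb (xi c : R) : 0 < xi -> pi / xi <= c \/ T <= c -> `|E xi| <= M * (c `^ (1 - be) / (1 - be)).
  move=> xi0 hc.
  have pixi : 0 < pi / xi by rewrite divr_gt0 ?pi_gt0.
  have c0 : 0 < c by case: hc; apply: lt_le_trans.
  have mt : measurable_fun [set: R] (fun r : R => trig b (xi * r)).
    by apply: measurableT_comp (@measurable_trig R b) _; exact: measurable_funM.
  have mr : measurable_fun [set: R] (fun r : R => t - r) by exact: measurable_funB.
  have -> : E xi = \int[mu]_x (ep x * trig b (xi * (t - x))).
    rewrite /E -[LHS](Rintegral_reflect t); last first.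
      by apply: measurable_funM => //; exact: measurableT_comp mep mr.
    by apply: eq_Rintegral => x _; rewrite subKr.
  apply: (le_trans (half_period_le (psi := fun x => trig b (xi * (t - x))) pixi mep _ ep0 epneg epn iep _ _)).
  - exact: measurableT_comp mt mr.
  - by move=> x; exact: trig_le1.
  - move=> x; rewrite -trigBpi; congr trig; field; exact: lt0r_neq0.
  apply: le_trans (bnd c c0); apply: le_Rintegral => //.
  - apply: (le_integrable _ _ _ iep) => //.
      by apply/measurable_EFinP; apply: measurable_indM => //; exact: measurable_fun_ler.
    by move=> x _; rewrite /= lee_fin normrM normr_nat ler_piMr// lern1 leq_b1.
  - apply: (le_integrable _ _ _ iep) => //.
      by apply/measurable_EFinP; apply: measurable_indM => //; exact: measurable_fun_ler.
    by move=> x _; rewrite /= lee_fin normrM normr_nat ler_piMr// lern1 leq_b1.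
  - move=> x _; have [xp|] := leP x (pi / xi); last by rewrite mulr0 mulr_ge0.
    case: hc => hc; first by rewrite (le_trans xp hc).
    have [xc|cx] := leP x c; first by [].
    by rewrite ept ?mul0r// (le_trans tT)// (le_trans hc)// ltW.
have mE : measurable_fun [set: R] E.
  apply: (@measurable_Rintegral2 _ _ _ _ R mu (fun z : measurableTypeR R * measurableTypeR R => ep (t - z.2) * trig b (z.1 * z.2))).
  apply: measurable_funM.
    have mr : measurable_fun [set: R] (fun r : R => t - r) by exact: measurable_funB.
    by apply: (measurableT_comp (measurableT_comp mep mr)).
  by apply: measurableT_comp (@measurable_trig R b) _; exact: measurable_funM.
pose A := (M / (1 - be)) ^+ 2 * T `^ (2 - 2 * be); pose B := (M / (1 - be)) ^+ 2 * pi `^ (2 - 2 * be).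
have A0 : 0 <= A by rewrite mulr_ge0 ?powR_ge0// sqr_ge0.
have B0 : 0 <= B by rewrite mulr_ge0 ?powR_ge0// sqr_ge0.
have -> : (T `^ (2 - 2 * be) / (2 - 2 * H) + pi `^ (2 - 2 * be) / (2 * (H - be))) / (1 - be) ^+ 2 * M ^+ 2 =
    A / (2 - 2 * H) + B / (2 * (H - be)).
  by rewrite /A /B; field; rewrite !gt_eqF//; move: beH be0; lra.
rewrite -integral_powk_split//; [|lra|by move: beH be0; lra].
apply: ge0_le_integral => //.
- by move=> x _; rewrite lee_fin sqr_ge0.
- by apply/measurable_EFinP; apply: measurable_funX; apply: measurable_funM => //; exact: measurable_powk.
- apply/measurable_EFinP; apply: measurable_funD; apply: measurable_funM => //.
    by apply: measurable_indM; [exact: measurable_powk|exact: measurable_fun_ltr].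
  by apply: measurable_indM; [exact: measurable_powR|exact: measurable_fun_ler].
move=> xi _; rewrite lee_fin exprMn expr2 powk_sqr -/(E xi).
have -> : 2 * (3 / 2 - H) - 1 = 2 - 2 * H by field.
have [x0|x0] := ltP 0 xi; last first.
  have -> : powk (2 - 2 * H) xi = 0 by rewrite /powk ltNge x0.
  rewrite !mul0r mulr0 add0r; apply: mulr_ge0 => //; apply: mulr_ge0 => //; exact: powR_ge0.
have sq (c : R) : 0 < c -> `|E xi| <= M * (c `^ (1 - be) / (1 - be)) -> E xi ^+ 2 <= (M / (1 - be)) ^+ 2 * c `^ (2 - 2 * be).
  move=> c0 Ec; rewrite -real_normK ?num_real//.
  have -> : c `^ (2 - 2 * be) = (c `^ (1 - be)) ^+ 2.
    by rewrite expr2 -powRD ?(gt_eqF c0) ?implybT//; congr (_ `^ _); ring.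
  rewrite -exprMn ler_sqr ?nnegrE//; first by rewrite mulrAC -mulrA.
  by rewrite mulr_ge0 ?powR_ge0// divr_ge0// ltW.
have [x1|x1] := ltP xi 1.
  rewrite mulr1 mulr0 mulr0 addr0 mulrC ler_wpM2r ?powk_ge0//.
  by apply: sq => //; apply: Eb => //; right.
rewrite mulr0 mulr0 add0r mulr1 /powk x0.
have pix : 0 < pi / xi by rewrite divr_gt0 ?pi_gt0.
have := sq (pi / xi) pix (Eb xi (pi / xi) x0 (or_introl (lexx _))).
move=> /(ler_wpM2l (powR_ge0 xi (2 - 2 * H - 1))) /le_trans; apply.
rewrite le_eqVlt; apply/orP; left; apply/eqP.
have -> : (pi / xi) `^ (2 - 2 * be) = pi `^ (2 - 2 * be) * xi `^ (- (2 - 2 * be)).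
  rewrite powRN; apply: (canRL (mulfK (lt0r_neq0 (powR_gt0 _ x0)))).
  by rewrite -powRM ?(ltW x0) ?(ltW pix)// divfK// gt_eqF.
have -> : - (2 * (H - be)) - 1 = (2 - 2 * H - 1) - (2 - 2 * be) + 2 * (2 * H - 2 * be - (H - be) * 2) by ring.
rewrite (_ : 2 * H - 2 * be - (H - be) * 2 = 0); last by ring.
rewrite mulr0 addr0 [in RHS]powRD ?(gt_eqF x0) ?implybT// /B; ring.
Qed.

End time_bound.

(** * Fourier energy of a sine on the unit interval *)

Section space_bound.
Variables (R : realType).
Local Notation mu := (@lebesgue_measure R).

Lemma continuous_trigZ (b : bool) (c : R) : continuous (fun y : R => trig b (c * y)).
Proof.
move=> y; apply: pair_continuous; have dxi : is_derive y 1 (fun y : R => c * y) c.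
  by have := is_deriveZ c (is_derive_id y (1 : R)); rewrite /GRing.scale/= mulr1.
case: b; first by apply: ex_derive; exact: is_derive1_comp (is_derive_cos (c * y)) dxi.
by apply: ex_derive; exact: is_derive1_comp (is_derive_sin (c * y)) dxi.
Qed.

(* The antiderivative of [sin (m x) trig (xi x)] times [m ^ 2 - xi ^ 2]; the
   vanishing of [sin (m x)] at both ends leaves only the factor [m]. *)
Lemma sine_fourier_le (n : nat) (xi : R) (b : bool) : (0 < n)%N -> 0 < xi ->
  let S := \int[mu]_y ((sin (n%:R * pi * y) * (0 < y < 1)%R%:R) * trig b (xi * y)) in
  `|S| <= 1 /\ `|(n%:R * pi) ^+ 2 - xi ^+ 2| * `|S| <= 2 * (n%:R * pi).
Proof.
move=> n0 xi0 S; set m := n%:R * pi.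
have m0 : 0 < m by rewrite mulr_gt0 ?pi_gt0// ltr0n.
have sm : sin m = 0 :> R by have := sin_natpi n (0 : R); rewrite add0r sin0 mulr0.
have mf : measurable_fun [set: R] (fun y : R => sin (m * y) * trig b (xi * y)).
  apply: measurable_funM; first exact: measurable_sinZ.
  by apply: measurableT_comp (@measurable_trig R b) _; exact: measurable_funM.
have mfE : measurable_fun [set: R] (fun y : R => (sin (m * y) * trig b (xi * y))%:E) by exact/measurable_EFinP.
have cf : continuous (fun y : R => sin (m * y) * trig b (xi * y)).
  by move=> y; apply: cvgM; [exact: continuous_sinZ|exact: continuous_trigZ].
have SE : S = fine (\int[mu]_(y in `]0%R, 1%R[) (sin (m * y) * trig b (xi * y))%:E)%E.
  rewrite /S /Rintegral; congr fine; rewrite [RHS]integral_mkcond; apply: eq_integral => y _.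
  by rewrite patchE mem_setE in_itv/=; case: ifP => _; rewrite ?mulr1 ?mulr0 ?mul0r.
split.
  rewrite SE -(@integral_itv_bndoo R 0 1 _ true false); last exact: measurable_funTS.
  have ic : mu.-integrable `[0%R, 1%R] (EFin \o (fun y : R => sin (m * y) * trig b (xi * y))).
    apply: continuous_compact_integrable; first exact: segment_compact.
    exact: continuous_subspaceT.
  apply: (le_trans (le_normr_Rintegral _ ic)) => //.
  have i1 : mu.-integrable `[0%R, 1%R] (EFin \o (fun=> 1 : R)).
    by apply: continuous_compact_integrable; [exact: segment_compact|apply: continuous_subspaceT => y; exact: cvg_cst].
  apply: (@le_trans _ _ (\int[mu]_(y in `[0%R, 1%R]) 1)).
    apply: le_Rintegral => //; first exact: integrable_norm ic.
    move=> y _; rewrite /= normrM mulr_ile1// ?trig_le1//.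
    by rewrite ler_norml sin_geN1 sin_le1.
  rewrite /Rintegral integral_cst//= mul1e lebesgue_measure_itv/= lte_fin ltr01/=.
  by rewrite subr0.
pose F (y : R) := - m * (cos (m * y) * trig b (xi * y)) + (if b then - xi else xi) * (sin (m * y) * trig (~~ b) (xi * y)).
have dxi (c y : R) : is_derive y 1 (fun y : R => c * y) c.
  by have := is_deriveZ c (is_derive_id y (1 : R)); rewrite /GRing.scale/= mulr1.
have dc (c y : R) : is_derive y 1 (fun y : R => cos (c * y)) (- (c * sin (c * y))).
  by have := is_derive1_comp (is_derive_cos (c * y)) (dxi c y); rewrite mulNr mulrC.
have ds := @is_derive_sinZ R.
have dF (y : R) : is_derive y 1 F ((m ^+ 2 - xi ^+ 2) * (sin (m * y) * trig b (xi * y))).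
  rewrite /F /trig; case: (b) => /=.
    have := is_deriveD (is_deriveZ (- m) (is_deriveM (dc m y) (dc xi y))) (is_deriveZ (- xi) (is_deriveM (ds m y) (ds xi y))).
    rewrite /GRing.scale/=; set z := (X in is_derive _ _ _ X -> _); set z' := (X in _ -> is_derive _ _ _ X).
    by suff -> : z = z' by []; rewrite /z /z'; ring.
  have := is_deriveD (is_deriveZ (- m) (is_deriveM (dc m y) (ds xi y))) (is_deriveZ xi (is_deriveM (ds m y) (dc xi y))).
  rewrite /GRing.scale/=; set z := (X in is_derive _ _ _ X -> _); set z' := (X in _ -> is_derive _ _ _ X).
  by suff -> : z = z' by []; rewrite /z /z'; ring.
have cF (y : R) : {for y, continuous F} by apply: pair_continuous; apply: ex_derive; exact: dF.
have E : ((m ^+ 2 - xi ^+ 2) * S)%:E = (F 1 - F 0)%:E.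
  have -> : (F 1 - F 0)%:E = (\int[mu]_(y in `[0%R, 1%R]) ((m ^+ 2 - xi ^+ 2) * (sin (m * y) * trig b (xi * y)))%:E)%E.
    rewrite (@continuous_FTC2 R _ F 0 1)//.
    - by apply: continuous_subspaceT => y; apply: cvgM; [exact: cvg_cst|exact: cf].
    - split.
      + by move=> y _; apply: ex_derive; exact: dF.
      + by apply: cvg_at_right_filter; exact: cF.
      + by apply: cvg_at_left_filter; exact: cF.
    - by move=> y _; rewrite derive1E; have [_ ->] := dF y.
  have ic : mu.-integrable `[0%R, 1%R] (EFin \o (fun y : R => sin (m * y) * trig b (xi * y))).
    apply: continuous_compact_integrable; first exact: segment_compact.
    exact: continuous_subspaceT.
  under eq_integral do rewrite EFinM.
  rewrite integralZl//= EFinM; congr (_ * _)%E.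
  rewrite SE -(@integral_itv_bndoo R 0 1 _ true false); last exact: measurable_funTS.
  by rewrite fineK//; apply: integrable_fin_num.
case: E => E; rewrite -normrM E /F !mulr0 !mulr1 sm sin0 !mul0r !mulr0 !addr0.
rewrite -mulrBr normrM normrN (gtr0_norm m0) mulrC ler_wpM2r ?(ltW m0)//.
apply: (le_trans (ler_normB _ _)); rewrite -[2]/(1 + 1) lerD// normrM mulr_ile1// ?trig_le1// ler_norml cos_geN1 cos_le1//.
Qed.

Lemma powR_le_1D (x p : R) : 0 <= x -> 0 <= p <= 1 -> x `^ p <= 1 + x.
Proof.
move=> x0 /andP[p0 p1]; have [x1|x1] := leP x 1.
  have : x `^ p <= 1 `^ p by apply: ge0_ler_powR; rewrite ?nnegrE.
  by rewrite powR1; lra.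
have : x `^ p <= x `^ 1 by apply: ler_powR => //; exact: ltW.
by rewrite powRr1//; lra.
Qed.

(** With u = xi - m, the weight xi^(1 - 2 H) is at most m^(1 - 2 H) (1 + xi / m). Near resonance,
    |u| < 1, the last factor is at most 3 and |S| <= 1; away from it, (1 + xi / m) S^2 <= 4 m / (u^2
    (xi + m)) <= 4 / u^2. The majorant [B] integrates to 3 * 2 + 4 + 4 = 14. *)
Lemma space_fourier_le (H : R) (n : nat) (b : bool) : 0 < H <= 2^-1 -> (0 < n)%N ->
  (\int[mu]_xi ((powk (3 / 2 - H) xi *
      \int[mu]_y ((sin (n%:R * pi * y) * (0 < y < 1)%R%:R) * trig b (xi * y))) ^+ 2)%:E <=
   (14 * (n%:R * pi) `^ (1 - 2 * H))%:E)%E.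
Proof.
move=> /andP[H0 H2] n0; set m := n%:R * pi.
have H2' : 2 * H <= 1 by rewrite -ler_pdivlMl// mulr1.
have pi0 := pi_gt0 R.
have m1 : 1 <= m.
  have : 2 <= pi :> R by exact: pi_ge2.
  have : 1 <= n%:R :> R by rewrite ler1n.
  by rewrite /m; nra.
have m0 : 0 < m by exact: lt_le_trans m1.
pose S xi := \int[mu]_y ((sin (m * y) * (0 < y < 1)%R%:R) * trig b (xi * y)).
have mS : measurable_fun [set: R] S.
  apply: (@measurable_Rintegral2 _ _ _ _ R mu (fun z : measurableTypeR R * measurableTypeR R => (sin (m * z.2) * (0 < z.2 < 1)%R%:R) * trig b (z.1 * z.2))).
  have ms : measurable_fun [set: R] (fun y : R => sin (m * y) * (0 < y < 1)%R%:R).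
    by apply: measurable_funM; [exact: measurable_sinZ|exact: measurable_itvR].
  apply: measurable_funM; first by apply: (measurableT_comp ms).
  by apply: measurableT_comp (@measurable_trig R b) _; exact: measurable_funM.
pose h (u : R) : R := u `^ (- 1 - 1) * (1 <= u)%R%:R.
have mh : measurable_fun [set: R] h by apply: measurable_indM; [exact: measurable_powR|exact: measurable_fun_ler].
have h0 u : 0 <= h u by rewrite mulr_ge0// powR_ge0.
have ih : (\int[mu]_u (h u)%:E = 1%:E)%E.
  have -> : 1 = 1 `^ (- 1) / 1 :> R by rewrite powR1 divr1.
  rewrite -(ge0_integral_powRN ltr01 ltr01) [RHS]integral_mkcond; apply: eq_integral => x _.
  by rewrite patchE mem_setE in_itv/= andbT /h; case: (1 <= x); rewrite ?mulr1 ?mulr0.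
pose c (u : R) : R := (-1 < u < 1)%R%:R.
have mc : measurable_fun [set: R] c by exact: measurable_itvR.
have ic : (\int[mu]_u (c u)%:E = 2%:E)%E.
  transitivity (\int[mu]_(u in `](-1)%R, 1%R[) (cst 1%E u))%E.
    rewrite [RHS]integral_mkcond; apply: eq_integral => x _.
    by rewrite patchE mem_setE in_itv/= /c; case: ifP.
  rewrite integral_cst//= mul1e lebesgue_measure_itv/= lte_fin (@lt_trans _ _ 0) ?ltrN10//.
  by rewrite -EFinB opprK.
pose B (u : R) := 3 * c u + (4 * h u + 4 * h (- u)).
have mhN : measurable_fun [set: R] (fun u => h (- u)) by exact: measurableT_comp.
have mB : measurable_fun [set: R] B.
  by apply: measurable_funD; [|apply: measurable_funD]; apply: measurable_funM.
have B0 u : 0 <= B u by rewrite !addr_ge0// mulr_ge0.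
have iB : (\int[mu]_u (B u)%:E = 14%:E)%E.
  transitivity (\int[mu]_u (3%:E * (c u)%:E + (4%:E * (h u)%:E + 4%:E * (h (- u))%:E)))%E; first by [].
  have q (f : R -> R) (k : R) : 0 <= k -> (forall x, 0 <= f x) -> forall x, (0 <= k%:E * (f x)%:E)%E.
    by move=> k0 f0 x; rewrite -EFinM lee_fin mulr_ge0.
  have mq (f : R -> R) (k : R) : measurable_fun [set: R] f -> measurable_fun [set: R] (fun x => k%:E * (f x)%:E)%E.
    by move=> mf; apply: measurable_funeM; exact/measurable_EFinP.
  have c0 x : 0 <= c x by [].
  have hN0 x : 0 <= h (- x) by [].
  rewrite ge0_integralD//; last 4 first.
  - by move=> x _; exact: (q c).
  - exact: mq.
  - by move=> x _; apply: adde_ge0; [exact: (q h)|exact: (q (fun x => h (- x)))].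
  - by apply: emeasurable_funD; exact: mq.
  rewrite ge0_integralD//; last 4 first.
  - by move=> x _; exact: (q h).
  - exact: mq.
  - by move=> x _; exact: (q (fun x => h (- x))).
  - exact: mq.
  rewrite !ge0_integralZl//; try by [exact/measurable_EFinP|move=> x _; rewrite lee_fin].
  rewrite (@ge0_integral_oppr R (EFin \o h))//; last by exact/measurable_EFinP.
  rewrite ic ih -!EFinM -!EFinD; congr EFin; ring.
have key (xi : R) : 0 < xi -> xi `^ (1 - 2 * H) * S xi ^+ 2 <= m `^ (1 - 2 * H) * B (xi - m).
  move=> x0; have [S1 S2] := sine_fourier_le b n0 x0; rewrite -/m -/(S xi) in S1 S2.
  have xm0 : 0 <= xi / m by rewrite divr_ge0// ltW.
  have -> : xi `^ (1 - 2 * H) = m `^ (1 - 2 * H) * (xi / m) `^ (1 - 2 * H).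
    by rewrite -(powRM _ (ltW m0) xm0) (mulrC m) divfK// gt_eqF.
  rewrite -mulrA ler_wpM2l ?powR_ge0//.
  have pl : (xi / m) `^ (1 - 2 * H) <= 1 + xi / m by apply: powR_le_1D => //; apply/andP; split; lra.
  apply: (le_trans (ler_wpM2r (sqr_ge0 _) pl)).
  have Sq : S xi ^+ 2 <= 1 by rewrite -real_normK ?num_real// expr_le1.
  have S4 : (m ^+ 2 - xi ^+ 2) ^+ 2 * S xi ^+ 2 <= 4 * m ^+ 2.
    rewrite -[X in X * _]real_normK ?num_real// -[X in _ * X]real_normK ?num_real// -exprMn.
    have -> : 4 * m ^+ 2 = (2 * m) ^+ 2 by ring.
    by rewrite ler_sqr // nnegrE; [exact: mulr_ge0|exact: mulr_ge0 (ltW m0)].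
  have far (u : R) : 1 <= u -> u ^+ 2 = (xi - m) ^+ 2 -> (1 + xi / m) * S xi ^+ 2 <= 4 * u `^ (- 1 - 1).
    move=> u1 ue; have u0 : 0 < u by exact: lt_le_trans u1.
    have -> : - 1 - 1 = - (2%:R) :> R by ring.
    rewrite powRN powR_mulrn ?(ltW u0)// ler_pdivlMr ?exprn_gt0// ue.
    have xm : 0 < xi + m by rewrite addr_gt0.
    have e : (1 + xi / m) * S xi ^+ 2 * (xi - m) ^+ 2 = ((m ^+ 2 - xi ^+ 2) ^+ 2 * S xi ^+ 2) / (m * (xi + m)).
      by field; rewrite !gt_eqF.
    rewrite e ler_pdivrMr; last exact: mulr_gt0 m0 xm.
    apply: (le_trans S4).
    by rewrite ler_pM2l// expr2 ler_pM2l// lerDr ltW.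
  have hE (u : R) : 1 <= u -> h u = u `^ (- 1 - 1) by move=> u1; rewrite /h u1 mulr1.
  have B1 u : 4 * h u <= B u by rewrite /B addrCA lerDl addr_ge0// mulr_ge0.
  have B2 u : 4 * h (- u) <= B u by rewrite /B addrA lerDr addr_ge0// mulr_ge0.
  have B3 u : 3 * c u <= B u by rewrite /B lerDl addr_ge0// mulr_ge0.
  have [hl|hl] := leP 1 (xi - m).
    by apply: le_trans (B1 _); rewrite hE//; exact: far.
  have [hl'|hl'] := leP (xi - m) (- 1).
    apply: le_trans (B2 _); rewrite hE; last by rewrite lerNr.
    by apply: far; [rewrite lerNr|rewrite sqrrN].
  apply: le_trans (B3 _); rewrite /c hl hl' mulr1.
  rewrite -[leRHS]mulr1; apply: ler_pM => //; [by rewrite addr_ge0|exact: sqr_ge0|].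
  have : xi / m <= 2 by rewrite ler_pdivrMr//; lra.
  by lra.
rewrite -/m.
apply: (@le_trans _ _ (\int[mu]_xi ((m `^ (1 - 2 * H))%:E * (B (xi - m))%:E))%E).
  apply: ge0_le_integral => //.
  - by move=> x _; rewrite lee_fin sqr_ge0.
  - by apply/measurable_EFinP; apply: measurable_funX; apply: measurable_funM => //; exact: measurable_powk.
  - apply: measurable_funeM; apply/measurable_EFinP; apply: measurableT_comp mB _; exact: measurable_funB.
  move=> xi _; rewrite -EFinM lee_fin exprMn expr2 powk_sqr -/(S xi) /powk.
  case: ifP => x0; last by rewrite mul0r mulr_ge0// powR_ge0.
  have -> : 2 * (3 / 2 - H) - 1 - 1 = 1 - 2 * H by field.
  exact: key.
rewrite ge0_integralZl//; last 3 first.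
- by apply/measurable_EFinP; apply: measurableT_comp mB _; exact: measurable_funB.
- by move=> x _; rewrite lee_fin.
- by rewrite lee_fin powR_ge0.
rewrite (@ge0_integral_shift R (- m) (EFin \o B)); [|exact/measurable_EFinP|by move=> x; rewrite lee_fin].
by rewrite iB -EFinM mulrC.
Qed.

End space_bound.

(** * Fourier energy of kernel series *)

Section kernel_series.
Variables (R : realType) (T H1 H2 : R).
Hypothesis T0 : 0 < T.
Local Notation mu := (@lebesgue_measure R).
Local Notation mm := (sprod mu mu).
Local Notation RR := (measurableTypeR R).
Variables (p e : nat -> RR -> R).
Hypothesis p2 : forall j, p j \in Lfun mu 2%:E.
Hypothesis e2 : forall j, e j \in Lfun mu 2%:E.
Hypothesis po : forall j k, dot mu (p j) (p k) = (j == k)%:R.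
Hypothesis ps : forall j x, p j x = p j x * (0 < x < 1)%R%:R.
Hypothesis es : forall j r, e j r = e j r * (0 < r < T)%R%:R.
Hypothesis p_le : forall j x, p j x ^+ 2 <= 2.

Definition kterm j (z : RR * RR) := p j z.1 * e j z.2.

Definition ksum n (x : RR) (z : RR * RR) : R := \sum_(j <- iota 0 n) p j x * kterm j z.

Definition pcoef b j xi : R := powk (3 / 2 - H1) xi * \int[mu]_y (p j y * trig b (xi * y)).
Definition ecoef b j xi : R := powk (3 / 2 - H2) xi * \int[mu]_y (e j y * trig b (xi * y)).

Lemma integrable_trig_supp (b : bool) (L xi : R) (h : RR -> R) : 0 < L -> h \in Lfun mu 2%:E ->
  mu.-integrable setT (EFin \o (fun y : RR => h y * (trig b (xi * y) * (0 < y < L)%R%:R))).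
Proof.
move=> L0 h2; apply: L2_integrable => //.
have mt : measurable_fun setT (fun y : RR => trig b (xi * y) * (0 < y < L)%R%:R).
  apply: measurable_funM; last exact: measurable_itvR.
  by apply: (measurableT_comp (@measurable_trig R b)); exact: measurable_funM.
apply: L2_of_sqr => //.
apply: (@le_lt_trans _ _ (\int[mu]_(y in `]0%R, L[) 1)%E); last first.
  by rewrite integral_cst//= mul1e lebesgue_measure_itv/= lte_fin L0 -EFinB ltry.
rewrite [leRHS]integral_mkcond; apply: ge0_le_integral => //.
- by move=> z _; rewrite lee_fin sqr_ge0.
- by apply/measurable_EFinP; exact: measurable_funX.
- by apply/(measurable_restrictT (fun=> 1%E : \bar R)) => //; exact: measurable_cst.
- move=> y _; rewrite patchE mem_setE/= in_itv/=; case: ifPn => yL; last first.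
    by rewrite mulr0 expr0n.
  by rewrite mulr1 lee_fin -real_normK ?num_real// expr_le1// trig_le1.
Qed.

Lemma prod_L2 (f h : RR -> R) : f \in Lfun mu 2%:E -> h \in Lfun mu 2%:E ->
  (fun z : RR * RR => f z.1 * h z.2) \in Lfun mm 2%:E.
Proof.
move=> f2 h2; have m1 := L2_measurable f2; have m2 := L2_measurable h2.
apply: L2_of_sqr; first exact: measurable_prodM.
have -> : (fun z : RR * RR => ((f z.1 * h z.2) ^+ 2)%:E) =
    (fun z => ((\sum_(i <- [:: tt]) 1 * (f z.1 * h z.2)) ^+ 2)%:E).
  by apply/funext => z; rewrite big_seq1 mul1r.
by rewrite (@integral_tensor_sum _ _ _ _ _ mu mu unit [:: tt] (fun=> 1) (fun=> f) (fun=> h) (fun=> f2) (fun=> h2)) ltry.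
Qed.

Lemma kterm_L2 j : kterm j \in Lfun mm 2%:E.
Proof. exact: prod_L2. Qed.

Lemma dot_prod (f h f' h' : RR -> R) : f \in Lfun mu 2%:E -> h \in Lfun mu 2%:E ->
  f' \in Lfun mu 2%:E -> h' \in Lfun mu 2%:E ->
  dot mm (fun z : RR * RR => f z.1 * h z.2) (fun z : RR * RR => f' z.1 * h' z.2) = dot mu f f' * dot mu h h'.
Proof.
move=> f2 h2 f2' h2'; rewrite -Rintegral_prodM; try exact: L2_integrable.
by apply: eq_Rintegral => z _; ring.
Qed.

Lemma ksum_L2 n x : ksum n x \in Lfun mm 2%:E.
Proof. by apply: L2_sum => j; apply: L2Z; exact: kterm_L2. Qed.

Lemma specK_kterm b j xi : specK T H1 H2 b (kterm j) xi = pcoef b.1 j xi.1 * ecoef b.2 j xi.2.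
Proof.
rewrite /specK /pcoef /ecoef.
have -> : dot mm (kterm j) (trig_ST T b xi) =
    (\int[mu]_y (p j y * trig b.1 (xi.1 * y))) * (\int[mu]_y (e j y * trig b.2 (xi.2 * y))).
  have E1 : \int[mu]_y (p j y * trig b.1 (xi.1 * y)) = \int[mu]_y (p j y * (trig b.1 (xi.1 * y) * (0 < y < 1)%R%:R)).
    by apply: eq_Rintegral => y _; rewrite ps; case: (0 < y < 1)%R; rewrite ?(mulr1, mulr0, mul0r).
  have E2 : \int[mu]_y (e j y * trig b.2 (xi.2 * y)) = \int[mu]_y (e j y * (trig b.2 (xi.2 * y) * (0 < y < T)%R%:R)).
    by apply: eq_Rintegral => y _; rewrite es; case: (0 < y < T)%R; rewrite ?(mulr1, mulr0, mul0r).
  rewrite E1 E2 -Rintegral_prodM; try exact: integrable_trig_supp.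
  by apply: eq_Rintegral => z _; rewrite /kterm /trig_ST; ring.
by ring.
Qed.

Lemma specK_ksum b n x xi : specK T H1 H2 b (ksum n x) xi =
  \sum_(j <- iota 0 n) 1 * (p j x * (pcoef b.1 j xi.1 * ecoef b.2 j xi.2)).
Proof.
rewrite {1}/specK /ksum dot_suml => [|j|]; [|exact/L2Z/kterm_L2|exact: trig_ST_L2].
rewrite mulr_sumr; apply: eq_bigr => j _; rewrite mul1r -specK_kterm dotZl; [|exact: kterm_L2|exact: trig_ST_L2].
by rewrite /specK; ring.
Qed.

Variables (A B : nat -> R) (E M : R).
Hypothesis pA : forall b j, (\int[mu]_xi (pcoef b j xi ^+ 2)%:E <= (A j)%:E)%E.
Hypothesis eB : forall b j, (\int[mu]_xi (ecoef b j xi ^+ 2)%:E <= (B j)%:E)%E.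
Hypothesis eE : forall n, \sum_(j < n) dot mu (e j) (e j) <= E.
Hypothesis ABM : forall n, \sum_(j < n) A j * B j <= M.
Variable g : RR * (RR * RR) -> R.
Hypothesis mg : measurable_fun setT g.
Hypothesis gE : forall x, {ae mm, forall z, ksum n x z @[n --> \oo] --> g (x, z)}.

Lemma nrm_ksumB n m x : (n <= m)%N ->
  (\int[mm]_z ((ksum m x z - ksum n x z) ^+ 2)%:E <= (2 * \sum_(n <= j < m) dot mu (e j) (e j))%:E)%E.
Proof.
move=> nm.
have -> : (fun z => ((ksum m x z - ksum n x z) ^+ 2)%:E) =
    (fun z => ((\sum_(j <- index_iota n m) p j x * (p j z.1 * e j z.2)) ^+ 2)%:E).
  apply/funext => z; congr (_ ^+ 2)%:E; rewrite /ksum.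
  by rewrite -{1}(subnKC nm) iotaD big_cat/= add0n [X in X - _]addrC addrK.
rewrite (integral_tensor_sum _ _ p2 e2) lee_fin mulr_sumr.
rewrite big_seq [leRHS]big_seq; apply: ler_sum => i im.
rewrite (bigD1_seq i) ?iota_uniq//= big1 => [|j ij]; last by rewrite po eq_sym (negbTE ij) mul0r mulr0.
by rewrite po eqxx mul1r addr0 -expr2 ler_wpM2r ?dot_ge0.
Qed.

(** For every x, the bound p_j(x)^2 <= 2 and the summability of the squared norms of e_j make the
    partial sums Cauchy in L^2; Fatou identifies their L^2 limit with the pointwise limit g. *)
Lemma kernel_series_limit x : (fun z => g (x, z)) \in Lfun mm 2%:E /\
  nrm mm (fun z => ksum n x z - g (x, z)) @[n --> \oo] --> 0.
Proof.
have mgx : measurable_fun setT (fun z => g (x, z)) by exact: measurableT_comp.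
have d0 j : 0 <= dot mu (e j) (e j) by exact: dot_ge0.
have cS : cvgn (series (fun j => dot mu (e j) (e j))).
  apply: nondecreasing_is_cvgn; first by apply: nondecreasing_series => j _ _.
  by exists E => _ [n _ <-]; rewrite /series/= big_mkord.
set S := limn (series (fun j => dot mu (e j) (e j))).
have tail n : (\int[mm]_z ((g (x, z) - ksum n x z) ^+ 2)%:E <=
    (2 * (S - series (fun j => dot mu (e j) (e j)) n))%:E)%E.
  apply: (@fatou_sqr _ _ _ mm (fun m z => ksum (n + m)%N x z - ksum n x z)).
  - by move=> m; apply: measurable_funB; apply: L2_measurable; exact: ksum_L2.
  - by apply: measurable_funB => //; apply: L2_measurable; exact: ksum_L2.
  - apply: filterS (gE x) => z gz; apply: cvgB; last exact: cvg_cst.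
    by move: gz; rewrite -(cvg_shiftn n) => gz; under eq_fun do rewrite addnC; exact: gz.
  - move=> m; apply: (le_trans (nrm_ksumB x (leq_addr m n))); rewrite lee_fin ler_pM2l//.
    rewrite lerBrDr addrC /series/= -big_cat_nat//= ?leq_addr//.
    apply: (@nondecreasing_cvgn_le _ (series (fun j => dot mu (e j) (e j)))) => //.
    by apply: nondecreasing_series => j _ _.
have gB2 n : (fun z => g (x, z) - ksum n x z) \in Lfun mm 2%:E.
  apply: L2_of_sqr; first by apply: measurable_funB => //; apply: L2_measurable; exact: ksum_L2.
  by apply: (le_lt_trans (tail n)); rewrite ltry.
have g2 : (fun z => g (x, z)) \in Lfun mm 2%:E.
  have -> : (fun z => g (x, z)) = (fun z => (g (x, z) - ksum 0 x z) + ksum 0 x z).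
    by apply/funext => z; rewrite subrK.
  by apply: L2_add => //; exact: ksum_L2.
split=> //; have k2 n := ksum_L2 n x.
apply/cvg_epsP => ep ep0; have /cvg_epsP/(_ (ep ^+ 2 / 2)) := cS.
rewrite divr_gt0 ?exprn_gt0// => /(_ isT)[N HN]; exists N => n /HN hn; rewrite subr0 ger0_norm ?nrm_ge0//.
rewrite nrm_distC//; apply/(nrm_le_sqr (gB2 n) (ltW ep0)); apply: (le_trans (tail n)); rewrite lee_fin.
rewrite -[leRHS](divfK (lt0r_neq0 (ltr0Sn R 1))) [leRHS]mulrC ler_pM2l//.
by rewrite (le_trans _ hn)// distrC ler_norm.
Qed.

Lemma coef_L2 (K : R) (q : RR -> R) b (N : R) : measurable_fun setT q ->
  (\int[mu]_xi ((powk K xi * \int[mu]_y (q y * trig b (xi * y))) ^+ 2)%:E <= N%:E)%E ->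
  (fun xi => powk K xi * \int[mu]_y (q y * trig b (xi * y))) \in Lfun mu 2%:E.
Proof.
move=> mq qN; apply: L2_of_sqr; last by apply: (le_lt_trans qN); rewrite ltry.
apply: measurable_funM; first exact: measurable_powk.
apply: (@measurable_Rintegral2 _ _ _ _ _ mu (fun w : RR * RR => q w.2 * trig b (w.1 * w.2))).
apply: measurable_funM; first exact: measurableT_comp.
by apply: (measurableT_comp (@measurable_trig R b)); exact: measurable_funM.
Qed.

Lemma pcoef_L2 b j : pcoef b j \in Lfun mu 2%:E.
Proof. by apply: coef_L2 (pA b j); exact: L2_measurable. Qed.

Lemma ecoef_L2 b j : ecoef b j \in Lfun mu 2%:E.
Proof. by apply: coef_L2 (eB b j); exact: L2_measurable. Qed.

Lemma coef_prod_L2 b j : (fun xi : RR * RR => pcoef b.1 j xi.1 * ecoef b.2 j xi.2) \in Lfun mm 2%:E.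
Proof. exact: prod_L2 (pcoef_L2 _ _) (ecoef_L2 _ _). Qed.

(** Fatou is applied jointly in (x, xi). The transform of a partial sum is a sum of tensor products
    with factors p_j(x), so its squared norm over (x, xi) is diagonal and at most the sum of the A_j
    B_j. *)
Lemma kernel_series_specK b : (\int[mu]_x \int[mm]_xi (specK T H1 H2 b (fun z => g (x, z)) xi ^+ 2)%:E <= M%:E)%E.
Proof.
have mK : measurable_fun setT (fun w : RR * (RR * RR) => specK T H1 H2 b (fun z => g (w.1, z)) w.2).
  exact: measurable_specK_gen.
rewrite -(@sprod_tonelli _ _ _ _ _ mu mm (fun w => (specK T H1 H2 b (fun z => g (w.1, z)) w.2 ^+ 2)%:E)); last 2 first.
- by apply/measurable_EFinP; exact: measurable_funX.
- by move=> w; rewrite lee_fin sqr_ge0.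
apply: (@fatou_sqr _ _ _ (sprod mu mm) (fun n w => specK T H1 H2 b (ksum n w.1) w.2)).
- move=> n; apply: (@measurable_specK_gen _ T H1 H2 _ _ b (fun w : RR * (RR * RR) => ksum n w.1 w.2)).
  apply: measurable_sum => j; apply: measurable_funM.
    by apply: (measurableT_comp (L2_measurable (p2 j))).
  by apply: (measurableT_comp (L2_measurable (kterm_L2 j))).
- by [].
- apply: aeW => w; have [g2 gl] := kernel_series_limit w.1.
  by apply: specK_lim => // n; exact: ksum_L2.
- move=> n; under eq_integral do rewrite specK_ksum.
  rewrite (@integral_tensor_sum _ _ _ _ _ mu mm _ _ _ p _ p2 (coef_prod_L2 b)) lee_fin.
  apply: le_trans (ABM n); rewrite -(big_mkord xpredT (fun j => A j * B j)) /index_iota subn0.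
  rewrite big_seq [leRHS]big_seq; apply: ler_sum => i im.
  rewrite (bigD1_seq i) ?iota_uniq//= big1 => [|j ij]; last by rewrite po eq_sym (negbTE ij) mul0r mulr0.
  rewrite po eqxx !mul1r addr0 (dot_prod (pcoef_L2 _ _) (ecoef_L2 _ _) (pcoef_L2 _ _) (ecoef_L2 _ _)).
  have h1 : dot mu (pcoef b.1 i) (pcoef b.1 i) <= A i by rewrite -lee_fin (EFin_dot (pcoef_L2 _ _)); exact: pA.
  have h2 : dot mu (ecoef b.2 i) (ecoef b.2 i) <= B i by rewrite -lee_fin (EFin_dot (ecoef_L2 _ _)); exact: eB.
  by apply: (ler_pM _ _ h1 h2); exact: dot_ge0.
Qed.

Lemma measurable_int_specK b :
  measurable_fun setT (fun x : RR => \int[mm]_xi (specK T H1 H2 b (fun z => g (x, z)) xi ^+ 2)%:E)%E.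
Proof.
apply: (@measurable_fun_fubini_tonelli_F _ _ _ _ _ mm (fun w : RR * (RR * RR) => (specK T H1 H2 b (fun z => g (w.1, z)) w.2 ^+ 2)%:E)).
  by apply/measurable_EFinP; apply: measurable_funX; exact: measurable_specK_gen.
by move=> w; rewrite lee_fin sqr_ge0.
Qed.

Lemma measurable_specQ : measurable_fun setT (fun x : RR => specQ T H1 H2 (fun z => g (x, z))).
Proof. by apply: emeasurable_sum => b; exact: measurable_int_specK. Qed.

Lemma kernel_series_specQ : (\int[mu]_x specQ T H1 H2 (fun z => g (x, z)) <= (4 * M)%:E)%E.
Proof.
rewrite ge0_integral_sum//; last 2 first.
- by move=> b; exact: measurable_int_specK.
- by move=> b x _; apply: integral_ge0 => xi _; rewrite lee_fin sqr_ge0.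
apply: (@le_trans _ _ (\sum_(b <- bools2) M%:E)%E); first by apply: lee_sum => b _; exact: kernel_series_specK.
by rewrite sumEFin lee_fin /bools2 !big_cons big_nil; lra.
Qed.

End kernel_series.

(** * The stochastic convolution *)

Section relaxation.
Variables (R : realType) (alpha s : R) (lam : nat -> R).
Hypothesis alpha01 : 0 < alpha < 1.
Hypothesis s0 : 0 < s.
Hypothesis lamE : forall k, lam k = (k.+1%:R * pi) ^+ 2.
Local Notation rel := (relaxation alpha s lam).

Lemma alpha_gt0 : 0 < alpha. Proof. by case/andP: alpha01. Qed.

Lemma lam_gt0 k : 0 < lam k.
Proof. by rewrite lamE exprn_gt0// mulr_gt0 ?pi_gt0// ltr0n. Qed.

Lemma lam_homo j k : (j <= k)%N -> lam j <= lam k.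
Proof.
move=> jk; rewrite !lamE ler_sqr ?nnegrE ?mulr_ge0 ?pi_ge0//.
by rewrite ler_pM2r ?pi_gt0// ler_nat.
Qed.

Lemma relaxation_arg_ge0 k (t : R) : 0 <= lam k `^ s * t `^ alpha.
Proof. by rewrite mulr_ge0 ?powR_ge0. Qed.

Lemma relaxation_ge0 k (t : R) : 0 <= rel k t.
Proof.
have [c c0 H] := mittag_leffler_ge alpha01.
by apply: le_trans (H _ (relaxation_arg_ge0 k t)); rewrite divr_ge0 ?(ltW c0)// addr_ge0// relaxation_arg_ge0.
Qed.

Lemma relaxation_le1 k (t : R) : rel k t <= 1.
Proof.
rewrite -(mittag_leffler1_0 alpha) -oppr0.
exact: mittag_leffler_homo alpha01 (lexx 0) (relaxation_arg_ge0 k t).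
Qed.

Lemma relaxation_noninc_time k (t t' : R) : 0 <= t -> t <= t' -> rel k t' <= rel k t.
Proof.
move=> t0 tt'; apply: mittag_leffler_homo alpha01 (relaxation_arg_ge0 k t) _.
rewrite ler_wpM2l ?powR_ge0//; apply: ge0_ler_powR => //; rewrite ?nnegrE//.
- exact/ltW/alpha_gt0.
- exact: le_trans tt'.
Qed.

Lemma relaxation_noninc j k (t : R) : (j <= k)%N -> rel k t <= rel j t.
Proof.
move=> jk; apply: mittag_leffler_homo alpha01 (relaxation_arg_ge0 j t) _.
rewrite ler_wpM2r ?powR_ge0//; apply: ge0_ler_powR; rewrite ?nnegrE ?(ltW (lam_gt0 _))//; first exact: ltW.
exact: lam_homo.
Qed.

Lemma measurable_relaxation k : measurable_fun [set: R] (rel k).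
Proof.
apply: (measurableT_comp (f := fun z : R => mittag_leffler alpha 1 (- z))).
  apply: (measurableT_comp (f := mittag_leffler alpha 1)) => //.
  by apply: continuous_measurable_fun; apply: continuous_mittag_leffler => //; exact: alpha_gt0.
by apply: measurable_funM => //; exact: measurable_powR.
Qed.

Lemma powR_le_addr1 (x th : R) : 0 < x -> 0 <= th <= 1 -> (1 + x)^-1 <= x `^ (- th).
Proof.
move=> x0 th01; have x1 : 0 < 1 + x by rewrite addr_gt0.
by rewrite powRN lef_pV2 ?posrE ?powR_gt0 ?powR_le_1D// ltW.
Qed.

(** The bound C / (1 + x) is interpolated by 1 / (1 + x) <= x^(- th), and the factor pi^(- 2 s th)
    <= 1 is dropped. C does not depend on [th]: the noise takes an intermediate exponent, the
    deterministic part takes 1. *)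
Lemma relaxation_decay : exists2 C : R, 0 < C & forall th k t, 0 <= th <= 1 -> 0 < t ->
  rel k t <= C * (k.+1%:R `^ (- (2 * s * th)) * t `^ (- (alpha * th))).
Proof.
have [C C0 HC] := mittag_leffler_le alpha01.
exists C => // th k t th01 t0.
have pi0 := pi_gt0 R; have k0 : 0 < k.+1%:R :> R by rewrite ltr0n.
have l0 : 0 < lam k `^ s by rewrite powR_gt0// lam_gt0.
have x0 : 0 < lam k `^ s * t `^ alpha by exact: (mulr_gt0 l0 (powR_gt0 _ t0)).
apply: (le_trans (HC _ (ltW x0))); rewrite ler_wpM2l ?(ltW C0)//.
apply: (le_trans (powR_le_addr1 x0 th01)); rewrite powRM ?powR_ge0// -!powRrM.
have -> : alpha * - th = - (alpha * th) by ring.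
rewrite ler_wpM2r ?powR_ge0// lamE -powR_mulrn ?mulr_ge0 ?pi_ge0// -!powRrM.
have -> : 2 * (s * - th) = - (2 * s * th) by ring.
rewrite powRM ?pi_ge0// ler_piMr ?powR_ge0//.
have : pi `^ (- (2 * s * th)) <= pi `^ 0 :> R.
  apply: ler_powR; first by apply: le_trans (pi_ge2 R); rewrite ler1n.
  by rewrite oppr_le0 !mulr_ge0 ?(ltW s0)//; case/andP: th01.
by rewrite powRr0.
Qed.

Lemma cvg_powRN (q : R) : 0 < q -> (k.+1%:R : R) `^ (- q) @[k --> \oo] --> 0.
Proof.
move=> q0; apply/cvg_epsP => e e0; exists (Num.truncn (e `^ (- q^-1))) => k ek.
rewrite subr0 ger0_norm ?powR_ge0//.
have h : e `^ (- q^-1) <= k.+1%:R.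
  by rewrite (le_trans (ltW (truncnS_gt _)))// ler_nat.
have p0 : 0 < e `^ (- q^-1) by rewrite powR_gt0.
have : (e `^ (- q^-1)) `^ q <= k.+1%:R `^ q by apply: (ge0_ler_powR (ltW q0) _ _ h); rewrite nnegrE ?(ltW p0).
rewrite -powRrM mulNr mulVf ?gt_eqF// powR_inv1 ?(ltW e0)// => h2; rewrite powRN.
by rewrite -[leRHS]invrK lef_pV2 ?posrE ?invr_gt0 ?powR_gt0.
Qed.

Lemma relaxation_cvg0 (t : R) : 0 < t -> rel k t @[k --> \oo] --> 0.
Proof.
move=> t0; have [C C0 HC] := relaxation_decay.
apply: (@squeeze_cvgr _ _ _ _ (fun=> 0) (fun k : nat => C * (k.+1%:R `^ (- (2 * s * 1)) * t `^ (- (alpha * 1))))).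
- near=> k; rewrite relaxation_ge0/= HC// ?lexx ?ler01//.
- exact: cvg_cst.
- rewrite -(mulr0 C); apply: cvgM; first exact: cvg_cst.
  rewrite -(mul0r (t `^ (- (alpha * 1)))); apply: cvgM; last exact: cvg_cst.
  by apply: cvg_powRN; rewrite mulr1 mulr_gt0.
Unshelve. all: by end_near.
Qed.

End relaxation.

(** * The Green kernel as a series *)

Section kernel.
Variables (R : realType) (alpha s H1 H2 T t : R) (lam : nat -> R) (phi : nat -> R -> R).
Hypothesis alpha01 : 0 < alpha < 1.
Hypothesis s0 : 0 < s.
Hypothesis T0 : 0 < T.
Hypothesis t0T : 0 <= t <= T.
Hypothesis eb : dirichlet_eigenbasis lam phi.
Local Notation rel := (relaxation alpha s lam).
Local Notation mu := (@lebesgue_measure R).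
Local Notation mm := (sprod mu mu).
Local Notation RR := (measurableTypeR R).

Let lamE k : lam k = (k.+1%:R * pi) ^+ 2. Proof. by have [] := eigenbasis_sin eb k. Qed.

(** The eigenfunctions are unconstrained outside [0, 1]; the cutoff allows integration over the
    line. *)
Definition phi0 k (x : RR) : R := phi k x * (0 < x < 1)%R%:R.
Definition relt k (r : RR) : R := rel k (t - r) * (0 < r < t)%R%:R.

Lemma phi0_sin k : exists2 c : R, c ^+ 2 = 2 &
  forall x, phi0 k x = c * (sin (k.+1%:R * pi * x) * (0 < x < 1)%R%:R).
Proof.
have [_ [c c2 H]] := eigenbasis_sin eb k; exists c => // x; rewrite /phi0.
have [/andP[x0 x1]|] := boolP (0 < x < 1); last by rewrite !mulr0.
by rewrite H ?mulr1// in_itv/= !ltW.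
Qed.

(** The undetermined sign of the eigenfunction drops out of the product. *)
Lemma phi0_sin_sin k (x y : R) : phi0 k x * phi0 k y =
  2 * ((sin (k.+1%:R * pi * x) * (0 < x < 1)%R%:R) * (sin (k.+1%:R * pi * y) * (0 < y < 1)%R%:R)).
Proof. by have [c <- E] := phi0_sin k; rewrite !E; ring. Qed.

Lemma phi0_supp k x : phi0 k x = phi0 k x * (0 < x < 1)%R%:R.
Proof. by rewrite /phi0; case: (0 < x < 1); rewrite ?mulr1 ?mulr0. Qed.

Lemma phi0_le k x : phi0 k x ^+ 2 <= 2.
Proof.
rewrite expr2 phi0_sin_sin -expr2 ler_piMr// -real_normK ?num_real// expr_le1// normrM.
by rewrite mulr_ile1// ?normr_nat ?lern1 ?leq_b1// ler_norml sin_geN1 sin_le1.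
Qed.

Lemma measurable_phi k : measurable_fun [set: RR] (phi k).
Proof. exact: L2_measurable (eigenbasis_L2D eb k). Qed.

Lemma measurable_phi0 k : measurable_fun [set: RR] (phi0 k).
Proof. by apply: measurable_funM; [exact: measurable_phi|exact: measurable_itvR]. Qed.

Lemma phi0_mulE j k x : (phi0 j x * phi0 k x)%:E = ((fun x => (phi j x * phi k x)%:E) \_ `]0, 1[%classic) x.
Proof.
rewrite patchE mem_setE in_itv/= /phi0; case: (0 < x < 1); rewrite ?mulr1 ?mulr0 ?mul0r//.
Qed.

Lemma phi0_ortho j k : dot mu (phi0 j) (phi0 k) = (j == k)%:R.
Proof.
rewrite -(eigenbasis_ortho eb) /dot /dotD /Rintegral; congr fine.
rewrite integral_lebD; last first.
  by apply/measurable_EFinP; apply: measurable_funM; exact: measurable_phi.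
by rewrite [RHS]integral_mkcond; apply: eq_integral => x _; rewrite phi0_mulE.
Qed.

Lemma phi0_L2 k : phi0 k \in Lfun mu 2%:E.
Proof.
apply: L2_of_sqr; first exact: measurable_phi0.
under eq_integral do rewrite expr2 phi0_mulE.
rewrite -integral_mkcond -integral_lebD; last first.
  by apply/measurable_EFinP; apply: measurable_funM; exact: measurable_phi.
have := EFin_dot (eigenbasis_L2D eb k).
by under eq_integral do rewrite expr2; move=> <-; rewrite ltry.
Qed.

Lemma measurable_relt k : measurable_fun [set: RR] (relt k).
Proof.
apply: measurable_funM; last exact: measurable_itvR.
apply: (@measurableT_comp _ _ _ _ _ _ (relaxation alpha s lam k : RR -> RR)); first exact: measurable_relaxation.
by apply: measurable_funB => //; exact: measurable_cst.
Qed.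

Lemma relt_supp k r : relt k r = relt k r * (0 < r < T)%R%:R.
Proof.
rewrite /relt; have [/andP[r0 rt]|] := boolP (0 < r < t); last by rewrite !mulr0 mul0r.
by case/andP: t0T => _ tT; rewrite r0 (lt_le_trans rt tT) !mulr1.
Qed.

(** The condition on [th] makes the square of t^(- alpha th) integrable at 0. The bound serves the
    L^2 convergence of the kernel series. *)
Lemma relt_sqr_le (th : R) : 0 <= th <= 1 -> 2 * (alpha * th) < 1 -> exists2 C : R, 0 <= C & forall k,
  (\int[mu]_r (relt k r ^+ 2)%:E <= (C * k.+1%:R `^ (- (4 * s * th)))%:E)%E.
Proof.
move=> th01 ath; have [C C0 HC] := relaxation_decay alpha01 s0 lamE.
have g0 : 0 < 1 - 2 * (alpha * th) by lra.
case/andP: (t0T) => t0 _.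
exists (C ^+ 2 * (t `^ (1 - 2 * (alpha * th)) / (1 - 2 * (alpha * th)))).
  by rewrite mulr_ge0 ?sqr_ge0// divr_ge0 ?powR_ge0 ?ltW.
move=> k.
have -> : (\int[mu]_r (relt k r ^+ 2)%:E = \int[mu]_r ((rel k r * (0 < r < t)%R%:R) ^+ 2)%:E)%E.
  pose G (r : R) : \bar R := ((rel k r * (0 < r < t)%R%:R) ^+ 2)%:E.
  transitivity (\int[mu]_r G (t - r)%R)%E.
    apply: eq_integral => r _; rewrite /relt /G; congr ((_ * _%:R) ^+ 2)%:E.
    by rewrite subr_gt0 ltrBlDr ltrDl andbC.
  apply: ge0_integral_reflect; last by move=> r; rewrite lee_fin sqr_ge0.
  apply/measurable_EFinP; apply: measurable_funX; apply: measurable_funM; last exact: measurable_itvR.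
  exact: measurable_relaxation.
apply: (@le_trans _ _ (\int[mu]_r ((C ^+ 2 * k.+1%:R `^ (- (4 * s * th)))%:E * (powk (1 - 2 * (alpha * th)) r * (r < t)%R%:R)%:E))%E).
  apply: ge0_le_integral => //.
  - by move=> r _; rewrite lee_fin sqr_ge0.
  - apply/measurable_EFinP; apply: measurable_funX; apply: measurable_funM; last exact: measurable_itvR.
    exact: measurable_relaxation.
  - apply: measurable_funeM; apply/measurable_EFinP; apply: measurable_indM; [exact: measurable_powk|exact: measurable_fun_ltr].
  - move=> r _; rewrite -EFinM lee_fin /powk; have [r0|_] := boolP (0 < r); last by rewrite mulr0 expr0n mul0r mulr0.
    case: (r < t); last by rewrite !mulr0 expr0n.
    rewrite !mulr1; have h := HC th k r th01 r0.
    apply: (@le_trans _ _ ((C * (k.+1%:R `^ (- (2 * s * th)) * r `^ (- (alpha * th)))) ^+ 2)).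
      by rewrite ler_sqr ?nnegrE ?relaxation_ge0 ?(le_trans _ h) ?relaxation_ge0.
    have sq (x a : R) : (x `^ a) ^+ 2 = x `^ (2 * a) by rewrite -powR_mulrn ?powR_ge0// -powRrM mulrC.
    rewrite !exprMn mulrA !sq.
    have -> : 2 * - (2 * s * th) = - (4 * s * th) by ring.
    by have -> : 1 - 2 * (alpha * th) - 1 = 2 * - (alpha * th) by ring.
rewrite ge0_integralZl//.
- by rewrite integral_powk_lt// -EFinM lee_fin le_eqVlt; apply/orP; left; apply/eqP; ring.
- apply/measurable_EFinP; apply: measurable_indM; [exact: measurable_powk|exact: measurable_fun_ltr].
- by move=> r _; rewrite lee_fin mulr_ge0 ?powk_ge0.
- by rewrite lee_fin mulr_ge0 ?sqr_ge0 ?powR_ge0.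
Qed.

(** 28 = 2 * 14, the 2 being the squared normalization of the sines. *)
Lemma pcoef_phi0_le b k : 0 < H1 <= 2^-1 ->
  (\int[mu]_xi (pcoef H1 phi0 b k xi ^+ 2)%:E <= (28 * (k.+1%:R * pi) `^ (1 - 2 * H1))%:E)%E.
Proof.
move=> H12; have [c c2 pE] := phi0_sin k.
have := space_fourier_le b H12 (ltn0Sn k); set F := (X in (\int[_]_xi (X xi ^+ 2)%:E)%E) => h.
have mF : measurable_fun setT F.
  apply: measurable_funM; first exact: measurable_powk.
  apply: (@measurable_Rintegral2 _ _ _ _ _ mu (fun w : RR * RR => sin (k.+1%:R * pi * w.2) * (0 < w.2 < 1)%R%:R * trig b (w.1 * w.2))).
  apply: measurable_funM.
    apply: (@measurableT_comp _ _ _ _ _ _ (fun y : RR => sin (k.+1%:R * pi * y) * (0 < y < 1)%R%:R)) => //.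
    by apply: measurable_funM; [exact: measurable_sinZ|exact: measurable_itvR].
  by apply: (measurableT_comp (@measurable_trig R b)); exact: measurable_funM.
have E xi : pcoef H1 phi0 b k xi = c * F xi.
  rewrite /pcoef /F mulrCA; congr (_ * _).
  have cn0 : c != 0 by apply: contra_eq_neq c2 => ->; rewrite expr0n/= eq_sym pnatr_eq0.
  have I : mu.-integrable setT (EFin \o (fun y : RR => phi0 k y * trig b (xi * y))).
    have := integrable_trig_supp b xi ltr01 (phi0_L2 k); congr (integrable _ _ _).
    by apply/funext => y /=; rewrite [in RHS]phi0_supp; congr _%:E; ring.
  rewrite -[LHS](mulVKf cn0) -(RintegralZl _ measurableT I); congr (_ * _); apply: eq_Rintegral => y _.
  by rewrite pE -!mulrA mulKf.
under eq_integral do rewrite E exprMn c2 EFinM.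
rewrite ge0_integralZl//.
- apply: (le_trans (lee_mulEFin _ h)) => //.
  by rewrite lee_fin mulrA; have -> : 2 * 14 = 28 :> R by ring.
- by apply/measurable_EFinP; exact: measurable_funX.
- by move=> xi _; rewrite lee_fin sqr_ge0.
Qed.

(** The constant of [time_fourier_le] for the time singularity alpha th. *)
Definition time_const (th : R) : R :=
  (T `^ (2 - 2 * (alpha * th)) / (2 - 2 * H2) + pi `^ (2 - 2 * (alpha * th)) / (2 * (H2 - alpha * th))) / (1 - alpha * th) ^+ 2.

Lemma time_const_ge0 (th : R) : 0 < H2 <= 2^-1 -> alpha * th < H2 -> 0 <= time_const th.
Proof.
move=> H22 ath.
have [H20 H21] : 0 < H2 /\ 2 * H2 <= 1.
  by case/andP: H22 => ? ?; split=> //; rewrite -ler_pdivlMl// mulr1.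
rewrite divr_ge0 ?sqr_ge0// addr_ge0// divr_ge0 ?powR_ge0//; first by lra.
by rewrite mulr_ge0// subr_ge0 ltW.
Qed.

Lemma ecoef_relt_le (th C : R) b k : 0 <= th -> 0 < H2 <= 2^-1 -> alpha * th < H2 -> 0 < C ->
  (forall k t, 0 < t -> rel k t <= C * (k.+1%:R `^ (- (2 * s * th)) * t `^ (- (alpha * th)))) ->
  (\int[mu]_xi (ecoef H2 relt b k xi ^+ 2)%:E <= (time_const th * C ^+ 2 * k.+1%:R `^ (- (4 * s * th)))%:E)%E.
Proof.
move=> th0 H22 ath C0 HC; case/andP: (t0T) => t0 tT; case/andP: (alpha01) => a0 _.
have ath0 : 0 <= alpha * th by rewrite mulr_ge0 ?(ltW a0).
set K := time_const th.
pose M := C * k.+1%:R `^ (- (2 * s * th)).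
have M0 : 0 <= M by rewrite mulr_ge0 ?powR_ge0 ?ltW.
pose ep (x : R) := rel k x * (0 < x < t)%R%:R.
have -> : K * C ^+ 2 * k.+1%:R `^ (- (4 * s * th)) = K * M ^+ 2.
  rewrite /M exprMn -[(k.+1%:R `^ _) ^+ 2]powR_mulrn ?powR_ge0// -powRrM.
  have -> : - (2 * s * th) * 2 = - (4 * s * th) by ring.
  by rewrite !mulrA.
have epE y : relt k y = ep (t - y).
  by rewrite /relt /ep subr_gt0 ltrBlDr ltrDl andbC.
rewrite /ecoef; under eq_integral => xi _ do under [X in (_ * X) ^+ 2]eq_Rintegral => y _ do rewrite epE.
apply: (time_fourier_le H22 ath0 ath T0 b M0 t0T).
- apply: measurable_funM; last exact: measurable_itvR.
  exact: measurable_relaxation.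
- by move=> x; rewrite mulr_ge0 ?relaxation_ge0.
- by move=> x x0; rewrite /ep ltNge x0 mulr0.
- by move=> x x0; rewrite /ep [x < t]ltNge x0 andbF mulr0.
- move=> x y x0 xy; rewrite /ep x0 (lt_le_trans x0 xy)/=; have [yt|_] := ltP y t.
    by rewrite (le_lt_trans xy yt) !mulr1; apply: relaxation_noninc_time => //; exact: ltW.
  by rewrite mulr0 mulr_ge0 ?relaxation_ge0.
- move=> x x0; rewrite /M -mulrA; apply: le_trans (HC k x x0).
  by rewrite ler_piMr ?relaxation_ge0// lern1 leq_b1.
Qed.

(** The first factor is zero on the diagonal, where the series need not converge; the limit then
    exists at every point, which gives joint measurability. *)
Definition gker0 (w : RR * (RR * RR)) : R :=
  limn (fun n => ((w.2.1 < w.1) || (w.1 < w.2.1))%R%:R * ksum phi0 relt n w.1 w.2).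

(** Dirichlet's test off the diagonal: the partial sums of phi_k(x) phi_k(y) are bounded, and e_k(t
    - r) decreases to 0 in k. *)
Lemma cvg_gker0 (w : RR * (RR * RR)) :
  ((w.2.1 < w.1) || (w.1 < w.2.1))%R%:R * ksum phi0 relt n w.1 w.2 @[n --> \oo] --> gker0 w.
Proof.
case: w => x [y r]; rewrite /gker0/=.
suff : cvgn (fun n => ((y < x) || (x < y))%R%:R * ksum phi0 relt n x (y, r)) by [].
have [->|xy] := eqVneq x y; first by rewrite !ltxx/=; under eq_fun do rewrite mul0r; exact: is_cvg_cst.
apply: is_cvgM; first exact: is_cvg_cst.
have E n : ksum phi0 relt n x (y, r) = series (fun k => (phi0 k x * phi0 k y) * relt k r) n.
  by rewrite /ksum /series/= /index_iota subn0; apply: eq_bigr => k _; rewrite /kterm/= mulrA.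
under eq_fun do rewrite E.
have Z0 : cvgn (series (fun=> 0 : R)).
  by rewrite (_ : series _ = fun=> 0); [exact: is_cvg_cst|apply/funext => n; rewrite /series/= big1].
have [x01|x01] := boolP (0 < x < 1); last first.
  have -> : (fun k => phi0 k x * phi0 k y * relt k r) = (fun=> 0).
    by apply/funext => k; rewrite /phi0 (negbTE x01) mulr0 !mul0r.
  exact: Z0.
have [y01|y01] := boolP (0 < y < 1); last first.
  have -> : (fun k => phi0 k x * phi0 k y * relt k r) = (fun=> 0).
    by apply/funext => k; rewrite /phi0 (negbTE y01) !mulr0 !mul0r.
  exact: Z0.
have [r01|r01] := boolP (0 < r < t); last first.
  have -> : (fun k => phi0 k x * phi0 k y * relt k r) = (fun=> 0).
    by apply/funext => k; rewrite /relt (negbTE r01) !mulr0.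
  exact: Z0.
have [B HB] := sum_sin_sin_le x01 y01 xy.
apply: (@dirichlet_test _ _ _ (2 * B)).
- move=> n; have -> : \sum_(k < n) phi0 k x * phi0 k y = 2 * \sum_(k < n) sin (k.+1%:R * pi * x) * sin (k.+1%:R * pi * y).
    by rewrite mulr_sumr; apply: eq_bigr => k _; rewrite phi0_sin_sin x01 y01 !mulr1.
  by rewrite normrM ger0_norm// ler_pM2l.
- by move=> k; rewrite /relt r01 !mulr1; exact: relaxation_noninc.
- rewrite /relt r01; under eq_fun do rewrite mulr1; apply: relaxation_cvg0 => //.
  by rewrite subr_gt0; case/andP: r01.
Qed.

Lemma measurable_ksum n : measurable_fun setT (fun w : RR * (RR * RR) => ksum phi0 relt n w.1 w.2).
Proof.
apply: measurable_sum => k.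
have m1 : measurable_fun setT (fun w : RR * (RR * RR) => w.2.1) by exact: measurableT_comp.
have m2 : measurable_fun setT (fun w : RR * (RR * RR) => w.2.2) by exact: measurableT_comp.
apply: measurable_funM; first exact: (measurableT_comp (measurable_phi0 k)).
by apply: measurable_funM; [exact: (measurableT_comp (measurable_phi0 k))|exact: (measurableT_comp (measurable_relt k))].
Qed.

Lemma measurable_gker0 : measurable_fun setT gker0.
Proof.
have m1 : measurable_fun setT (fun w : RR * (RR * RR) => w.2.1) by exact: measurableT_comp.
apply: (@measurable_fun_cvg _ _ _ _ (fun n (w : RR * (RR * RR)) => ((w.2.1 < w.1) || (w.1 < w.2.1))%R%:R * ksum phi0 relt n w.1 w.2)).
  move=> n; apply: measurable_funM; last exact: measurable_ksum.
  apply: measurable_bool; apply: measurable_or; exact: measurable_fun_ltr.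
by move=> w _; exact: cvg_gker0.
Qed.

(** Links the kernels occurring in the two stochastic convolutions to the measurable [gker0]; the
    excluded line z.1 = x is null in space-time. *)
Lemma gker0E N (x : R) z : 0 < x < 1 -> space_time T z -> z.1 != x ->
  (if z.2 < t then Gker alpha s lam phi (t - z.2) x z.1 else 0) -
  (if z.2 < t then GkerN alpha s lam phi N (t - z.2) x z.1 else 0) =
  gker0 (x, z) - ksum phi0 relt N x z.
Proof.
case: z => y r x01 [/=]; rewrite !in_itv/= => y01 /andP[r0 rT] yx.
have -> : gker0 (x, (y, r)) = limn (fun n => ksum phi0 relt n x (y, r)).
  by rewrite /gker0/= -neq_lt yx; under eq_fun do rewrite mul1r.
have E n : ksum phi0 relt n x (y, r) = \sum_(k <- iota 0 n) (if r < t then rel k (t - r) * phi k x * phi k y else 0).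
  apply: eq_bigr => k _; rewrite /kterm /relt /phi0/= x01 y01 r0/=; case: (r < t); rewrite ?mulr0// !mulr1; ring.
under eq_fun do rewrite E; rewrite E.
case: (r < t); last first.
  rewrite big1// (_ : (fun=> _) = fun=> 0) ?lim_cst// ?subr0//.
  by apply/funext => n; rewrite big1.
congr (_ - _).
  by rewrite /Gker; congr (limn _); apply/funext => n; rewrite /series/= /index_iota subn0.
by rewrite /GkerN -(big_mkord xpredT (fun k => rel k (t - r) * phi k x * phi k y)) /index_iota subn0.
Qed.

End kernel.

(** * Energy of the truncated kernel *)

Section kernel_error.
Variables (R : realType) (alpha s H1 H2 T th : R) (lam : nat -> R) (phi : nat -> R -> R).
Hypothesis alpha01 : 0 < alpha < 1.
Hypothesis s0 : 0 < s.
Hypothesis T0 : 0 < T.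
Hypothesis H12 : 0 < H1 <= 2^-1.
Hypothesis H22 : 0 < H2 <= 2^-1.
Hypothesis eb : dirichlet_eigenbasis lam phi.
Hypothesis th01 : 0 <= th <= 1.
Hypothesis ath : alpha * th < H2.
Hypothesis p0 : 0 < 4 * s * th + 2 * H1 - 2.
Local Notation mu := (@lebesgue_measure R).
Local Notation mm := (sprod mu mu).
Local Notation RR := (measurableTypeR R).
Local Notation relt := (relt alpha s).
Local Notation gker0 := (gker0 alpha s).

Definition kernel_diff t N (w : RR * (RR * RR)) : R := gker0 t lam phi w - ksum (phi0 phi) (relt t lam) N w.1 w.2.

Lemma ae_fst_neq (x : RR) (Q : RR * RR -> Prop) : (forall z, z.1 != x -> Q z) -> {ae mm, forall z, Q z}.
Proof.
move=> HQ; exists ([set x] `*` setT); split.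
- by apply: measurableX => //; exact: measurable_set1.
- transitivity (mu [set x] * mu [set: RR])%E; first exact: product_measure1E.
  by rewrite lebesgue_measure_set1 mul0e.
- move=> z /= nQ; split => //; apply: contrapT => /eqP zx; exact: nQ (HQ _ zx).
Qed.

(** The results on kernel series are applied to the families shifted by N. The space and time
    energies multiply to a constant times (j + N + 1)^(- p - 1) with p = 4 s th + 2 H1 - 2, whose
    sum is O((N + 1)^(- p)), uniformly in t. *)
Lemma kernel_diff_specQ : exists2 M : R, 0 <= M & forall N t, 0 <= t <= T ->
  measurable_fun setT (kernel_diff t N) /\
  measurable_fun setT (fun x : RR => specQ T H1 H2 (fun z => kernel_diff t N (x, z))) /\
  (\int[mu]_x specQ T H1 H2 (fun z => kernel_diff t N (x, z)) <=
   (M * N.+1%:R `^ (- (4 * s * th + 2 * H1 - 2)))%:E)%E.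
Proof.
have lamE k : lam k = (k.+1%:R * pi) ^+ 2 by have [] := eigenbasis_sin eb k.
have [C C0 HC] := relaxation_decay alpha01 s0 lamE.
have th0 : 0 <= th by case/andP: th01.
have HC' k t : 0 < t -> relaxation alpha s lam k t <= C * (k.+1%:R `^ (- (2 * s * th)) * t `^ (- (alpha * th))).
  exact: HC.
have K0 := time_const_ge0 T H22 ath.
have pg0 := p0; set p := 4 * s * th + 2 * H1 - 2 in pg0 *.
set K := time_const alpha H2 T th in K0.
pose D := 28 * pi `^ (1 - 2 * H1) * (K * C ^+ 2).
have D0 : 0 <= D by exact: (mulr_ge0 (mulr_ge0 (ler0n _ 28) (powR_ge0 _ _)) (mulr_ge0 K0 (sqr_ge0 C))).
exists (4 * (D * (2 `^ (p + 1) / p))).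
  exact: (mulr_ge0 (ler0n _ 4) (mulr_ge0 D0 (divr_ge0 (powR_ge0 _ _) (ltW pg0)))).
move=> N t t0T.
have mk : measurable_fun setT (kernel_diff t N).
  by apply: measurable_funB; [exact: measurable_gker0 alpha01 s0 eb|exact: measurable_ksum alpha01 eb N].
split => //.
pose pp j := phi0 phi (j + N); pose ee j := relt t lam (j + N).
have H1' : 2 * H1 <= 1 by case/andP: H12 => _ h; rewrite -ler_pdivlMl// mulr1.
have H2' : 2 * H2 <= 1 by case/andP: H22 => _ h; rewrite -ler_pdivlMl// mulr1.
have ath2 : 2 * (alpha * th) < 1 by move: ath; lra.
have [C1 C10 HC1] := relt_sqr_le alpha01 s0 t0T eb th01 ath2.
have re k : relt t lam k \in Lfun mu 2%:E.
  apply: L2_of_sqr; first by apply: measurable_relt.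
  by apply: (le_lt_trans (HC1 k)); rewrite ltry.
have eeL j : ee j \in Lfun mu 2%:E by exact: re.
(* Follows from p > 0 and H1 <= 1 / 2; it makes the squared norms of the time factors summable. *)
have pq : 0 < 4 * s * th - 1 by move: p0; rewrite /p; lra.
have sumE (f : nat -> R) n : \sum_(j < n) f (j + N)%N = \sum_(N <= k < n + N) f k.
  by rewrite -{2}[N]add0n big_addn addnK big_mkord.
have hA (b : bool) j := pcoef_phi0_le eb b (j + N) H12.
have hB (b : bool) j : (\int[mu]_xi (ecoef H2 (relt t lam) b (j + N) xi ^+ 2)%:E <=
    (K * C ^+ 2 * (j + N).+1%:R `^ (- (4 * s * th)))%:E)%E.
  exact: ecoef_relt_le.
have hE n : \sum_(j < n) dot mu (ee j) (ee j) <= C1 * (2 `^ (4 * s * th - 1 + 1) / (4 * s * th - 1) * N.+1%:R `^ (- (4 * s * th - 1))).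
  apply: (@le_trans _ _ (C1 * \sum_(j < n) (j + N).+1%:R `^ (- (4 * s * th - 1) - 1))).
    rewrite mulr_sumr; apply: ler_sum => j _; rewrite -lee_fin (EFin_dot (eeL j)).
    have -> : - (4 * s * th - 1) - 1 = - (4 * s * th) by ring.
    exact: HC1.
  rewrite ler_wpM2l// (sumE (fun k => k.+1%:R `^ (- (4 * s * th - 1) - 1))); exact: sum_powRN_le.
pose A j : R := 28 * ((j + N).+1%:R * pi) `^ (1 - 2 * H1).
pose B j : R := K * C ^+ 2 * (j + N).+1%:R `^ (- (4 * s * th)).
have hM n : \sum_(j < n) A j * B j <= D * (2 `^ (p + 1) / p * N.+1%:R `^ (- p)).
  apply: (@le_trans _ _ (D * \sum_(j < n) (j + N).+1%:R `^ (- p - 1))).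
    rewrite mulr_sumr; apply: ler_sum => j _; rewrite /A /B powRM ?pi_ge0//.
    have -> : - p - 1 = (1 - 2 * H1) + - (4 * s * th) by rewrite /p; ring.
    rewrite [X in _ <= _ * X]powRD; last by rewrite pnatr_eq0 implybT.
    by rewrite le_eqVlt; apply/orP; left; apply/eqP; rewrite /D; ring.
  rewrite ler_wpM2l// (sumE (fun k => k.+1%:R `^ (- p - 1))); exact: sum_powRN_le.
have hg (x : RR) : {ae mm, forall z, ksum pp ee n x z @[n --> \oo] --> kernel_diff t N (x, z)}.
  apply: (ae_fst_neq (x := x)) => z zx.
  have E n : ksum pp ee n x z = ksum (phi0 phi) (relt t lam) (n + N) x z - ksum (phi0 phi) (relt t lam) N x z.
    rewrite /ksum addnC iotaD add0n big_cat/= [X in _ = X - _]addrC addrK.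
    have -> : iota N n = [seq (j + N)%N | j <- iota 0 n].
      by rewrite -{1}[N]addn0 iotaDl; apply: eq_map => j; rewrite addnC.
    by rewrite big_map.
  under eq_fun do rewrite E; apply: cvgB; last exact: cvg_cst.
  have : ((z.1 < x) || (x < z.1))%R%:R * ksum (phi0 phi) (relt t lam) n x z @[n --> \oo] --> gker0 t lam phi (x, z).
    exact: cvg_gker0.
  rewrite -neq_lt zx.
  by under eq_fun do rewrite mul1r; rewrite -(cvg_shiftn N).
have po j k : dot mu (pp j) (pp k) = (j == k)%:R by rewrite (phi0_ortho eb) eqn_add2r.
have ps j x : pp j x = pp j x * (0 < x < 1)%R%:R by exact: phi0_supp.
have es j r : ee j r = ee j r * (0 < r < T)%R%:R by exact: relt_supp t0T _ _.
have pl j x : pp j x ^+ 2 <= 2 by exact: phi0_le eb _ _.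
have pL j : pp j \in Lfun mu 2%:E by exact: phi0_L2 eb _.
split.
  exact: (@measurable_specQ _ _ _ _ _ mk).
have := @kernel_series_specQ R T H1 H2 T0 pp ee pL eeL po ps es pl A B _ _ hA hB hE hM _ mk hg.
by rewrite !mulrA.
Qed.

End kernel_error.

Section stochastic_convolution.
Variables (d : measure_display) (Omega : measurableType d) (R : realType) (P : probability Omega R).
Variables (alpha s H1 H2 T th : R) (lam : nat -> R) (phi : nat -> R -> R) (W : R -> R -> Omega -> R).
Hypothesis alpha01 : 0 < alpha < 1.
Hypothesis s0 : 0 < s.
Hypothesis T0 : 0 < T.
Hypothesis H12 : 0 < H1 <= 2^-1.
Hypothesis H22 : 0 < H2 <= 2^-1.
Hypothesis eb : dirichlet_eigenbasis lam phi.
Hypothesis sW : fractional_brownian_sheet P H1 H2 T W.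
Hypothesis th01 : 0 <= th <= 1.
Hypothesis ath : alpha * th < H2.
Hypothesis p0 : 0 < 4 * s * th + 2 * H1 - 2.
Local Notation mu := (@lebesgue_measure R).
Local Notation RR := (measurableTypeR R).

(** After exchanging the expectation with the integral in x, [wiener_integral_le] applies for almost
    every x, with x itself as the exceptional abscissa. The constant serves all N, t and all
    versions of the convolutions. *)
Lemma stoch_convolution_diff : exists2 C : R, 0 <= C & forall N t Z Z', 0 <= t <= T ->
  is_stoch_convolution P W T (Gker alpha s lam phi) t Z ->
  is_stoch_convolution P W T (GkerN alpha s lam phi N) t Z' ->
  (\int[P]_w \int[@lebD R]_x ((Z w x - Z' w x) ^+ 2)%:E <=
    (C * N.+1%:R `^ (- (4 * s * th + 2 * H1 - 2)))%:E)%E.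
Proof.
have half1 : (2^-1 : R) < 1 by rewrite invf_lt1// ltr1n.
have H11 : 0 < H1 < 1 by case/andP: H12 => -> h; exact: le_lt_trans half1.
have H21 : 0 < H2 < 1 by case/andP: H22 => -> h; exact: le_lt_trans half1.
have [c1 c10 cE1] := integral_fbm_kernel H11.
have [c2 c20 cE2] := integral_fbm_kernel H21.
have [M M0 HM] := kernel_diff_specQ alpha01 s0 T0 H12 H22 eb th01 ath p0.
have k0 : 0 <= (c1 * c2)^-1 by rewrite invr_ge0 mulr_ge0 ?ltW.
exists ((c1 * c2)^-1 * M); first exact: mulr_ge0.
move=> N t Z Z' t0T [mZ hZ] [mZ' hZ']; have [mk [mS HS]] := HM N t t0T.
pose X (z : Omega * RR) : R := (Z z.1 z.2 - Z' z.1 z.2) * (0 < z.2 < 1)%R%:R.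
have mX : measurable_fun setT X.
  apply: measurable_funM; first exact: measurable_funB.
  exact: (measurableT_comp (@measurable_itvR R 0 1)).
have mX2 : measurable_fun setT (fun z => (X z ^+ 2)%:E).
  by apply/measurable_EFinP; exact: measurable_funX.
have X20 z : (0 <= (X z ^+ 2)%:E)%E by rewrite lee_fin sqr_ge0.
have -> : (\int[P]_w \int[@lebD R]_x ((Z w x - Z' w x) ^+ 2)%:E = \int[P]_w \int[mu]_x (X (w, x) ^+ 2)%:E)%E.
  apply: eq_integral => w _; rewrite ge0_integral_lebD; last 2 first.
  - apply/measurable_EFinP; apply: measurable_funX; apply: measurable_funB.
    + exact: (measurableT_comp mZ (pair1_measurable w)).
    + exact: (measurableT_comp mZ' (pair1_measurable w)).
  - by move=> x; rewrite lee_fin sqr_ge0.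
  rewrite integral_mkcond; apply: eq_integral => x _; rewrite patchE mem_setE in_itv/= /X/=.
  by case: (0 < x < 1); rewrite ?mulr1 ?mulr0 ?expr0n.
rewrite (@fubini_tonelli _ _ _ _ _ P mu (fun z => (X z ^+ 2)%:E))//.
apply: (@le_trans _ _ (\int[mu]_x (((c1 * c2)^-1)%:E * specQ T H1 H2 (fun z => kernel_diff alpha s lam phi t N (x, z))))%E).
  have Q0 x : (0 <= specQ T H1 H2 (fun z => kernel_diff alpha s lam phi t N (x, z)))%E.
    by apply: sume_ge0 => b _; apply: integral_ge0 => xi _; rewrite lee_fin sqr_ge0.
  apply: ae_ge0_le_integral => //.
  - by move=> x _; apply: integral_ge0 => w _.
  - exact: (@measurable_fun_fubini_tonelli_G _ _ _ _ _ P (fun z => (X z ^+ 2)%:E)).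
  - by move=> x _; rewrite mule_ge0.
  - exact: measurable_funeM.
  have hb := (ae_lebD _).1 hZ; have hb' := (ae_lebD _).1 hZ'.
  have FF : Filter (almost_everywhere mu) := ae_filter_ringOfSetsType mu.
  apply: (@filterS2 _ _ FF _ _ _ _ hb' hb) => x h' h _.
  rewrite /X/=; have [x01|x01] := boolP (0 < x < 1); last first.
    under eq_integral do rewrite mulr0 expr0n/=.
    by rewrite integral0 mule_ge0.
  have xin : x \in `]0, 1[ by rewrite in_itv.
  have hd := wiener_integral_sub sW (h xin) (h' xin).
  under eq_integral do rewrite mulr1.
  apply: (wiener_integral_le T0 sW cE1 cE2 c10 c20 (x0 := x) hd).
    exact: (measurableT_comp mk (pair1_measurable x)).
  by move=> z zS zx; rewrite /kernel_diff; apply: gker0E zS zx.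
rewrite ge0_integralZl//; last first.
  by move=> x _; apply: sume_ge0 => b _; apply: integral_ge0 => xi _; rewrite lee_fin sqr_ge0.
by apply: (le_trans (lee_mulEFin k0 HS)); rewrite lee_fin mulrA.
Qed.

(** The case N = 0 of the preceding estimate, where the truncated kernel is zero and 0 is a version
    of its stochastic convolution. *)
Lemma stoch_convolution_bounded : exists2 C : R, 0 <= C & forall t Z, 0 <= t <= T ->
  is_stoch_convolution P W T (Gker alpha s lam phi) t Z ->
  (\int[P]_w \int[@lebD R]_x (Z w x ^+ 2)%:E <= C%:E)%E.
Proof.
have [C C0 HC] := stoch_convolution_diff; exists C => // t Z t0T hZ.
have h0 : is_stoch_convolution P W T (GkerN alpha s lam phi 0) t (fun _ _ => 0).
  split; first exact: measurable_cst.
  apply/ae_lebD; apply: aeW => x _.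
  have -> : (fun z : R * R => if z.2 < t then GkerN alpha s lam phi 0 (t - z.2) x z.1 else 0) = (fun=> 0).
    by apply/funext => z; rewrite /GkerN big_ord0 if_same.
  split; [exact: measurable_cst|exact: measurable_cst|exists (fun=> [::])].
  split => //.
  - rewrite (_ : (fun n : nat => _) = fun=> 0%E); first exact: cvg_cst.
    apply/funext => n; rewrite /step_eval; apply: integral0_eq => z _; by rewrite big_nil subr0 expr0n.
  - rewrite (_ : (fun n : nat => _) = fun=> 0%E); first exact: cvg_cst.
    apply/funext => n; rewrite /step_wiener; apply: integral0_eq => z _; by rewrite big_nil subr0 expr0n.
have := HC 0%N t Z _ t0T hZ h0; rewrite powR1 mulr1.
by under eq_integral do (under eq_integral do rewrite subr0).
Qed.

End stochastic_convolution.

(** * Spectral multipliers *)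

Lemma cvg_le_cst (R : realType) (u : nat -> R) (l B : R) N : u n @[n --> \oo] --> l ->
  (forall n, (N <= n)%N -> u n <= B) -> l <= B.
Proof.
move=> /cvg_epsP h H; apply/ler_addgt0Pr => e /h[M HM].
have := HM (maxn N M) (leq_maxr _ _); have := H (maxn N M) (leq_maxl _ _).
by rewrite ler_norml => h1 /andP[h2 _]; lra.
Qed.

Lemma cvg_le2 (R : realType) (u v : nat -> R) (l l' : R) : u n @[n --> \oo] --> l -> v n @[n --> \oo] --> l' ->
  (forall n, u n <= v n) -> l <= l'.
Proof.
move=> hu hv H; rewrite -subr_le0; apply: (@cvg_le_cst _ (fun n => u n - v n) _ _ 0%N); first exact: cvgB.
by move=> n _; rewrite subr_le0.
Qed.

Lemma lincombB d (T : measurableType d) (R : realType) (p : nat -> T -> R) (a : nat -> R) (i j : nat) x : (i <= j)%N ->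
  lincomb p a j x - lincomb p a i x = lincomb p (fun k => a k * (i <= k)%N%:R) j x.
Proof.
move=> ij; rewrite /lincomb.
rewrite -!(big_mkord xpredT (fun k => a k * p k x)) -(big_mkord xpredT (fun k => a k * (i <= k)%N%:R * p k x)).
rewrite (big_cat_nat (leq0n i) ij)/= addrAC subrr add0r.
rewrite [RHS](big_cat_nat (leq0n i) ij)/= [X in _ = X + _]big_nat_cond [X in _ = X + _]big1 ?add0r; last first.
  by move=> k /andP[/andP[_ ki] _]; rewrite leqNgt ki mulr0 mul0r.
by apply: eq_big_nat => k /andP[-> _]; rewrite mulr1.
Qed.

Section orthonormal_series.
Context d (T : measurableType d) (R : realType) (m : {measure set T -> \bar R}).
Variable p : nat -> T -> R.
Hypothesis p2 : forall k, p k \in Lfun m 2%:E.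
Hypothesis po : forall j k, dot m (p j) (p k) = (j == k)%:R.

Lemma lincomb_cvg (a : nat -> R) (S : R) : (forall n, \sum_(k < n) a k ^+ 2 <= S) ->
  exists2 g, g \in Lfun m 2%:E & nrm m (fun x => lincomb p a n x - g x) @[n --> \oo] --> 0.
Proof.
move=> aS; have l2 n : lincomb p a n \in Lfun m 2%:E by exact: L2_lincomb.
pose s := series (fun k => a k ^+ 2).
have sE n : s n = \sum_(k < n) a k ^+ 2 by rewrite /s/series/= big_mkord.
have snd : nondecreasing_seq s by apply: nondecreasing_series => k _ _; exact: sqr_ge0.
have cs : cvgn s by apply: nondecreasing_is_cvgn => //; exists S => _ [n _ <-]; rewrite sE.
have nE i j : (i <= j)%N -> nrm m (fun x => lincomb p a j x - lincomb p a i x) ^+ 2 = s j - s i.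
  move=> ij; under eq_fun do rewrite lincombB//.
  rewrite (sqr_nrm_lincomb p2 po) !sE -!(big_mkord xpredT (fun k => a k ^+ 2)).
  rewrite -(big_mkord xpredT (fun k => (a k * (i <= k)%N%:R) ^+ 2)).
  rewrite [X in X - _](big_cat_nat (leq0n i) ij)/= addrAC subrr add0r.
  rewrite (big_cat_nat (leq0n i) ij)/= [X in X + _]big_nat_cond big1 ?add0r; last first.
    by move=> k /andP[/andP[_ ki] _]; rewrite leqNgt ki mulr0 expr0n.
  by apply: eq_big_nat => k /andP[-> _]; rewrite mulr1.
have [g g2 Hg] : exists2 g, g \in Lfun m 2%:E & forall e : R, 0 < e -> exists N, forall n, (N <= n)%N ->
    nrm m (fun x => lincomb p a n x - g x) <= e.
  apply: L2_complete => // e e0; have /cvg_epsP/(_ (e ^+ 2 / 2)) := cs.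
  rewrite divr_gt0 ?exprn_gt0// => /(_ isT)[N HN]; exists N.
  have main i j : (N <= i)%N -> (i <= j)%N -> nrm m (fun x => lincomb p a j x - lincomb p a i x) <= e.
    move=> Ni ij; rewrite -ler_sqr ?nnegrE ?nrm_ge0 ?(ltW e0)// nE//.
    have h1 := HN i Ni; have h2 := HN j (leq_trans Ni ij).
    rewrite (splitr (e ^+ 2)) -(subrK (limn s) (s j)) -addrA lerD//.
      exact: le_trans (ler_norm _) h2.
    by apply: le_trans (ler_norm _) _; rewrite distrC.
  move=> i j Ni Nj; have [ij|/ltnW ij] := leqP i j; last exact: main.
  by rewrite nrm_distC//; exact: main.
exists g => //; apply/cvg_epsP => e e0; have [N HN] := Hg e e0; exists N => n /HN.
by rewrite subr0 ger0_norm ?nrm_ge0.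
Qed.

Lemma nrm_cvg (v : nat -> T -> R) (g : T -> R) : (forall n, v n \in Lfun m 2%:E) -> g \in Lfun m 2%:E ->
  nrm m (fun x => v n x - g x) @[n --> \oo] --> 0 -> nrm m (v n) @[n --> \oo] --> nrm m g.
Proof.
move=> v2 g2 /cvg_epsP h; apply/cvg_epsP => e /h[N HN]; exists N => n /HN.
rewrite subr0 ger0_norm ?nrm_ge0// => hn; apply: le_trans hn.
rewrite ler_norml; apply/andP; split.
  rewrite lerNl opprB lerBlDr.
  have -> : nrm m g = nrm m (fun x => (g x - v n x) + v n x) by congr nrm; apply/funext => x; rewrite subrK.
  by rewrite nrm_distC// nrmD//; exact: L2B.
rewrite lerBlDr.
have {1}-> : v n = (fun x => (v n x - g x) + g x) by apply/funext => x; rewrite subrK.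
by rewrite nrmD//; exact: L2B.
Qed.

Lemma nrmB_cvg (F F' : nat -> T -> R) (G G' : T -> R) : (forall n, F n \in Lfun m 2%:E) ->
  (forall n, F' n \in Lfun m 2%:E) -> G \in Lfun m 2%:E -> G' \in Lfun m 2%:E ->
  nrm m (fun x => F n x - G x) @[n --> \oo] --> 0 -> nrm m (fun x => F' n x - G' x) @[n --> \oo] --> 0 ->
  nrm m (fun x => F n x - F' n x) @[n --> \oo] --> nrm m (fun x => G x - G' x).
Proof.
move=> A A' S2 S2' h h'.
apply: (nrm_cvg (fun n => L2B (A n) (A' n)) (L2B S2 S2')).
apply: (@squeeze_cvgr _ _ _ _ (fun=> 0) (fun n => nrm m (fun x => F n x - G x) + nrm m (fun x => F' n x - G' x))).
- near=> n; rewrite nrm_ge0/=.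
  have -> : (fun x => F n x - F' n x - (G x - G' x)) = (fun x => (F n x - G x) - (F' n x - G' x)).
    by apply/funext => x; ring.
  exact: (nrmB (L2B (A n) S2) (L2B (A' n) S2')).
- exact: cvg_cst.
- by rewrite -(addr0 0); apply: cvgD.
Unshelve. all: by end_near.
Qed.

Lemma dot_cvg (v : nat -> T -> R) (g w : T -> R) : (forall n, v n \in Lfun m 2%:E) -> g \in Lfun m 2%:E -> w \in Lfun m 2%:E ->
  nrm m (fun x => v n x - g x) @[n --> \oo] --> 0 -> dot m (v n) w @[n --> \oo] --> dot m g w.
Proof.
move=> v2 g2 w2 /cvg_epsP h; apply/cvg_epsP => e e0.
have M0 : 0 < nrm m w + 1 by rewrite ltr_wpDl ?nrm_ge0.
have [N HN] := h _ (divr_gt0 e0 M0); exists N => n /HN.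
rewrite subr0 ger0_norm ?nrm_ge0// => hn; rewrite -dotBl//.
have d2 := L2B (v2 n) g2.
have cs : `|dot m (fun x => v n x - g x) w| <= nrm m (fun x => v n x - g x) * nrm m w.
  by rewrite ler_norml cauchy_schwarz// andbT lerNl -dotNl// -(nrmN d2) cauchy_schwarz//; exact: L2N.
apply: (le_trans cs); rewrite -(divfK (lt0r_neq0 M0) e).
by apply: ler_pM; rewrite ?nrm_ge0// lerDl.
Qed.

End orthonormal_series.

(** * Diagonal operators in the eigenbasis *)

Section multipliers.
Variables (R : realType) (phi : nat -> R -> R).
Local Notation lebD := (@lebD R).
Local Notation L2 := (Lfun lebD 2%:E).
Local Notation nD := (nrm lebD).
Hypothesis phi2 : forall k, phi k \in L2.
Hypothesis phio : forall j k, dot lebD (phi j) (phi k) = (j == k)%:R.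

(** At a fixed time t, [SopN] and [Sop] are [multN] and [mult] with coefficients
    [relaxation k t]. *)
Definition multN (c : nat -> R) N v : R -> R := fun x => \sum_(k < N) c k * dotD v (phi k) * phi k x.
Definition mult (c : nat -> R) v : R -> R := L2sum (fun k x => c k * dotD v (phi k) * phi k x).

Lemma multNE c N v : multN c N v = lincomb phi (fun k => c k * dot lebD v (phi k)) N.
Proof. by []. Qed.

Lemma multN_L2 c N v : multN c N v \in L2.
Proof. by rewrite multNE; apply: L2_lincomb. Qed.

Lemma sqr_nrm_multN c N v : nD (multN c N v) ^+ 2 = \sum_(k < N) (c k * dot lebD v (phi k)) ^+ 2.
Proof. by rewrite multNE (sqr_nrm_lincomb phi2 phio). Qed.

Lemma multNB c N v v' : v \in L2 -> v' \in L2 ->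
  (fun x => multN c N v x - multN c N v' x) = multN c N (fun x => v x - v' x).
Proof.
move=> v2 v'2; apply/funext => x; rewrite /multN -sumrB; apply: eq_bigr => k _.
by rewrite !dotDE dotBl// mulrBr mulrBl.
Qed.

Lemma multN_scale (K : R) (c c' : nat -> R) N v : 0 <= K -> (forall k, 0 <= c k <= K * c' k) ->
  nD (multN c N v) <= K * nD (multN c' N v).
Proof.
move=> K0 H; rewrite -ler_sqr ?nnegrE ?mulr_ge0 ?nrm_ge0// exprMn !sqr_nrm_multN mulr_sumr.
apply: ler_sum => k _; have /andP[H1 H2] := H k.
have -> : K ^+ 2 * (c' k * dot lebD v (phi k)) ^+ 2 = (K * c' k) ^+ 2 * dot lebD v (phi k) ^+ 2 by ring.
rewrite [leLHS]exprMn ler_wpM2r ?sqr_ge0//.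
by rewrite ler_sqr ?nnegrE ?(le_trans H1 H2).
Qed.

(** Removes the projection from the Galerkin equation, so that both equations carry the same
    nonlinearity. *)
Lemma multN_projN c N v : multN c N (projN phi N v) = multN c N v.
Proof.
apply/funext => x; apply: eq_bigr => k _; congr (_ * _ * _).
rewrite dotDE (_ : projN phi N v = lincomb phi (fun k => dot lebD v (phi k)) N)//.
by rewrite (dot_lincomb_p phi2 phio) ltn_ord.
Qed.

Section contraction.
Variable c : nat -> R.
Hypothesis c01 : forall k, 0 <= c k <= 1.

Lemma multN_le N v : v \in L2 -> nD (multN c N v) <= nD v.
Proof.
move=> v2; rewrite -ler_sqr ?nnegrE ?nrm_ge0// sqr_nrm_multN (le_trans _ (bessel phi2 phio N v2))//.
apply: ler_sum => k _; have /andP[c0 c1] := c01 k.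
by rewrite exprMn ler_piMl ?sqr_ge0// expr_le1.
Qed.

(** Bessel's inequality and completeness of L^2 provide a sum, so [L2sum] does not return its
    default value. *)
Lemma mult_spec v : v \in L2 ->
  mult c v \in L2 /\ nD (fun x => multN c n v x - mult c v x) @[n --> \oo] --> 0.
Proof.
move=> v2.
have [g g2 gl] : exists2 g, g \in L2 & nD (fun x => multN c n v x - g x) @[n --> \oo] --> 0.
  apply: (@lincomb_cvg _ _ _ lebD phi phi2 phio (fun k => c k * dot lebD v (phi k)) (nD v ^+ 2)) => n.
  by rewrite -sqr_nrm_multN ler_sqr ?nnegrE ?nrm_ge0// multN_le.
have eE h : h \in L2 -> (fun n => normD (fun x => \sum_(k < n) c k * dotD v (phi k) * phi k x - h x)) =
    (fun n => (nD (fun x => multN c n v x - h x))%:E).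
  move=> h2; apply/funext => n; exact: (Lnorm_nrm (L2B (multN_L2 c n v) h2)).
have [] := @xgetPex _ (cst 0) [set g : R -> R | g \in @L2D R /\
    normD (fun x => \sum_(k < n) (c k * dotD v (phi k) * phi k x) - g x) @[n --> \oo] --> 0%E].
  exists g; split => //=; rewrite eE//; apply: cvg_EFin; first exact: nearW.
  exact: gl.
rewrite -/(mult c v) => S2; rewrite eE// => /fine_cvgP[_ h]; split => //.
Qed.

Lemma mult_cvg v : v \in L2 -> nD (multN c n v) @[n --> \oo] --> nD (mult c v).
Proof.
move=> v2; have [S2 h] := mult_spec v2; exact: nrm_cvg (fun n => multN_L2 c n v) S2 h.
Qed.

Lemma mult_le v : v \in L2 -> nD (mult c v) <= nD v.
Proof. by move=> v2; apply: (cvg_le_cst (N := 0%N) (mult_cvg v2)) => n _; exact: multN_le. Qed.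

Lemma multB_cvg v v' : v \in L2 -> v' \in L2 ->
  nD (multN c n (fun x => v x - v' x)) @[n --> \oo] --> nD (fun x => mult c v x - mult c v' x).
Proof.
move=> v2 v'2; under eq_fun do rewrite -multNB//.
have [S2 h] := mult_spec v2; have [S2' h'] := mult_spec v'2.
exact: (nrmB_cvg (multN_L2 c ^~ v) (multN_L2 c ^~ v') S2 S2' h h').
Qed.

Lemma mult_lip v v' : v \in L2 -> v' \in L2 ->
  nD (fun x => mult c v x - mult c v' x) <= nD (fun x => v x - v' x).
Proof.
move=> v2 v'2; apply: (cvg_le_cst (N := 0%N) (multB_cvg v2 v'2)) => n _; apply: multN_le; exact: L2B.
Qed.

(** As the numbering starts at 0, the first omitted coefficient is c N, and it is the largest of the
    tail. *)
Lemma mult_multN N v : v \in L2 -> (forall j k, (j <= k)%N -> c k <= c j) ->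
  nD (fun x => mult c v x - multN c N v x) <= c N * nD v.
Proof.
move=> v2 cmono; have [S2 h] := mult_spec v2.
have A n := multN_L2 c n v.
have cv : nD (fun x => multN c n v x - multN c N v x) @[n --> \oo] --> nD (fun x => mult c v x - multN c N v x).
  apply: (nrm_cvg (fun n => L2B (A n) (A N)) (L2B S2 (A N))).
  have E n : (fun x => multN c n v x - multN c N v x - (mult c v x - multN c N v x)) = (fun x => multN c n v x - mult c v x).
    by apply/funext => x; ring.
  by under eq_fun do rewrite E.
apply: (cvg_le_cst (N := N) cv) => n Nn; have /andP[c0 _] := c01 N.
rewrite -ler_sqr ?nnegrE ?mulr_ge0 ?nrm_ge0//.
have -> : (fun x => multN c n v x - multN c N v x) = lincomb phi (fun k => c k * dot lebD v (phi k) * (N <= k)%N%:R) n.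
  by apply/funext => x; rewrite !multNE lincombB.
rewrite (sqr_nrm_lincomb phi2 phio) exprMn; apply: le_trans (ler_wpM2l (sqr_ge0 _) (bessel phi2 phio n v2)).
rewrite mulr_sumr; apply: ler_sum => k _; rewrite !exprMn; have /andP[ck _] := c01 k.
case: leqP => Nk; last by rewrite expr0n mulr0; apply: mulr_ge0; exact: sqr_ge0.
by rewrite expr1n mulr1 ler_wpM2r ?sqr_ge0// ler_sqr ?nnegrE// cmono.
Qed.

End contraction.

Lemma mult_scale (K : R) (c c' : nat -> R) v : (forall k, 0 <= c k <= 1) -> (forall k, 0 <= c' k <= 1) ->
  0 <= K -> (forall k, c k <= K * c' k) -> v \in L2 -> nD (mult c v) <= K * nD (mult c' v).
Proof.
move=> c01 c01' K0 H v2.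
have h : K * nD (multN c' n v) @[n --> \oo] --> K * nD (mult c' v).
  by apply: cvgM; [exact: cvg_cst|exact: mult_cvg].
apply: (cvg_le2 (mult_cvg c01 v2) h) => n; apply: multN_scale => // k.
by rewrite H andbT; case/andP: (c01 k).
Qed.

(** A dense family indexed by a countable type. *)
Definition qcomb (l : seq rat) : R -> R := lincomb phi (fun k => ratr (nth 0 l k)) (size l).

Lemma qcomb_L2 l : qcomb l \in L2.
Proof. by apply: L2_lincomb. Qed.

(** The expansion of v converges to some g with the same coefficients, and completeness of the
    eigenbasis gives v = g almost everywhere; it remains to truncate and to round the
    coefficients. *)
Lemma qcomb_dense v (e : R) : (forall v, v \in L2 ->
    (forall k, dotD v (phi k) = 0) -> {ae lebD, forall x, v x = 0}) ->
  v \in L2 -> 0 < e -> exists l, nD (fun x => v x - qcomb l x) <= e.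
Proof.
move=> total v2 e0; pose b k := dot lebD v (phi k).
have [g g2 gl] : exists2 g, g \in L2 & nD (fun x => lincomb phi b n x - g x) @[n --> \oo] --> 0.
  by apply: (lincomb_cvg phi2 phio (S := nD v ^+ 2)) => n; exact: bessel.
have l2 a n : lincomb phi a n \in L2 by apply: L2_lincomb.
have vg2 := L2B v2 g2.
have vg : nD (fun x => v x - g x) = 0.
  have vgp k : dotD (fun x => v x - g x) (phi k) = 0.
    rewrite dotDE dotBl//; apply/eqP; rewrite subr_eq0; apply/eqP.
    apply: (cvg_unique _ _ (dot_cvg (l2 b) g2 (phi2 k) gl)) => //.
    apply: cvg_near_cst; exists k.+1 => // n /= kn.
    by rewrite (dot_lincomb_p phi2 phio) kn.
  have ae0 := total _ vg2 vgp.
  apply/eqP; rewrite -sqrf_eq0 sqr_nrm; apply/eqP.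
  by rewrite (dot_ae vg2 (L2_0 lebD) vg2)// dot0l.
have /cvg_epsP/(_ _ (divr_gt0 e0 (ltr0Sn R 1)))[n Hn] := gl.
have := Hn n (leqnn n); rewrite subr0 ger0_norm ?nrm_ge0// => hn.
(* Rounding n coefficients by at most [dl] changes the norm by at most sqrt(n) dl <= e / 2. *)
pose dl : R := e / 2 / n.+1%:R.
have dl0 : 0 < dl by rewrite !divr_gt0.
have /choice[q Hq] : forall k, exists q : rat, `|b k - ratr q| <= dl.
  move=> k; have [|q] := @rat_in_itvoo R (b k - dl) (b k + dl); first by rewrite ltrD2l gtrN.
  rewrite in_itv/= => /andP[h1 h2]; exists q; rewrite ler_norml; apply/andP; split; lra.
exists (mkseq q n).
have qE : qcomb (mkseq q n) = lincomb phi (fun k => ratr (q k)) n.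
  apply/funext => x; rewrite /qcomb size_mkseq; apply: eq_bigr => k _; rewrite nth_mkseq//.
rewrite qE (splitr e).
have -> : (fun x => v x - lincomb phi (fun k => ratr (q k)) n x) =
  (fun x => (v x - g x) + ((g x - lincomb phi b n x) + lincomb phi (fun k => b k - ratr (q k)) n x)).
  apply/funext => x; rewrite [X in _ = _ + (_ + X)](_ : _ = lincomb phi b n x - lincomb phi (fun k => ratr (q k)) n x); first by ring.
  by rewrite /lincomb -sumrB; apply: eq_bigr => k _; rewrite mulrBl.
apply: (le_trans (nrmD vg2 (L2_add (L2B g2 (l2 b n)) (l2 _ n)))); rewrite vg add0r.
apply: (le_trans (nrmD (L2B g2 (l2 b n)) (l2 _ n))); rewrite nrm_distC// lerD//.
rewrite -ler_sqr ?nnegrE ?nrm_ge0//; last by rewrite divr_ge0 ?ltW.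
rewrite (sqr_nrm_lincomb phi2 phio).
apply: (@le_trans _ _ (\sum_(k < n) dl ^+ 2)).
  by apply: ler_sum => k _; rewrite -real_normK ?num_real// ler_sqr ?nnegrE ?(ltW dl0).
rewrite sumr_const card_ord -[_ *+ n]mulr_natl.
have -> : e / 2 = n.+1%:R * dl by rewrite /dl [RHS]mulrC divfK.
rewrite [leRHS]exprMn; apply: ler_wpM2r; first exact: sqr_ge0.
by rewrite -natrX ler_nat; nia.
Qed.

End multipliers.

(** * Norm bounds for Bochner integrals *)

(** [f] stands for a norm along a Bochner integrand, whose measurability is unknown. The integral is
    a supremum over simple functions below it, so discarding the null set from the measurable [g]
    suffices. *)
Lemma lower_integral_le d (T : measurableType d) (R : realType) (m : {measure set T -> \bar R})
    (D : set T) (g f : T -> \bar R) : measurable D -> measurable_fun D g ->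
  (forall x, 0 <= g x)%E -> (forall x, 0 <= f x)%E ->
  {ae m, forall x, D x -> (g x <= f x)%E} ->
  (\int[m]_(x in D) g x <= \int[m]_(x in D) f x)%E.
Proof.
move=> mD mg g0 f0 [N [mN N0 NH]].
rewrite (@ge0_negligible_integral _ _ _ m D N g)//.
rewrite [leLHS]integral_mkcond [leRHS]integral_mkcond.
rewrite !ge0_integralTE; last 2 first.
- by move=> x; apply: erestrict_ge0.
- by move=> x; apply: erestrict_ge0.
apply: le_ereal_sup => y [h hg <-]; exists h => //= x; apply: (le_trans (hg x)).
rewrite !patchE; case: ifPn => [|_]; last by case: ifPn.
rewrite inE => -[Dx Nx]; rewrite mem_set//.
by apply: contrapT => /negP nle; apply: Nx; apply: NH => /= /(_ Dx); exact/negP.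
Qed.

Lemma Rintegral_ord_sum d (T : measurableType d) (R : realType) (m : {measure set T -> \bar R})
    (D : set T) (F : nat -> T -> R) n : measurable D ->
  (forall i, m.-integrable D (EFin \o F i)) ->
  m.-integrable D (EFin \o (fun x => \sum_(i < n) F i x)) /\
  \int[m]_(x in D) (\sum_(i < n) F i x) = \sum_(i < n) \int[m]_(x in D) F i x.
Proof.
move=> mD FI; elim: n => [|n [IH1 IH2]].
  have -> : (fun x => \sum_(i < 0) F i x) = (fun=> 0) by apply/funext => x; rewrite big_ord0.
  by rewrite big_ord0 /Rintegral integral0; split => //; exact: integrable0.
have -> : (fun x => \sum_(i < n.+1) F i x) = (fun x => \sum_(i < n) F i x + F n x).
  by apply/funext => x; rewrite big_ord_recr.
rewrite big_ord_recr/= -IH2 -RintegralD//; split => //.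
exact: (integrableD mD IH1 (FI n)).
Qed.

Section bochner.
Variables (R : realType) (t : R).
Hypothesis t0 : 0 <= t.
Local Notation mu := (@lebesgue_measure R).
Local Notation lebD := (@lebD R).
Local Notation L2 := (Lfun lebD 2%:E).
Local Notation nD := (nrm lebD).
Local Notation D := (`]0, t[%classic : set R).
Let mD : measurable D. Proof. exact: measurable_itv. Qed.

Section simple.
Variable h : simple_data R.
Hypothesis hw : simple_wf h.
Let A i := (nth (set0, cst 0) h i).1.
Let v i := (nth (set0, cst 0) h i).2.
Let n := size h.

Lemma simple_measurable i : measurable (A i).
Proof.
have [i_lt|i_ge] := ltnP i (size h); first by have [] := hw i_lt.
by rewrite /A nth_default//=; exact: measurable0.
Qed.

Lemma simple_L2 i : v i \in L2.
Proof.
have [i_lt|i_ge] := ltnP i (size h); first by have [] := hw i_lt.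
by rewrite /v nth_default//; exact: L2_0.
Qed.

Lemma simple_evalE r : simple_eval h r = lincomb v (fun i => \1_(A i) r) n.
Proof. by apply/funext => x; rewrite /simple_eval (big_nth (set0, cst 0)) big_mkord. Qed.

Lemma simple_intE : simple_int t h = lincomb v (fun i => fine (mu (A i `&` D))) n.
Proof. by apply/funext => x; rewrite /simple_int (big_nth (set0, cst 0)) big_mkord. Qed.

Lemma simple_eval_L2 r : simple_eval h r \in L2.
Proof. by rewrite simple_evalE; apply: L2_lincomb; exact: simple_L2. Qed.

Lemma simple_int_L2 : simple_int t h \in L2.
Proof. by rewrite simple_intE; apply: L2_lincomb; exact: simple_L2. Qed.

Lemma dot_simple_eval r w : w \in L2 -> dot lebD (simple_eval h r) w = \sum_(i < n) \1_(A i) r * dot lebD (v i) w.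
Proof. by move=> w2; rewrite simple_evalE dot_lincomb//; exact: simple_L2. Qed.

Lemma measurable_simple_dot w : w \in L2 -> measurable_fun setT (fun r : R => dot lebD (simple_eval h r) w).
Proof.
move=> w2; under eq_fun do rewrite dot_simple_eval//.
apply: measurable_sum => i; apply: measurable_funM => //.
by apply: measurable_indic; exact: simple_measurable.
Qed.

Lemma measurable_simple_nrm : measurable_fun setT (fun r : R => nD (simple_eval h r)).
Proof.
apply: (measurableT_comp (f := @Num.sqrt R)); first by apply: continuous_measurable_fun; exact: sqrt_continuous.
have -> : (fun r => dot lebD (simple_eval h r) (simple_eval h r)) =
    (fun r => \sum_(i < n) \1_(A i) r * dot lebD (simple_eval h r) (v i)).
  apply/funext => r; rewrite dot_simple_eval ?simple_eval_L2//.
  by apply: eq_bigr => i _; rewrite dotC.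
apply: measurable_sum => i; apply: measurable_funM.
  by apply: measurable_indic; exact: simple_measurable.
exact: measurable_simple_dot (simple_L2 i).
Qed.

Lemma simple_nrm_le r : nD (simple_eval h r) <= \sum_(i < n) nD (v i).
Proof.
rewrite simple_evalE; have v2 := simple_L2; elim: n => [|k IH].
  rewrite big_ord0 (_ : lincomb _ _ _ = fun=> 0); first by rewrite /nrm (dot0l lebD (fun=> 0)) sqrtr0.
  by apply/funext => x; rewrite /lincomb big_ord0.
rewrite big_ord_recr/= (_ : lincomb _ _ _ = fun x => lincomb v (fun i => \1_(A i) r) k x + \1_(A k) r * v k x); last first.
  by apply/funext => x; rewrite /lincomb big_ord_recr.
apply: (le_trans (nrmD (L2_lincomb v2 (fun i => \1_(A i) r) k) (L2Z _ (v2 k)))).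
apply: lerD => //; rewrite nrmZ// ler_piMl ?nrm_ge0//.
by rewrite indicE; case: (_ \in _); rewrite ?normr1 ?normr0.
Qed.

Lemma simple_nrm_integral_lty : (\int[mu]_(r in D) (nD (simple_eval h r))%:E < +oo)%E.
Proof.
apply: (@le_lt_trans _ _ (\int[mu]_(r in D) (cst (\sum_(i < n) nD (v i))%:E r))%E).
  apply: ge0_le_integral => //.
  - by move=> r _; rewrite lee_fin nrm_ge0.
  - by apply/measurable_EFinP; apply: measurable_funS measurable_simple_nrm.
  - by move=> r _; rewrite lee_fin simple_nrm_le.
rewrite integral_cst//= lebesgue_measure_itv/= lte_fin; case: ifP => _.
  by rewrite -EFinB -EFinM ltry.
by rewrite mule0 ltry.
Qed.

(** Pairing the integral J with itself gives ||J||^2 = \int (h(r), J) dr <= ||J|| \int ||h(r)|| dr;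
    the sets of the simple function need not be made disjoint. *)
Lemma simple_int_le : ((nD (simple_int t h))%:E <= \int[mu]_(r in D) (nD (simple_eval h r))%:E)%E.
Proof.
have J2 := simple_int_L2; set J := simple_int t h in J2 *.
have [J0|J0] := eqVneq (nD J) 0.
  by rewrite J0; apply: integral_ge0 => r _; rewrite lee_fin nrm_ge0.
have Jp : 0 < nD J by rewrite lt_neqAle eq_sym J0 nrm_ge0.
have Af i : (mu (A i `&` D) < +oo)%E.
  apply: (@le_lt_trans _ _ (mu D)).
    by apply: le_measure; rewrite ?inE//; apply: measurableI => //; exact: simple_measurable.
  by rewrite lebesgue_measure_itv/= lte_fin; case: ifP => _; rewrite ?ltry// -EFinB ltry.
have I1 : mu.-integrable D (EFin \o (fun r => nD (simple_eval h r))).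
  apply/integrableP; split; first by apply/measurable_EFinP; apply: measurable_funS measurable_simple_nrm.
  apply: le_lt_trans simple_nrm_integral_lty; apply: ge0_le_integral => //.
  - by apply/measurable_EFinP; apply: measurableT_comp => //; apply: measurable_funS measurable_simple_nrm.
  - by apply/measurable_EFinP; apply: measurable_funS measurable_simple_nrm.
  - by move=> r _ /=; rewrite lee_fin ger0_norm ?nrm_ge0.
have I3 i : mu.-integrable D (EFin \o \1_(A i)).
  apply/integrableP; split.
    by apply/measurable_EFinP; apply: measurable_funTS; apply: measurable_indic; exact: simple_measurable.
  under eq_integral do rewrite /= ger0_norm//.
  have mA := simple_measurable i.
  by rewrite integral_indic//; exact: Af.
have I2 i : mu.-integrable D (EFin \o (fun r => \1_(A i) r * dot lebD (v i) J)).
  have -> : EFin \o (fun r => \1_(A i) r * dot lebD (v i) J) = (fun r => (dot lebD (v i) J)%:E * (\1_(A i) r)%:E)%E.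
    by apply/funext => r /=; rewrite -EFinM mulrC.
  exact: integrableZl (I3 i).
have sumE := @Rintegral_ord_sum _ (measurableTypeR R) R mu D _ n mD I2.
have E : nD J ^+ 2 = \int[mu]_(r in D) dot lebD (simple_eval h r) J.
  rewrite sqr_nrm {1}/J simple_intE dot_lincomb//; last exact: simple_L2.
  under eq_Rintegral do rewrite dot_simple_eval//.
  rewrite sumE.2; apply: eq_bigr => i _.
  rewrite (_ : (fun r => \1_(A i) r * dot lebD (v i) J) = (fun r => dot lebD (v i) J * \1_(A i) r)); last first.
    by apply/funext => r; rewrite mulrC.
  rewrite (@RintegralZl _ (measurableTypeR R) R mu D (\1_(A i)) _ mD (I3 i)).
  have mA := simple_measurable i.
  by rewrite mulrC /Rintegral integral_indic.
have h1 : nD J ^+ 2 <= nD J * \int[mu]_(r in D) nD (simple_eval h r).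
  rewrite E -RintegralZl//; apply: le_Rintegral => //.
  - have := sumE.1; congr (integrable _ _ _).
    by apply/funext => r /=; rewrite dot_simple_eval.
  - rewrite (_ : _ \o _ = (fun r => (nD J)%:E * (EFin \o (fun r => nD (simple_eval h r))) r)%E); last by apply/funext.
    exact: integrableZl.
  - move=> r _; rewrite mulrC; apply: cauchy_schwarz => //; exact: simple_eval_L2.
have -> : (\int[mu]_(r in D) (nD (simple_eval h r))%:E = (\int[mu]_(r in D) nD (simple_eval h r))%:E)%E.
  by rewrite /Rintegral fineK//; exact: integrable_fin_num.
by rewrite lee_fin -(ler_pM2l Jp) -expr2.
Qed.

End simple.

Definition simple_sub (h h' : simple_data R) : simple_data R :=
  h ++ [seq (q.1, (fun x => - q.2 x)) | q <- h'].

Lemma simple_sub_wf h h' : simple_wf h -> simple_wf h' -> simple_wf (simple_sub h h').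
Proof.
move=> hw hw' i; rewrite size_cat size_map nth_cat => ilt; case: ltnP => ih; first exact: hw.
have ih' : (i - size h < size h')%N by rewrite ltn_subLR.
rewrite (nth_map (set0, cst 0))//=; have [m1 m2] := hw' _ ih'; split => //; exact: L2N.
Qed.

Lemma simple_sub_eval h h' r x : simple_eval (simple_sub h h') r x = simple_eval h r x - simple_eval h' r x.
Proof.
rewrite /simple_eval big_cat big_map/= -sumrN; congr (_ + _); apply: eq_bigr => q _; by rewrite mulrN.
Qed.

Lemma simple_sub_int h h' x : simple_int t (simple_sub h h') x = simple_int t h x - simple_int t h' x.
Proof.
rewrite /simple_int big_cat big_map/= -sumrN; congr (_ + _); apply: eq_bigr => q _; by rewrite mulrN.
Qed.

(* [e n] is a measurable version of the norm of [F - h n], the limit of the norms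
   of [h m - h n]. *)
Lemma bochner_approx F I : is_bochner_integral t F I -> exists h : nat -> simple_data R, exists e : nat -> R -> \bar R,
  [/\ forall n, simple_wf (h n),
      (forall n, measurable_fun setT (e n)) /\ (forall n r, 0 <= e n r)%E,
      {ae mu, forall r, r \in `]0, t[ -> F r \in L2 /\ forall n, (nD (fun x => F r x - simple_eval (h n) r x))%:E = e n r},
      (\int[mu]_(r in D) e n r)%E @[n --> \oo] --> 0%E &
      nD (fun x => simple_int t (h n) x - I x) @[n --> \oo] --> 0].
Proof.
move=> [F2 I2 [h [hw hF hE hI]]].
pose q n m (r : R) : \bar R := (nD (fun x => simple_eval (h m) r x - simple_eval (h n) r x))%:E.
pose e n (r : R) := limn_einf (fun m => q n m r).
have mq n m : measurable_fun setT (q n m).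
  apply/measurable_EFinP; rewrite (_ : (fun r => _) = (fun r => nD (simple_eval (simple_sub (h m) (h n)) r))).
    by apply: measurable_simple_nrm; exact: simple_sub_wf.
  by apply/funext => r; congr nrm; apply/funext => x; rewrite simple_sub_eval.
have q0 n m r : (0 <= q n m r)%E by rewrite lee_fin nrm_ge0.
have me n : measurable_fun setT (e n) by exact: measurable_limn_einf.
have e0 n r : (0 <= e n r)%E.
  by rewrite /e limn_einf_lim; apply: lime_ge; [exact: is_cvg_einfs|apply: nearW => k; apply: le_ereal_inf_tmp => _ [m _ <-]; exact: q0].
have eE : {ae mu, forall r, r \in `]0, t[ -> F r \in L2 /\ forall n, (nD (fun x => F r x - simple_eval (h n) r x))%:E = e n r}.
  have FF : Filter (almost_everywhere mu) := ae_filter_ringOfSetsType mu.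
  apply: (@filterS2 _ _ FF _ _ _ _ F2 hF) => r h1 h2 r0t.
  have Fr := h1 r0t; split => // n; have hL k : simple_eval (h k) r \in L2 by exact: simple_eval_L2.
  have c1 : nD (fun x => simple_eval (h m) r x - F r x) @[m --> \oo] --> 0.
    have := h2 r0t; rewrite (_ : (fun _ => _) = (fun m => (nD (fun x => simple_eval (h m) r x - F r x))%:E)).
      by move/fine_cvgP => [].
    by apply/funext => m; rewrite /normD (Lnorm_nrm (L2B Fr (hL m))) nrm_distC.
  have c0 : nD (fun x => simple_eval (h n) r x - simple_eval (h n) r x) @[m --> \oo] --> 0.
    rewrite (_ : nD _ = 0); first exact: cvg_cst.
    rewrite (_ : (fun x => _) = fun=> 0); first by rewrite /nrm (dot0l lebD (fun=> 0)) sqrtr0.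
    by apply/funext => x; rewrite subrr.
  have c2 := nrmB_cvg hL (fun=> hL n) Fr (hL n) c1 c0.
  have c3 : q n m r @[m --> \oo] --> (nD (fun x => F r x - simple_eval (h n) r x))%:E.
    by apply: cvg_EFin; [exact: nearW|exact: c2].
  rewrite /e is_cvg_limn_einfE; first by apply/esym/cvg_lim.
  by apply/cvg_ex; exists (nD (fun x => F r x - simple_eval (h n) r x))%:E.
exists h, e; split => //.
- have n0 n : (0 <= \int[mu]_(r in D) normD (fun x => (F r x - simple_eval (h n) r x)%R))%E.
    by apply: integral_ge0 => r _; exact: Lnorm_ge0.
  apply/cvge0_epsP; first by move=> n; exact: integral_ge0.
  move=> ep ep0; have [N HN] := (cvge0_epsP n0).2 hE ep ep0; exists N => n /HN; apply: le_trans.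
  apply: lower_integral_le => //.
  + exact: (measurable_funTS (me n)).
  + by move=> r; exact: Lnorm_ge0.
  have FF : Filter (almost_everywhere mu) := ae_filter_ringOfSetsType mu.
  apply: (@filterS _ _ FF _ _ _ eE) => r H Dr; have r0t : r \in `]0, t[ by rewrite inE.
  have [Fr /(_ n) <-] := H r0t; rewrite /normD Lnorm_nrm//; apply: L2B => //; exact: simple_eval_L2.
- have := hI; rewrite (_ : (fun _ => _) = (fun n => (nD (fun x => simple_int t (h n) x - I x))%:E)).
    by move/fine_cvgP => [].
  by apply/funext => n; rewrite /normD Lnorm_nrm//; apply: L2B => //; exact: simple_int_L2.
Qed.

(** ||F|| is at most the norm of a simple function, which is bounded, plus an approximation error
    with finite integral. The measurable minorant [A] is what can be integrated. *)
Lemma bochner_lty F I (A : R -> \bar R) : is_bochner_integral t F I ->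
  measurable_fun setT A -> (forall r, 0 <= A r)%E ->
  {ae mu, forall r, r \in `]0, t[ -> F r \in L2 -> (A r <= (nD (F r))%:E)%E} ->
  (\int[mu]_(r in D) A r < +oo)%E.
Proof.
move=> /bochner_approx[h [e [hw [me e0] Fe eI _]]] mA A0 AF.
have [|N HN] := (cvge0_epsP _).2 eI 1 ltr01; first by move=> n; exact: integral_ge0.
have m1 := measurable_simple_nrm (hw N).
apply: (@le_lt_trans _ _ (\int[mu]_(r in D) ((nD (simple_eval (h N) r))%:E + e N r))%E).
  apply: ae_ge0_le_integral => //.
  - exact: measurable_funTS.
  - by move=> r _; rewrite adde_ge0// lee_fin nrm_ge0.
  - by apply: measurable_funTS; apply: emeasurable_funD; [exact/measurable_EFinP|exact: me].
  have FF : Filter (almost_everywhere mu) := ae_filter_ringOfSetsType mu.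
  apply: (@filterS2 _ _ FF _ _ _ _ Fe AF) => r h1 h2 Dr; have r0t : r \in `]0, t[ by rewrite inE.
  have [Fr /(_ N) <-] := h1 r0t; apply: (le_trans (h2 r0t Fr)); rewrite -EFinD lee_fin.
  have hL : simple_eval (h N) r \in L2 by exact: simple_eval_L2.
  apply: le_trans (nrmD hL (L2B Fr hL)); rewrite le_eqVlt; apply/orP; left; apply/eqP; congr nrm.
  by apply/funext => x; rewrite addrC subrK.
rewrite ge0_integralD//.
- apply: lte_add_pinfty; first exact: simple_nrm_integral_lty.
  by apply: le_lt_trans (HN N (leqnn N)) _; rewrite ltry.
- by move=> r _; rewrite lee_fin nrm_ge0.
- by apply: measurable_funTS; exact/measurable_EFinP.
- exact: (measurable_funTS (me N)).
Qed.

(** Both integrals are replaced by simple ones at a late common index; the four approximation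
    errors, two in the integrands and two in the integrals, are each at most ep / 4. *)
Lemma bochner_diff_le F I F' I' (B : R -> \bar R) : is_bochner_integral t F I -> is_bochner_integral t F' I' ->
  measurable_fun setT B -> (forall r, 0 <= B r)%E ->
  {ae mu, forall r, r \in `]0, t[ -> F r \in L2 -> F' r \in L2 -> ((nD (fun x => F r x - F' r x))%:E <= B r)%E} ->
  ((nD (fun x => I x - I' x))%:E <= \int[mu]_(r in D) B r)%E.
Proof.
move=> bF bF'; have [_ I2 _] := bF; have [_ I2' _] := bF'; move: bF bF'.
move=> /bochner_approx[h [e [hw [me e0] Fe eI hI]]] /bochner_approx[h' [e' [hw' [me' e0'] Fe' eI' hI']]] mB B0 FB.
apply/lee_addgt0Pr => ep ep0; have ep4 : 0 < ep / 4 by rewrite divr_gt0.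
have [|N1 H1] := (cvge0_epsP _).2 eI _ ep4; first by move=> n; exact: integral_ge0.
have [|N2 H2] := (cvge0_epsP _).2 eI' _ ep4; first by move=> n; exact: integral_ge0.
have [N3 H3] := (cvg_epsP _ _).2 hI _ ep4; have [N4 H4] := (cvg_epsP _ _).2 hI' _ ep4.
pose N := maxn (maxn N1 N2) (maxn N3 N4).
have {}H1 := H1 N (leq_trans (leq_maxl _ _) (leq_maxl _ _)).
have {}H2 := H2 N (leq_trans (leq_maxr _ _) (leq_maxl _ _)).
have {}H3 := H3 N (leq_trans (leq_maxl _ _) (leq_maxr _ _)).
have {}H4 := H4 N (leq_trans (leq_maxr _ _) (leq_maxr _ _)).
rewrite subr0 ger0_norm ?nrm_ge0// in H3; rewrite subr0 ger0_norm ?nrm_ge0// in H4.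
have wf := simple_sub_wf (hw N) (hw' N); set hh := simple_sub (h N) (h' N) in wf.
have J2 := simple_int_L2 (hw N); have J2' := simple_int_L2 (hw' N).
have step : (\int[mu]_(r in D) (nD (simple_eval hh r))%:E <= \int[mu]_(r in D) B r + (ep / 4 + ep / 4)%:E)%E.
  apply: (@le_trans _ _ (\int[mu]_(r in D) (B r + (e N r + e' N r)))%E).
    apply: ae_ge0_le_integral => //.
    - by move=> r _; rewrite lee_fin nrm_ge0.
    - by apply: measurable_funTS; apply/measurable_EFinP; exact: measurable_simple_nrm.
    - by move=> r _; rewrite !adde_ge0.
    - by apply: measurable_funTS; exact: (emeasurable_funD mB (emeasurable_funD (me N) (me' N))).
    have FF : Filter (almost_everywhere mu) := ae_filter_ringOfSetsType mu.
    apply: (@filterS3 _ _ FF _ _ _ _ _ Fe Fe' FB) => r h1 h2 h3 Dr; have r0t : r \in `]0, t[ by rewrite inE.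
    have [Fr /(_ N) <-] := h1 r0t; have [Fr' /(_ N) <-] := h2 r0t.
    have hL : simple_eval (h N) r \in L2 by exact: simple_eval_L2.
    have hL' : simple_eval (h' N) r \in L2 by exact: simple_eval_L2.
    apply: le_trans (leeD (h3 r0t Fr Fr') (lexx _)); rewrite -!EFinD lee_fin.
    have -> : simple_eval hh r = (fun x => (F r x - F' r x) + ((simple_eval (h N) r x - F r x) - (simple_eval (h' N) r x - F' r x))).
      by apply/funext => x; rewrite simple_sub_eval; ring.
    apply: (le_trans (nrmD (L2B Fr Fr') (L2B (L2B hL Fr) (L2B hL' Fr')))); rewrite lerD2l.
    apply: (le_trans (nrmB (L2B hL Fr) (L2B hL' Fr'))).
    by rewrite (nrm_distC hL Fr) (nrm_distC hL' Fr').
  rewrite ge0_integralD//; last 3 first.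
  - exact: measurable_funTS.
  - by move=> r _; rewrite adde_ge0.
  - by apply: measurable_funTS; exact: (emeasurable_funD (me N) (me' N)).
  rewrite leeD2l// ge0_integralD//; [|exact: (measurable_funTS (me N))|exact: (measurable_funTS (me' N))].
  by rewrite EFinD; exact: leeD.
have tri : nD (fun x => I x - I' x) <= nD (simple_int t hh) + (ep / 4 + ep / 4).
  have -> : (fun x => I x - I' x) = (fun x => simple_int t hh x + ((I x - simple_int t (h N) x) - (I' x - simple_int t (h' N) x))).
    by apply/funext => x; rewrite simple_sub_int; ring.
  apply: (le_trans (nrmD (simple_int_L2 wf) (L2B (L2B I2 J2) (L2B I2' J2')))); rewrite lerD2l.
  apply: (le_trans (nrmB (L2B I2 J2) (L2B I2' J2'))).
  by rewrite (nrm_distC I2 J2) (nrm_distC I2' J2') lerD.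
apply: (@le_trans _ _ ((nD (simple_int t hh))%:E + (ep / 4 + ep / 4)%:E)%E); first by rewrite -EFinD lee_fin.
have -> : (ep%:E = (ep / 4 + ep / 4)%:E + (ep / 4 + ep / 4)%:E)%E by rewrite -EFinD; congr _%:E; lra.
by rewrite addeA; apply: leeD => //; apply: le_trans (simple_int_le wf) step.
Qed.

Lemma bochner0 : is_bochner_integral t (fun _ _ => 0) (fun=> 0).
Proof.
have z0 : normD (fun=> 0 : R) = 0%E by rewrite /normD (Lnorm_nrm (L2_0 lebD)) /nrm (dot0l lebD (fun=> 0)) sqrtr0.
split; [by apply: aeW => r _; exact: L2_0|exact: L2_0|exists (fun=> [::])].
have E1 r : (fun x => 0 - simple_eval [::] r x) = (fun=> 0 : R).
  by apply/funext => x; rewrite /simple_eval big_nil subr0.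
split => //.
- by apply: aeW => r _; rewrite E1 z0; exact: cvg_cst.
- rewrite (_ : (fun _ => _) = fun=> 0%E); first exact: cvg_cst.
  by apply/funext => n; apply: integral0_eq => r _; rewrite E1.
- rewrite (_ : (fun _ => _) = fun=> 0%E); first exact: cvg_cst.
  apply/funext => n; rewrite -z0; congr normD.
  by apply/funext => x; rewrite /simple_int big_nil subr0.
Qed.

Lemma bochner_le F I (B : R -> \bar R) : is_bochner_integral t F I ->
  measurable_fun setT B -> (forall r, 0 <= B r)%E ->
  {ae mu, forall r, r \in `]0, t[ -> F r \in L2 -> ((nD (F r))%:E <= B r)%E} ->
  ((nD I)%:E <= \int[mu]_(r in D) B r)%E.
Proof.
move=> bF mB B0 FB.
have s0 (v : R -> R) : (fun x => v x - 0) = v by apply/funext => x; rewrite subr0.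
have := bochner_diff_le bF bochner0 mB B0; rewrite s0; apply.
have FF : Filter (almost_everywhere mu) := ae_filter_ringOfSetsType mu.
by apply: (@filterS _ _ FF _ _ _ FB) => r H r0t Fr _; rewrite s0; exact: H.
Qed.

End bochner.

(** * Stochastic Gronwall inequality *)

Lemma lee_sqr_add (R : realType) (x : R) (a b : \bar R) : 0 <= x -> (0 <= a)%E -> (0 <= b)%E ->
  (x%:E <= a + b)%E -> ((x ^+ 2)%:E <= 2%:E * (a * a) + 2%:E * (b * b))%E.
Proof.
move=> x0; case: a => [a| |]//; case: b => [b| |]//; rewrite ?lee_fin => a0 b0.
- move=> xab.
  apply: (@le_trans _ _ ((a + b) ^+ 2)); first by rewrite ler_sqr ?nnegrE// addr_ge0.
  by have := sqr_ge0 (a - b); nra.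
- by move=> _; rewrite mulyy gt0_muley ?lte_fin// -EFinM addey ?leey// -EFinM.
- by move=> _; rewrite mulyy gt0_muley ?lte_fin// -EFinM addye ?leey// -EFinM.
- by move=> _; rewrite mulyy gt0_muley ?lte_fin// addye ?leey.
Qed.

(** Young's inequality h <= c / 2 + h^2 / (2 c) is integrated against rho with c free, which leaves
    room for infinite integrals. *)
Lemma weighted_cauchy_schwarz d (T : measurableType d) (R : realType) (m : {measure set T -> \bar R})
    (rho h : T -> R) (K : R) : measurable_fun setT rho -> measurable_fun setT h ->
  (forall x, 0 <= rho x) -> (forall x, 0 <= h x) -> 0 < K ->
  (\int[m]_x (rho x)%:E <= K%:E)%E ->
  ((\int[m]_x (rho x * h x)%:E) * (\int[m]_x (rho x * h x)%:E) <=
   K%:E * \int[m]_x (rho x * h x ^+ 2)%:E)%E.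
Proof.
move=> mr mh r0 h0 K0 rK; set b := (\int[m]_x (rho x * h x)%:E)%E; set B := (\int[m]_x (rho x * h x ^+ 2)%:E)%E.
have b0 : (0 <= b)%E by apply: integral_ge0 => x _; rewrite lee_fin mulr_ge0.
have B0 : (0 <= B)%E by apply: integral_ge0 => x _; rewrite lee_fin mulr_ge0// sqr_ge0.
have key (c : R) : 0 < c -> (b <= (c / 2)%:E * K%:E + (2 * c)^-1%:E * B)%E.
  move=> c0; have c2 : 0 <= c / 2 by rewrite divr_ge0// ltW.
  have c3 : 0 <= (2 * c)^-1 by rewrite invr_ge0 mulr_ge0// ltW.
  apply: (@le_trans _ _ (\int[m]_x ((c / 2)%:E * (rho x)%:E + (2 * c)^-1%:E * (rho x * h x ^+ 2)%:E))%E).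
    apply: ge0_le_integral => //.
    - by move=> x _; rewrite lee_fin mulr_ge0.
    - by apply/measurable_EFinP; exact: measurable_funM.
    - apply: emeasurable_funD; apply: measurable_funeM; apply/measurable_EFinP => //.
      by apply: measurable_funM => //; exact: measurable_funX.
    - move=> x _; rewrite -!EFinM -EFinD lee_fin.
      have -> : c / 2 * rho x + (2 * c)^-1 * (rho x * h x ^+ 2) = rho x * (h x + (2 * c)^-1 * (h x - c) ^+ 2).
        by field; rewrite gt_eqF.
      by rewrite ler_wpM2l// lerDl mulr_ge0// sqr_ge0.
  rewrite ge0_integralD//; last 4 first.
  - by move=> x _; rewrite -EFinM lee_fin mulr_ge0.
  - by apply: measurable_funeM; exact/measurable_EFinP.
  - by move=> x _; rewrite -EFinM lee_fin; apply: mulr_ge0 => //; apply: mulr_ge0 => //; exact: sqr_ge0.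
  - apply: measurable_funeM; apply/measurable_EFinP; apply: measurable_funM => //; exact: measurable_funX.
  rewrite !ge0_integralZl//; [| |by move=> x _; rewrite lee_fin; apply: mulr_ge0 => //; exact: sqr_ge0| |by move=> x _; rewrite lee_fin].
  - by apply: leeD => //; apply: lee_wpmul2l; rewrite ?lee_fin.
  - apply/measurable_EFinP; apply: measurable_funM => //; exact: measurable_funX.
  - exact/measurable_EFinP.
case: B B0 key => [B| |] //; last first.
  by move=> _ _; rewrite gt0_muley ?lte_fin// leey.
rewrite lee_fin => B0 key.
(* Any c shows that b is finite once B is. *)
have := key 1 ltr01; case: b b0 key => [b| |]//.
rewrite lee_fin => b0 key _; rewrite -!EFinM lee_fin.
have [->|bn0] := eqVneq b 0; first by rewrite mul0r mulr_ge0// ltW.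
have bp : 0 < b by rewrite lt_neqAle eq_sym bn0.
(* The choice c = b / K turns the first term into b / 2, which is absorbed on the left. *)
have := key (b / K) (divr_gt0 bp K0); rewrite -!EFinM -EFinD lee_fin => h2.
have h3 : b <= b / 2 + K * B / (2 * b).
  by apply: le_trans h2 _; rewrite le_eqVlt; apply/orP; left; apply/eqP; field; rewrite !gt_eqF.
have : b * (2 * b) <= (b / 2 + K * B / (2 * b)) * (2 * b) by rewrite ler_pM2r// mulr_gt0.
have -> : (b / 2 + K * B / (2 * b)) * (2 * b) = b * b + K * B by field; rewrite gt_eqF.
lra.
Qed.

Section gronwall.
Variables (R : realType) (L T : R).
Hypothesis L0 : 0 < L.
Hypothesis T0 : 0 < T.
Local Notation mu := (@lebesgue_measure R).
Local Notation RR := (measurableTypeR R).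

Lemma integral_itv_ind (f : RR -> R) (a b : R) :
  (\int[mu]_(r in `]a, b[) (f r)%:E = \int[mu]_r (f r * (a < r < b)%R%:R)%:E)%E.
Proof.
rewrite integral_mkcond; apply: eq_integral => r _; rewrite patchE mem_setE in_itv/=.
by case: (a < r < b); rewrite ?mulr1 ?mulr0.
Qed.

Lemma exp_tail (r : R) : (\int[mu]_t (expR (- (2 * L * t)) * L * (r < t)%R%:R)%:E <= (expR (- (2 * L * r)) / 2)%:E)%E.
Proof.
have L2 : 0 < 2 * L by rewrite mulr_gt0.
have me : measurable_fun setT (fun t : RR => expR (- (2 * L * t))).
  apply: (measurableT_comp (f := @expR R)); first exact: measurable_expR.
  by apply: measurableT_comp => //; exact: measurable_funM.
have -> : (expR (- (2 * L * r)) / 2)%:E = (2^-1%:E * \int[mu]_(t in `[r, +oo[) ((2 * L) * expR (- ((2 * L) * t)))%:E)%E.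
  by rewrite integral_expRN_le// -EFinM mulrC.
rewrite -ge0_integralZl//; last 2 first.
- by apply: measurable_funTS; apply/measurable_EFinP; exact: measurable_funM.
- by move=> t _; rewrite lee_fin; apply: mulr_ge0; [exact: ltW|exact: expR_ge0].
rewrite [leRHS]integral_mkcond.
apply: ge0_le_integral => //.
- by move=> t _; rewrite lee_fin; apply: mulr_ge0 => //; apply: mulr_ge0; [exact: expR_ge0|exact: ltW].
- apply/measurable_EFinP; apply: measurable_funM; first exact: measurable_funM.
  by apply: measurable_bool; exact: measurable_fun_ltr.
- apply/(measurable_restrictT (fun t : RR => (2^-1%:E * (2 * L * expR (- (2 * L * t)))%:E)%E)) => //.
  by apply: measurable_funTS; apply: measurable_funeM; apply/measurable_EFinP; exact: measurable_funM.
- move=> t _; rewrite patchE mem_setE in_itv/= andbT.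
  have [rt|rt] := ltP r t; last first.
    by rewrite mulr0; case: (r <= t) => //; rewrite -EFinM lee_fin; apply: mulr_ge0 => //; apply: mulr_ge0; [exact: ltW|exact: expR_ge0].
  rewrite (ltW rt) mulr1 -EFinM lee_fin le_eqVlt; apply/orP; left; apply/eqP; by field.
Qed.

(** The inequality is multiplied by exp(- 2 L t) and integrated. By Tonelli and [exp_tail] the
    memory term is at most half of the weighted integral of y; it can be absorbed because that
    integral is finite by assumption. Removing the weight costs exp(2 L T). *)
Lemma gronwall (y eta : RR -> R) : measurable_fun setT y -> measurable_fun setT eta ->
  (forall r, 0 <= y r) -> (forall r, 0 <= eta r) ->
  (\int[mu]_(r in `]0%R, T[) (y r)%:E < +oo)%E ->
  (forall t, 0 < t < T -> ((y t)%:E <= (eta t)%:E + L%:E * \int[mu]_(r in `]0%R, t[) (y r)%:E)%E) ->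
  (\int[mu]_(r in `]0%R, T[) (y r)%:E <= (2 * expR (2 * L * T))%:E * \int[mu]_(r in `]0%R, T[) (eta r)%:E)%E.
Proof.
move=> my meta y0 e0 ylty H.
pose W (t : R) := expR (- (2 * L * t)).
have W0 t : 0 < W t by exact: expR_gt0.
have W1 t : 0 <= t -> W t <= 1 by move=> t0; rewrite -[leRHS]expR0 ler_expR oppr_le0; apply: mulr_ge0 => //; apply: mulr_ge0 => //; exact: ltW.
have mW : measurable_fun setT (W : RR -> R).
  apply: (measurableT_comp (f := @expR R)); first exact: measurable_expR.
  by apply: measurableT_comp => //; exact: measurable_funM.
have mI (a b : R) := @measurable_itvR R a b.
pose A := (\int[mu]_r (W r * y r * (0 < r < T)%R%:R)%:E)%E.
pose F (z : RR * RR) : R := (W z.1 * L * (z.2 < z.1)%R%:R) * (y z.2 * (0 < z.2 < T)%R%:R).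
have F0 z : 0 <= F z by rewrite !mulr_ge0 ?(ltW L0) ?(ltW (W0 _)).
have mF : measurable_fun setT F.
  apply: measurable_funM; last by apply: measurable_funM; [exact: measurableT_comp|exact: (measurableT_comp (mI 0 T))].
  apply: measurable_funM; first by apply: measurable_funM => //; exact: (measurableT_comp mW).
  by apply: measurable_bool; exact: measurable_fun_ltr.
have mF2 : measurable_fun setT (fun z => (F z)%:E) by exact/measurable_EFinP.
have A0 : (0 <= A)%E by apply: integral_ge0 => r _; rewrite lee_fin !mulr_ge0 ?(ltW (W0 _)).
have mWy : measurable_fun setT (fun r : RR => W r * y r * (0 < r < T)%R%:R).
  exact: (measurable_funM (measurable_funM mW my) (mI 0 T)).
have Alty : (A < +oo)%E.
  apply: le_lt_trans ylty; rewrite integral_itv_ind; apply: ge0_le_integral => //.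
  - by move=> r _; rewrite lee_fin !mulr_ge0 ?(ltW (W0 _)).
  - exact/measurable_EFinP.
  - by apply/measurable_EFinP; exact: (measurable_funM my (mI 0 T)).
  - move=> r _; rewrite lee_fin; case: (boolP (0 < r < T)) => [/andP[r0 _]|_]; last by rewrite !mulr0.
    by rewrite !mulr1 ler_piMl// W1// ltW.
have FA : (\int[mu]_t \int[mu]_r (F (t, r))%:E <= 2^-1%:E * A)%E.
  rewrite (@fubini_tonelli _ _ _ _ _ mu mu (fun z => (F z)%:E))//.
  rewrite -ge0_integralZl//; last 2 first.
  - exact/measurable_EFinP.
  - by move=> r _; rewrite lee_fin !mulr_ge0 ?(ltW (W0 _)).
  apply: ge0_le_integral => //.
  - by move=> r _; apply: integral_ge0 => t _; rewrite lee_fin.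
  - exact: (@measurable_fun_fubini_tonelli_G _ _ _ _ _ mu (fun z => (F z)%:E)).
  - by apply: measurable_funeM; exact/measurable_EFinP.
  - move=> r _; rewrite /F/=; set Y := y r * _.
    have Y0 : 0 <= Y by rewrite mulr_ge0.
    under eq_integral do rewrite mulrC EFinM.
    rewrite ge0_integralZl//; last 2 first.
    + apply/measurable_EFinP; apply: measurable_funM; first exact: measurable_funM.
      by apply: measurable_bool; exact: measurable_fun_ltr.
    + by move=> t _; rewrite lee_fin !mulr_ge0 ?(ltW L0) ?(ltW (W0 _)).
    apply: (le_trans (lee_mulEFin Y0 (exp_tail r))); rewrite -EFinM lee_fin /Y /W le_eqVlt; apply/orP; left; apply/eqP; ring.
have AE : (A <= \int[mu]_(r in `]0%R, T[) (eta r)%:E + 2^-1%:E * A)%E.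
  apply: (@le_trans _ _ (\int[mu]_t ((eta t * (0 < t < T)%R%:R)%:E + \int[mu]_r (F (t, r))%:E))%E).
    apply: ge0_le_integral => //.
    - by move=> r _; rewrite lee_fin !mulr_ge0 ?(ltW (W0 _)).
    - exact/measurable_EFinP.
    - apply: emeasurable_funD; first by apply/measurable_EFinP; exact: (measurable_funM meta (mI 0 T)).
      exact: (@measurable_fun_fubini_tonelli_F _ _ _ _ _ mu (fun z => (F z)%:E)).
    - move=> t _; have F1 : (0 <= \int[mu]_r (F (t, r))%:E)%E by apply: integral_ge0 => r _; rewrite lee_fin.
      case: (boolP (0 < t < T)) => [t0T|_]; last by rewrite !mulr0 add0e.
      have /andP[t0 tT] := t0T.
      have -> : (\int[mu]_r (F (t, r))%:E = (W t)%:E * (L%:E * \int[mu]_(r in `]0%R, t[) (y r)%:E))%E.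
        rewrite integral_itv_ind muleA -EFinM -ge0_integralZl//; last 3 first.
        + by apply/measurable_EFinP; exact: (measurable_funM my (mI 0 t)).
        + by move=> r _; rewrite lee_fin mulr_ge0.
        + by rewrite lee_fin mulr_ge0 ?(ltW L0) ?(ltW (W0 _)).
        apply: eq_integral => r _; rewrite /F/= -EFinM; congr _%:E; rewrite -!mulrA; congr (_ * (_ * _)).
        have [rt|tr] := ltP r t; last by rewrite andbF mul0r mulr0.
        by rewrite (lt_trans rt tT) mul1r.
      rewrite !mulr1; apply: (@le_trans _ _ ((W t)%:E * ((eta t)%:E + L%:E * \int[mu]_(r in `]0%R, t[) (y r)%:E))%E).
        by rewrite EFinM; apply: lee_wpmul2l; [rewrite lee_fin ltW|exact: H].
      rewrite ge0_muleDr; last first.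
        by rewrite mule_ge0 ?lee_fin ?(ltW L0)//; apply: integral_ge0 => r _; rewrite lee_fin.
        by rewrite lee_fin.
      by apply: leeD => //; rewrite -EFinM lee_fin ler_piMl// W1// ltW.
  rewrite ge0_integralD//; last 4 first.
  - by move=> r _; rewrite lee_fin mulr_ge0.
  - by apply/measurable_EFinP; exact: (measurable_funM meta (mI 0 T)).
  - by move=> t _; apply: integral_ge0 => r _; rewrite lee_fin.
  - exact: (@measurable_fun_fubini_tonelli_F _ _ _ _ _ mu (fun z => (F z)%:E)).
  by rewrite -integral_itv_ind leeD2l.
have A2 : (A <= 2%:E * \int[mu]_(r in `]0%R, T[) (eta r)%:E)%E.
  move: AE; have : (0 <= \int[mu]_(r in `]0%R, T[) (eta r)%:E)%E by apply: integral_ge0 => r _; rewrite lee_fin.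
  case: (\int[mu]_(r in `]0%R, T[) (eta r)%:E)%E => [a| |]//; last by move=> _ _; rewrite gt0_muley ?lte_fin// leey.
  have : A \is a fin_num by rewrite ge0_fin_numE.
  by case: A {A0 Alty FA} => [b| |]// _; rewrite -!EFinM -EFinD !lee_fin; lra.
rewrite EFinM [(2%:E * _)%E]muleC -muleA.
apply: (@le_trans _ _ ((expR (2 * L * T))%:E * A)%E); last by apply: lee_wpmul2l => //; rewrite lee_fin expR_ge0.
rewrite integral_itv_ind -ge0_integralZl//; last 2 first.
- exact/measurable_EFinP.
- by move=> r _; rewrite lee_fin !mulr_ge0 ?(ltW (W0 _)).
apply: ge0_le_integral => //.
- by move=> r _; rewrite lee_fin mulr_ge0.
- by apply/measurable_EFinP; exact: (measurable_funM my (mI 0 T)).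
- by apply: measurable_funeM; exact/measurable_EFinP.
- move=> r _; rewrite -EFinM lee_fin; case: (boolP (0 < r < T)) => [/andP[r0 rT]|_]; last by rewrite !mulr0.
  rewrite !mulr1 mulrA /W -expRD ler_peMl// -[leLHS]expR0 ler_expR.
  by rewrite subr_ge0 ler_pM2l ?(ltW rT)// mulr_gt0.
Qed.

Lemma measurable_running_integral d (Omega : measurableType d) (y : Omega * RR -> R) : measurable_fun setT y ->
  (forall z, 0 <= y z) ->
  measurable_fun setT (fun z : Omega * RR => \int[mu]_(r in `]0%R, z.2[) (y (z.1, r))%:E)%E.
Proof.
move=> my y0; pose F (q : (Omega * RR) * RR) : R := y (q.1.1, q.2) * (0 < q.2 < q.1.2)%R%:R.
have m11 : measurable_fun setT (fun q : (Omega * RR) * RR => q.1.1) by exact: measurableT_comp.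
have m12 : measurable_fun setT (fun q : (Omega * RR) * RR => q.1.2) by exact: measurableT_comp.
have m2 : measurable_fun setT (fun q : (Omega * RR) * RR => q.2) by exact: measurable_snd.
have mF : measurable_fun setT F.
  apply: measurable_funM.
    exact: (measurableT_comp my (measurable_fun_pair m11 m2)).
  apply: measurable_bool; apply: measurable_and; apply: measurable_fun_ltr => //.
rewrite (_ : (fun z => _) = (fun z => \int[mu]_r (F (z, r))%:E)%E).
  apply: (@measurable_fun_fubini_tonelli_F _ _ _ _ _ mu (fun q => (F q)%:E)); first exact/measurable_EFinP.
  by move=> q; rewrite lee_fin mulr_ge0.
by apply/funext => z; rewrite (integral_itv_ind (fun r => y (z.1, r))).
Qed.

(** The bound with g holds off a null set depending on t, so no path need satisfy it at all times.
    The excess [eta], the positive part of y - L \int y, is jointly measurable, satisfies the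
    integral inequality at every time on almost every path, and has second moment at most K at each
    time. Pathwise Gronwall controls \int y by \int eta, whose second moment follows from
    Cauchy-Schwarz and Tonelli. *)
Lemma stochastic_gronwall d (Omega : measurableType d) (P : probability Omega R) (y : Omega * RR -> R) (K : R) :
  measurable_fun setT y -> (forall z, 0 <= y z) -> 0 <= K ->
  {ae P, forall w, (\int[mu]_(r in `]0%R, T[) (y (w, r))%:E < +oo)%E} ->
  (forall t, 0 <= t <= T -> exists G : Omega -> \bar R,
     [/\ measurable_fun setT G, (forall w, 0 <= G w)%E, (\int[P]_w G w <= K%:E)%E &
      {ae P, forall w, exists g : \bar R, [/\ (0 <= g)%E, (g * g <= G w)%E &
        ((y (w, t))%:E <= g + L%:E * \int[mu]_(r in `]0%R, t[) (y (w, r))%:E)%E]}]) ->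
  forall t, 0 <= t <= T ->
  (\int[P]_w (y (w, t) ^+ 2)%:E <= (K * (2 + 2 * (L * (2 * expR (2 * L * T))) ^+ 2 * T ^+ 2))%:E)%E.
Proof.
move=> my y0 K0 yfin H.
have mY := measurable_running_integral my y0.
pose Y (z : Omega * RR) : \bar R := (\int[mu]_(r in `]0%R, z.2[) (y (z.1, r))%:E)%E.
have Y0 z : (0 <= Y z)%E by apply: integral_ge0 => r _; rewrite lee_fin.
pose eta (z : Omega * RR) : R := Num.max 0 (y z - L * fine (Y z)).
have eta0 z : 0 <= eta z by rewrite le_max lexx.
have meta : measurable_fun setT eta.
  apply: measurable_maxr; first exact: measurable_cst.
  apply: measurable_funB => //; apply: measurable_funM => //.
  by apply: measurableT_comp => //; exact: fine_measurable.
have Yle w t : t <= T -> (Y (w, t) <= Y (w, T))%E.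
  move=> tT; apply: ge0_subset_integral => //.
  - by apply/measurable_EFinP; apply: measurable_funTS; exact: measurableT_comp.
  - by move=> r _; rewrite lee_fin.
  - by move=> r /=; rewrite !in_itv/= => /andP[-> rt]; exact: lt_le_trans tT.
have eta2 t : 0 <= t <= T -> (\int[P]_w (eta (w, t) ^+ 2)%:E <= K%:E)%E.
  move=> t0T; have [G [mG G0 GK aeG]] := H t t0T; apply: le_trans GK.
  apply: ae_ge0_le_integral => //.
  - by move=> w _; rewrite lee_fin sqr_ge0.
  - by apply/measurable_EFinP; apply: measurable_funX; exact: measurableT_comp.
  apply: filterS2 yfin aeG => w yw [g [g0 gG yg]] _; apply: le_trans gG.
  have Yf : Y (w, t) \is a fin_num.
    by rewrite ge0_fin_numE//; apply: le_lt_trans yw; apply: Yle; case/andP: t0T.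
  move: yg; rewrite -/(Y (w, t)) -(fineK Yf); case: g g0 => [g| |]//.
    rewrite lee_fin -!EFinM -EFinD !lee_fin => g0 yg; rewrite -expr2 ler_sqr ?nnegrE//.
    by rewrite ge_max g0/= lerBlDr.
  by move=> _ _; rewrite mulyy leey.
have Ymain : {ae P, forall w, (Y (w, T) <= (2 * expR (2 * L * T))%:E * \int[mu]_(r in `]0%R, T[) (eta (w, r))%:E)%E}.
  apply: filterS yfin => w yw; apply: gronwall => //; try exact: measurableT_comp.
  move=> t /andP[t0 tT]; have Yf : Y (w, t) \is a fin_num.
    by rewrite ge0_fin_numE//; apply: le_lt_trans yw; apply: Yle; exact: ltW.
  rewrite -/(Y (w, t)) -(fineK Yf) -EFinM -EFinD lee_fin /eta -lerBlDr le_max.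
  by rewrite -/(Y (w, t)) lexx orbT.
set c0 := L * (2 * expR (2 * L * T)).
have c00 : 0 <= c0 by rewrite /c0 !mulr_ge0 ?expR_ge0 ?(ltW L0).
move=> t t0T; have [G [mG G0 GK aeG]] := H t t0T.
pose E2 w : \bar R := (\int[mu]_r ((0 < r < T)%R%:R * eta (w, r) ^+ 2)%:E)%E.
have mI := @measurable_itvR R 0 T.
pose F (z : Omega * RR) : R := (0 < z.2 < T)%R%:R * eta z ^+ 2.
have mF : measurable_fun setT (fun z => (F z)%:E).
  apply/measurable_EFinP; apply: measurable_funM; first exact: (measurableT_comp mI).
  exact: measurable_funX.
have F0 z : (0 <= (F z)%:E)%E by rewrite lee_fin mulr_ge0// sqr_ge0.
have mE2 : measurable_fun setT E2 by exact: (@measurable_fun_fubini_tonelli_F _ _ _ _ _ mu (fun z => (F z)%:E)).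
have E20 w : (0 <= E2 w)%E by apply: integral_ge0 => r _; exact: (F0 (w, r)).
have indT : (\int[mu]_r ((0 < r < T)%R%:R : R)%:E = T%:E)%E.
  under eq_integral do rewrite -[X in X%:E]mul1r.
  by rewrite -(integral_itv_ind (fun=> 1)) integral_cst//= lebesgue_measure_itv/= lte_fin T0 mul1e oppr0 adde0.
have PE2 : (\int[P]_w E2 w <= (T * K)%:E)%E.
  rewrite (@fubini_tonelli _ _ _ _ _ P mu (fun z => (F z)%:E))//.
  apply: (@le_trans _ _ (\int[mu]_r (K%:E * ((0 < r < T)%R%:R : R)%:E))%E).
    apply: ge0_le_integral => //.
    - by move=> r _; apply: integral_ge0 => w _; exact: F0.
    - exact: (@measurable_fun_fubini_tonelli_G _ _ _ _ _ P (fun z => (F z)%:E)).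
    - by apply: measurable_funeM; apply/measurable_EFinP.
    - move=> r _; rewrite /F/=; case: (boolP (0 < r < T)) => [/andP[r0 rT]|_].
        under eq_integral do rewrite mul1r; rewrite mule1; apply: eta2; by rewrite !ltW.
      by under eq_integral do rewrite mul0r; rewrite integral0 mule0.
  rewrite ge0_integralZl//; first by rewrite indT -EFinM mulrC.
  exact/measurable_EFinP.
apply: (@le_trans _ _ (\int[P]_w (2%:E * G w + (2 * c0 ^+ 2 * T)%:E * E2 w))%E).
  have k0 : 0 <= 2 * c0 ^+ 2 * T by apply: mulr_ge0; [apply: mulr_ge0 => //; exact: sqr_ge0|exact: ltW].
  apply: ae_ge0_le_integral => //.
  - by move=> w _; rewrite lee_fin sqr_ge0.
  - by apply/measurable_EFinP; apply: measurable_funX; exact: measurableT_comp.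
  - by move=> w _; rewrite adde_ge0// mule_ge0// lee_fin.
  - by apply: emeasurable_funD; exact: measurable_funeM.
  apply: filterS2 Ymain aeG => w Yw [g [g0 gG yg]] _.
  pose I1 := (\int[mu]_r ((0 < r < T)%R%:R * eta (w, r))%:E)%E.
  have I10 : (0 <= I1)%E by apply: integral_ge0 => r _; rewrite lee_fin mulr_ge0.
  have y1 : ((y (w, t))%:E <= g + c0%:E * I1)%E.
    apply: (le_trans yg); apply: leeD => //; rewrite /c0 EFinM -muleA; apply: lee_wpmul2l; first by rewrite lee_fin ltW.
    apply: (le_trans (Yle w t _)); first by case/andP: t0T.
    apply: (le_trans Yw); rewrite le_eqVlt; apply/orP; left; apply/eqP; congr (_ * _)%E.
    by rewrite integral_itv_ind; apply: eq_integral => r _; rewrite mulrC.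
  have c0I : (0 <= c0%:E * I1)%E by rewrite mule_ge0 ?lee_fin.
  apply: (le_trans (lee_sqr_add (y0 _) g0 c0I y1)); apply: leeD; first by apply: lee_wpmul2l; rewrite ?lee_fin.
  have CS : (I1 * I1 <= T%:E * E2 w)%E.
    apply: weighted_cauchy_schwarz => //; first exact: measurableT_comp.
    by rewrite indT.
  have -> : (c0%:E * I1 * (c0%:E * I1) = (c0 * c0)%:E * (I1 * I1))%E by rewrite muleACA.
  have -> : (2%:E * ((c0 * c0)%:E * (I1 * I1)) = (2 * (c0 * c0))%:E * (I1 * I1))%E by rewrite EFinM muleA.
  have -> : (2 * c0 ^+ 2 * T)%:E = ((2 * (c0 * c0))%:E * T%:E)%E by rewrite -EFinM expr2.
  by rewrite -muleA; apply: lee_wpmul2l CS; rewrite lee_fin mulr_ge0// mulr_ge0.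
rewrite ge0_integralD//; last 4 first.
- by move=> w _; rewrite mule_ge0.
- exact: measurable_funeM.
- by move=> w _; rewrite mule_ge0// lee_fin; apply: mulr_ge0; [apply: mulr_ge0 => //; exact: sqr_ge0|exact: ltW].
- exact: measurable_funeM.
have -> : K * (2 + 2 * c0 ^+ 2 * T ^+ 2) = 2 * K + 2 * c0 ^+ 2 * T * (T * K) by ring.
have k0 : 0 <= 2 * c0 ^+ 2 * T by apply: mulr_ge0; [apply: mulr_ge0 => //; exact: sqr_ge0|exact: ltW].
rewrite !ge0_integralZl//.
exact: (leeD (lee_mulEFin (ler0n R 2) GK) (lee_mulEFin k0 PE2)).
Qed.

End gronwall.

(** * Almost sure integrability of the solution *)

Lemma ae_lty d (T : measurableType d) (R : realType) (m : {measure set T -> \bar R}) (f : T -> \bar R) :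
  measurable_fun setT f -> (forall x, 0 <= f x)%E -> (\int[m]_x f x < +oo)%E ->
  {ae m, forall x, (f x < +oo)%E}.
Proof.
move=> mf f0 If.
have I : m.-integrable setT f.
  by apply/integrableP; split => //; under eq_integral do rewrite gee0_abs//.
by apply: filterS (integrable_ae measurableT I) => x /(_ Logic.I); rewrite ge0_fin_numE.
Qed.

Section random_field.
Variables (R : realType).
Local Notation mu := (@lebesgue_measure R).
Local Notation RR := (measurableTypeR R).
Local Notation lebD := (@lebD R).
Local Notation L2 := (Lfun lebD 2%:E).
Local Notation nD := (nrm lebD).

Lemma measurable_nrm_lebD d (A : measurableType d) (V : A * RR -> R) : measurable_fun setT V ->
  measurable_fun setT (fun z => nD (fun x => V (z, x))).
Proof.
move=> mV; apply: (measurableT_comp (f := @Num.sqrt R)); first by apply: continuous_measurable_fun; exact: sqrt_continuous.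
have mI := @measurable_itvR R 0 1.
have mF : measurable_fun setT (fun q : A * RR => V q * V q * (0 < q.2 < 1)%R%:R).
  by apply: measurable_funM; [exact: measurable_funM|exact: (measurableT_comp mI)].
have := measurable_Rintegral2 mu mF; congr (measurable_fun _ _); apply/funext => z.
rewrite /dot /Rintegral integral_lebD; last first.
  by apply/measurable_EFinP; apply: measurable_funM; exact: (measurableT_comp mV (pair1_measurable z)).
congr fine; rewrite [RHS]integral_mkcond; apply: eq_integral => x _; rewrite patchE mem_setE in_itv/=.
by case: (0 < x < 1); rewrite ?mulr1 ?mulr0.
Qed.

(* McShane's extension formula over a countable dense family: it will exhibit
   [Psi] of a random field as an infimum of measurable functions. *)
Lemma lipschitz_einfs (q : nat -> R -> R) (Psi : (R -> R) -> R) (L : R) v : 0 < L ->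
  (forall j, q j \in L2) -> v \in L2 ->
  (forall e : R, 0 < e -> exists j, nD (fun x => v x - q j x) <= e) ->
  (forall v v', v \in L2 -> v' \in L2 -> Psi v - Psi v' <= L * nD (fun x => v x - v' x)) ->
  (Psi v)%:E = einfs (fun j => (Psi (q j) + L * nD (fun x => v x - q j x))%:E) 0.
Proof.
move=> L0 q2 v2 dens lip; apply/eqP; rewrite eq_le; apply/andP; split.
  apply: le_ereal_inf_tmp => _ [j _ <-]; rewrite lee_fin addrC -lerBlDr; exact: lip.
apply/lee_addgt0Pr => e e0; have [j Hj] := dens (e / (2 * L)) (divr_gt0 e0 (mulr_gt0 (ltr0Sn R 1) L0)).
apply: (@le_trans _ _ (Psi (q j) + L * nD (fun x => v x - q j x))%:E); first by apply: ereal_inf_lbound; exists j.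
rewrite -EFinD lee_fin.
have h1 : L * nD (fun x => v x - q j x) <= e / 2.
  apply: (le_trans (ler_wpM2l (ltW L0) Hj)); rewrite le_eqVlt; apply/orP; left; apply/eqP; field.
  by rewrite gt_eqF.
have := lip _ _ (q2 j) v2; rewrite nrm_distC// => h2; lra.
Qed.

Lemma measurable_lipschitz d (A : measurableType d) (V : A * RR -> R) (q : nat -> R -> R) (Psi : (R -> R) -> R) (L : R) :
  0 < L -> measurable_fun setT V -> (forall z, (fun x => V (z, x)) \in L2) -> (forall j, q j \in L2) ->
  (forall v (e : R), v \in L2 -> 0 < e -> exists j, nD (fun x => v x - q j x) <= e) ->
  (forall v v', v \in L2 -> v' \in L2 -> Psi v - Psi v' <= L * nD (fun x => v x - v' x)) ->
  measurable_fun setT (fun z => Psi (fun x => V (z, x))).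
Proof.
move=> L0 mV V2 q2 dens lip; apply/measurable_EFinP.
rewrite (_ : EFin \o _ = (fun z => einfs (fun j => (Psi (q j) + L * nD (fun x => V (z, x) - q j x))%:E) 0)); last first.
  apply/funext => z /=; apply: lipschitz_einfs => // e; exact: dens.
apply: (@measurable_fun_einfs _ _ _ setT (fun j z => (Psi (q j) + L * nD (fun x => V (z, x) - q j x))%:E)) => j.
apply/measurable_EFinP; apply: measurable_funD => //; apply: measurable_funM => //.
apply: (@measurable_nrm_lebD _ A (fun w => V w - q j w.2)); apply: measurable_funB => //.
exact: (measurableT_comp (L2_measurable (q2 j))).
Qed.

(** Random fields are measurable on [0, T] only; extension by zero gives a field measurable in all
    times. *)
Definition field_on d (Omega : measurableType d) (T : R) (u : Omega -> R -> R -> R) (z : Omega * RR) : R -> R :=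
  fun x => if 0 <= z.2 <= T then u z.1 z.2 x else 0.

Lemma measurable_field_on d (Omega : measurableType d) (T : R) (u : Omega -> R -> R -> R) :
  measurable_fun (setT `*` `[0, T]%classic `*` setT)
    (fun z : Omega * measurableTypeR R * measurableTypeR R => u z.1.1 z.1.2 z.2) ->
  measurable_fun setT (fun w : (Omega * RR) * RR => field_on T u w.1 w.2).
Proof.
move=> mu_; have mD : measurable (setT `*` `[0, T]%classic `*` setT : set (Omega * RR * RR)).
  by apply: measurableX => //; exact: measurableX.
have := (measurable_restrictT (fun z : Omega * RR * RR => u z.1.1 z.1.2 z.2) mD).1 mu_.
congr (measurable_fun _ _); apply/funext => -[[w r] x]; rewrite patchE /field_on/=.
case: ifPn => [|h].
  by rewrite inE/= => -[[_ /=]]; rewrite in_itv/= => ->.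
case: ifPn => // h'; exfalso; move: h; rewrite notin_setE; apply; by split.
Qed.

End random_field.

(** * From the equation at time T to integrable paths *)

Section integrability.
Variables (d : measure_display) (Omega : measurableType d) (R : realType) (P : probability Omega R).
Variables (T al C M : R) (u : Omega -> R -> R -> R) (Phi : R -> (R -> R) -> (R -> R)) (Z : R -> Omega -> R -> R).
Hypothesis T0 : 0 < T.
Hypothesis al01 : 0 < al < 1.
Hypothesis C0 : 0 <= C.
Hypothesis M0 : 0 <= M.
Local Notation mu := (@lebesgue_measure R).
Local Notation RR := (measurableTypeR R).
Local Notation lebD := (@lebD R).
Local Notation L2 := (Lfun lebD 2%:E).
Local Notation nD := (nrm lebD).
Local Notation U := (field_on T u).
Hypothesis mu_ : measurable_fun (setT `*` `[0, T]%classic `*` setT)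
    (fun z : Omega * measurableTypeR R * measurableTypeR R => u z.1.1 z.1.2 z.2).
Hypothesis u2 : forall w t, 0 <= t <= T -> u w t \in L2.
Hypothesis mPhi : measurable_fun setT (fun z : Omega * RR => nD (Phi T (U z))).
Hypothesis Phi_mono : forall t v, 0 < t < T -> v \in L2 -> nD (Phi T v) <= nD (Phi t v).
Hypothesis Phi_smooth : forall t v, 0 < t <= T -> v \in L2 -> nD (Phi t v) <= C * t `^ (- al) * nD (Phi T v).
Hypothesis mZ : forall t, 0 <= t <= T -> measurable_fun setT (fun z : Omega * RR => Z t z.1 z.2).
Hypothesis ZM : forall t, 0 <= t <= T -> (\int[P]_w \int[lebD]_x (Z t w x ^+ 2)%:E <= M%:E)%E.
Hypothesis uE : forall t, 0 <= t <= T -> {ae P, forall w, exists2 I : R -> R,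
  is_bochner_integral t (fun r => Phi (t - r) (u w r)) I & {ae lebD, forall x, u w t x = I x + Z t w x}}.

Lemma U_in w (r : R) : 0 <= r <= T -> U (w, r) = u w r.
Proof. by move=> h; apply/funext => x; rewrite /field_on/= h. Qed.

Lemma U_L2 z : U z \in L2.
Proof.
case: z => w r; have [h|h] := boolP (0 <= r <= T); first by rewrite U_in// u2.
have -> : U (w, r) = (fun=> 0) by apply/funext => x; rewrite /field_on/= (negbTE h).
exact: L2_0.
Qed.

Lemma measurable_nrmU : measurable_fun setT (fun z : Omega * RR => nD (U z)).
Proof. exact: (@measurable_nrm_lebD _ _ _ (fun w => U w.1 w.2) (measurable_field_on mu_)). Qed.

Lemma measurable_Z2 t : 0 <= t <= T -> measurable_fun setT (fun w => \int[lebD]_x (Z t w x ^+ 2)%:E)%E.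
Proof.
move=> t0T; have mI := @measurable_itvR R 0 1.
pose F (q : Omega * RR) := Z t q.1 q.2 ^+ 2 * (0 < q.2 < 1)%R%:R.
have mF : measurable_fun setT (fun q => (F q)%:E).
  apply/measurable_EFinP; apply: measurable_funM; last exact: (measurableT_comp mI).
  by apply: measurable_funX; exact: mZ.
rewrite (_ : (fun w => _) = (fun w => \int[mu]_x (F (w, x))%:E)%E).
  apply: (@measurable_fun_fubini_tonelli_F _ _ _ _ _ mu (fun q => (F q)%:E)) => // q.
  by rewrite lee_fin mulr_ge0// sqr_ge0.
apply/funext => w; rewrite ge0_integral_lebD; last 2 first.
- apply/measurable_EFinP; apply: measurable_funX; exact: (measurableT_comp (mZ t0T) (pair1_measurable w)).
- by move=> x; rewrite lee_fin sqr_ge0.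
by rewrite (integral_itv_ind (fun x => Z t w x ^+ 2)).
Qed.

Lemma field_decomp t : 0 <= t <= T -> {ae P, forall w, exists2 I : R -> R,
  is_bochner_integral t (fun r => Phi (t - r) (u w r)) I &
  [/\ I \in L2, Z t w \in L2, nD (u w t) <= nD I + nD (Z t w) & ((nD (Z t w)) ^+ 2)%:E = (\int[lebD]_x (Z t w x ^+ 2)%:E)%E]}.
Proof.
move=> t0T; apply: filterS (uE t0T) => w [I bI uI]; exists I => //.
have [_ I2 _] := bI; have ut := u2 w t0T.
have mZw : measurable_fun setT (Z t w) by exact: (measurableT_comp (mZ t0T) (pair1_measurable w)).
have Z2 : Z t w \in L2.
  have FF : Filter (almost_everywhere lebD) := ae_filter_ringOfSetsType lebD.
  by apply: (L2_ae (L2B ut I2) mZw); apply: (@filterS _ _ FF _ _ _ uI) => x ->; rewrite addrC addKr.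
split => //; last by rewrite -(EFin_dot Z2) sqr_nrm.
have E2 := L2_add I2 Z2.
have -> : nD (u w t) = nD (fun x => I x + Z t w x).
  congr Num.sqrt; rewrite (dot_ae ut E2 ut uI) dotC (dot_ae ut E2 E2 uI)//.
exact: nrmD.
Qed.

Definition smooth_nrm (z : Omega * RR) : R := nD (Phi T (U z)) * (0 < z.2 < T)%R%:R.
Lemma measurable_smooth_nrm : measurable_fun setT smooth_nrm.
Proof.
by apply: measurable_funM => //; exact: (measurableT_comp (@measurable_itvR R 0 T)).
Qed.
Lemma smooth_nrm_ge0 z : 0 <= smooth_nrm z.
Proof. by rewrite mulr_ge0// nrm_ge0. Qed.

(** The equation at T contains the Bochner integral of Phi(T - r)(u(r)), whose norm is at least that
    of Phi(T)(u(r)) by monotonicity in time. *)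
Lemma ae_integrable_smooth : {ae P, forall w, (\int[mu]_r (smooth_nrm (w, r))%:E < +oo)%E}.
Proof.
have TT : 0 <= T <= T by rewrite lexx ltW.
apply: filterS (uE TT) => w [I bI _].
have ma1 : measurable_fun setT (fun r : RR => (smooth_nrm (w, r))%:E).
  by apply/measurable_EFinP; exact: (measurableT_comp measurable_smooth_nrm (pair1_measurable w)).
have := @bochner_lty _ T _ _ (fun r => (smooth_nrm (w, r))%:E) bI ma1 (fun r => smooth_nrm_ge0 (w, r)).
have -> : (\int[mu]_(r in `]0%R, T[) (smooth_nrm (w, r))%:E = \int[mu]_r (smooth_nrm (w, r))%:E)%E.
  rewrite (integral_itv_ind (fun r => smooth_nrm (w, r))); apply: eq_integral => r _; rewrite /smooth_nrm/=.
  by case: (0 < r < T); rewrite ?mulr1 ?mulr0.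
apply; apply: aeW => r; rewrite in_itv/= => rT _; rewrite lee_fin /smooth_nrm/= rT mulr1.
have rT' : 0 <= r <= T by case/andP: rT => ? ?; rewrite !ltW.
rewrite U_in//; apply: Phi_mono; last exact: u2.
by case/andP: rT => r0 rT; rewrite subr_gt0 rT/= ltrBlDr ltrDl.
Qed.

(** The bound C (t - r)^(- al) ||Phi(T)(u(r))|| for the integrand at time t, by the comparison of
    Phi(t - r) with Phi(T). *)
Definition conv_kernel (q : (Omega * RR) * RR) : R := C * (powk (1 - al) (q.1.2 - q.2) * smooth_nrm (q.1.1, q.2)).
Lemma conv_kernel_ge0 q : 0 <= conv_kernel q.
Proof. by rewrite mulr_ge0// mulr_ge0 ?powk_ge0 ?smooth_nrm_ge0. Qed.

Lemma measurable_conv_kernel : measurable_fun setT conv_kernel.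
Proof.
have m11 : measurable_fun setT (fun q : (Omega * RR) * RR => q.1.1) by exact: measurableT_comp.
have m12 : measurable_fun setT (fun q : (Omega * RR) * RR => q.1.2) by exact: measurableT_comp.
have m2 : measurable_fun setT (fun q : (Omega * RR) * RR => q.2) by exact: measurable_snd.
apply: measurable_funM => //; apply: measurable_funM.
  by apply: (measurableT_comp (measurable_powk (1 - al))); exact: measurable_funB.
exact: (measurableT_comp measurable_smooth_nrm (measurable_fun_pair m11 m2)).
Qed.
Definition conv_bound (z : Omega * RR) : \bar R := (\int[mu]_r (conv_kernel (z, r))%:E)%E.
Lemma measurable_conv_bound : measurable_fun setT conv_bound.
Proof.
apply: (@measurable_fun_fubini_tonelli_F _ _ _ _ _ mu (fun q => (conv_kernel q)%:E)).
  by apply/measurable_EFinP; exact: measurable_conv_kernel.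
by move=> q; rewrite lee_fin conv_kernel_ge0.
Qed.
Lemma conv_bound_ge0 z : (0 <= conv_bound z)%E.
Proof. by apply: integral_ge0 => r _; rewrite lee_fin conv_kernel_ge0. Qed.

Lemma bochner_le_conv_bound t w I : 0 <= t <= T -> is_bochner_integral t (fun r => Phi (t - r) (u w r)) I ->
  ((nD I)%:E <= conv_bound (w, t))%E.
Proof.
move=> t0T bI; have /andP[t0 tT] := t0T.
have mth : measurable_fun setT (fun r : RR => (conv_kernel ((w, t), r))%:E).
  by apply/measurable_EFinP; exact: (measurableT_comp measurable_conv_kernel (pair1_measurable (w, t))).
apply: (@le_trans _ _ (\int[mu]_(r in `]0%R, t[) (conv_kernel ((w, t), r))%:E)%E).
  apply: (bochner_le bI mth) => [r|]; first by rewrite lee_fin conv_kernel_ge0.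
  apply: aeW => r; rewrite in_itv/= => /andP[r0 rt] _; rewrite lee_fin /conv_kernel/= /smooth_nrm/=.
  have rT : 0 <= r <= T by rewrite (ltW r0) (le_trans (ltW rt) tT).
  rewrite r0 (lt_le_trans rt tT) mulr1 U_in// mulrA.
  have -> : powk (1 - al) (t - r) = (t - r) `^ (- al).
    by rewrite /powk subr_gt0 rt; congr (_ `^ _); ring.
  apply: Phi_smooth; last exact: u2.
  by rewrite subr_gt0 rt/= lerBlDr (le_trans tT)// lerDl ltW.
by apply: ge0_subset_integral => // r _; rewrite lee_fin conv_kernel_ge0.
Qed.

(** Young's inequality for convolutions: the singularity t^(- al) has mass T^(1 - al) / (1 - al) on
    (0, T). *)
Lemma integral_conv_bound w : (\int[mu]_(t in `]0%R, T[) conv_bound (w, t) <= (C * (T `^ (1 - al) / (1 - al)))%:E * \int[mu]_r (smooth_nrm (w, r))%:E)%E.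
Proof.
have mI := @measurable_itvR R 0 T.
have k0 : 0 <= C * (T `^ (1 - al) / (1 - al)).
  by rewrite mulr_ge0// divr_ge0 ?powR_ge0// subr_ge0 ltW//; case/andP: al01.
have ma1 : measurable_fun setT (fun r : RR => (smooth_nrm (w, r))%:E).
  by apply/measurable_EFinP; exact: (measurableT_comp measurable_smooth_nrm (pair1_measurable w)).
pose F (q : RR * RR) : R := conv_kernel ((w, q.1), q.2) * (0 < q.1 < T)%R%:R.
have F0 q : (0 <= (F q)%:E)%E by rewrite lee_fin mulr_ge0// conv_kernel_ge0.
have m1 : measurable_fun setT (fun q : RR * RR => (w, q.1)) by apply: measurable_fun_pair => //; exact: measurable_cst.
have mF : measurable_fun setT (fun q => (F q)%:E).
  apply/measurable_EFinP; apply: measurable_funM; last exact: (measurableT_comp mI).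
  exact: (measurableT_comp measurable_conv_kernel (measurable_fun_pair m1 (@measurable_snd _ _ RR RR))).
have -> : (\int[mu]_(t in `]0%R, T[) conv_bound (w, t) = \int[mu]_t \int[mu]_r (F (t, r))%:E)%E.
  rewrite integral_mkcond; apply: eq_integral => t _; rewrite patchE mem_setE in_itv/= /conv_bound /F/=.
  case: ifP => _; first by apply: eq_integral => r _; rewrite mulr1.
  by under eq_integral do rewrite mulr0; rewrite integral0.
rewrite (@fubini_tonelli _ _ _ _ _ mu mu (fun q => (F q)%:E))// -ge0_integralZl//; last by move=> r _; rewrite lee_fin smooth_nrm_ge0.
apply: ge0_le_integral => //.
- by move=> r _; apply: integral_ge0.
- exact: (@measurable_fun_fubini_tonelli_G _ _ _ _ _ mu (fun q => (F q)%:E)).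
- exact: measurable_funeM.
move=> r _; pose pw (x : RR) : \bar R := (powk (1 - al) x * (x < T)%R%:R)%:E.
have g0 : 0 < 1 - al by rewrite subr_gt0; case/andP: al01.
have mpw : measurable_fun setT pw.
  by apply/measurable_EFinP; apply: measurable_indM; [exact: measurable_powk|exact: measurable_fun_ltr].
have pw0 x : (0 <= pw x)%E by rewrite lee_fin mulr_ge0// powk_ge0.
have mpws : measurable_fun setT (fun t : RR => pw (t - r)).
  by apply: (measurableT_comp mpw); exact: measurable_funB.
apply: (@le_trans _ _ (\int[mu]_t ((C * smooth_nrm (w, r))%:E * pw (t - r)%R))%E); last first.
  rewrite ge0_integralZl//; last by rewrite lee_fin mulr_ge0// smooth_nrm_ge0.
  rewrite (ge0_integral_shift (- r) mpw pw0) /pw integral_powk_lt ?(ltW T0)// -!EFinM lee_fin.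
  by rewrite le_eqVlt; apply/orP; left; apply/eqP; ring.
apply: ge0_le_integral => //.
- exact: (measurableT_comp mF (measurable_pair2 r)).
- exact: measurable_funeM.
move=> t _; rewrite /pw -EFinM lee_fin /F/= /conv_kernel/= /smooth_nrm/=.
have [/andP[t0 tT]|_] := boolP (0 < t < T); last first.
  by rewrite mulr0 mulr_ge0// mulr_ge0 ?powk_ge0// mulr_ge0 ?nrm_ge0.
have [/andP[r0 rT]|_] := boolP (0 < r < T); last by rewrite !(mulr0, mul0r).
have -> : (t - r < T)%R by rewrite ltrBlDr (lt_trans tT)// ltrDl.
by rewrite le_eqVlt; apply/orP; left; apply/eqP; rewrite /=; ring.
Qed.

(** For each t, almost surely, ||u(t)|| is at most [conv_bound] plus ||Z(t)||. The positive part
    [eta] of ||u|| - [conv_bound] is jointly measurable with mean at most 1 + M at each t, since z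
    <= 1 + z^2; by Tonelli its time integral is almost surely finite. *)
Lemma ae_integrable_nrm : {ae P, forall w, (\int[mu]_(r in `]0%R, T[) (nD (U (w, r)))%:E < +oo)%E}.
Proof.
have my := measurable_nrmU; have mI := @measurable_itvR R 0 T.
pose eta (z : Omega * RR) : \bar R := (maxe 0 ((nD (U z))%:E - conv_bound z) * ((0 < z.2 < T)%R%:R)%:E)%E.
have eta0 z : (0 <= eta z)%E by rewrite mule_ge0// ?lee_fin// le_max lexx.
have meta : measurable_fun setT eta.
  apply: emeasurable_funM; last by apply/measurable_EFinP; exact: (measurableT_comp mI).
  apply: measurable_maxe; first exact: measurable_cst.
  by apply: emeasurable_funB; [exact/measurable_EFinP|exact: measurable_conv_bound].
have Eeta t : 0 <= t <= T -> (\int[P]_w eta (w, t) <= (1 + M)%:E)%E.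
  move=> t0T; apply: (@le_trans _ _ (\int[P]_w (1%:E + \int[lebD]_x (Z t w x ^+ 2)%:E))%E).
    apply: ae_ge0_le_integral => //.
    - exact: (measurableT_comp meta (measurable_pair2 t)).
    - by move=> w _; rewrite adde_ge0//; apply: integral_ge0 => x _; rewrite lee_fin sqr_ge0.
    - by apply: emeasurable_funD; [exact: measurable_cst|exact: measurable_Z2].
    apply: filterS (field_decomp t0T) => w [I bI [I2 Z2 uIZ ZE]] _.
    rewrite -ZE -EFinD; apply: (@le_trans _ _ (nD (Z t w))%:E); last first.
      by rewrite lee_fin; exact: le1D_of_sqr_le.
    have h : (maxe 0 ((nD (U (w, t)))%:E - conv_bound (w, t)) <= (nD (Z t w))%:E)%E.
      rewrite ge_max lee_fin nrm_ge0/= U_in//.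
      have := bochner_le_conv_bound t0T bI; have := conv_bound_ge0 (w, t).
      case: (conv_bound (w, t)) => [th| |]// _; rewrite ?leNye// lee_fin => hI.
      by rewrite -EFinB lee_fin; lra.
    rewrite /eta/=; case: (0 < t < T); rewrite ?mule1 ?mule0//.
    by rewrite lee_fin nrm_ge0.
  rewrite ge0_integralD//.
  - rewrite integral_cst//= probability_setT mule1 EFinD; apply: leeD => //; exact: ZM.
  - by move=> w _; apply: integral_ge0 => x _; rewrite lee_fin sqr_ge0.
  - exact: measurable_Z2.
have Ieta : {ae P, forall w, (\int[mu]_r eta (w, r) < +oo)%E}.
  apply: ae_lty.
  - exact: (@measurable_fun_fubini_tonelli_F _ _ _ _ _ mu eta).
  - by move=> w; apply: integral_ge0.
  rewrite (@fubini_tonelli _ _ _ _ _ P mu eta)//.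
  apply: (@le_lt_trans _ _ (\int[mu]_(r in `]0%R, T[) (cst (1 + M)%:E r))%E).
    rewrite [leRHS]integral_mkcond; apply: ge0_le_integral => //.
    - by move=> r _; apply: integral_ge0.
    - exact: (@measurable_fun_fubini_tonelli_G _ _ _ _ _ P eta).
    - by apply/(measurable_restrictT (cst (1 + M)%:E : RR -> \bar R)) => //; exact: measurable_cst.
    move=> r _; rewrite patchE mem_setE in_itv/=; case: ifPn => [/andP[r0 rT]|h].
      by apply: Eeta; rewrite !ltW.
    by rewrite /eta/= (negbTE h); under eq_integral do rewrite mule0; rewrite integral0.
  by rewrite integral_cst//= lebesgue_measure_itv/= lte_fin T0 -EFinB -EFinM ltry.
apply: filterS2 ae_integrable_smooth Ieta => w aw ew.
have mTw : measurable_fun setT (fun t : RR => conv_bound (w, t)) by exact: (measurableT_comp measurable_conv_bound (pair1_measurable w)).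
have mew : measurable_fun setT (fun t : RR => eta (w, t)) by exact: (measurableT_comp meta (pair1_measurable w)).
apply: (@le_lt_trans _ _ (\int[mu]_(r in `]0%R, T[) (conv_bound (w, r) + eta (w, r)))%E).
  apply: ge0_le_integral => //.
  - by move=> r _; rewrite lee_fin nrm_ge0.
  - by apply: measurable_funTS; apply/measurable_EFinP; exact: (measurableT_comp my (pair1_measurable w)).
  - by apply: measurable_funTS; exact: emeasurable_funD.
  move=> r; rewrite /= in_itv/= => rT; rewrite /eta/= rT mule1.
  have := conv_bound_ge0 (w, r); case: (conv_bound (w, r)) => [th| |]//; last first.
    by move=> _; rewrite addye ?leey// -ltNye; apply: lt_le_trans (ltNy0 _) _; rewrite le_max lexx.
  move=> th0; rewrite -leeBlDl//; by rewrite le_max lexx orbT.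
rewrite ge0_integralD//; [|by move=> r _; exact: conv_bound_ge0|exact: (measurable_funTS mTw)|exact: (measurable_funTS mew)].
apply: lte_add_pinfty.
  apply: (le_lt_trans (integral_conv_bound w)); have : (0 <= \int[mu]_r (smooth_nrm (w, r))%:E)%E by apply: integral_ge0 => r _; rewrite lee_fin smooth_nrm_ge0.
  by move: aw; case: (\int[mu]_r (smooth_nrm (w, r))%:E)%E => [b| |]// _ _; rewrite -EFinM ltry.
by apply: le_lt_trans ew; apply: ge0_subset_integral.
Qed.

End integrability.

(** * Moment bound and error recursion *)

Lemma lee_sqr_add2 (R : realType) (a b : \bar R) : (0 <= a)%E -> (0 <= b)%E ->
  ((a + b) * (a + b) <= 2%:E * (a * a) + 2%:E * (b * b))%E.
Proof.
case: a => [a| |]//; case: b => [b| |]//; rewrite ?lee_fin => a0 b0.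
- by have := @lee_sqr_add R (a + b) a%:E b%:E (addr_ge0 a0 b0); rewrite !lee_fin expr2; apply.
- by rewrite mulyy [X in (_ <= _ + X)%E]gt0_muley ?lte_fin// -EFinM addey ?leey// -EFinM.
- by rewrite mulyy gt0_muley ?lte_fin// -EFinM addye ?leey// -EFinM.
- by rewrite mulyy gt0_muley ?lte_fin// addye ?leey.
Qed.

(** Both Mittag-Leffler bounds enter: with l = lam_k^s, C1 / (1 + l t^alpha) <= C1 (T / t)^alpha /
    (1 + l T^alpha), and the lower bound at T replaces the last fraction at the price of 1 / c. *)
Lemma relaxation_smooth (R : realType) (alpha s T : R) (lam : nat -> R) : 0 < alpha < 1 -> 0 < T ->
  exists2 C : R, 0 <= C & forall k t, 0 < t <= T ->
    relaxation alpha s lam k t <= C * t `^ (- alpha) * relaxation alpha s lam k T.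
Proof.
move=> alpha01 T0; have a0 : 0 < alpha by case/andP: alpha01.
have [C1 C10 H1] := mittag_leffler_le alpha01; have [c c0 Hc] := mittag_leffler_ge alpha01.
have Ta : 0 < T `^ alpha by rewrite powR_gt0.
exists (C1 * T `^ alpha / c); first by rewrite divr_ge0 ?mulr_ge0 ?ltW.
move=> k t /andP[t0 tT]; have ta : 0 < t `^ alpha by rewrite powR_gt0.
set l := lam k `^ s; have l0 : 0 <= l by exact: powR_ge0.
have tTa : t `^ alpha <= T `^ alpha by apply: (ge0_ler_powR (ltW a0) _ _ tT); rewrite nnegrE ltW.
have h1 := H1 _ (relaxation_arg_ge0 alpha s lam k t); have hc := Hc _ (relaxation_arg_ge0 alpha s lam k T).
apply: (le_trans h1).
have q0 : 0 <= C1 * T `^ alpha / c * t `^ (- alpha) by rewrite mulr_ge0 ?powR_ge0// divr_ge0 ?mulr_ge0 ?ltW.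
apply: le_trans (ler_wpM2l q0 hc); rewrite -/l powRN.
have p1 : 0 < 1 + l * t `^ alpha by rewrite ltr_pwDl// mulr_ge0// ltW.
have p2 : 0 < 1 + l * T `^ alpha by rewrite ltr_pwDl// mulr_ge0// ltW.
move: Ta ta tTa p1 p2; set a := t `^ alpha; set b := T `^ alpha => Ta ta tTa p1 p2.
have -> : C1 * b / c / a * (c / (1 + l * b)) = C1 * (b / (a * (1 + l * b))) by field; rewrite !gt_eqF.
rewrite ler_wpM2l ?(ltW C10)// ler_pdivlMr ?mulr_gt0// mulrC ler_pdivrMr//; nra.
Qed.

Lemma measurable_int_sqr d (Omega : measurableType d) (R : realType)
    (V : Omega * measurableTypeR R -> R) : measurable_fun setT V ->
  measurable_fun setT (fun w => \int[@lebD R]_x (V (w, x) ^+ 2)%:E)%E.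
Proof.
move=> mV; have mI := @measurable_itvR R 0 1.
pose F (q : Omega * measurableTypeR R) := V q ^+ 2 * (0 < q.2 < 1)%R%:R.
have mF : measurable_fun setT (fun q => (F q)%:E).
  apply/measurable_EFinP; apply: measurable_funM; last exact: (measurableT_comp mI).
  exact: measurable_funX.
rewrite (_ : (fun w => _) = (fun w => \int[@lebesgue_measure R]_x (F (w, x))%:E)%E).
  apply: (@measurable_fun_fubini_tonelli_F _ _ _ _ _ (@lebesgue_measure R) (fun q => (F q)%:E)) => // q.
  by rewrite lee_fin mulr_ge0// sqr_ge0.
apply/funext => w; rewrite ge0_integral_lebD; last 2 first.
- apply/measurable_EFinP; apply: measurable_funX; exact: (measurableT_comp mV (pair1_measurable w)).
- by move=> x; rewrite lee_fin sqr_ge0.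
by rewrite (integral_itv_ind (fun x => V (w, x) ^+ 2)).
Qed.

(* The exponent [th] interpolates between the two decay regimes of the
   relaxation functions; [alpha * th < H2] makes the time integral of the noise
   finite, and [4 * s * th + 2 * H1 - 2] is the resulting spatial rate. *)
Lemma exists_exponent (R : realType) (alpha s H1 H2 sigma : R) : 0 < alpha < 1 -> 0 < s -> 0 < H1 <= 2^-1 -> 0 < H2 ->
  0 < 2 * s * H2 / alpha + H1 - 1 -> 0 < H1 + 2 * s - 1 ->
  2 * sigma < Num.min (2 * s * H2 / alpha + H1 - 1) (H1 + 2 * s - 1) ->
  exists th : R, [/\ 0 <= th <= 1, alpha * th < H2, 0 < 4 * s * th + 2 * H1 - 2 &
    4 * sigma <= 4 * s * th + 2 * H1 - 2].
Proof.
move=> /andP[a0 a1] s0 /andP[H10 H12] H20 h1 h2 hs.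
have H1' : 2 * H1 <= 1 by rewrite -ler_pdivlMl// mulr1.
pose m := Num.min (2 * s * H2 / alpha + H1 - 1) (H1 + 2 * s - 1).
have m0 : 0 < m by rewrite lt_min h1.
have m1 : m <= H1 + 2 * s - 1 by rewrite ge_min lexx orbT.
have m2 : m <= 2 * s * H2 / alpha + H1 - 1 by rewrite ge_min lexx.
(* The maximum with 0 covers negative sigma and ensures e <= m. *)
pose e := m - Num.max (2 * sigma) 0.
have e0 : 0 < e by rewrite subr_gt0 gt_max hs m0.
have em : e <= m by rewrite gerBl le_max lexx orbT.
have es : 2 * sigma <= m - e by rewrite /e subKr le_max lexx.
have s2 : 0 < 2 * s by rewrite mulr_gt0.
(* With this exponent the rate 4 s th + 2 H1 - 2 equals 2 m - e, which is positive and at least 4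
   sigma; lowering m by e / 2 makes alpha th < H2 strict. *)
exists ((m - e / 2 + 1 - H1) / (2 * s)).
set th := (m - e / 2 + 1 - H1) / (2 * s).
have E : 2 * s * th = m - e / 2 + 1 - H1 by rewrite /th; field; rewrite gt_eqF.
have E4 : 4 * s * th = 2 * (m - e / 2 + 1 - H1) by rewrite -E; ring.
split.
- rewrite /th divr_ge0 ?(ltW s2)//=; last by lra.
  by rewrite ler_pdivrMr// mul1r; lra.
- rewrite /th mulrA ltr_pdivrMr//.
  have : alpha * (m - H1 + 1) <= alpha * (2 * s * H2 / alpha) by rewrite ler_pM2l//; lra.
  have -> : alpha * (2 * s * H2 / alpha) = H2 * (2 * s) by field; rewrite gt_eqF.
  apply: lt_le_trans; rewrite ltr_pM2l//; lra.
- by rewrite E4; lra.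
- by rewrite E4; lra.
Qed.

(** * A priori bounds for one solution *)

Section solution.
Variables (d : measure_display) (Omega : measurableType d) (R : realType) (P : probability Omega R).
Variables (alpha T Cf C : R) (phi : nat -> R -> R) (f : (R -> R) -> R -> R) (Op : R -> (R -> R) -> R -> R).
Local Notation mu := (@lebesgue_measure R).
Local Notation RR := (measurableTypeR R).
Local Notation lebD := (@lebD R).
Local Notation L2 := (Lfun lebD 2%:E).
Local Notation nD := (nrm lebD).
Hypothesis T0 : 0 < T.
Hypothesis alpha01 : 0 < alpha < 1.
Hypothesis Cf0 : 0 < Cf.
Hypothesis C0 : 0 <= C.
Hypothesis phi2 : forall k, phi k \in L2.
Hypothesis phio : forall j k, dot lebD (phi j) (phi k) = (j == k)%:R.
Hypothesis total : forall v, v \in L2 -> (forall k, dotD v (phi k) = 0) -> {ae lebD, forall x, v x = 0}.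
Hypothesis f2 : forall v, v \in L2 -> f v \in L2.
Hypothesis f_lip : forall v w, v \in L2 -> w \in L2 -> nD (fun x => f v x - f w x) <= Cf * nD (fun x => v x - w x).
Hypothesis Op2 : forall t v, v \in L2 -> Op t v \in L2.
Hypothesis Op_lip : forall t v w, v \in L2 -> w \in L2 -> nD (fun x => Op t v x - Op t w x) <= nD (fun x => v x - w x).
Hypothesis Op_mono : forall t v, 0 < t < T -> v \in L2 -> nD (Op T v) <= nD (Op t v).
Hypothesis Op_smooth : forall t v, 0 < t <= T -> v \in L2 -> nD (Op t v) <= C * t `^ (- alpha) * nD (Op T v).
Variables (u : Omega -> R -> R -> R).
Hypothesis mu_ : measurable_fun (setT `*` `[0, T]%classic `*` setT)
    (fun z : Omega * measurableTypeR R * measurableTypeR R => u z.1.1 z.1.2 z.2).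
Hypothesis u2 : forall w t, 0 <= t <= T -> u w t \in L2.

(** v |-> ||Op T (f v)|| is Lipschitz with constant [Cf]; the countable dense family consists of
    rational combinations of eigenfunctions. *)
Lemma measurable_nonlinearity : measurable_fun setT (fun z : Omega * RR => nD (Op T (f (field_on T u z)))).
Proof.
pose q (j : nat) := qcomb phi (odflt [::] (unpickle j)).
apply: (@measurable_lipschitz _ _ _ (fun w : (Omega * RR) * RR => field_on T u w.1 w.2) q (fun v => nD (Op T (f v))) Cf Cf0).
- exact: measurable_field_on.
- by move=> z; exact: U_L2.
- by move=> j; exact: qcomb_L2.
- move=> v e v2 e0; have [l Hl] := qcomb_dense phi2 phio total v2 e0.
  by exists (pickle l); rewrite /q pickleK.
- move=> v w v2 w2; have fv := f2 v2; have fw := f2 w2.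
  apply: le_trans (f_lip v2 w2); apply: le_trans (Op_lip T fv fw).
  have A := Op2 T fv; have B := Op2 T fw.
  move: A B; move: (Op T (f v)) (Op T (f w)) => g h g2 h2.
  rewrite lerBlDr; have {1}-> : g = (fun x => (g x - h x) + h x) by apply/funext => x; rewrite subrK.
  exact: (nrmD (L2B g2 h2) h2).
Qed.

(** [Op] stands for S or for S_N, so that the exact and the Galerkin solution are treated at
    once. *)
Lemma solution_integrable (M : R) (Z : R -> Omega -> R -> R) :
  (forall t, 0 <= t <= T -> measurable_fun setT (fun z : Omega * RR => Z t z.1 z.2)) ->
  (forall t, 0 <= t <= T -> (\int[P]_w \int[lebD]_x (Z t w x ^+ 2)%:E <= M%:E)%E) ->
  (forall t, 0 <= t <= T -> {ae P, forall w, exists2 I : R -> R,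
    is_bochner_integral t (fun r => Op (t - r) (f (u w r))) I & {ae lebD, forall x, u w t x = I x + Z t w x}}) ->
  {ae P, forall w, (\int[mu]_(r in `]0%R, T[) (nD (field_on T u (w, r)))%:E < +oo)%E}.
Proof.
move=> mZ ZM uE.
apply: (@ae_integrable_nrm _ _ _ P T alpha C M u (fun t v => Op t (f v)) Z) => //.
- exact: measurable_nonlinearity.
- by move=> t v t0T v2; apply: Op_mono => //; exact: f2.
- by move=> t v t0T v2; apply: Op_smooth => //; exact: f2.
Qed.

Hypothesis f_growth : forall v, v \in L2 -> nD (f v) <= Cf * (1 + nD v).
Hypothesis Op_le : forall t v, v \in L2 -> nD (Op t v) <= nD v.

(** Controls the factor ||f(u)|| multiplying the truncation error of S. Linear growth of f gives
    Gronwall's inequality with forcing Cf T + ||Z(t)||. *)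
Lemma solution_moment (M : R) (Z : R -> Omega -> R -> R) : 0 <= M ->
  (forall t, 0 <= t <= T -> measurable_fun setT (fun z : Omega * RR => Z t z.1 z.2)) ->
  (forall t, 0 <= t <= T -> (\int[P]_w \int[lebD]_x (Z t w x ^+ 2)%:E <= M%:E)%E) ->
  (forall t, 0 <= t <= T -> {ae P, forall w, exists2 I : R -> R,
    is_bochner_integral t (fun r => Op (t - r) (f (u w r))) I & {ae lebD, forall x, u w t x = I x + Z t w x}}) ->
  exists2 M' : R, 0 <= M' & forall t, 0 <= t <= T ->
    (\int[P]_w (nD (field_on T u (w, t)) ^+ 2)%:E <= M'%:E)%E.
Proof.
move=> M0 mZ ZM uE; have my := measurable_nrmU mu_.
have K0 : 0 <= 2 * (Cf * T * (Cf * T)) + 2 * M.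
  by rewrite addr_ge0// mulr_ge0// mulr_ge0// mulr_ge0// ltW.
have k1 : 0 <= 2 + 2 * (Cf * (2 * expR (2 * Cf * T))) ^+ 2 * T ^+ 2.
  by rewrite addr_ge0//; apply: mulr_ge0; [apply: mulr_ge0 => //; exact: sqr_ge0|exact: sqr_ge0].
exists ((2 * (Cf * T * (Cf * T)) + 2 * M) * (2 + 2 * (Cf * (2 * expR (2 * Cf * T))) ^+ 2 * T ^+ 2)); first exact: mulr_ge0.
move=> t t0T.
apply: (stochastic_gronwall Cf0 T0 (y := fun z => nD (field_on T u z)) my _ K0 _ _ t0T).
- by move=> z; exact: nrm_ge0.
- exact: solution_integrable mZ ZM uE.
move=> {t t0T} t t0T; have /andP[t0 tT] := t0T.
have mZt := mZ t t0T; have mi := measurable_int_sqr mZt.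
exists (fun w => 2%:E * (Cf * T * (Cf * T))%:E + 2%:E * \int[lebD]_x (Z t w x ^+ 2)%:E)%E.
have z0 w : (0 <= \int[lebD]_x (Z t w x ^+ 2)%:E)%E by apply: integral_ge0 => x _; rewrite lee_fin sqr_ge0.
have c0 : 0 <= Cf * T * (Cf * T) by rewrite mulr_ge0// mulr_ge0// ltW.
split.
- by apply: emeasurable_funD; [exact: measurable_cst|exact: measurable_funeM].
- by move=> w; rewrite adde_ge0// mule_ge0// lee_fin.
- rewrite ge0_integralD//; last 3 first.
  + by move=> w _; rewrite mule_ge0// lee_fin.
  + by move=> w _; rewrite mule_ge0.
  + exact: measurable_funeM.
  rewrite integral_cst//= probability_setT mule1 ge0_integralZl//.
  exact: (leeD (lexx _) (lee_mulEFin (ler0n R 2) (ZM t t0T))).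
have dec := @field_decomp _ _ _ P T u (fun t v => Op t (f v)) Z u2 mZ uE t t0T.
apply: filterS dec => w [I bI [I2 Z2 uIZ ZE]].
exists ((Cf * T)%:E + (nD (Z t w))%:E)%E; split.
- by rewrite -EFinD lee_fin addr_ge0 ?nrm_ge0// mulr_ge0// ltW.
- have -> : (\int[lebD]_x (Z t w x ^+ 2)%:E = (nD (Z t w))%:E * (nD (Z t w))%:E)%E by rewrite -ZE -EFinM expr2.
  by rewrite EFinM; apply: lee_sqr_add2; rewrite lee_fin ?nrm_ge0// mulr_ge0// ltW.
have ymw : measurable_fun setT (fun r : RR => nD (field_on T u (w, r))) by exact: (measurableT_comp my (pair1_measurable w)).
have Ile : ((nD I)%:E <= (Cf * T)%:E + Cf%:E * \int[mu]_(r in `]0%R, t[) (nD (field_on T u (w, r)))%:E)%E.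
  have mB : measurable_fun setT (fun r : RR => (Cf * (1 + nD (field_on T u (w, r))))%:E).
    by apply/measurable_EFinP; apply: measurable_funM => //; exact: measurable_funD.
  apply: (@le_trans _ _ (\int[mu]_(r in `]0%R, t[) (Cf * (1 + nD (field_on T u (w, r))))%:E)%E).
    apply: (bochner_le bI mB) => [r|].
      by rewrite lee_fin mulr_ge0 ?(ltW Cf0)// addr_ge0 ?nrm_ge0.
    apply: aeW => r; rewrite in_itv/= => /andP[r0 rt] _.
    have rT : 0 <= r <= T by rewrite (ltW r0) (le_trans (ltW rt) tT).
    rewrite lee_fin (U_in u w rT); have ur := u2 w rT.
    exact: (le_trans (Op_le _ (f2 ur)) (f_growth ur)).
  under eq_integral do rewrite mulrDr mulr1 EFinD EFinM.
  rewrite ge0_integralD//; last 3 first.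
  - by move=> r _; rewrite lee_fin ltW.
  - by move=> r _; rewrite -EFinM lee_fin mulr_ge0 ?nrm_ge0 ?(ltW Cf0).
  - by apply: measurable_funTS; apply: measurable_funeM; exact/measurable_EFinP.
  rewrite ge0_integralZl; last 4 first.
  - by [].
  - by apply: measurable_funTS; exact/measurable_EFinP.
  - by move=> r _; rewrite lee_fin nrm_ge0.
  - by rewrite lee_fin ltW.
  apply: leeD => //; rewrite integral_cst//= lebesgue_measure_itv/= lte_fin.
  case: ifP => _; first by rewrite oppr0 adde0 -EFinM lee_fin ler_wpM2l// ltW.
  by rewrite mule0 lee_fin mulr_ge0// ltW.
rewrite (U_in u w t0T); apply: (@le_trans _ _ ((nD I)%:E + (nD (Z t w))%:E)%E); first by rewrite -EFinD lee_fin.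
by rewrite addeAC; apply: leeD.
Qed.

End solution.

(** * Gronwall argument for the error *)

Section difference.
Variables (d : measure_display) (Omega : measurableType d) (R : realType) (P : probability Omega R).
Variables (alpha T Cf A Kz M : R) (f : (R -> R) -> R -> R) (Op Op' : R -> (R -> R) -> R -> R).
Variables (u v : Omega -> R -> R -> R) (Z Z' : R -> Omega -> R -> R).
Local Notation mu := (@lebesgue_measure R).
Local Notation RR := (measurableTypeR R).
Local Notation lebD := (@lebD R).
Local Notation L2 := (Lfun lebD 2%:E).
Local Notation nD := (nrm lebD).
Local Notation U := (field_on T u).
Local Notation V := (field_on T v).
Local Notation meas3 u := (measurable_fun (setT `*` `[0, T]%classic `*` setT)
    (fun z : Omega * measurableTypeR R * measurableTypeR R => u z.1.1 z.1.2 z.2)).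
Hypothesis T0 : 0 < T.
Hypothesis alpha01 : 0 < alpha < 1.
Hypothesis Cf0 : 0 < Cf.
Hypothesis A0 : 0 <= A.
Hypothesis Kz0 : 0 <= Kz.
Hypothesis M0 : 0 <= M.
Hypothesis f2 : forall g, g \in L2 -> f g \in L2.
Hypothesis f_lip : forall g h, g \in L2 -> h \in L2 -> nD (fun x => f g x - f h x) <= Cf * nD (fun x => g x - h x).
Hypothesis f_growth : forall g, g \in L2 -> nD (f g) <= Cf * (1 + nD g).
Hypothesis Op_diff : forall t g h, 0 < t <= T -> g \in L2 -> h \in L2 ->
  nD (fun x => Op t g x - Op' t h x) <= nD (fun x => g x - h x) + A * t `^ (- alpha) * nD g.
Hypothesis mu_ : meas3 u.
Hypothesis mv_ : meas3 v.
Hypothesis u2 : forall w t, 0 <= t <= T -> u w t \in L2.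
Hypothesis v2 : forall w t, 0 <= t <= T -> v w t \in L2.
Hypothesis uint : {ae P, forall w, (\int[mu]_(r in `]0%R, T[) (nD (U (w, r)))%:E < +oo)%E}.
Hypothesis vint : {ae P, forall w, (\int[mu]_(r in `]0%R, T[) (nD (V (w, r)))%:E < +oo)%E}.
Hypothesis uM : forall t, 0 <= t <= T -> (\int[P]_w (nD (U (w, t)) ^+ 2)%:E <= M%:E)%E.
Hypothesis mZ : forall t, 0 <= t <= T -> measurable_fun setT (fun z : Omega * RR => Z t z.1 z.2).
Hypothesis mZ' : forall t, 0 <= t <= T -> measurable_fun setT (fun z : Omega * RR => Z' t z.1 z.2).
Hypothesis ZZ' : forall t, 0 <= t <= T -> (\int[P]_w \int[lebD]_x ((Z t w x - Z' t w x) ^+ 2)%:E <= Kz%:E)%E.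
Hypothesis uE : forall t, 0 <= t <= T -> {ae P, forall w, exists2 I : R -> R,
    is_bochner_integral t (fun r => Op (t - r) (f (u w r))) I & {ae lebD, forall x, u w t x = I x + Z t w x}}.
Hypothesis vE : forall t, 0 <= t <= T -> {ae P, forall w, exists2 I : R -> R,
    is_bochner_integral t (fun r => Op' (t - r) (f (v w r))) I & {ae lebD, forall x, v w t x = I x + Z' t w x}}.

Let ka := T `^ (1 - alpha) / (1 - alpha).

(** The singularity (t - r)^(- alpha), cut off to 0 < r < t. *)
Definition sing t (r : RR) : R := powk (1 - alpha) (t - r) * (0 < r)%R%:R.

Lemma sing_ge0 t r : 0 <= sing t r.
Proof. by rewrite mulr_ge0// powk_ge0. Qed.

Lemma measurable_sing t : measurable_fun setT (sing t).
Proof.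
apply: measurable_funM; first by apply: (measurableT_comp (measurable_powk (1 - alpha))); exact: measurable_funB.
by apply: measurable_bool; exact: measurable_fun_ltr.
Qed.

Lemma integral_sing_le t : 0 <= t <= T -> (\int[mu]_r (sing t r)%:E <= ka%:E)%E.
Proof.
move=> /andP[t0 tT]; have g0 : 0 < 1 - alpha by rewrite subr_gt0; case/andP: alpha01.
pose pw (x : RR) : \bar R := (powk (1 - alpha) x * (x < t)%R%:R)%:E.
have -> : (\int[mu]_r (sing t r)%:E = \int[mu]_r pw (t - r)%R)%E.
  by apply: eq_integral => r _; rewrite /sing /pw ltrBlDr ltrDl.
rewrite (@ge0_integral_reflect _ t pw); last 2 first.
- by apply/measurable_EFinP; apply: measurable_indM; [exact: measurable_powk|exact: measurable_fun_ltr].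
- by move=> x; rewrite lee_fin mulr_ge0// powk_ge0.
rewrite /pw integral_powk_lt// lee_fin ler_pM2r ?invr_gt0//.
by apply: (ge0_ler_powR (ltW g0) _ _ tT); rewrite nnegrE ?(ltW T0).
Qed.

Lemma measurable_diff_field : measurable_fun setT (fun z : Omega * RR => nD (fun x => U z x - V z x)).
Proof.
apply: (@measurable_nrm_lebD _ _ _ (fun w : (Omega * RR) * RR => U w.1 w.2 - V w.1 w.2)).
by apply: measurable_funB; exact: measurable_field_on.
Qed.

Lemma expected_weighted_moment t : 0 <= t <= T ->
  measurable_fun setT (fun w => \int[mu]_r (sing t r * (1 + nD (U (w, r))) ^+ 2)%:E)%E /\
  (\int[P]_w \int[mu]_r (sing t r * (1 + nD (U (w, r))) ^+ 2)%:E <= (ka * (2 + 2 * M))%:E)%E.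
Proof.
move=> t0T; have my := measurable_nrmU mu_.
pose F (z : Omega * RR) : R := sing t z.2 * (1 + nD (U z)) ^+ 2.
have mF : measurable_fun setT (fun z => (F z)%:E).
  apply/measurable_EFinP; apply: measurable_funM; first exact: (measurableT_comp (measurable_sing t)).
  by apply: measurable_funX; exact: measurable_funD.
have F0 z : (0 <= (F z)%:E)%E by rewrite lee_fin; apply: mulr_ge0; [exact: sing_ge0|exact: sqr_ge0].
split; first exact: (@measurable_fun_fubini_tonelli_F _ _ _ _ _ mu (fun z => (F z)%:E)).
rewrite (@fubini_tonelli _ _ _ _ _ P mu (fun z => (F z)%:E))//.
have k0 : 0 <= 2 + 2 * M by rewrite addr_ge0// mulr_ge0.
apply: (@le_trans _ _ (\int[mu]_r ((2 + 2 * M)%:E * (sing t r)%:E))%E); last first.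
  rewrite ge0_integralZl//.
  - by apply: (le_trans (lee_mulEFin k0 (integral_sing_le t0T))); rewrite mulrC.
  - by apply/measurable_EFinP; exact: measurable_sing.
  - by move=> r _; rewrite lee_fin sing_ge0.
apply: ge0_le_integral => //.
- by move=> r _; apply: integral_ge0.
- exact: (@measurable_fun_fubini_tonelli_G _ _ _ _ _ P (fun z => (F z)%:E)).
- by apply: measurable_funeM; apply/measurable_EFinP; exact: measurable_sing.
move=> r _; have myr : measurable_fun setT (fun w => nD (U (w, r))) by exact: (measurableT_comp my (measurable_pair2 r)).
rewrite /F/=; under eq_integral do rewrite EFinM.
rewrite ge0_integralZl//; last 3 first.
- by apply/measurable_EFinP; apply: measurable_funX; exact: measurable_funD.
- by move=> w _; rewrite lee_fin sqr_ge0.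
- by rewrite lee_fin sing_ge0.
rewrite [leRHS]muleC; have [rt|rt] := boolP (0 < r < t); last first.
  have -> : sing t r = 0; last by rewrite !mul0e.
  rewrite /sing /powk subr_gt0; move: rt; case: (0 < r) => /=; last by rewrite mulr0.
  by move=> /negbTE ->; rewrite mul0r.
apply: lee_wpmul2l; first by rewrite lee_fin sing_ge0.
have rT : 0 <= r <= T by case/andP: rt => r0 rt; rewrite (ltW r0) (le_trans (ltW rt))//; case/andP: t0T.
apply: (@le_trans _ _ (\int[P]_w (2%:E + 2%:E * (nD (U (w, r)) ^+ 2)%:E))%E).
  apply: ge0_le_integral => //.
  - by move=> w _; rewrite lee_fin sqr_ge0.
  - by apply/measurable_EFinP; apply: measurable_funX; exact: measurable_funD.
  - apply: emeasurable_funD; first exact: measurable_cst.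
    by apply: measurable_funeM; apply/measurable_EFinP; exact: measurable_funX.
  - move=> w _; rewrite -EFinM -EFinD lee_fin; have := sqr_ge0 (1 - nD (U (w, r))).
    by move: (nD _) => y h; nra.
rewrite ge0_integralD//; last 2 first.
- by move=> w _; rewrite mule_ge0// lee_fin sqr_ge0.
- by apply: measurable_funeM; apply/measurable_EFinP; exact: measurable_funX.
rewrite integral_cst//= probability_setT mule1 ge0_integralZl//; last 2 first.
- by apply/measurable_EFinP; exact: measurable_funX.
- by move=> w _; rewrite lee_fin sqr_ge0.
exact: (leeD (lexx _) (lee_mulEFin (ler0n R 2) (uM rT))).
Qed.

(** The forcing is ||Z - Z'|| plus A Cf \int sing (1 + ||u||). The square of the latter integral is
    at most ka \int sing (1 + ||u||)^2, by Cauchy-Schwarz with weight [sing] of mass at most ka; its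
    expectation contributes the second ka and 2 + 2 M. The last factor is that of
    [stochastic_gronwall]. *)
Lemma solution_difference t : 0 <= t <= T ->
  (\int[P]_w (nD (fun x => u w t x - v w t x) ^+ 2)%:E <=
   ((2 * Kz + 2 * ((A * Cf) ^+ 2 * ka) * (ka * (2 + 2 * M))) *
    (2 + 2 * (Cf * (2 * expR (2 * Cf * T))) ^+ 2 * T ^+ 2))%:E)%E.
Proof.
move=> t0T'; have my := measurable_nrmU mu_; have mv := measurable_nrmU mv_.
have U2 := U_L2 u2; have V2 := U_L2 v2.
have g0 : 0 < 1 - alpha by rewrite subr_gt0; case/andP: alpha01.
have ka0 : 0 < ka by rewrite divr_gt0// powR_gt0.
have ac0 : 0 <= A * Cf by rewrite mulr_ge0// ltW.
have kk0 : 0 <= 2 * ((A * Cf) ^+ 2 * ka).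
  by apply: mulr_ge0 => //; apply: mulr_ge0; [exact: sqr_ge0|exact: ltW].
have m20 : 0 <= ka * (2 + 2 * M) by rewrite mulr_ge0 ?(ltW ka0)// addr_ge0// mulr_ge0.
have K0 : 0 <= 2 * Kz + 2 * ((A * Cf) ^+ 2 * ka) * (ka * (2 + 2 * M)).
  by apply: addr_ge0; apply: mulr_ge0.
have -> : (\int[P]_w (nD (fun x => u w t x - v w t x) ^+ 2)%:E =
    \int[P]_w (nD (fun x => U (w, t) x - V (w, t) x) ^+ 2)%:E)%E.
  by apply: eq_integral => w _; rewrite (U_in u w t0T') (U_in v w t0T').
apply: (stochastic_gronwall Cf0 T0 (y := fun z => nD (fun x => U z x - V z x)) measurable_diff_field _ K0 _ _ t0T').
- by move=> z; exact: nrm_ge0.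
- apply: filterS2 uint vint => w uw vw.
  have m1 : measurable_fun setT (fun r : RR => nD (U (w, r))) by exact: (measurableT_comp my (pair1_measurable w)).
  have m2 : measurable_fun setT (fun r : RR => nD (V (w, r))) by exact: (measurableT_comp mv (pair1_measurable w)).
  apply: (@le_lt_trans _ _ (\int[mu]_(r in `]0%R, T[) ((nD (U (w, r)))%:E + (nD (V (w, r)))%:E))%E).
    apply: ge0_le_integral => //.
    + by move=> r _; rewrite lee_fin nrm_ge0.
    + by apply: measurable_funTS; apply/measurable_EFinP; exact: (measurableT_comp measurable_diff_field (pair1_measurable w)).
    + by apply: measurable_funTS; apply: emeasurable_funD; exact/measurable_EFinP.
    + by move=> r _; rewrite -EFinD lee_fin; apply: nrmB.
  rewrite ge0_integralD//; last 4 first.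
  + by move=> r _; rewrite lee_fin nrm_ge0.
  + by apply: measurable_funTS; exact/measurable_EFinP.
  + by move=> r _; rewrite lee_fin nrm_ge0.
  + by apply: measurable_funTS; exact/measurable_EFinP.
  exact: (lte_add_pinfty uw vw).
move=> {t t0T'} t t0T; have /andP[t0 tT] := t0T.
have mZZ : measurable_fun setT (fun z : Omega * RR => Z t z.1 z.2 - Z' t z.1 z.2).
  by apply: measurable_funB; [exact: mZ|exact: mZ'].
have mi := measurable_int_sqr mZZ.
have [mQ2 Q2M] := expected_weighted_moment t0T.
pose Q2 w := (\int[mu]_r (sing t r * (1 + nD (U (w, r))) ^+ 2)%:E)%E.
have Q20 w : (0 <= Q2 w)%E.
  by apply: integral_ge0 => r _; rewrite lee_fin; apply: mulr_ge0; [exact: sing_ge0|exact: sqr_ge0].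
have z0 w : (0 <= \int[lebD]_x ((Z t w x - Z' t w x) ^+ 2)%:E)%E by apply: integral_ge0 => x _; rewrite lee_fin sqr_ge0.
exists (fun w => 2%:E * (\int[lebD]_x ((Z t w x - Z' t w x) ^+ 2)%:E) + (2 * ((A * Cf) ^+ 2 * ka))%:E * Q2 w)%E.
split.
- by apply: emeasurable_funD; exact: measurable_funeM.
- by move=> w; rewrite adde_ge0// mule_ge0.
- rewrite ge0_integralD//; last 4 first.
  + by move=> w _; rewrite mule_ge0.
  + exact: measurable_funeM.
  + by move=> w _; rewrite mule_ge0.
  + exact: measurable_funeM.
  rewrite !ge0_integralZl//.
  exact: (leeD (lee_mulEFin (ler0n R 2) (ZZ' t0T)) (lee_mulEFin kk0 Q2M)).
have du := @field_decomp _ _ _ P T u (fun t g => Op t (f g)) Z u2 mZ uE t t0T.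
have dv := @field_decomp _ _ _ P T v (fun t g => Op' t (f g)) Z' v2 mZ' vE t t0T.
have duv : {ae P, forall w, (exists2 I, is_bochner_integral t (fun r => Op (t - r) (f (u w r))) I &
    {ae lebD, forall x, u w t x = I x + Z t w x}) /\ (exists2 I, is_bochner_integral t (fun r => Op' (t - r) (f (v w r))) I &
    {ae lebD, forall x, v w t x = I x + Z' t w x})}.
  by apply: filterS2 (uE t0T) (vE t0T) => w.
apply: filterS duv => w [[I bI uI] [I' bI' vI]].
have FF : Filter (almost_everywhere lebD) := ae_filter_ringOfSetsType lebD.
have [_ I2 _] := bI; have [_ I2' _] := bI'; have ut := u2 w t0T; have vt := v2 w t0T.
have mZw : measurable_fun setT (fun x => Z t w x - Z' t w x) by exact: (measurableT_comp mZZ (pair1_measurable w)).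
have II2 := L2B I2 I2'; have uv2 := L2B ut vt.
have Zae : {ae lebD, forall x, (u w t x - v w t x) - (I x - I' x) = Z t w x - Z' t w x}.
  by apply: (@filterS2 _ _ FF _ _ _ _ uI vI) => x -> ->; ring.
have Z2 : (fun x => Z t w x - Z' t w x) \in L2 by exact: (L2_ae (L2B uv2 II2) mZw Zae).
pose nZ := nD (fun x => Z t w x - Z' t w x).
have nZE : (\int[lebD]_x ((Z t w x - Z' t w x) ^+ 2)%:E = nZ%:E * nZ%:E)%E.
  by rewrite -(EFin_dot Z2) -sqr_nrm -EFinM expr2.
have uvle : nD (fun x => u w t x - v w t x) <= nD (fun x => I x - I' x) + nZ.
  have E2 := L2_add II2 Z2.
  have uvI : {ae lebD, forall x, u w t x - v w t x = (I x - I' x) + (Z t w x - Z' t w x)}.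
    by apply: (@filterS2 _ _ FF _ _ _ _ uI vI) => x -> ->; ring.
  have -> : nD (fun x => u w t x - v w t x) = nD (fun x => (I x - I' x) + (Z t w x - Z' t w x)).
    by congr Num.sqrt; rewrite (dot_ae uv2 E2 uv2 uvI) dotC (dot_ae uv2 E2 E2 uvI).
  exact: nrmD.
pose Q := (\int[mu]_r (sing t r * (1 + nD (U (w, r))))%:E)%E.
have Q0 : (0 <= Q)%E.
  by apply: integral_ge0 => r _; rewrite lee_fin; apply: mulr_ge0; [exact: sing_ge0|rewrite addr_ge0 ?nrm_ge0].
have m1 : measurable_fun setT (fun r : RR => 1 + nD (U (w, r))).
  by apply: measurable_funD => //; exact: (measurableT_comp my (pair1_measurable w)).
have h0 (r : RR) : 0 <= 1 + nD (U (w, r)) by rewrite addr_ge0 ?nrm_ge0.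
have QQ : (Q * Q <= ka%:E * Q2 w)%E.
  by apply: weighted_cauchy_schwarz => //; [exact: measurable_sing|exact: sing_ge0|exact: integral_sing_le].
exists (nZ%:E + (A * Cf)%:E * Q)%E; split.
- by rewrite adde_ge0 ?lee_fin ?nrm_ge0// mule_ge0 ?lee_fin.
- have c1 : (0 <= nZ%:E :> \bar R)%E by rewrite lee_fin nrm_ge0.
  have c2 : (0 <= (A * Cf)%:E * Q)%E by rewrite mule_ge0 ?lee_fin.
  apply: (le_trans (lee_sqr_add2 c1 c2)); rewrite nZE; apply: leeD => //.
  have -> : ((A * Cf)%:E * Q * ((A * Cf)%:E * Q) = ((A * Cf) ^+ 2)%:E * (Q * Q))%E by rewrite muleACA -EFinM -expr2.
  have assoc (a b c : R) (z : \bar R) : ((a * (b * c))%:E * z = a%:E * (b%:E * (c%:E * z)))%E by rewrite !EFinM !muleA.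
  rewrite assoc; apply: lee_wpmul2l => //; apply: lee_wpmul2l => //.
  by rewrite lee_fin sqr_ge0.
have mdw : measurable_fun setT (fun r : RR => nD (fun x => U (w, r) x - V (w, r) x)).
  exact: (measurableT_comp measurable_diff_field (pair1_measurable w)).
pose B (r : RR) : \bar R := (Cf%:E * (nD (fun x => U (w, r) x - V (w, r) x))%:E + (A * Cf)%:E * (sing t r * (1 + nD (U (w, r))))%:E)%E.
have ms1 : measurable_fun setT (fun r : RR => (sing t r * (1 + nD (U (w, r))))%:E).
  by apply/measurable_EFinP; apply: measurable_funM => //; exact: measurable_sing.
have sg0 r : (0 <= (sing t r * (1 + nD (U (w, r))))%:E)%E by rewrite lee_fin; apply: mulr_ge0; [exact: sing_ge0|].
have B0 r : (0 <= B r)%E.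
  by rewrite adde_ge0// mule_ge0// ?lee_fin ?nrm_ge0// ltW.
have mB : measurable_fun setT B.
  by apply: emeasurable_funD; apply: measurable_funeM => //; exact/measurable_EFinP.
have Ile : ((nD (fun x => I x - I' x))%:E <= \int[mu]_(r in `]0%R, t[) B r)%E.
  apply: (bochner_diff_le bI bI' mB B0); apply: aeW => r; rewrite in_itv/= => /andP[r0 rt] _ _.
  have rT : 0 <= r <= T by rewrite (ltW r0) (le_trans (ltW rt) tT).
  have tr : 0 < t - r <= T by rewrite subr_gt0 rt/= lerBlDr (le_trans tT)// lerDl ltW.
  have ur := u2 w rT; have vr := v2 w rT.
  rewrite /B (U_in u w rT) (U_in v w rT) -!EFinM -EFinD lee_fin.
  apply: (le_trans (Op_diff tr (f2 ur) (f2 vr))); apply: lerD; first exact: f_lip.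
  have -> : sing t r = (t - r) `^ (- alpha).
    by rewrite /sing /powk subr_gt0 rt r0 mulr1; congr (_ `^ _); ring.
  have -> : A * Cf * ((t - r) `^ (- alpha) * (1 + nD (u w r))) = A * (t - r) `^ (- alpha) * (Cf * (1 + nD (u w r))) by ring.
  by apply: ler_wpM2l; [rewrite mulr_ge0 ?powR_ge0|exact: f_growth].
have BE : (\int[mu]_(r in `]0%R, t[) B r <= Cf%:E * \int[mu]_(r in `]0%R, t[) (nD (fun x => U (w, r) x - V (w, r) x))%:E + (A * Cf)%:E * Q)%E.
  rewrite /B ge0_integralD//; last 4 first.
  - by move=> r _; rewrite mule_ge0// lee_fin ?nrm_ge0// ltW.
  - by apply: measurable_funTS; apply: measurable_funeM; exact/measurable_EFinP.
  - by move=> r _; rewrite mule_ge0.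
  - by apply: measurable_funTS; exact: measurable_funeM.
  rewrite ge0_integralZl; last 4 first.
  - by [].
  - by apply: measurable_funTS; exact/measurable_EFinP.
  - by move=> r _; rewrite lee_fin nrm_ge0.
  - by rewrite lee_fin ltW.
  rewrite ge0_integralZl//; last exact: measurable_funTS.
  by apply: leeD => //; apply: lee_wpmul2l; rewrite ?lee_fin//; apply: ge0_subset_integral.
rewrite (U_in u w t0T) (U_in v w t0T).
apply: (@le_trans _ _ ((nD (fun x => I x - I' x))%:E + nZ%:E)%E); first by rewrite -EFinD lee_fin.
rewrite addeC -addeA; apply: leeD => //; rewrite addeC; exact: (le_trans Ile BE).
Qed.

End difference.

(** * The error estimate *)

Theorem theorem4p2 (R : realType)
  (d : measure_display) (Omega : measurableType d) (P : probability Omega R)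
  (alpha s H1 H2 T : R)
  (lam : nat -> R) (phi : nat -> R -> R)
  (W : R -> R -> Omega -> R)
  (f : (R -> R) -> R -> R) (Cf : R)
  (u : Omega -> R -> R -> R) (ubar : nat -> Omega -> R -> R -> R) :
  0 < alpha < 1 -> 0 < s < 1 ->
  0 < H1 <= 2^-1 -> 0 < H2 <= 2^-1 -> 0 < T ->
  dirichlet_eigenbasis lam phi ->
  fractional_brownian_sheet P H1 H2 T W ->
  0 < Cf ->
  (forall v, v \in @L2D R -> f v \in @L2D R) ->
  (forall v, v \in @L2D R ->
    (normD (f v) <= Cf%:E * (1 + normD v))%E) ->
  (forall v w, v \in @L2D R -> w \in @L2D R ->
    (normD (fun x => f v x - f w x)%R <=
     Cf%:E * normD (fun x => v x - w x)%R)%E) ->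
  0 < 2 * s * H2 / alpha + H1 - 1 ->
  0 < H1 + 2 * s - 1 ->
  mild_solution P W T alpha s lam phi f u ->
  (forall N, (0 < N)%N ->
    galerkin_solution P W T alpha s lam phi f N (ubar N)) ->
  forall sigma : R,
  2 * sigma < Num.min (2 * s * H2 / alpha + H1 - 1) (H1 + 2 * s - 1) ->
  exists C : R, forall N, (0 < N)%N -> forall t, t \in `[0, T] ->
    (\int[P]_w (normD (fun x => u w t x - ubar N w t x)%R ^+ 2)
      <= (C * N.+1%:R `^ (- (4 * sigma)))%:E)%E.
Proof.
move=> alpha01 s01 H12 H22 T0 eb sW Cf0 f2 f_growth' f_lip' hA hB [mu_ u2' uE'] hbar sigma hsigma.
have s0 : 0 < s by case/andP: s01.
have [th [th01 ath p0 psig]] := exists_exponent alpha01 s0 H12 (andP H22).1 hA hB hsigma.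
set p := 4 * s * th + 2 * H1 - 2 in p0 psig.
have lamE k : lam k = (k.+1%:R * pi) ^+ 2 by have [] := eigenbasis_sin eb k.
have phi2 k : phi k \in Lfun (@lebD R) 2%:E by exact: eigenbasis_L2D eb k.
have phio j k : dot (@lebD R) (phi j) (phi k) = (j == k)%:R by exact: eigenbasis_ortho eb j k.
have total := eigenbasis_total eb.
pose nD (v : R -> R) := nrm (@lebD R) v.
have nDE v : v \in Lfun (@lebD R) 2%:E -> normD v = (nD v)%:E by exact: Lnorm_nrm.
have f_growth v : v \in Lfun (@lebD R) 2%:E -> nD (f v) <= Cf * (1 + nD v).
  by move=> v2; have := f_growth' v v2; rewrite (nDE _ v2) (nDE _ (f2 _ v2)) -EFinD -EFinM lee_fin.
have f_lip v w : v \in Lfun (@lebD R) 2%:E -> w \in Lfun (@lebD R) 2%:E ->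
    nD (fun x => f v x - f w x) <= Cf * nD (fun x => v x - w x).
  move=> v2 w2; have := f_lip' v w v2 w2.
  by rewrite (nDE _ (L2B v2 w2)) (nDE _ (L2B (f2 _ v2) (f2 _ w2))) -EFinM lee_fin.
pose rel k t := relaxation alpha s lam k t.
have rel01 t k : 0 <= rel k t <= 1 by rewrite relaxation_ge0//= relaxation_le1.
have rel_mono t k : 0 < t < T -> rel k T <= 1 * rel k t.
  by move=> /andP[t0 tT]; rewrite mul1r; apply: relaxation_noninc_time => //; exact: ltW.
have [C1 C10 HC1] := relaxation_smooth s lam alpha01 T0.
have [C2 C20 HC2] := relaxation_decay alpha01 s0 lamE.
have [Cz Cz0 Hz] := stoch_convolution_diff alpha01 s0 T0 H12 H22 eb sW th01 ath p0.
have [M M0 HM] := stoch_convolution_bounded alpha01 s0 T0 H12 H22 eb sW th01 ath p0.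
have inT t : (t \in `[0, T]) = (0 <= t <= T) by rewrite in_itv.
have u2 w t : 0 <= t <= T -> u w t \in Lfun (@lebD R) 2%:E by move=> ?; apply: u2'; rewrite inT.
pose Op t v := mult phi (fun k => rel k t) v.
pose OpN N t v := multN phi (fun k => rel k t) N v.
(* One version of the stochastic convolution is fixed for each time; outside [0, T] any function
   will do. *)
have /choice[Z HZ] : forall t, exists Z : Omega -> R -> R, 0 <= t <= T ->
    is_stoch_convolution P W T (Gker alpha s lam phi) t Z /\
    {ae P, forall w, exists2 I : R -> R,
      is_bochner_integral t (fun r => Op (t - r) (f (u w r))) I &
      {ae @lebD R, forall x, u w t x = I x + Z w x}}.
  move=> t; have [t0T|] := boolP (0 <= t <= T); last by exists (fun _ _ => 0).
  by have [|Z h1 h2] := uE' t; [rewrite inT|exists Z].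
have mZ t : 0 <= t <= T -> measurable_fun setT (fun z : Omega * measurableTypeR R => Z t z.1 z.2).
  by move=> /HZ[[]].
have ZM t : 0 <= t <= T -> (\int[P]_w \int[@lebD R]_x (Z t w x ^+ 2)%:E <= M%:E)%E.
  by move=> t0T; exact: (HM t (Z t) t0T (HZ t t0T).1).
have uE t (t0T : 0 <= t <= T) := (HZ t t0T).2.
have Op2 t v : v \in Lfun (@lebD R) 2%:E -> Op t v \in Lfun (@lebD R) 2%:E.
  by move=> v2; have [] := mult_spec phi2 phio (rel01 t) v2.
have Op_lip t v w (v2 : v \in Lfun (@lebD R) 2%:E) (w2 : w \in Lfun (@lebD R) 2%:E) := mult_lip phi2 phio (rel01 t) v2 w2.
have Op_mono t v : 0 < t < T -> v \in Lfun (@lebD R) 2%:E -> nD (Op T v) <= nD (Op t v).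
  move=> t0T v2; rewrite -[leRHS]mul1r.
  by apply: (mult_scale phi2 phio (rel01 T) (rel01 t) ler01) => // k; exact: rel_mono.
have sc0 t : 0 <= C1 * t `^ (- alpha) by rewrite mulr_ge0 ?powR_ge0.
have Op_smooth t v : 0 < t <= T -> v \in Lfun (@lebD R) 2%:E -> nD (Op t v) <= C1 * t `^ (- alpha) * nD (Op T v).
  by move=> t0T v2; apply: (mult_scale phi2 phio (rel01 t) (rel01 T) (sc0 t)) => // k; exact: HC1.
have Op_le t v (v2 : v \in Lfun (@lebD R) 2%:E) := mult_le phi2 phio (rel01 t) v2.
have uint := solution_integrable T0 alpha01 Cf0 C10 phi2 phio total f2 f_lip Op2 Op_lip Op_mono Op_smooth mu_ u2 mZ ZM uE.
have [M' M'0 HM'] := solution_moment T0 alpha01 Cf0 C10 phi2 phio total f2 f_lip Op2 Op_lip Op_mono Op_smooth mu_ u2 f_growth Op_le M0 mZ ZM uE.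
pose ka := T `^ (1 - alpha) / (1 - alpha).
pose G := 2 + 2 * (Cf * (2 * expR (2 * Cf * T))) ^+ 2 * T ^+ 2.
exists ((2 * Cz + 2 * ((C2 * Cf) ^+ 2 * ka) * (ka * (2 + 2 * M'))) * G) => N N0 t; rewrite inT => t0T.
have [[mv_ v2' vE'] _] := hbar N N0.
have v2 w r : 0 <= r <= T -> ubar N w r \in Lfun (@lebD R) 2%:E by move=> ?; apply: v2'; rewrite inT.
have /choice[Z' HZ'] : forall t, exists Z' : Omega -> R -> R, 0 <= t <= T ->
    is_stoch_convolution P W T (GkerN alpha s lam phi N) t Z' /\
    {ae P, forall w, exists2 I : R -> R,
      is_bochner_integral t (fun r => OpN N (t - r) (f (ubar N w r))) I &
      {ae @lebD R, forall x, ubar N w t x = I x + Z' w x}}.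
  move=> r; have [r0T|] := boolP (0 <= r <= T); last by exists (fun _ _ => 0).
  have [|Z' h1 h2] := vE' r; first by rewrite inT.
  have E w : (fun q => OpN N (r - q) (f (ubar N w q))) =
      (fun q => SopN alpha s lam phi N (r - q) (projN phi N (f (ubar N w q)))).
    by apply/funext => q; exact: esym (multN_projN phi2 phio _ _ _).
  exists Z' => _; split; first exact: h1.
  apply: filterS h2 => w [I bI vI]; exists I; last exact: vI.
  by rewrite E; exact: bI.
have mZ' r : 0 <= r <= T -> measurable_fun setT (fun z : Omega * measurableTypeR R => Z' r z.1 z.2).
  by move=> /HZ'[[]].
have vE r (r0T : 0 <= r <= T) := (HZ' r r0T).2.
have ZZ' r : 0 <= r <= T -> (\int[P]_w \int[@lebD R]_x ((Z r w x - Z' r w x) ^+ 2)%:E <= (Cz * N.+1%:R `^ (- p))%:E)%E.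
  by move=> r0T; exact: (Hz N r (Z r) (Z' r) r0T (HZ r r0T).1 (HZ' r r0T).1).
have OpN2 r v : v \in Lfun (@lebD R) 2%:E -> OpN N r v \in Lfun (@lebD R) 2%:E.
  by move=> _; exact: multN_L2.
have OpN_lip r v w : v \in Lfun (@lebD R) 2%:E -> w \in Lfun (@lebD R) 2%:E ->
    nD (fun x => OpN N r v x - OpN N r w x) <= nD (fun x => v x - w x).
  by move=> hv hw; rewrite /OpN multNB//; apply: (multN_le phi2 phio (rel01 r)); exact: L2B.
have OpN_mono r v : 0 < r < T -> v \in Lfun (@lebD R) 2%:E -> nD (OpN N T v) <= nD (OpN N r v).
  move=> r0T hv; rewrite -[leRHS]mul1r; apply: (multN_scale phi2 phio) => // k.
  by rewrite rel_mono// andbT; case/andP: (rel01 T k).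
have OpN_smooth r v : 0 < r <= T -> v \in Lfun (@lebD R) 2%:E -> nD (OpN N r v) <= C1 * r `^ (- alpha) * nD (OpN N T v).
  move=> r0T hv; apply: (multN_scale phi2 phio) => // k.
  by rewrite HC1// andbT; case/andP: (rel01 r k).
(* This bound depends on N, which is harmless: only almost sure integrability of the Galerkin paths
   is drawn from it. *)
pose M2 := 2 * M + 2 * (Cz * N.+1%:R `^ (- p)).
have Z'M r : 0 <= r <= T -> (\int[P]_w \int[@lebD R]_x (Z' r w x ^+ 2)%:E <= M2%:E)%E.
  move=> r0T; have mZZ : measurable_fun setT (fun z : Omega * measurableTypeR R => Z r z.1 z.2 - Z' r z.1 z.2).
    by apply: measurable_funB; [exact: mZ|exact: mZ'].
  have m1 := measurable_int_sqr (mZ r r0T); have m2 := measurable_int_sqr mZZ; have m3 := measurable_int_sqr (mZ' r r0T).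
  have n1 w : (0 <= \int[@lebD R]_x (Z r w x ^+ 2)%:E)%E by apply: integral_ge0 => x _; rewrite lee_fin sqr_ge0.
  have n2 w : (0 <= \int[@lebD R]_x ((Z r w x - Z' r w x) ^+ 2)%:E)%E by apply: integral_ge0 => x _; rewrite lee_fin sqr_ge0.
  apply: (@le_trans _ _ (\int[P]_w (2%:E * \int[@lebD R]_x (Z r w x ^+ 2)%:E + 2%:E * \int[@lebD R]_x ((Z r w x - Z' r w x) ^+ 2)%:E))%E).
    apply: ge0_le_integral => //.
    - by move=> w _; apply: integral_ge0 => x _; rewrite lee_fin sqr_ge0.
    - by apply: emeasurable_funD; exact: measurable_funeM.
    - move=> w _; have a1 := measurableT_comp (mZ r r0T) (pair1_measurable w); have a2 := measurableT_comp mZZ (pair1_measurable w).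
      apply: le_trans (sqrB_integral_le (@lebD R) measurableT a1 a2).
      by rewrite le_eqVlt; apply/orP; left; apply/eqP; apply: eq_integral => x _ /=; rewrite subKr.
  rewrite ge0_integralD//; last 4 first.
  - by move=> w _; rewrite mule_ge0.
  - exact: measurable_funeM.
  - by move=> w _; rewrite mule_ge0.
  - exact: measurable_funeM.
  rewrite !ge0_integralZl//.
  exact: (leeD (lee_mulEFin (ler0n R 2) (ZM r r0T)) (lee_mulEFin (ler0n R 2) (ZZ' r r0T))).
have vint := solution_integrable T0 alpha01 Cf0 C10 phi2 phio total f2 f_lip OpN2 OpN_lip OpN_mono OpN_smooth mv_ v2 mZ' Z'M vE.
pose A := C2 * N.+1%:R `^ (- (2 * s)).
have A0 : 0 <= A by rewrite mulr_ge0 ?powR_ge0 ?ltW.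
have Kz0 : 0 <= Cz * N.+1%:R `^ (- p) by rewrite mulr_ge0 ?powR_ge0.
(* S g - S_N h = S_N (g - h) + (S - S_N) g: the first term is a contraction, the second is at most
   the relaxation coefficient of index N times ||g||, which the decay bound with exponent 1
   controls. *)
have Op_diff r g h : 0 < r <= T -> g \in Lfun (@lebD R) 2%:E -> h \in Lfun (@lebD R) 2%:E ->
    nD (fun x => Op r g x - OpN N r h x) <= nD (fun x => g x - h x) + A * r `^ (- alpha) * nD g.
  move=> /andP[r0 _] g2 h2; have a1 := OpN2 r g g2; have a2 := OpN2 r h h2; have a3 := Op2 r g g2.
  have -> : (fun x => Op r g x - OpN N r h x) = (fun x => (OpN N r g x - OpN N r h x) + (Op r g x - OpN N r g x)).
    by apply/funext => x; ring.
  apply: (le_trans (nrmD (L2B a1 a2) (L2B a3 a1))); apply: lerD; first exact: OpN_lip.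
  apply: (le_trans (mult_multN phi2 phio (rel01 r) N g2 _)).
    by move=> j k jk; apply: relaxation_noninc.
  apply: ler_wpM2r; first exact: nrm_ge0.
  have /(_ _)/= := HC2 1 N r _ r0; rewrite ler01 lexx => /(_ isT) h1.
  by apply: (le_trans h1); rewrite /A !mulr1 mulrA.
have main := solution_difference T0 alpha01 Cf0 A0 Kz0 M'0 f2 f_lip f_growth Op_diff mu_ mv_ u2 v2 uint vint HM' mZ mZ' ZZ' uE vE t0T.
have -> : (\int[P]_w (normD (fun x => u w t x - ubar N w t x)%R ^+ 2) = \int[P]_w (nD (fun x => u w t x - ubar N w t x) ^+ 2)%:E)%E.
  by apply: eq_integral => w _; rewrite (nDE _ (L2B (u2 w t t0T) (v2 w t t0T))) EFin_expe.
apply: (le_trans main); rewrite lee_fin -/ka -/G.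
have G0 : 0 <= G by rewrite addr_ge0//; apply: mulr_ge0; [apply: mulr_ge0 => //; exact: sqr_ge0|exact: sqr_ge0].
rewrite [leRHS]mulrAC; apply: ler_wpM2r => //.
have n1 : 1 <= N.+1%:R :> R by rewrite ler1n.
have e1 : N.+1%:R `^ (- p) <= N.+1%:R `^ (- (4 * sigma)) :> R by apply: ler_powR => //; rewrite lerN2.
(* The deterministic rate is better than required: 4 sigma < 4 s + 2 H1 - 2 <= 4 s - 1. *)
have e2 : N.+1%:R `^ (- (4 * s)) <= N.+1%:R `^ (- (4 * sigma)) :> R.
  apply: ler_powR => //; rewrite lerN2.
  have h1 : 2 * sigma < H1 + 2 * s - 1 by apply: lt_le_trans hsigma _; rewrite ge_min lexx orbT.
  have h2 : 2 * H1 <= 1 by case/andP: H12 => _ h; rewrite -ler_pdivlMl// mulr1.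
  move: (andP s01).1 h1 h2; clear; lra.
have Asq : (A * Cf) ^+ 2 = (C2 * Cf) ^+ 2 * N.+1%:R `^ (- (4 * s)).
  rewrite /A mulrAC exprMn; congr (_ * _).
  by rewrite -powR_mulrn ?powR_ge0// -powRrM; congr (_ `^ _); ring.
have g0 : 0 < 1 - alpha by rewrite subr_gt0; case/andP: alpha01.
have ka0 : 0 <= ka by rewrite divr_ge0 ?powR_ge0// ltW.
rewrite Asq [leRHS]mulrDl; apply: lerD.
  by rewrite -!mulrA ler_wpM2l// ler_wpM2l.
have -> : 2 * ((C2 * Cf) ^+ 2 * N.+1%:R `^ (- (4 * s)) * ka) * (ka * (2 + 2 * M')) =
  2 * ((C2 * Cf) ^+ 2 * ka) * (ka * (2 + 2 * M')) * N.+1%:R `^ (- (4 * s)) by ring.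
apply: ler_wpM2l => //; apply: mulr_ge0.
  by apply: mulr_ge0 => //; apply: mulr_ge0 => //; exact: sqr_ge0.
by apply: mulr_ge0 => //; rewrite addr_ge0// mulr_ge0.
Qed.
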